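(* Let $\mathcal{A}$ and $\mathcal{B}$ be DG-categories and let $(E_i,\alpha_{ij})$ be a one-sided twisted complex over $\mathcal{A}\text{-}\overline{\mathrm{Mod}}\text{-}\mathcal{B}$. Then there are homotopy equivalences in $\mathcal{B}\text{-}\overline{\mathrm{Mod}}\text{-}\mathcal{A}$: $$\{E_i,\alpha_{ij}\}^{\overline{\mathcal{B}}}\to\{E_{-i}^{\overline{\mathcal{B}}},\ (-1)^{j^2+ij+1}\alpha_{(-j)(-i)}^{\overline{\mathcal{B}}}\},$$ $$\{E_i,\alpha_{ij}\}^{\overline{\mathcal{A}}}\to\{E_{-i}^{\overline{\mathcal{A}}},\ (-1)^{j^2+ij+1}\alpha_{(-j)(-i)}^{\overline{\mathcal{A}}}\},$$ where on the right-hand sides the expressions in brackets list the $i$-th object and the $(i,j)$-th differential of a twisted complex, and curly brackets denote convolution.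
   Context: $k$ is a field; DG-categories are over $k$. $\mathcal{A}$ also denotes the diagonal bimodule. The bar complex $\overline{\mathcal{A}}$ is the $\mathcal{A}$-$\mathcal{A}$-bimodule which is the convolution of $\dots\to\mathcal{A}^{\otimes_k3}\to\mathcal{A}^{\otimes_k2}$ ($\mathcal{A}^{\otimes n}$ in degree $2-n$) with differentials $\sum_{i=0}^{n-1}(-1)^i\mathrm{id}^{\otimes i}\otimes m\otimes\mathrm{id}^{\otimes(n-i-1)}\colon\mathcal{A}^{\otimes(n+1)}\to\mathcal{A}^{\otimes n}$, $m$ the composition. $\tau\colon\overline{\mathcal{A}}\to\mathcal{A}$ is $m$ on $\mathcal{A}^{\otimes2}$, zero elsewhere; $\Delta\colon\overline{\mathcal{A}}\to\overline{\mathcal{A}}\otimes_{\mathcal{A}}\overline{\mathcal{A}}$ is (on the level of twisted complexes) $a_1\otimes\dots\otimes a_n\mapsto\sum_{p=1}^{n-1}(a_1\otimes\dots\otimes a_p\otimes1)\otimes_{\mathcal{A}}(1\otimes a_{p+1}\otimes\dots\otimes a_n)$. $\mathcal{A}\text{-}\overline{\mathrm{Mod}}\text{-}\mathcal{B}$ has the DG $\mathcal{A}$-$\mathcal{B}$-bimodules as objects and morphism complexes $\mathrm{Hom}_{\mathcal{A}\text{-}\mathcal{B}}(\overline{\mathcal{A}}\otimes_{\mathcal{A}}M\otimes_{\mathcal{B}}\overline{\mathcal{B}},N)$; identities are $\tau\otimes\mathrm{id}\otimes\tau$, the composition of $\alpha\colon L\to M$, $\beta\colon M\to N$ is $\beta\circ(\mathrm{id}\otimes\alpha\otimes\mathrm{id})\circ(\Delta\otimes\mathrm{id}\otimes\Delta)$.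 Dualising functors: $M^{\overline{\mathcal{B}}}=\overline{\mathrm{Hom}}_{\mathcal{B}}(M,\mathcal{B})=\mathrm{Hom}_{\mathcal{B}}(M\otimes_{\mathcal{B}}\overline{\mathcal{B}},\mathcal{B})$ and $M^{\overline{\mathcal{A}}}=\overline{\mathrm{Hom}}_{\mathcal{A}}(M,\mathcal{A})=\mathrm{Hom}_{\mathcal{A}^{opp}}(\overline{\mathcal{A}}\otimes_{\mathcal{A}}M,\mathcal{A})$, contravariant functors $\mathcal{A}\text{-}\overline{\mathrm{Mod}}\text{-}\mathcal{B}\to\mathcal{B}\text{-}\overline{\mathrm{Mod}}\text{-}\mathcal{A}$. On morphisms, for $\alpha\colon M'\to M$ in $\mathcal{A}\text{-}\overline{\mathrm{Mod}}\text{-}\mathcal{B}$ the map $\alpha^{\overline{\mathcal{B}}}=(-)\circ\alpha\colon M^{\overline{\mathcal{B}}}\to M'^{\overline{\mathcal{B}}}$ has underlying map $\overline{\mathcal{B}}\otimes M^{\overline{\mathcal{B}}}\otimes\overline{\mathcal{A}}\to M'^{\overline{\mathcal{B}}}$, $x\otimes\gamma\otimes a\mapsto\big(m'\otimes b\mapsto\sum(-1)^{\deg(\alpha)(\deg x+\deg\gamma)}\tau(x)\,\gamma(\alpha(a\otimes m'\otimes b_{(1)})\otimes b_{(2)})\big)$, $\Delta(b)=\sum b_{(1)}\otimes b_{(2)}$; $\alpha^{\overline{\mathcal{A}}}$ is defined similarly. A twisted complex over a DG-category $\mathcal{D}$ is a collection $(E_i,\alpha_{ij})$ of objects $E_i$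 ($i\in\mathbb{Z}$, finitely many nonzero) and $\alpha_{ij}\in\mathrm{Hom}^{i-j+1}_{\mathcal{D}}(E_i,E_j)$ with $(-1)^jd\alpha_{ij}+\sum_k\alpha_{kj}\alpha_{ik}=0$; it is one-sided if $\alpha_{ij}=0$ for $i\ge j$. The convolution of a one-sided twisted complex over $\mathcal{A}\text{-}\overline{\mathrm{Mod}}\text{-}\mathcal{B}$ is the bimodule $\bigoplus_i\widetilde{E_i}[-i]$ with differential $d+\sum\widetilde{\alpha}_{ij}$, where $\widetilde{E}=\overline{\mathcal{A}}\otimes E\otimes\overline{\mathcal{B}}$ and $\widetilde{\alpha}=(\mathrm{id}\otimes\alpha\otimes\mathrm{id})\circ(\Delta\otimes\mathrm{id}\otimes\Delta)$. *)

(* Defs.v *)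
From HB Require Import structures.
From mathcomp Require Import all_boot all_order all_algebra.
From mathcomp Require Import all_classical.

Set Implicit Arguments.
Unset Strict Implicit.
Unset Printing Implicit Defensive.

Import GRing.Theory.
Local Open Scope ring_scope.

(* CONVENTIONS.  A graded vector space is an ungraded vector space V, the     *)
(* direct sum of its homogeneous parts, together with the operators pr n      *)
(* which extract the component of degree n.  Formulas with Koszul signs are   *)
(* written for homogeneous elements and extended additively ([hsum], [twist]),*)
(* so no cast between degrees is ever needed.                                 *)
(*   Categories, modules and morphisms are given by raw data; their axioms    *)
(* are the predicates [is_dgvect], [is_bimod], [is_hom].  The operations on   *)
(* raw data are total: a map out of a tensor product is evaluated on a        *)
(* representative ([tlift]; see [tlift_sum]), and [to_span] sends vectors     *)
(* outside the relevant subspace to 0.  On data which satisfy the axioms the  *)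
(* representative is irrelevant and the second case does not occur.           *)

Section DependentProduct.
Variables (k : fieldType) (I : Type) (V : I -> lmodType k).

Record dprod := DProd { dprod_fun :> forall i, V i }.

HB.instance Definition _ := gen_eqMixin dprod.
HB.instance Definition _ := gen_choiceMixin dprod.

Lemma dprodP (f g : dprod) : (forall i, f i = g i) -> f = g.
Proof.
case: f g => [f] [g] /= fg; congr DProd.
exact: functional_extensionality_dep.
Qed.

Definition dprod_add (f g : dprod) := DProd (fun i => f i + g i).
Definition dprod_zero := DProd (fun i => 0).
Definition dprod_opp (f : dprod) := DProd (fun i => - f i).
Definition dprod_scale (c : k) (f : dprod) := DProd (fun i => c *: f i).

Fact dprod_addA : associative dprod_add.
Proof. by move=> f g h; apply: dprodP => i /=; rewrite addrA. Qed.
Fact dprod_addC : commutative dprod_add.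
Proof. by move=> f g; apply: dprodP => i /=; rewrite addrC. Qed.
Fact dprod_add0 : left_id dprod_zero dprod_add.
Proof. by move=> f; apply: dprodP => i /=; rewrite add0r. Qed.
Fact dprod_addN : left_inverse dprod_zero dprod_opp dprod_add.
Proof. by move=> f; apply: dprodP => i /=; rewrite addNr. Qed.

HB.instance Definition _ :=
  GRing.isZmodule.Build dprod dprod_addA dprod_addC dprod_add0 dprod_addN.

Fact dprod_scaleA a b f : dprod_scale a (dprod_scale b f) = dprod_scale (a * b) f.
Proof. by apply: dprodP => i /=; rewrite scalerA. Qed.
Fact dprod_scale1 : left_id 1 dprod_scale.
Proof. by move=> f; apply: dprodP => i /=; rewrite scale1r. Qed.
Fact dprod_scaleDr : right_distributive dprod_scale +%R.
Proof. by move=> a f g; apply: dprodP => i /=; rewrite scalerDr. Qed.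
Fact dprod_scaleDl f : {morph dprod_scale^~ f : a b / a + b}.
Proof. by move=> a b; apply: dprodP => i /=; rewrite scalerDl. Qed.

HB.instance Definition _ := GRing.Zmodule_isLmodule.Build k dprod
  dprod_scaleA dprod_scale1 dprod_scaleDr dprod_scaleDl.

End DependentProduct.

Section Span.
Variables (k : fieldType) (V : lmodType k) (P : V -> Prop).

Definition lspan (x : V) : Prop := exists s : seq (k * V),
  (forall p, p \in s -> P p.2) /\ x = \sum_(p <- s) p.1 *: p.2.

Definition lspanb : {pred V} := fun x => `[< lspan x >].

Fact lspan_closed : submod_closed lspanb.
Proof.
split; first by apply/asboolP; exists [::]; rewrite big_nil.
move=> a x y /asboolP [s [Ps ->]] /asboolP [t [Pt ->]]; apply/asboolP.
exists ([seq (a * p.1, p.2) | p <- s] ++ t); split.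
  move=> p; rewrite mem_cat => /orP[|pt]; last exact: Pt.
  by case/mapP=> q qs -> /=; apply: Ps.
rewrite big_cat big_map scaler_sumr /=; congr (_ + _).
by apply: eq_bigr => p _ /=; rewrite scalerA.
Qed.

HB.instance Definition _ := GRing.isSubmodClosed.Build k V lspanb lspan_closed.

Record spanned := Spanned { spanned_val : V; _ : spanned_val \in lspanb }.

HB.instance Definition _ := [isSub for spanned_val].
HB.instance Definition _ := [Choice of spanned by <:].
HB.instance Definition _ := [SubChoice_isSubLmodule of spanned by <:].

Definition to_span (x : V) : spanned := insubd 0 x.

Lemma to_spanK x : lspan x -> val (to_span x) = x.
Proof. by move=> Px; rewrite /to_span insubdK //; apply/asboolP. Qed.

End Span.

Section DirectSum.
Variables (k : fieldType) (I : choiceType) (V : I -> lmodType k).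

Definition dsum : lmodType k :=
  spanned (fun f : dprod V => exists i, forall j, j != i -> f j = 0).

Definition dcomp (x : dsum) (i : I) : V i := val x i.

Definition to_dsum (f : forall i, V i) : dsum := to_span _ (DProd f).

Definition dinj (i : I) (v : V i) : dsum :=
  to_dsum (fun j => match i =P j with
                    | ReflectT e => ecast j (V j) e v
                    | ReflectF _ => 0
                    end).

End DirectSum.

Arguments dinj {k I V} i v.

Record grvect (k : fieldType) := GrVect {
  grcar :> lmodType k;
  pr : int -> grcar -> grcar }.

Record dgvect (k : fieldType) := DgVect {
  dgcar :> grvect k;
  dd : dgcar -> dgcar }.

Section Complexes.
Variable k : fieldType.

Definition sgn (n : int) : k := (-1) ^ n.

Definition homog (V : grvect k) (n : int) (x : V) : Prop := pr n x = x.

(* \sum_n F n x_n, where x_n is the component of x of degree n *)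
Definition hsum (V : grvect k) (W : lmodType k) (x : V) (F : int -> V -> W) : W :=
  \sum_(n \in [set: int]) F n (pr n x).

(* the map x |-> (-1)^(n deg x) x *)
Definition twist (V : grvect k) (n : int) (x : V) : V :=
  hsum x (fun i x' => sgn (n * i) *: x').

Record is_dgvect (V : dgvect k) : Prop := IsDgVect {
  pr_linear : forall i, linear (@pr k V i);
  pr_pr : forall i j (x : V), pr i (pr j x) = if i == j then pr i x else 0;
  pr_sum : forall x : V,
    exists s : seq int, uniq s /\ x = \sum_(i <- s) pr i x;
  dd_linear : linear (@dd k V);
  dd_homog : forall i (x : V), homog i x -> homog (i + 1) (dd x);
  dd_dd : forall x : V, dd (dd x) = 0 }.

End Complexes.

Record dgcat (k : fieldType) := DgCat {
  ob :> Type;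
  mor : ob -> ob -> dgvect k;
  mcomp : forall a b c, mor b c -> mor a b -> mor a c;
  idm : forall a, mor a a;
  mor_dgvect : forall a b, is_dgvect (mor a b);
  mcomp_linearl : forall a b c (f : mor a b), linear (fun g : mor b c => mcomp g f);
  mcomp_linearr : forall a b c (g : mor b c), linear (fun f : mor a b => mcomp g f);
  mcomp_homog : forall a b c i j (g : mor b c) (f : mor a b),
    homog i g -> homog j f -> homog (i + j) (mcomp g f);
  mcomp_dd : forall a b c i (g : mor b c) (f : mor a b), homog i g ->
    dd (mcomp g f) = mcomp (dd g) f + sgn k i *: mcomp g (dd f);
  mcompA : forall a b c d (h : mor c d) (g : mor b c) (f : mor a b),
    mcomp h (mcomp g f) = mcomp (mcomp h g) f;
  mcomp1l : forall a b (f : mor a b), mcomp (idm b) f = f;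
  mcomp1r : forall a b (f : mor a b), mcomp f (idm a) = f;
  idm_homog : forall a, homog 0 (idm a);
  idm_dd : forall a, dd (idm a) = 0 }.

Arguments mor {k} _ _ _.
Arguments mcomp {k _ a b c} _ _.
Arguments idm {k _} _.

(* [M a b] is the fibre often written {}_a M_b, covariant in a and            *)
(* contravariant in b; for the diagonal bimodule it is mor A b a.             *)
Record bimod (k : fieldType) (A B : dgcat k) := Bimod {
  bcar :> A -> B -> dgvect k;
  lact : forall a a' b, mor A a' a -> bcar a' b -> bcar a b;
  ract : forall a b b', bcar a b -> mor B b' b -> bcar a b' }.

Arguments lact {k A B} _ {a a' b} _ _.
Arguments ract {k A B} _ {a b b'} _ _.

Record is_bimod (k : fieldType) (A B : dgcat k) (M : bimod A B) : Prop := IsBimod {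
  bcar_dgvect : forall a b, is_dgvect (M a b);
  lact_linearl : forall a a' b (m : M a' b), linear (fun x : mor A a' a => lact M x m);
  lact_linearr : forall a a' b (x : mor A a' a), linear (fun m : M a' b => lact M x m);
  ract_linearl : forall a b b' (y : mor B b' b), linear (fun m : M a b => ract M m y);
  ract_linearr : forall a b b' (m : M a b), linear (fun y : mor B b' b => ract M m y);
  lact_homog : forall a a' b i j (x : mor A a' a) (m : M a' b),
    homog i x -> homog j m -> homog (i + j) (lact M x m);
  ract_homog : forall a b b' i j (m : M a b) (y : mor B b' b),
    homog i m -> homog j y -> homog (i + j) (ract M m y);
  lact_dd : forall a a' b i (x : mor A a' a) (m : M a' b), homog i x ->
    dd (lact M x m) = lact M (dd x) m + sgn k i *: lact M x (dd m);
  ract_dd : forall a b b' i (m : M a b) (y : mor B b' b), homog i m ->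
    dd (ract M m y) = ract M (dd m) y + sgn k i *: ract M m (dd y);
  lact_comp : forall a a' a'' b (x : mor A a' a) (x' : mor A a'' a') (m : M a'' b),
    lact M (mcomp x x') m = lact M x (lact M x' m);
  ract_comp : forall a b b' b'' (m : M a b) (y : mor B b' b) (y' : mor B b'' b'),
    ract M m (mcomp y y') = ract M (ract M m y) y';
  lact_ract : forall a a' b b' (x : mor A a' a) (m : M a' b) (y : mor B b' b),
    lact M x (ract M m y) = ract M (lact M x m) y;
  lact1 : forall a b (m : M a b), lact M (idm a) m = m;
  ract1 : forall a b (m : M a b), ract M m (idm b) = m }.

Definition is_zero (k : fieldType) (A B : dgcat k) (M : bimod A B) : Prop :=
  forall a b (m : M a b), m = 0.

Definition diag (k : fieldType) (A : dgcat k) : bimod A A :=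
  @Bimod k A A (fun a b => mor A b a)
    (fun _ _ _ x m => mcomp x m) (fun _ _ _ m y => mcomp m y).

(* [tens_car true M N a b] is the (a, b) fibre of M (x)_C N, and              *)
(* [tens_car false M N a b] that of M (x)_k N, the direct sum over the        *)
(* objects c of M a c (x)_k N c b.  Elements are formal sums of pairs; two    *)
(* of them are identified when every bilinear (and, over C, balanced) family  *)
(* of maps to a vector space takes the same value on them.                    *)
Section TensorCarrier.
Variables (k : fieldType) (A B C : dgcat k) (over : bool).
Variables (M : bimod A C) (N : bimod C B) (a : A) (b : B).

Definition pure_pair : Type := {c : C & (M a c * N c b)%type}.
Definition formal : Type := {classic (seq pure_pair)}.

Definition formal_sum (W : lmodType k) (F : forall c, M a c -> N c b -> W)
    (s : seq pure_pair) : W :=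
  \sum_(p <- s) F (tag p) (tagged p).1 (tagged p).2.

Record balanced (W : lmodType k) (F : forall c, M a c -> N c b -> W) : Prop :=
  Balanced {
    balanced_linearl : forall c y, linear (fun x => F c x y);
    balanced_linearr : forall c x, linear (F c x);
    balanced_act : over -> forall c c' (x : M a c) (z : mor C c' c) (y : N c' b),
      F c' (ract M x z) y = F c x (lact N z y) }.

Definition formal_eq (s t : formal) : Prop :=
  forall (W : lmodType k) (F : forall c, M a c -> N c b -> W),
    balanced F -> formal_sum F s = formal_sum F t.

Definition formal_eqb : rel formal := fun s t => `[< formal_eq s t >].

Fact formal_eqb_refl : reflexive formal_eqb.
Proof. by move=> s; apply/asboolP. Qed.
Fact formal_eqb_sym : symmetric formal_eqb.
Proof. by move=> s t; apply/asboolP/asboolP => st W F bF; rewrite st. Qed.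
Fact formal_eqb_trans : transitive formal_eqb.
Proof.
move=> t s u /asboolP st /asboolP tu; apply/asboolP => W F bF.
by rewrite st ?tu.
Qed.

Canonical formal_equiv :=
  EquivRel formal_eqb formal_eqb_refl formal_eqb_sym formal_eqb_trans.

Definition tens_car : Type := {eq_quot formal_equiv}%qT.
HB.instance Definition _ := EqQuotient.on tens_car.
HB.instance Definition _ := Choice.on tens_car.

Definition tclass (s : seq pure_pair) : tens_car :=
  (\pi_tens_car (s : formal))%qT.
Definition trepr (t : tens_car) : seq pure_pair := repr t.

Lemma tclassP (s t : seq pure_pair) : tclass s = tclass t <-> formal_eq s t.
Proof. by split=> [/eqmodP/asboolP //|st]; apply/eqmodP/asboolP. Qed.

Lemma treprK t : tclass (trepr t) = t.
Proof. exact: reprK. Qed.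

Lemma formal_sum_repr (W : lmodType k) (F : forall c, M a c -> N c b -> W) s :
  balanced F -> formal_sum F (trepr (tclass s)) = formal_sum F s.
Proof. by move=> bF; apply: (iffLR (tclassP _ _) (treprK _)). Qed.

Definition scale_pair (c : k) (p : pure_pair) : pure_pair :=
  Tagged (fun c => (M a c * N c b)%type) (c *: (tagged p).1, (tagged p).2).

Lemma formal_sum_scale (W : lmodType k) (F : forall c, M a c -> N c b -> W) c s :
  balanced F -> formal_sum F (map (scale_pair c) s) = c *: formal_sum F s.
Proof.
move=> bF; rewrite /formal_sum big_map scaler_sumr; apply: eq_bigr => p _ /=.
have lF := balanced_linearl bF (c := tag p) (tagged p).2.
have F0 : F (tag p) 0 (tagged p).2 = 0.
  by have := lF (-1) 0 0; rewrite scaler0 addr0 scaleN1r addNr.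
by have := lF c (tagged p).1 0; rewrite F0 !addr0.
Qed.

Lemma formal_sum_cat (W : lmodType k) (F : forall c, M a c -> N c b -> W) s t :
  formal_sum F (s ++ t) = formal_sum F s + formal_sum F t.
Proof. exact: big_cat. Qed.

Definition tens_add (s t : tens_car) := tclass (trepr s ++ trepr t).
Definition tens_scale (c : k) (s : tens_car) := tclass (map (scale_pair c) (trepr s)).
Definition tens_zero := tclass [::].
Definition tens_opp := tens_scale (-1).

Let tensE := (formal_sum_repr, formal_sum_scale, formal_sum_cat).

Fact tens_addA : associative tens_add.
Proof. by move=> s t u; apply/tclassP => W F bF; rewrite !tensE // addrA. Qed.
Fact tens_addC : commutative tens_add.
Proof. by move=> s t; apply/tclassP => W F bF; rewrite !tensE // addrC. Qed.
Fact tens_add0 : left_id tens_zero tens_add.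
Proof.
move=> s; rewrite -[RHS]treprK; apply/tclassP => W F bF.
by rewrite !tensE // {1}/formal_sum big_nil add0r.
Qed.
Fact tens_addN : left_inverse tens_zero tens_opp tens_add.
Proof.
move=> s; apply/tclassP => W F bF.
by rewrite !tensE // scaleN1r addNr /formal_sum big_nil.
Qed.

HB.instance Definition _ :=
  GRing.isZmodule.Build tens_car tens_addA tens_addC tens_add0 tens_addN.

Fact tens_scaleA c d s : tens_scale c (tens_scale d s) = tens_scale (c * d) s.
Proof. by apply/tclassP => W F bF; rewrite !tensE // scalerA. Qed.
Fact tens_scale1 : left_id 1 tens_scale.
Proof.
move=> s; rewrite -[RHS]treprK; apply/tclassP => W F bF.
by rewrite !tensE // scale1r.
Qed.
Fact tens_scaleDr : right_distributive tens_scale +%R.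
Proof. by move=> c s t; apply/tclassP => W F bF; rewrite !tensE // scalerDr. Qed.
Fact tens_scaleDl s : {morph tens_scale^~ s : c d / c + d}.
Proof. by move=> c d; apply/tclassP => W F bF; rewrite !tensE // scalerDl. Qed.

HB.instance Definition _ := GRing.Zmodule_isLmodule.Build k tens_car
  tens_scaleA tens_scale1 tens_scaleDr tens_scaleDl.

Definition tpure c (x : M a c) (y : N c b) : tens_car :=
  tclass [:: Tagged (fun c => (M a c * N c b)%type) (x, y)].

Definition tlift (W : lmodType k) (F : forall c, M a c -> N c b -> W)
    (t : tens_car) : W := formal_sum F (trepr t).

(* balanced families factor uniquely through the tensor product *)
Lemma tpure_balanced : balanced tpure.
Proof.
split=> [c y t x x'|c x t y y'|ov c c' x z y]; apply/tclassP => W F bF;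
  rewrite ?tensE // /formal_sum !big_seq1 /=.
- exact: (balanced_linearl bF).
- exact: (balanced_linearr bF).
- exact: (balanced_act bF).
Qed.

Lemma tlift_sum (W : lmodType k) (F : forall c, M a c -> N c b -> W) :
  balanced F -> linear (tlift F) /\ forall c x y, tlift F (tpure x y) = F c x y.
Proof.
move=> bF; split=> [t s s'|c x y]; rewrite /tlift !tensE //.
by rewrite /formal_sum big_seq1.
Qed.

Lemma tens_pure_sum (t : tens_car) : t = tlift tpure t.
Proof.
rewrite -[LHS]treprK; rewrite /tlift; elim: (trepr t) => [|p s IHs].
  by rewrite /formal_sum big_nil.
rewrite /formal_sum big_cons -/(formal_sum _ s) -IHs; case: p => c [x y].
apply/tclassP => W F bF; rewrite !tensE //.
by rewrite /formal_sum big_cons big_seq1.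
Qed.

End TensorCarrier.

Arguments tpure {k A B C over M N a b c} x y.
Arguments tlift {k A B C over M N a b W} F t.

Section Tensor.
Variables (k : fieldType) (A B C : dgcat k) (over : bool).
Variables (M : bimod A C) (N : bimod C B).

Definition tens_gr (a : A) (b : B) : grvect k :=
  @GrVect k (tens_car over M N a b)
    (fun n => tlift (fun c x y => hsum x (fun i x' => tpure x' (pr (n - i) y)))).

Definition tens_dg (a : A) (b : B) : dgvect k :=
  @DgVect k (tens_gr a b)
    (tlift (fun c x y =>
       tpure (dd x) y + tpure (twist 1 x) (dd y) : tens_car over M N a b)).

Definition tens : bimod A B :=
  @Bimod k A B tens_dg
    (fun a a' b z => tlift (fun c x y =>
       tpure (lact M z x) y : tens_car over M N a b))
    (fun a b b' t z => tlift (fun c x y =>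
       tpure x (ract N y z) : tens_car over M N a b') t).

Definition tmk a c b (x : M a c) (y : N c b) : tens a b := tpure x y.

End Tensor.

Arguments tmk {k A B C over M N a c b} x y.

Notation tensor M N := (tens true M N).
Notation tensor_k M N := (tens false M N).

Section Morphisms.
Variables (k : fieldType) (A B : dgcat k).

Definition bmap (M N : bimod A B) : Type := forall a b, M a b -> N a b.

Variables M N : bimod A B.

(* the elements of degree n of the complex Hom_{A-B}(M, N) *)
Record is_hom (n : int) (f : bmap M N) : Prop := IsHom {
  hom_linear : forall a b, linear (f a b);
  hom_homog : forall a b i (x : M a b), homog i x -> homog (n + i) (f a b x);
  hom_lact : forall a a' b i (z : mor A a' a) (x : M a' b), homog i z ->
    f a b (lact M z x) = sgn k (n * i) *: lact N z (f a' b x);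
  hom_ract : forall a b b' (x : M a b) (z : mor B b' b),
    f a b' (ract M x z) = ract N (f a b x) z }.

(* the differential of an element of degree n *)
Definition dhom (n : int) (f : bmap M N) : bmap M N :=
  fun a b x => dd (f a b x) - sgn k n *: f a b (dd x).

End Morphisms.

(* The bimodule (+)_i E_i[- p i], with differential the sum of the            *)
(* differentials (-1)^(p i) d of the shifts E_i[- p i] and of delta.  An      *)
(* element z of A acts on the left of the shift by (-1)^(p i deg z) z, and B  *)
(* acts on the right without sign.                                            *)
Section Convolution.
Variables (k : fieldType) (A B : dgcat k) (I : choiceType) (p : I -> int).
Variable E : I -> bimod A B.
Variable delta : forall j a b, dsum (fun i => E i a b : lmodType k) -> E j a b.

Definition shift_gr (a : A) (b : B) : grvect k :=
  @GrVect k (dsum (fun i => E i a b : lmodType k))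
    (fun n x => to_dsum (fun i => pr (n - p i) (dcomp x i))).

Definition shift_dg (a : A) (b : B) : dgvect k :=
  @DgVect k (shift_gr a b)
    (fun x => to_dsum (fun j => sgn k (p j) *: dd (dcomp x j) + delta j x)).

Definition shift_sum : bimod A B :=
  @Bimod k A B shift_dg
    (fun a a' b z x => to_dsum (fun i => lact (E i) (twist (p i) z) (dcomp x i)))
    (fun a b b' x z => to_dsum (fun i => ract (E i) (dcomp x i) z)).

End Convolution.

Section Bar.
Variables (k : fieldType) (A : dgcat k).

(* the tensor power of A with n + 1 factors *)
Fixpoint tpow (n : nat) : bimod A A :=
  if n is n'.+1 then tensor_k (diag A) (tpow n') else diag A.

(* id^i (x) m (x) id^(n - i), for i <= n; the case i = 0 is the left action   *)
(* of the first factor on the tensor product of the others                    *)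
Fixpoint mult_at (n i : nat) {struct n} : bmap (tpow n.+1) (tpow n) :=
  match n return bmap (tpow n.+1) (tpow n) with
  | 0 => fun a b =>
      tlift (fun c (x : diag A a c) (y : tpow 0 c b) => lact (tpow 0) x y)
  | n'.+1 => fun a b =>
      if i is i'.+1
      then tlift (fun c (x : diag A a c) (y : tpow n'.+1 c b) =>
                    tmk x (@mult_at n' i' c b y) : tpow n'.+1 a b)
      else tlift (fun c (x : diag A a c) (y : tpow n'.+1 c b) =>
                    lact (tpow n'.+1) x y)
  end.

Arguments mult_at n i {a b} _.

(* The summand of index n is the tensor power with n + 2 factors, placed in   *)
(* degree - n.                                                                *)
Definition bar_delta (n : nat) (a b : A)
    (x : dsum (fun n => tpow n.+1 a b : lmodType k)) : tpow n.+1 a b :=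
  \sum_(i < n.+2) (-1) ^+ i *: mult_at n.+1 i (dcomp x n.+1).

Definition bar : bimod A A :=
  shift_sum (fun n : nat => - n%:Z) (E := fun n => tpow n.+1) bar_delta.

Definition bar_tau (a b : A) (x : bar a b) : diag A a b := mult_at 0 0 (dcomp x 0).

(* nonempty words: Cons x w stands for x (x) w *)
Inductive word : A -> A -> Type :=
  | Letter a b (x : diag A a b) : word a b
  | Cons a c b (x : diag A a c) (w : word c b) : word a b.

(* the number of letters, minus one *)
Fixpoint wsize a b (w : word a b) : nat :=
  match w with Letter _ _ _ => 0 | Cons _ _ _ _ w' => (wsize w').+1 end.

Fixpoint wtens a b (w : word a b) : tpow (wsize w) a b :=
  match w with
  | Letter _ _ x => x
  | Cons _ _ _ x w' => tmk x (wtens w')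
  end.

(* a word with at least two letters, as an element of the bar complex *)
Definition wbar a b (w : word a b) : bar a b :=
  match w with
  | Letter _ _ _ => 0
  | Cons _ _ _ x w' => dinj (wsize w') (tmk x (wtens w') : tpow (wsize w').+1 _ _)
  end.

Fixpoint wsnoc a c (w : word a c) : forall b, diag A c b -> word a b :=
  match w with
  | Letter _ _ x => fun b y => Cons x (Letter y)
  | Cons _ _ _ x w' => fun b y => Cons x (wsnoc w' y)
  end.

Fixpoint wtwist (n : int) a b (w : word a b) : word a b :=
  match w with
  | Letter _ _ x => Letter (twist n x)
  | Cons _ _ _ x w' => Cons (twist n x) (wtwist n w')
  end.

Fixpoint wsplits a b (w : word a b) : seq {c : A & (word a c * word c b)%type} :=
  match w with
  | Letter _ _ _ => [::]
  | Cons a c b x w' =>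
      Tagged (fun c => (word a c * word c b)%type) (Letter x, w') ::
      [seq Tagged (fun c => (word a c * word c b)%type)
             (Cons x (tagged s).1, (tagged s).2) | s <- wsplits w']
  end.

(* extends a multilinear function of words with n + 1 letters to tpow n *)
Fixpoint wlift (n : nat) (W : lmodType k) (a b : A) {struct n} :
    (word a b -> W) -> tpow n a b -> W :=
  match n return (word a b -> W) -> tpow n a b -> W with
  | 0 => fun F x => F (Letter x)
  | n'.+1 => fun F => tlift (fun c x y => wlift (fun w => F (Cons x w)) y)
  end.

(* A word with n letters goes to the sum, over its n - 1 cuts w = u v, of     *)
(* (u (x) 1) (x) (1 (x) v).  On the level of twisted complexes there is no    *)
(* sign; the sign here comes from the identification of the tensor product of *)
(* the convolutions of two twisted complexes with the convolution of their    *)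
(* tensor product, which sends e (x) f, with f in the summand placed in       *)
(* degree j, to (-1)^(j deg e) e (x) f, deg e being taken before the shift.   *)
(* Here j = - (wsize v).                                                      *)
Definition coprod_word a b (w : word a b) : tensor bar bar a b :=
  \sum_(s <- wsplits w)
    let u := (tagged s).1 in let v := (tagged s).2 in
    tmk (wbar (wsnoc (wtwist (wsize v)%:Z u) (idm (tag s) : diag A _ _)))
          (wbar (Cons (idm (tag s) : diag A _ _) v)).

Definition coprod a b (x : bar a b) : tensor bar bar a b :=
  \sum_(n \in [set: nat]) wlift (@coprod_word a b) (dcomp x n).

End Bar.

Section BarCategory.
Variables (k : fieldType) (A B : dgcat k).

Definition tilde (M : bimod A B) : bimod A B := tensor (tensor (bar A) M) (bar B).

(* A morphism of degree n from M to N in the bar category is a map f of type  *)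
(* bmap (tilde M) N with is_hom n f; its differential is dhom n f.            *)

Definition bar_id (M : bimod A B) : bmap (tilde M) M := fun a b =>
  tlift (fun b' (u : tensor (bar A) M a b') (y : bar B b' b) =>
    tlift (fun a' (x : bar A a a') (m : M a' b') =>
      ract M (lact M (bar_tau x) m) (bar_tau y)) u).

(* (id (x) f (x) id) o (Delta (x) id (x) Delta), for f of degree n *)
Definition tilde_map (M N : bimod A B) (n : int) (f : bmap (tilde M) N) :
    bmap (tilde M) (tilde N) := fun a b =>
  tlift (fun b' (u : tensor (bar A) M a b') (y : bar B b' b) =>
    tlift (fun a' (x : bar A a a') (m : M a' b') =>
      tlift (fun a'' (x1 : bar A a a'') (x2 : bar A a'' a') =>
        tlift (fun b'' (y1 : bar B b' b'') (y2 : bar B b'' b) =>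
          tmk (tmk (twist n x1)
                       (f a'' b'' (tmk (tmk x2 m) y1)) : tensor (bar A) N a b'')
                y2 : tilde N a b)
        (coprod y))
      (coprod x))
    u).

(* g o f, for f of degree n *)
Definition bar_comp (L M N : bimod A B) (n : int)
    (g : bmap (tilde M) N) (f : bmap (tilde L) M) : bmap (tilde L) N :=
  fun a b x => g a b (tilde_map n f x).

Definition closed0 (M N : bimod A B) (f : bmap (tilde M) N) : Prop :=
  is_hom 0 f /\ forall a b (x : tilde M a b), dhom 0 f x = 0.

Definition homotopic (M N : bimod A B) (f g : bmap (tilde M) N) : Prop :=
  exists h : bmap (tilde M) N,
    is_hom (-1) h /\
    forall a b (x : tilde M a b), f a b x - g a b x = dhom (-1) h x.

Definition homotopy_equivalence (M N : bimod A B) (f : bmap (tilde M) N) : Prop :=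
  closed0 f /\ exists g : bmap (tilde N) M,
    [/\ closed0 g,
        homotopic (bar_comp 0 g f) (@bar_id M)
      & homotopic (bar_comp 0 f g) (@bar_id N)].

(* the existence of a homotopy equivalence in the bar category, whose objects *)
(* are the DG-bimodules                                                       *)
Definition homotopy_equivalent (M N : bimod A B) : Prop :=
  [/\ is_bimod M, is_bimod N
    & exists f : bmap (tilde M) N, homotopy_equivalence f].

Section Twisted.
Variables (E : int -> bimod A B) (alpha : forall i j, bmap (tilde (E i)) (E j)).

Arguments alpha : clear implicits.

Record is_twisted : Prop := IsTwisted {
  twisted_bimod : forall i, is_bimod (E i);
  twisted_finite : exists s : seq int, forall i, i \notin s -> is_zero (E i);
  twisted_hom : forall i j : int, is_hom (i - j + 1) (alpha i j);
  twisted_eq : forall (i j : int) a b (x : tilde (E i) a b),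
    sgn k j *: dhom (i - j + 1) (alpha i j) x +
    \sum_(l \in [set: int])
       bar_comp (i - l + 1) (alpha l j) (alpha i l) x = 0 }.

Definition one_sided : Prop := forall i j : int, (j <= i)%R ->
  forall a b (x : tilde (E i) a b), alpha i j a b x = 0.

Definition conv_delta (j : int) a b
    (x : dsum (fun i => tilde (E i) a b : lmodType k)) : tilde (E j) a b :=
  \sum_(i \in [set: int]) tilde_map (i - j + 1) (alpha i j) (dcomp x i).

Definition conv : bimod A B :=
  shift_sum (fun i : int => i) (E := fun i => tilde (E i)) conv_delta.

End Twisted.

End BarCategory.

(* Hom_B(M, N), with the C-A-bimodule structure (z f)(x) = z f(x),            *)
(* (f z)(x) = f(z x); no signs arise                                          *)
Section HomRight.
Variables (k : fieldType) (A B C : dgcat k) (M : bimod A B) (N : bimod C B).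

Definition rfam (c : C) (a : A) : lmodType k :=
  dprod (fun b => dprod (fun _ : M a b => N c b : lmodType k) : lmodType k).

Record is_rhom c a (n : int) (f : rfam c a) : Prop := IsRhom {
  rhom_linear : forall b, linear (f b : M a b -> N c b);
  rhom_homog : forall b i (x : M a b), homog i x -> homog (n + i) (f b x);
  rhom_ract : forall b b' (x : M a b) (z : mor B b' b),
    f b' (ract M x z) = ract N (f b x) z }.

Definition rhom (c : C) (a : A) : lmodType k :=
  spanned (fun f : rfam c a => exists n, is_rhom n f).

Definition to_rhom c a (f : forall b, M a b -> N c b) : rhom c a :=
  to_span _ (DProd (fun b => DProd (f b)) : rfam c a).

Definition rapp c a (f : rhom c a) b (x : M a b) : N c b := val f b x.

Definition rhom_gr (c : C) (a : A) : grvect k :=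
  @GrVect k (rhom c a) (fun n f =>
    to_rhom (fun b x => hsum x (fun i x' => pr (n + i) (rapp f x')))).

Definition rhom_dg (c : C) (a : A) : dgvect k :=
  @DgVect k (rhom_gr c a) (fun f =>
    to_rhom (fun b x =>
      dd (rapp f x) - rapp (twist 1 (f : rhom_gr c a)) (dd x))).

Definition homR : bimod C A :=
  @Bimod k C A rhom_dg
    (fun c c' a z f => to_rhom (fun b x => lact N z (rapp f x)))
    (fun c a a' f z => to_rhom (fun b x => rapp f (lact M z x))).

End HomRight.

(* Hom_{A^opp}(M, N), with the B-C-bimodule structure                         *)
(* (z f)(x) = (-1)^(deg z (deg f + deg x)) f(x z),                            *)
(* (f z)(x) = (-1)^(deg z deg x) f(x) z                                       *)
Section HomLeft.
Variables (k : fieldType) (A B C : dgcat k) (M : bimod A B) (N : bimod A C).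

Definition lfam (b : B) (c : C) : lmodType k :=
  dprod (fun a => dprod (fun _ : M a b => N a c : lmodType k) : lmodType k).

Record is_lhom b c (n : int) (f : lfam b c) : Prop := IsLhom {
  lhom_linear : forall a, linear (f a : M a b -> N a c);
  lhom_homog : forall a i (x : M a b), homog i x -> homog (n + i) (f a x);
  lhom_lact : forall a a' i (z : mor A a' a) (x : M a' b), homog i z ->
    f a (lact M z x) = sgn k (n * i) *: lact N z (f a' x) }.

Definition lhom (b : B) (c : C) : lmodType k :=
  spanned (fun f : lfam b c => exists n, is_lhom n f).

Definition to_lhom b c (f : forall a, M a b -> N a c) : lhom b c :=
  to_span _ (DProd (fun a => DProd (f a)) : lfam b c).

Definition lapp b c (f : lhom b c) a (x : M a b) : N a c := val f a x.

Definition lhom_gr (b : B) (c : C) : grvect k :=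
  @GrVect k (lhom b c) (fun n f =>
    to_lhom (fun a x => hsum x (fun i x' => pr (n + i) (lapp f x')))).

Definition lhom_dg (b : B) (c : C) : dgvect k :=
  @DgVect k (lhom_gr b c) (fun f =>
    to_lhom (fun a x =>
      dd (lapp f x) - lapp (twist 1 (f : lhom_gr b c)) (dd x))).

Definition homL : bimod B C :=
  @Bimod k B C lhom_dg
    (fun b b' c z f => to_lhom (fun a x =>
       hsum z (fun i z' => hsum (f : lhom_gr b' c) (fun n f' => hsum x (fun j x' =>
         sgn k (i * (n + j)) *: lapp f' (ract M x' z'))))))
    (fun b c c' f z => to_lhom (fun a x =>
       hsum z (fun i z' => ract N (lapp f (twist i x)) z'))).

End HomLeft.

Section Dual.
Variables (k : fieldType) (A B : dgcat k).

Definition dualB (M : bimod A B) : bimod B A := homR (tensor M (bar B)) (diag B).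

Definition dualA (M : bimod A B) : bimod B A := homL (tensor (bar A) M) (diag A).

Variables (M' M : bimod A B) (n : int) (alpha : bmap (tilde M') M).

Arguments alpha : clear implicits.

(* The dual of alpha, of degree n, sends x (x) g (x) y to                     *)
(*   m' (x) z |-> (-1)^(n (deg x + deg g))                                    *)
(*                  tau(x) g(alpha(y (x) m' (x) z_1) (x) z_2).                *)
Definition dualB_map : bmap (tilde (dualB M)) (dualB M') := fun b a =>
  tlift (fun a' (u : tensor (bar B) (dualB M) b a') (y : bar A a' a) =>
    tlift (fun b' (x : bar B b b') (g : dualB M b' a') =>
      hsum x (fun i x' => hsum g (fun j g' => sgn k (n * (i + j)) *:
        to_rhom (M := tensor M' (bar B)) (N := diag B) (c := b) (a := a) (fun b'' =>
          tlift (fun e (m : M' a e) (z : bar B e b'') =>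
            tlift (fun e' (z1 : bar B e e') (z2 : bar B e' b'') =>
              mcomp (bar_tau x')
                (rapp g' (tmk (alpha a' e' (tmk (tmk y m) z1)) z2)))
            (coprod z))))))
    u).

(* The dual of alpha, of degree n, sends x (x) g (x) y to                     *)
(*   z (x) m' |-> (-1)^s g(z_1 (x) alpha(z_2 (x) m' (x) x)) tau(y),           *)
(*   s = n (deg g + deg z_1) + deg x (deg g + deg z + deg m')                 *)
(*         + deg y (deg z + deg m'),                                          *)
(* the sign given by the Koszul rule for the permutation which takes          *)
(* alpha, x, g, y, z_1, z_2, m' to g, z_1, alpha, z_2, m', x, y.              *)
Definition dualA_map : bmap (tilde (dualA M)) (dualA M') := fun b a =>
  tlift (fun a' (u : tensor (bar B) (dualA M) b a') (y : bar A a' a) =>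
    tlift (fun b' (x : bar B b b') (g : dualA M b' a') =>
      hsum x (fun i x' => hsum g (fun j g' => hsum y (fun l y' =>
        to_lhom (M := tensor (bar A) M') (N := diag A) (b := b) (c := a) (fun a'' =>
          tlift (fun e (z : bar A a'' e) (m : M' e b) =>
            tlift (fun e' (z1 : bar A a'' e') (z2 : bar A e' e) =>
              hsum z1 (fun p z1' => hsum z2 (fun q z2' => hsum m (fun r m' =>
                sgn k (n * (j + p) + i * (j + (p + q) + r) + l * ((p + q) + r)) *:
                mcomp (lapp g' (tmk z1' (alpha e' b' (tmk (tmk z2' m') x'))))
                     (bar_tau y')))))
            (coprod z)))))))
    u).

End Dual.

(* Main.v *)
Require Import Defs.
From HB Require Import structures.
From mathcomp Require Import all_boot all_order all_algebra.
From mathcomp Require Import all_classical.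
From mathcomp Require Import zify ring.
From Stdlib Require Import Btauto.

Set Implicit Arguments.
Unset Strict Implicit.
Unset Printing Implicit Defensive.

Import GRing.Theory.
Local Open Scope ring_scope.

(* The bar category of bimodules is a DG-category, and both dualising functors are contravariant         *)
(* DG-functors on it.  A convolution is determined by injections iota_i and projections pi_i with        *)
(* D iota_i = sum_j iota_j alpha_ij, and a contravariant DG-functor carries such data to such data, with *)
(* the signs of the statement.  Hence the dual of {E_i} is the formal convolution of the duals of the    *)
(* bar resolutions of the E_(-i), whereas the right-hand side is that of the bar resolutions of their    *)
(* duals.  The identity of the bar resolution of E, seen as a morphism from E to it, is strictly natural *)
(* in the bar category and a homotopy equivalence.  It gives a diagonal map between the two twisted      *)
(* complexes whose entries are homotopy equivalences, and for one-sided twisted complexes such a map is  *)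
(* a homotopy equivalence: the diagonal contraction of its cone is exact up to a nilpotent error n, and  *)
(* a Newton iteration replaces n by - n^2 until it vanishes.                                             *)

(** * Linear algebra and signs *)

(** A contravariant DG-functor F carries convolutions to convolutions almost for formal reasons. A
    convolution X of (E_i, a_ij) is described inside a DG-category by orthogonal injections iota_i
    of degree i and projections pi_i of degree -i, with sum of iota_i pi_i equal to 1 and D iota_i
    equal to the sum of the iota_j a_ij ([fconv]). F turns the projections of X into injections of
    F(X), and the Koszul rule F(g f) = (-1)^(deg g deg f) F(f) F(g) together with the shifts
    produces exactly the exponent j^2 + ij + 1 ([dual_twisted], [fconv_dual]).

    The convolution of bimodules is, however, a direct sum of shifted bar resolutions [tilde (E i)]
    and not of the [E i] ([conv_fconv]). The left-hand side of the theorem is therefore a formal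
    convolution of the F(tilde E_(-i)), the right-hand side one of the tilde F(E_(-i)). They are
    compared through F(tilde E) -> F(E) -> tilde F(E), both arrows coming from the unit E -> tilde E
    whose underlying map is the identity of [tilde E]. This unit is strictly natural for morphisms
    of all degrees ([bar_unit_natural]). It is a homotopy equivalence ([hequiv_bar_unit]) because it
    is a section of the action map tilde E -> E, which the bar category inverts up to homotopy: the
    two counits from the tensor square of the bar complex to the bar complex are homotopic through
    concatenation of words ([dhom_concat]).

    The entries of the comparison commute with the differentials of the two twisted complexes, but
    their homotopy inverses and homotopies need not. Put on the diagonal, these contract the cone of
    the comparison up to an error. Because the complexes are one-sided, all parts of the error raise
    the index strictly, except one off-diagonal entry that does not lower it. The Newton step H - H
    (D H - 1) replaces the error by minus its square, and the finiteness of the complexes makes it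
    vanish after finitely many steps ([perturbation], [conv_hequiv]).

    Most of the length goes into the DG-category itself and the two functors on it. The bar complex
    is a coassociative counital coalgebra ([coprod_coassoc], [coprod_counitl], [coprod_counitr],
    [coprod_closed]). A morphism of the bar category extends to a map of cofree comodules on the
    left and on the right ([lext], [rext]), and [tilde_map] is the combination of both
    ([tilde_mapE]); hence composition is associative ([bar_compA]). The dual of a morphism only
    involves one of these two halves ([dualB_mapE], [dualA_mapE]), and contravariance follows from
    [starR_comp] and [starL_comp]. The properties shared by both dualities are collected in
    [dual_axioms], and the argument about convolutions is carried out once for both. *)

Section Linear.
Variables (k : fieldType) (U V W : lmodType k).

Lemma lin0 (f : U -> V) : linear f -> f 0 = 0.
Proof. by move=> lf; have := lf (-1) 0 0; rewrite scaler0 addr0 scaleN1r addNr. Qed.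

Lemma linD (f : U -> V) : linear f -> {morph f : x y / x + y}.
Proof. by move=> lf x y; have := lf 1 x y; rewrite !scale1r. Qed.

Lemma linZ (f : U -> V) : linear f -> forall c x, f (c *: x) = c *: f x.
Proof. by move=> lf c x; have := lf c x 0; rewrite (lin0 lf) !addr0. Qed.

Lemma linN (f : U -> V) : linear f -> {morph f : x / - x}.
Proof. by move=> lf x; rewrite -!scaleN1r (linZ lf). Qed.

Lemma linB (f : U -> V) : linear f -> {morph f : x y / x - y}.
Proof. by move=> lf x y; rewrite (linD lf) (linN lf). Qed.

Lemma lin_sum (f : U -> V) : linear f -> forall I (r : seq I) (P : pred I) F,
  f (\sum_(i <- r | P i) F i) = \sum_(i <- r | P i) f (F i).
Proof. by move=> lf I r P F; apply: (big_morph f (linD lf) (lin0 lf)). Qed.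

Lemma lin_id : linear (fun x : U => x).
Proof. by []. Qed.

Lemma lin_cst0 : linear (fun _ : U => 0 : V).
Proof. by move=> c x y; rewrite scaler0 addr0. Qed.

Lemma lin_comp (g : V -> W) (f : U -> V) :
  linear g -> linear f -> linear (fun x => g (f x)).
Proof. by move=> lg lf c x y; rewrite lf lg. Qed.

Lemma lin_add (f g : U -> V) : linear f -> linear g -> linear (fun x => f x + g x).
Proof. by move=> lf lg c x y; rewrite lf lg scalerDr addrACA. Qed.

Lemma lin_scale (a : k) (f : U -> V) : linear f -> linear (fun x => a *: f x).
Proof. by move=> lf c x y; rewrite lf scalerDr !scalerA mulrC. Qed.

Lemma lin_opp (f : U -> V) : linear f -> linear (fun x => - f x).
Proof. by move=> lf c x y; rewrite lf opprD scalerN. Qed.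

Lemma lin_sub (f g : U -> V) : linear f -> linear g -> linear (fun x => f x - g x).
Proof. by move=> lf lg; apply/lin_add/lin_opp. Qed.

Lemma lin_bigsum I (r : seq I) (P : pred I) (F : I -> U -> V) :
  (forall i, linear (F i)) -> linear (fun x => \sum_(i <- r | P i) F i x).
Proof.
move=> lF c x y; rewrite scaler_sumr -big_split.
by apply: eq_bigr => i _; apply: lF.
Qed.

End Linear.

Section FiniteSupportSums.
Variables (k : fieldType) (I : choiceType).

Lemma fssumE (V : lmodType k) (s : seq I) (F : I -> V) :
  uniq s -> (forall i, i \notin s -> F i = 0) ->
  \sum_(i \in [set: I]) F i = \sum_(i <- s) F i.
Proof.
move=> us F0; rewrite (fsbigE s) //; last by move=> i _ /F0.
by apply: eq_bigl => i; rewrite in_setT.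
Qed.

Lemma fssum1 (V : lmodType k) (i : I) (F : I -> V) :
  (forall j, j != i -> F j = 0) -> \sum_(j \in [set: I]) F j = F i.
Proof.
move=> F0; rewrite (@fssumE _ [:: i]) //; first by rewrite big_seq1.
by move=> j; rewrite inE => /F0.
Qed.

Lemma fssum0 (V : lmodType k) (F : I -> V) :
  (forall j, F j = 0) -> \sum_(j \in [set: I]) F j = 0.
Proof. by move=> F0; rewrite (@fssumE _ [::]) ?big_nil. Qed.

End FiniteSupportSums.

Section Signs.
Variable k : fieldType.

(** Signs depend on their exponents only through parity, and parity turns sums and products of
    integers into [xorb] and [andb]. Every comparison of signs below thereby becomes a Boolean
    tautology, which [odd_tac] decides. *)
Definition oddz (n : int) : bool := odd `|n|%N.

Lemma oddzD m n : oddz (m + n) = xorb (oddz m) (oddz n).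
Proof. by rewrite /oddz; case: (boolP (odd `|m|%N)); case: (boolP (odd `|n|%N)) => /=; lia. Qed.

Lemma oddzN m : oddz (- m) = oddz m.
Proof. by rewrite /oddz abszN. Qed.

Lemma oddzM m n : oddz (m * n) = andb (oddz m) (oddz n).
Proof. by rewrite /oddz abszM oddM. Qed.

Lemma oddz0 : oddz 0 = false. Proof. by []. Qed.
Lemma oddz1 : oddz 1 = true. Proof. by []. Qed.
Lemma oddzS (n : nat) : oddz n.+1%:Z = negb (oddz n%:Z).
Proof. by []. Qed.

Lemma sgnE n : sgn k n = if oddz n then -1 else 1.
Proof.
rewrite /sgn /oddz; case: n => n.
  by rewrite -exprnP -signr_odd absz_nat; case: odd; rewrite ?expr1 ?expr0.
rewrite NegzE -exprnN -signr_odd abszN absz_nat.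
by case: odd; rewrite ?expr1 ?expr0 ?invrN1 ?invr1.
Qed.

Lemma sgn_eq m n : oddz m = oddz n -> sgn k m = sgn k n.
Proof. by rewrite !sgnE => ->. Qed.

Lemma sgnD m n : sgn k (m + n) = sgn k m * sgn k n.
Proof. by rewrite !sgnE oddzD; do 2!case: oddz; rewrite /= ?mulrNN ?mulr1 ?mul1r. Qed.

Lemma sgn0 : sgn k 0 = 1. Proof. by rewrite sgnE. Qed.
Lemma sgn1 : sgn k 1 = -1. Proof. by rewrite sgnE. Qed.

Lemma sgnN_ n : - sgn k n = sgn k (n + 1).
Proof. by rewrite sgnD sgn1 mulrN1. Qed.

Lemma sgnZ_eq (V : lmodType k) m n (x : V) :
  oddz m = oddz n -> sgn k m *: x = sgn k n *: x.
Proof. by move/sgn_eq ->. Qed.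

Lemma sgnZ1 (V : lmodType k) m (x : V) :
  oddz m = false -> sgn k m *: x = x.
Proof. by rewrite sgnE => ->; rewrite scale1r. Qed.

Lemma NsgnZ (V : lmodType k) m (x : V) : - (sgn k m *: x) = sgn k (m + 1) *: x.
Proof. by rewrite -scaleNr sgnN_. Qed.

Lemma sgnZZ (V : lmodType k) m n (x : V) : sgn k m *: (sgn k n *: x) = sgn k (m + n) *: x.
Proof. by rewrite scalerA sgnD. Qed.

End Signs.

Ltac odd_tac :=
  rewrite ?(expr2, oddzD, oddzN, oddzM, oddz0, oddz1, oddzS);
  repeat match goal with |- context [oddz ?n] => let b := fresh "b" in set b := oddz n; clearbody b end;
  rewrite ?(oddzD, oddz0, oddz1);
  try btauto.

(** * Identities in abelian groups, by reflection *)

Section AbelianReflection.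
Variable V : zmodType.

Inductive zexpr := ZVar of nat | ZAdd of zexpr & zexpr | ZOpp of zexpr | ZZero.

Fixpoint zeval (env : seq V) (e : zexpr) : V :=
  match e with
  | ZVar n => nth 0 env n
  | ZAdd e f => zeval env e + zeval env f
  | ZOpp e => - zeval env e
  | ZZero => 0
  end.

(** The Boolean selects which occurrences of the variable are counted, the positive ones for [true]
    and the negative ones for [false]; a negation exchanges the two. With both counts at hand,
    [zcheck] can compare coefficients without subtraction. *)
Fixpoint zcoef (e : zexpr) (s : bool) (n : nat) : nat :=
  match e with
  | ZVar m => (s && (m == n))%N
  | ZAdd e f => zcoef e s n + zcoef f s n
  | ZOpp e => zcoef e (~~ s) n
  | ZZero => 0
  end.

Definition zcheck (m : nat) (e f : zexpr) : bool :=
  all (fun n => zcoef e true n + zcoef f false n == zcoef e false n + zcoef f true n)%N (iota 0 m).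

Fixpoint zbound (e : zexpr) : nat :=
  match e with
  | ZVar n => n.+1
  | ZAdd e f => maxn (zbound e) (zbound f)
  | ZOpp e => zbound e
  | ZZero => 0
  end.

Lemma zevalE env e m : (zbound e <= m)%N ->
  zeval env e = \sum_(0 <= n < m) (nth 0 env n *+ zcoef e true n - nth 0 env n *+ zcoef e false n).
Proof.
elim: e => [n|e IHe f IHf|e IH|] /=.
- move=> nm; rewrite (bigD1_seq n) ?iota_uniq ?mem_index_iota //= eqxx mulr1n mulr0n subr0.
  by rewrite big1 ?addr0 // => i; rewrite eq_sym => /negPf ->; rewrite mulr0n subr0.
- rewrite geq_max => /andP[/IHe -> /IHf ->]; rewrite -big_split; apply: eq_bigr => i _ /=.
  by rewrite !mulrnDr opprD addrACA.
- by move=> /IH ->; rewrite -sumrN; apply: eq_bigr => i _; rewrite opprB.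
- by move=> _; rewrite big1 // => i _; rewrite subrr.
Qed.

Lemma zcheckP env e f : zcheck (maxn (zbound e) (zbound f)) e f -> zeval env e = zeval env f.
Proof.
set m := maxn _ _ => /allP ef.
rewrite (@zevalE env e m) ?leq_maxl // (@zevalE env f m) ?leq_maxr //.
rewrite !big_seq; apply: eq_bigr => n; rewrite mem_index_iota => nm.
have /ef /eqP E : n \in iota 0 m by rewrite mem_iota.
by apply/eqP; rewrite subr_eq addrAC eq_sym subr_eq -!mulrnDr [X in _ *+ X]addnC -E addnC.
Qed.

End AbelianReflection.

Ltac zhead t := lazymatch t with ?f _ => zhead f | _ => t end.
(** Atoms are matched literally, or by unification if their head symbols agree, so that convertible
    forms of one term are identified while terms with different heads are never compared by
    conversion. Scalar factors have to coincide literally. *)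
Ltac zsame x y :=
  first
  [ constr_eq x y
  | lazymatch x with
    | (?c *: ?u)%R =>
      lazymatch y with (?d *: ?v)%R => constr_eq c d; zsame u v end
    | _ => let f := zhead x in let g := zhead y in constr_eq f g; unify x y
    end ].
Ltac zsameb x y :=
  match goal with
  | _ => let _ := match goal with _ => zsame x y end in constr:(true)
  | _ => constr:(false)
  end.
Ltac zindex x l :=
  lazymatch l with
  | ?y :: ?t =>
    let b := zsameb x y in
    lazymatch b with
    | true => constr:(0%N)
    | false => let n := zindex x t in constr:(n.+1)
    end
  end.
Ltac zmem x l :=
  lazymatch l with
  | ?y :: ?t =>
    let b := zsameb x y in
    lazymatch b with true => constr:(true) | false => zmem x t end
  | _ => constr:(false)
  end.
Ltac zatoms e l :=
  lazymatch e with
  | (?a + ?b)%R => let l := zatoms a l in zatoms b l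
  | (- ?a)%R => zatoms a l
  | 0%R => l
  | _ => let b := zmem e l in lazymatch b with true => l | false => constr:(e :: l) end
  end.
Ltac zquote e l :=
  lazymatch e with
  | (?a + ?b)%R => let x := zquote a l in let y := zquote b l in constr:(ZAdd x y)
  | (- ?a)%R => let x := zquote a l in constr:(ZOpp x)
  | 0%R => constr:(ZZero)
  | _ => let n := zindex e l in constr:(ZVar n)
  end.
Ltac abelian :=
  lazymatch goal with
  | |- @eq ?T ?e ?f =>
    let l := zatoms e (@nil T) in let l := zatoms f l in
    let x := zquote e l in let y := zquote f l in
    refine (@zcheckP _ l x y _); vm_compute; reflexivity
  end.

(** * Graded spaces, direct sums and tensor products *)

Existing Class is_dgvect.
Existing Class is_bimod.
#[export] Existing Instance mor_dgvect.
#[export] Existing Instance bcar_dgvect.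

Section Graded.
Variable k : fieldType.
Implicit Types V : dgvect k.

Section One.
Variables (V : dgvect k) (HV : is_dgvect V).

Lemma pr0 i : pr i (0 : V) = 0. Proof. exact/lin0/(pr_linear HV). Qed.
Lemma prD i (x y : V) : pr i (x + y) = pr i x + pr i y.
Proof. exact: (linD (pr_linear HV i)). Qed.
Lemma prZ i c (x : V) : pr i (c *: x) = c *: pr i x.
Proof. exact: (linZ (pr_linear HV i)). Qed.
Lemma dd0 : dd (0 : V) = 0. Proof. exact/lin0/(dd_linear HV). Qed.
Lemma ddD (x y : V) : dd (x + y) = dd x + dd y.
Proof. exact: (linD (dd_linear HV)). Qed.
Lemma ddB (x y : V) : dd (x - y) = dd x - dd y.
Proof. exact: (linB (dd_linear HV)). Qed.
Lemma ddZ c (x : V) : dd (c *: x) = c *: dd x.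
Proof. exact: (linZ (dd_linear HV)). Qed.

Lemma homog_pr i (x : V) : homog i (pr i x).
Proof. by rewrite /homog (pr_pr HV) eqxx. Qed.

Lemma pr_homog i j (x : V) : homog i x -> pr j x = if j == i then x else 0.
Proof. by move=> <-; rewrite (pr_pr HV); case: eqP => [->|]. Qed.

Lemma homog0 i : homog i (0 : V). Proof. exact: pr0. Qed.
Lemma homogD i (x y : V) : homog i x -> homog i y -> homog i (x + y).
Proof. by rewrite /homog prD => -> ->. Qed.
Lemma homogZ i c (x : V) : homog i x -> homog i (c *: x).
Proof. by rewrite /homog prZ => ->. Qed.
Lemma homogN i (x : V) : homog i x -> homog i (- x).
Proof. by rewrite -scaleN1r; apply: homogZ. Qed.
Lemma homogB i (x y : V) : homog i x -> homog i y -> homog i (x - y).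
Proof. by move=> hx hy; apply/homogD/homogN. Qed.
Lemma homog_sum i I (r : seq I) (P : pred I) (F : I -> V) :
  (forall j, P j -> homog i (F j)) -> homog i (\sum_(j <- r | P j) F j).
Proof. by move=> hF; apply: big_ind => //; [apply: homog0 | move=> *; apply: homogD]. Qed.

Lemma pr_support (x : V) : exists s : seq int, uniq s /\ forall i, i \notin s -> pr i x = 0.
Proof.
have [s [us xE]] := pr_sum HV x; exists s; split=> // i is_.
rewrite xE (lin_sum (pr_linear HV i)) big_seq big1 // => j js.
by rewrite (pr_pr HV); case: eqP => // ij; rewrite ij js in is_.
Qed.

End One.

(** Generation under sums, stated directly as the induction principle for which it is used. The
    integer records the degree of a generator, and most identities below are checked on homogeneous
    generators through [lin_ext]. *)
Definition gens (V : grvect k) (G : int -> V -> Prop) : Prop :=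
  forall P : V -> Prop, P 0 -> (forall x y, P x -> P y -> P (x + y)) ->
    (forall i x, G i x -> P x) -> forall x, P x.

Lemma gens_homog V : is_dgvect V -> gens (@homog k V).
Proof.
move=> HV P P0 PD PG x; have [s [_ ->]] := pr_sum HV x.
by apply: big_ind => // i _; apply: (PG i); apply: homog_pr.
Qed.

(** Elements with a finite decomposition are closed under sums: the union of two supports serves for
    the sum, because orthogonality of the projections makes each component outside a support
    vanish. *)
Lemma sum_components (V : grvect k) (G : int -> V -> Prop) :
  (forall i, linear (@pr k V i)) -> (forall i j (x : V), pr i (pr j x) = if i == j then pr i x else 0) ->
  gens G -> (forall i x, G i x -> homog i x) ->
  forall x : V, exists s : seq int, uniq s /\ x = \sum_(i <- s) pr i x.
Proof.
move=> prl prpr gG Gh; apply: gG => [|x y [s [us xE]] [t [ut yE]]|i x /Gh hx].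
- by exists [::]; rewrite big_nil.
- pose r := undup (s ++ t); have ur : uniq r := undup_uniq _; exists r; split=> //.
  have H (z : V) s' : uniq s' -> z = \sum_(i <- s') pr i z -> {subset s' <= r} ->
      z = \sum_(i <- r) pr i z.
    move=> us' zE sr.
    rewrite {1}zE -(fssumE (I := int) us') ?(fssumE (I := int) ur) // => i ir.
      rewrite zE (lin_sum (prl i)) big_seq big1 // => j js.
      by rewrite prpr; case: eqP => // ij; rewrite ij sr in ir.
    rewrite zE (lin_sum (prl i)) big_seq big1 // => j js.
    by rewrite prpr; case: eqP => // ij; rewrite ij js in ir.
  rewrite {1}(H x s us xE); last by move=> i; rewrite mem_undup mem_cat => ->.
  rewrite {1}(H y t ut yE); last by move=> i; rewrite mem_undup mem_cat orbC => ->.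
  by rewrite -big_split; apply: eq_bigr => i _; rewrite (linD (prl i)).
- by exists [:: i]; rewrite big_seq1.
Qed.

Lemma lin_ext (V : grvect k) (W : lmodType k) G (f g : V -> W) :
  gens G -> linear f -> linear g -> (forall i x, G i x -> f x = g x) ->
  forall x, f x = g x.
Proof.
move=> gG lf lg fg; apply: gG => //; first by rewrite (lin0 lf) (lin0 lg).
by move=> x y fx fy; rewrite (linD lf) (linD lg) fx fy.
Qed.

(** Homogeneity of all values amounts to the equality of two linear maps,
    [pr (n + i) (f x) = f (pr i x)], and can therefore be tested on generators. *)
Lemma homog_ext (V W : dgvect k) (G : int -> V -> Prop) (f : V -> W) n :
  is_dgvect V -> is_dgvect W -> gens G -> (forall i x, G i x -> homog i x) ->
  linear f -> (forall i x, G i x -> homog (n + i) (f x)) ->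
  forall i x, homog i x -> homog (n + i) (f x).
Proof.
move=> HV HW gG Gh lf fG i x hx.
have: pr (n + i) (f x) = f (pr i x); last by rewrite hx.
apply: (lin_ext (G := G) gG (f := fun x => pr (n + i) (f x)) (g := fun x => f (pr i x))).
- exact/lin_comp/lf/(pr_linear HW).
- exact/lin_comp/(pr_linear HV).
move=> j y Gy; rewrite (pr_homog HV _ (Gh _ _ Gy)) (pr_homog HW _ (fG _ _ Gy)).
have ->: (n + i == n + j) = (i == j) by apply/eqP/eqP => [/addrI|->].
by case: eqP; rewrite ?(lin0 lf).
Qed.

Section Hsum.
Variables (V : dgvect k) (HV : is_dgvect V) (W : lmodType k).

Lemma hsum_homog n (x : V) (F : int -> V -> W) :
  homog n x -> (forall m, F m 0 = 0) -> hsum x F = F n x.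
Proof.
move=> hx F0; rewrite /hsum (@fssum1 _ _ _ n); first by rewrite hx.
by move=> j jn; rewrite (pr_homog HV _ hx) (negPf jn).
Qed.

Lemma hsum_lin (F : int -> V -> W) :
  (forall m, linear (F m)) -> linear (fun x => hsum x F).
Proof.
move=> lF c x y /=.
have [s [_ s0]] := pr_support HV x; have [t [_ t0]] := pr_support HV y.
have us := undup_uniq (s ++ t).
have E z : (forall i, i \notin undup (s ++ t) -> pr i z = 0) ->
    hsum z F = \sum_(i <- undup (s ++ t)) F i (pr i z).
  by move=> z0; rewrite /hsum (fssumE us) // => i /z0 ->; rewrite (lin0 (lF i)).
have s0' i : i \notin undup (s ++ t) -> pr i x = 0.
  by rewrite mem_undup mem_cat => /norP[/s0].
have t0' i : i \notin undup (s ++ t) -> pr i y = 0.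
  by rewrite mem_undup mem_cat => /norP[_ /t0].
rewrite !E //; last first.
  by move=> i iu; rewrite (prD HV) (prZ HV) s0' // t0' // scaler0 addr0.
rewrite scaler_sumr -big_split; apply: eq_bigr => i _ /=.
by rewrite (prD HV) (prZ HV) (lF i).
Qed.

(** The components that occur depend on [x] alone, so one finite sum serves for all values of the
    parameter. *)
Lemma hsum_lin_param (U : lmodType k) (F : int -> V -> U -> W) (x : V) :
  (forall m y, linear (F m y)) -> (forall m u, F m 0 u = 0) ->
  linear (fun u => hsum x (fun m y => F m y u)).
Proof.
move=> lF F0 c u v; have [s [us s0]] := pr_support HV x.
have E w : hsum x (fun m y => F m y w) = \sum_(i <- s) F i (pr i x) w.
  by rewrite /hsum (fssumE us) // => i /s0 ->.
by rewrite !E; exact: (lin_bigsum s xpredT (F := fun i w => F i (pr i x) w) (fun i => lF i (pr i x)) c u v).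
Qed.

End Hsum.

Section Twist.
Variables (V : dgvect k) (HV : is_dgvect V).

Lemma twist_lin n : linear (twist n : V -> V).
Proof. by apply: (hsum_lin HV) => m c x y; rewrite scalerDr !scalerA mulrC. Qed.

Lemma twistE n i (x : V) : homog i x -> twist n x = sgn k (n * i) *: x.
Proof. by move=> hx; rewrite /twist (hsum_homog HV hx) // => m; rewrite scaler0. Qed.

Lemma homog_twist n i (x : V) : homog i x -> homog i (twist n x).
Proof. by move=> hx; rewrite (twistE n hx); apply: homogZ. Qed.

Lemma twist_0 (x : V) : twist 0 x = x.
Proof.
move: x; apply: (lin_ext (gens_homog HV) (twist_lin 0) (@lin_id k V)) => i x hx.
by rewrite (twistE 0 hx) mul0r sgn0 scale1r.
Qed.

End Twist.

End Graded.

Arguments tens : simpl never.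
Arguments shift_sum : simpl never.
Arguments diag : simpl never.
Arguments bar : simpl never.
Arguments homR : simpl never.
Arguments homL : simpl never.
Arguments tilde : simpl never.

(** * Direct sums *)

Section DirectSumTheory.
Variables (k : fieldType) (I : choiceType) (V : I -> lmodType k).
Implicit Types x y : dsum V.

Lemma dcomp_lin i : linear (fun x => dcomp x i).
Proof. by []. Qed.

Lemma dsumP x y : (forall i, dcomp x i = dcomp y i) -> x = y.
Proof. by move=> xy; apply/val_inj/dprodP. Qed.

Lemma dcomp_to_dsum (f : forall i, V i) :
  (exists s : seq I, forall i, i \notin s -> f i = 0) ->
  forall i, dcomp (to_dsum f) i = f i.
Proof.
case=> s s0 i; rewrite /dcomp /to_dsum to_spanK //.
(* [e j] is the part of [f] at the index [j]; the sum of these parts over the support is [f], which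
   shows that [f] lies in the span. *)
pose e j : dprod V := DProd (fun l => if j == l then f l else 0).
exists [seq (1 : k, e j) | j <- undup s]; split.
  move=> p /mapP[j _ ->] /=; exists j => l lj /=.
  by rewrite eq_sym (negPf lj).
apply: dprodP => l /=; rewrite big_map.
have E (r : seq I) : (\sum_(j <- r) (1 : k) *: e j) l = \sum_(j <- r) e j l.
  by elim: r => [|j r IH]; rewrite ?big_nil ?big_cons //= scale1r IH.
rewrite E /=.
have [ls|ls] := boolP (l \in undup s).
  rewrite (bigD1_seq l) ?undup_uniq //= eqxx big1 ?addr0 // => j jl.
  by rewrite (negPf jl).
rewrite s0; last by rewrite -mem_undup.
by rewrite big1 // => j _; case: eqP => // _; rewrite s0 // -mem_undup.
Qed.

Lemma dinj_support i (v : V i) : exists s : seq I, forall j, j \notin s ->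
  match i =P j with ReflectT e => ecast j (V j) e v | ReflectF _ => 0 end = 0.
Proof.
exists [:: i] => j; rewrite inE; case: (i =P j) => // e.
by move/eqP => ji; case: ji.
Qed.

Lemma dinj_eq i (v : V i) : dcomp (dinj i v) i = v.
Proof.
rewrite /dinj dcomp_to_dsum; last exact: dinj_support.
by case: (i =P i) => // e; rewrite eq_axiomK.
Qed.

Lemma dinj_neq i j (v : V i) : j != i -> dcomp (dinj i v) j = 0.
Proof.
move=> ji; rewrite /dinj dcomp_to_dsum; last exact: dinj_support.
by case: (i =P j) => // e; move/eqP: ji => ji; case: ji.
Qed.

Lemma dinj_lin i : linear (dinj i : V i -> dsum V).
Proof.
move=> c u v; apply: dsumP => j; rewrite dcomp_lin.
have [->|ji] := eqVneq j i; first by rewrite !dinj_eq.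
by rewrite !dinj_neq // scaler0 addr0.
Qed.

Lemma dcomp_support x : exists s : seq I, uniq s /\ forall i, i \notin s -> dcomp x i = 0.
Proof.
case: x => x xP; have /asboolP [s [sP xE]] := xP.
have {xE} : forall i, (forall p, p \in s -> p.2 i = 0) -> dcomp (Spanned xP) i = 0.
  move=> i i0; rewrite /dcomp /= xE {xE xP sP}; elim: s i0 => [|p s IH] i0.
    by rewrite big_nil.
  rewrite big_cons /= i0 ?mem_head // scaler0 add0r IH // => q qs.
  by rewrite i0 // inE qs orbT.
move=> H; have [t tP] : exists t : seq I, forall i, i \notin t -> forall p, p \in s -> p.2 i = 0.
  elim: s sP {H} => [|p s IH] sP; first by exists [::].
  have [|t tP] := IH; first by move=> q qs; apply: sP; rewrite inE qs orbT.
  have [j jP] := sP p (mem_head _ _); exists (j :: t) => i.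
  rewrite inE negb_or => /andP[ij it] q; rewrite inE => /orP[/eqP ->|]; first exact: jP.
  exact: tP.
exists (undup t); split; first exact: undup_uniq.
by move=> i; rewrite mem_undup => /tP/H.
Qed.

Lemma dsum_dinj (s : seq I) x : uniq s -> (forall i, i \notin s -> dcomp x i = 0) ->
  x = \sum_(i <- s) dinj i (dcomp x i).
Proof.
move=> us s0; apply: dsumP => i; rewrite (lin_sum (dcomp_lin i)).
have [is_|is_] := boolP (i \in s).
  rewrite (bigD1_seq i) //= dinj_eq big1 ?addr0 // => j ji.
  by rewrite dinj_neq // eq_sym.
rewrite s0 // big_seq big1 // => j js; rewrite dinj_neq //.
by apply: contraNneq is_ => ->.
Qed.

Lemma dsum_ind (P : dsum V -> Prop) : P 0 -> (forall x y, P x -> P y -> P (x + y)) ->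
  (forall i v, P (dinj i v)) -> forall x, P x.
Proof.
move=> P0 PD PI x; have [s [us s0]] := dcomp_support x.
by rewrite (dsum_dinj us s0); apply: big_ind.
Qed.

End DirectSumTheory.

Section BimoduleTheory.
Variables (k : fieldType) (A B : dgcat k) (M : bimod A B) (HM : is_bimod M).

Lemma pr_lact a a' b i n (z : mor A a' a) (m : M a' b) : homog i z ->
  pr n (lact M z m) = lact M z (pr (n - i) m).
Proof.
move=> hz; move: m; apply: (lin_ext (gens_homog _) (f := fun m => pr n (lact M z m))
  (g := fun m => lact M z (pr (n - i) m))).
- exact: (lin_comp (pr_linear _ n) (lact_linearr _ z)).
- exact: (lin_comp (lact_linearr _ z) (pr_linear _ _)).
move=> j m hm; rewrite (pr_homog _ _ (lact_homog HM hz hm)) (pr_homog _ _ hm).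
have ->: (n == i + j) = (n - i == j) by rewrite subr_eq addrC.
by case: eqP => // _; rewrite (lin0 (lact_linearr HM z)).
Qed.

Lemma lactZl a a' b c (z : mor A a' a) (m : M a' b) : lact M (c *: z) m = c *: lact M z m.
Proof. exact: (linZ (lact_linearl HM m)). Qed.
Lemma lactZr a a' b c (z : mor A a' a) (m : M a' b) : lact M z (c *: m) = c *: lact M z m.
Proof. exact: (linZ (lact_linearr HM z)). Qed.
Lemma ractZl a b b' c (m : M a b) (z : mor B b' b) : ract M (c *: m) z = c *: ract M m z.
Proof. exact: (linZ (ract_linearl HM z)). Qed.
Lemma lactDr a a' b (z : mor A a' a) (m m' : M a' b) : lact M z (m + m') = lact M z m + lact M z m'.
Proof. exact: (linD (lact_linearr HM z)). Qed.
Lemma ractDl a b b' (m m' : M a b) (z : mor B b' b) : ract M (m + m') z = ract M m z + ract M m' z.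
Proof. exact: (linD (ract_linearl HM z)). Qed.
Lemma lact0r a a' b (z : mor A a' a) : lact M z (0 : M a' b) = 0.
Proof. exact: (lin0 (lact_linearr HM z)). Qed.
Lemma ract0l a b b' (z : mor B b' b) : ract M (0 : M a b) z = 0.
Proof. exact: (lin0 (ract_linearl HM z)). Qed.
Lemma lact0l a a' b (m : M a' b) : lact M (0 : mor A a' a) m = 0.
Proof. exact: (lin0 (lact_linearl HM m)). Qed.
Lemma ract0r a b b' (m : M a b) : ract M m (0 : mor B b' b) = 0.
Proof. exact: (lin0 (ract_linearr HM m)). Qed.

End BimoduleTheory.

#[export] Instance diag_bimod (k : fieldType) (A : dgcat k) : is_bimod (diag A).
Proof.
split; rewrite /diag /=.
- by move=> a b; apply: mor_dgvect.
- by move=> a a' b m; apply: mcomp_linearl.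
- by move=> a a' b x; apply: mcomp_linearr.
- by move=> a b b' y; apply: mcomp_linearl.
- by move=> a b b' m; apply: mcomp_linearr.
- by move=> a a' b i j x m; apply: mcomp_homog.
- by move=> a b b' i j x m; apply: mcomp_homog.
- by move=> a a' b i x m; apply: mcomp_dd.
- by move=> a b b' i x m; apply: mcomp_dd.
- by move=> *; rewrite mcompA.
- by move=> *; rewrite mcompA.
- by move=> *; rewrite mcompA.
- by move=> *; rewrite mcomp1l.
- by move=> *; rewrite mcomp1r.
Qed.

(** * Tensor products of bimodules *)

Section TensorTheory.
Variables (k : fieldType) (A B C : dgcat k) (over : bool).
Variables (M : bimod A C) (N : bimod C B).
Notation T := (tens over M N).

Lemma tmk_linl a b c (y : N c b) : linear (fun x : M a c => tmk x y : T a b).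
Proof. exact: (balanced_linearl (tpure_balanced _ _ _ _ _)). Qed.
Lemma tmk_linr a b c (x : M a c) : linear (fun y : N c b => tmk x y : T a b).
Proof. exact: (balanced_linearr (tpure_balanced _ _ _ _ _)). Qed.
Lemma tmkZl a b c s (x : M a c) (y : N c b) : tmk (s *: x) y = s *: tmk x y :> T a b.
Proof. exact: (linZ (tmk_linl y)). Qed.
Lemma tmkZr a b c s (x : M a c) (y : N c b) : tmk x (s *: y) = s *: tmk x y :> T a b.
Proof. exact: (linZ (tmk_linr x)). Qed.
Lemma tmkDl a b c (x x' : M a c) (y : N c b) : tmk (x + x') y = tmk x y + tmk x' y :> T a b.
Proof. exact: (linD (tmk_linl y)). Qed.
Lemma tmkDr a b c (x : M a c) (y y' : N c b) : tmk x (y + y') = tmk x y + tmk x y' :> T a b.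
Proof. exact: (linD (tmk_linr x)). Qed.
Lemma tmk0l a b c (y : N c b) : tmk (0 : M a c) y = 0 :> T a b.
Proof. exact: (lin0 (tmk_linl y)). Qed.
Lemma tmk0r a b c (x : M a c) : tmk x (0 : N c b) = 0 :> T a b.
Proof. exact: (lin0 (tmk_linr x)). Qed.

Lemma tmk_act a b c c' (x : M a c) (z : mor C c' c) (y : N c' b) :
  over -> tmk (ract M x z) y = tmk x (lact N z y) :> T a b.
Proof. by move=> ov; apply: (balanced_act (tpure_balanced _ _ _ _ _)). Qed.

Lemma tlift_lin a b (W : lmodType k) (F : forall c, M a c -> N c b -> W) :
  balanced over F -> linear (tlift F : T a b -> W).
Proof. by case/tlift_sum. Qed.

Lemma tliftE a b (W : lmodType k) (F : forall c, M a c -> N c b -> W) c x y :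
  balanced over F -> tlift F (tmk x y : T a b) = F c x y.
Proof. by move=> bF; case: (tlift_sum bF) => _ tE; apply: tE. Qed.

Lemma tens_ind a b (P : T a b -> Prop) : P 0 -> (forall t u, P t -> P u -> P (t + u)) ->
  (forall c (x : M a c) (y : N c b), P (tmk x y)) -> forall t, P t.
Proof.
move=> P0 PD Pt t; rewrite [t]tens_pure_sum /tlift /formal_sum.
by apply: big_ind => // p _; apply: Pt.
Qed.

(** Balancedness of [F] is inherited from [G], since [tmk] itself is balanced. The nested lifts in
    the definitions of [tilde_map], [bar_id] and the dual morphisms are identified in this way with
    composites of known maps, without a separate proof that each layer is balanced. *)
Lemma tlift_eq a b (W : lmodType k) (F : forall c, M a c -> N c b -> W) (G : T a b -> W) :
  linear G -> (forall c x y, F c x y = G (tmk x y)) -> forall t, tlift F t = G t.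
Proof.
move=> lG FG.
have bF : balanced over F.
  split=> [c y|c x|ov c c' x z y].
  - by move=> s u v; rewrite !FG tmk_linl lG.
  - by move=> s u v; rewrite !FG tmk_linr lG.
  - by rewrite !FG tmk_act.
apply: tens_ind; first by rewrite (lin0 (tlift_lin bF)) (lin0 lG).
  by move=> t u Ht Hu; rewrite (linD (tlift_lin bF)) (linD lG) Ht Hu.
by move=> c x y; rewrite (tliftE _ _ bF).
Qed.

Hypotheses (HM : is_bimod M) (HN : is_bimod N).

Definition tgen (a : A) (b : B) (n : int) (t : T a b) : Prop :=
  exists c p q (x : M a c) (y : N c b), [/\ n = p + q, homog p x, homog q y & t = tmk x y].

Lemma gens_tens a b : gens (@tgen a b).
Proof.
move=> P P0 PD PG; apply: tens_ind => // c x y.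
move: x; apply: (gens_homog (bcar_dgvect HM a c)); first by rewrite tmk0l.
  by move=> x x' Px Px'; rewrite tmkDl; apply: PD.
move=> p x hx; move: y; apply: (gens_homog (bcar_dgvect HN c b)); first by rewrite tmk0r.
  by move=> y y' Py Py'; rewrite tmkDr; apply: PD.
by move=> q y hy; apply: (PG (p + q)); exists c, p, q, x, y.
Qed.

Let prF a b n c (x : M a c) (y : N c b) : T a b :=
  hsum x (fun i x' => tpure x' (pr (n - i) y)).

Lemma tens_pr_homog a b n c p (x : M a c) (y : N c b) : homog p x ->
  prF n x y = tmk x (pr (n - p) y).
Proof.
by move=> hx; rewrite /prF (hsum_homog _ hx) // => m; apply: tmk0l.
Qed.

Lemma tens_pr_balanced a b n : balanced over (@prF a b n).
Proof.
split=> [c y|c x|ov c c' x z y].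
- apply: (hsum_lin (V := M a c) _ (F := fun i x' => tpure x' (pr (n - i) y))) => m.
  exact: tmk_linl.
- apply: hsum_lin_param => [m x'|m u]; last exact: tmk0l.
  exact: (lin_comp (tmk_linr _) (pr_linear _ _)).
- pose f x := prF (a := a) n (ract M x z) y; pose g x := prF (a := a) n x (lact N z y).
  rewrite -[LHS]/(f x) -[RHS]/(g x).
  have lf' (w : N c' b) : linear (fun x : M a c' => prF n x w).
    by apply: hsum_lin => m; apply: tmk_linl.
  have lf (w : N c b) : linear (fun x : M a c => prF n x w).
    by apply: hsum_lin => m; apply: tmk_linl.
  move: x; apply: (lin_ext (gens_homog _) _ (lf _)).
    exact: (lin_comp (lf' y) (ract_linearl _ z)).
  move=> p x hx; rewrite /f /g; move: z {f g}.
  apply: (lin_ext (gens_homog _) (f := fun z => prF n (ract M x z) y)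
                            (g := fun z => prF n x (lact N z y))).
  + exact: (lin_comp (lf' y) (ract_linearr _ x)).
  + have lr : linear (fun w : N c b => prF (a := a) n x w).
      apply: hsum_lin_param => [m x'|m u]; last exact: tmk0l.
      exact: (lin_comp (tmk_linr _) (pr_linear _ _)).
    exact: (lin_comp lr (lact_linearl _ y)).
  move=> i z hz; rewrite (tens_pr_homog _ _ (ract_homog HM hx hz)) (tens_pr_homog _ _ hx).
  (* Moving [z] across the tensor sign moves its degree as well: n - (p + i) on one side, (n - p) -
     i on the other. *)
  by rewrite tmk_act // (pr_lact _ _ _ hz) opprD addrA.
Qed.

Lemma tens_prE a b n c p (x : M a c) (y : N c b) : homog p x ->
  pr n (tmk x y : T a b) = tmk x (pr (n - p) y).
Proof.
move=> hx; rewrite -(tens_pr_homog n y hx).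
exact: (tliftE _ _ (tens_pr_balanced a b n)).
Qed.

Lemma homog_tmk a b c p q (x : M a c) (y : N c b) : homog p x -> homog q y ->
  homog (p + q) (tmk x y : T a b).
Proof. by move=> hx hy; rewrite /homog (tens_prE _ _ hx) addrAC subrr add0r hy. Qed.

Lemma tens_pr_lin a b n : linear (pr n : T a b -> T a b).
Proof. exact: (tlift_lin (tens_pr_balanced a b n)). Qed.

Lemma tens_pr_pr a b i j (t : T a b) : pr i (pr j t) = if i == j then pr i t else 0.
Proof.
move: t; apply: (lin_ext (gens_tens (a:=a) (b:=b)) (f := fun t : T a b => pr i (pr j t))
    (g := fun t : T a b => if i == j then pr i t else 0)).
- exact: (lin_comp (tens_pr_lin i) (tens_pr_lin j)).
- by case: eqP => _; [apply: tens_pr_lin | apply: lin_cst0].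
move=> n t [c [p [q [x [y [_ hx hy ->]]]]]].
rewrite !(tens_prE _ _ hx) (pr_pr (bcar_dgvect HN _ _)).
have ->: (i - p == j - p) = (i == j) by apply/eqP/eqP => [/addIr|->].
by case: eqP => // _; rewrite tmk0r.
Qed.

Let ddF a b c (x : M a c) (y : N c b) : T a b :=
  tmk (dd x) y + tmk (twist 1 x) (dd y).

Lemma tens_dd_balanced a b : balanced over (@ddF a b).
Proof.
split=> [c y|c x|ov c c' x z y].
- apply: lin_add; first exact: (lin_comp (tmk_linl _) (dd_linear _)).
  exact: (lin_comp (tmk_linl _) (twist_lin _ _)).
- apply: lin_add; first exact: tmk_linr.
  exact: (lin_comp (tmk_linr _) (dd_linear _)).
- have ll (w : N c b) : linear (fun x => ddF (a := a) x w).
    apply: lin_add; first exact: (lin_comp (tmk_linl _) (dd_linear _)).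
    exact: (lin_comp (tmk_linl _) (twist_lin _ _)).
  have ll' (w : N c' b) : linear (fun x => ddF (a := a) x w).
    apply: lin_add; first exact: (lin_comp (tmk_linl _) (dd_linear _)).
    exact: (lin_comp (tmk_linl _) (twist_lin _ _)).
  have lr (w : M a c) : linear (fun y => ddF (b := b) w y).
    apply: lin_add; first exact: tmk_linr.
    exact: (lin_comp (tmk_linr _) (dd_linear _)).
  move: x; apply: (lin_ext (gens_homog _) (lin_comp (ll' y) (ract_linearl _ z)) (ll _)).
  move=> p x hx; move: z.
  apply: (lin_ext (gens_homog _) (lin_comp (ll' y) (ract_linearr _ x))
                  (lin_comp (lr x) (lact_linearl _ y))) => i z hz.
  rewrite /ddF (ract_dd HM z hx) (lact_dd HN y hz).
  rewrite (twistE _ 1 hx) (twistE _ 1 (ract_homog HM hx hz)).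
  rewrite tmkDl !tmkDr !tmkZl !tmkZr !tmk_act // -addrA; congr (_ + _).
  by rewrite !mul1r sgnD scalerA.
Qed.

Lemma tens_dd_lin a b : linear (@dd k (T a b)).
Proof. exact: (tlift_lin (tens_dd_balanced a b)). Qed.

Lemma tens_ddE a b c p (x : M a c) (y : N c b) : homog p x ->
  dd (tmk x y : T a b) = tmk (dd x) y + sgn k p *: tmk x (dd y).
Proof.
move=> hx; rewrite -[LHS]/(tlift (@ddF a b) (tmk x y : T a b)) (tliftE _ _ (tens_dd_balanced a b)).
by rewrite /ddF (twistE _ 1 hx) mul1r -tmkZl.
Qed.

#[export] Instance tens_dgvect a b : is_dgvect (T a b).
Proof.
split.
- exact: tens_pr_lin.
- exact: tens_pr_pr.
- apply: (sum_components (@tens_pr_lin a b) (@tens_pr_pr a b) (gens_tens (a:=a) (b:=b))).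
  by move=> n t [c [p [q [x [y [-> hx hy ->]]]]]]; apply: homog_tmk.
- exact: tens_dd_lin.
- move=> i t ht.
  have: pr (i + 1) (dd t) = dd (pr i t); last by rewrite ht.
  move: t {ht}; apply: (lin_ext (gens_tens (a:=a) (b:=b)) (f := fun t : T a b => pr (i + 1) (dd t))
     (g := fun t : T a b => dd (pr i t))).
  + exact: (lin_comp (tens_pr_lin _) (@tens_dd_lin _ _)).
  + exact: (lin_comp (@tens_dd_lin _ _) (tens_pr_lin _)).
  move=> n t [c [p [q [x [y [_ hx hy ->]]]]]].
  rewrite (tens_prE _ _ hx) (tens_ddE _ hx) (linD (tens_pr_lin _)) (linZ (tens_pr_lin _)).
  rewrite (tens_prE _ _ hx) (tens_prE _ _ (dd_homog _ hx)) (tens_ddE _ hx).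
  have ->: i + 1 - (p + 1) = i - p by ring.
  congr (_ + _ *: tmk _ _); rewrite (pr_homog _ _ hy) (pr_homog _ _ (dd_homog _ hy)).
  have ->: (i + 1 - p == q + 1) = (i - p == q).
    by rewrite addrAC; apply/eqP/eqP => [/addIr|->].
  by case: eqP => // _; rewrite (lin0 (dd_linear _)).
- apply: (lin_ext (gens_tens (a:=a) (b:=b)) (f := fun t : T a b => dd (dd t))
     (g := fun t : T a b => 0)).
  + exact: (lin_comp (@tens_dd_lin _ _) (@tens_dd_lin _ _)).
  + exact: lin_cst0.
  move=> n t [c [p [q [x [y [_ hx hy ->]]]]]].
  rewrite (tens_ddE _ hx) (linD (@tens_dd_lin _ _)) (linZ (@tens_dd_lin _ _)).
  rewrite (tens_ddE _ hx) (tens_ddE _ (dd_homog _ hx)) !dd_dd tmk0l tmk0r scaler0 addr0 add0r.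
  by rewrite sgnD sgn1 mulrN1 scaleNr addNr.
Qed.

Lemma tens_lact_lift a a' b (z : mor A a' a) :
  balanced over (fun c (x : M a' c) (y : N c b) => tmk (lact M z x) y : T a b).
Proof.
split=> [c y|c x|ov c c' x w y].
- exact: (lin_comp (tmk_linl _) (lact_linearr _ z)).
- exact: tmk_linr.
- by rewrite (lact_ract HM) tmk_act.
Qed.

Lemma tens_ract_lift a b b' (z : mor B b' b) :
  balanced over (fun c (x : M a c) (y : N c b) => tmk x (ract N y z) : T a b').
Proof.
split=> [c y|c x|ov c c' x w y].
- exact: tmk_linl.
- exact: (lin_comp (tmk_linr _) (ract_linearl _ z)).
- by rewrite tmk_act // (lact_ract HN).
Qed.

Lemma tens_lactE a a' b c (z : mor A a' a) (x : M a' c) (y : N c b) :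
  lact T z (tmk x y) = tmk (lact M z x) y.
Proof. exact: (tliftE _ _ (tens_lact_lift b z)). Qed.

Lemma tens_ractE a b b' c (z : mor B b' b) (x : M a c) (y : N c b) :
  ract T (tmk x y) z = tmk x (ract N y z).
Proof. exact: (tliftE _ _ (tens_ract_lift a z)). Qed.

#[export] Instance tens_bimod : is_bimod T.
Proof.
have ll a a' b (z : mor A a' a) : linear (fun t : T a' b => lact T z t).
  exact: (tlift_lin (tens_lact_lift b z)).
have lr a b b' (z : mor B b' b) : linear (fun t : T a b => ract T t z).
  exact: (tlift_lin (tens_ract_lift a z)).
split.
- exact: tens_dgvect.
- move=> a a' b t s u v; move: t.
  apply: (lin_ext (gens_tens (a:=_) (b:=_)) (ll _ _ _ _) (lin_add (lin_scale s (ll _ _ _ u)) (ll _ _ _ v))).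
  move=> n t [c [p [q [x [y [_ hx hy ->]]]]]].
  by rewrite !tens_lactE (lact_linearl HM) tmk_linl.
- exact: ll.
- exact: lr.
- move=> a b b' t s u v; move: t.
  apply: (lin_ext (gens_tens (a:=_) (b:=_)) (lr _ _ _ _) (lin_add (lin_scale s (lr _ _ _ u)) (lr _ _ _ v))).
  move=> n t [c [p [q [x [y [_ hx hy ->]]]]]].
  by rewrite !tens_ractE (ract_linearr HN) tmk_linr.
- move=> a a' b i j z t hz.
  apply: (homog_ext (n := i) _ _ (gens_tens (a:=a') (b:=b)) _ (ll _ _ _ z)).
    by move=> n u [c [p [q [x [y [-> hx hy ->]]]]]]; apply: homog_tmk.
  move=> n u [c [p [q [x [y [-> hx hy ->]]]]]]; rewrite tens_lactE addrA.
  by apply: homog_tmk => //; apply: lact_homog.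
- move=> a b b' i j t z ht hz; rewrite addrC; move: i t ht.
  apply: (homog_ext (n := j) _ _ (gens_tens (a:=a) (b:=b)) _ (lr _ _ _ z)).
    by move=> n u [c [p [q [x [y [-> hx hy ->]]]]]]; apply: homog_tmk.
  move=> n u [c [p [q [x [y [-> hx hy ->]]]]]]; rewrite tens_ractE addrC -addrA.
  by apply: homog_tmk => //; apply: ract_homog.
- move=> a a' b i z t hz; move: t.
  apply: (lin_ext (gens_tens (a:=_) (b:=_)) (lin_comp (dd_linear _) (ll _ _ _ z))
    (lin_add (ll _ _ _ _) (lin_scale _ (lin_comp (ll _ _ _ z) (dd_linear _))))).
  move=> n t [c [p [q [x [y [_ hx hy ->]]]]]].
  rewrite (tens_ddE _ hx) (linD (ll _ _ _ _)) (linZ (ll _ _ _ _)) !tens_lactE.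
  rewrite (tens_ddE _ (lact_homog HM hz hx)) (lact_dd HM _ hz).
  by rewrite tmkDl tmkZl scalerDr scalerA -sgnD addrA.
- move=> a b b' i t z ht.
  have H : dd (ract T t z) = ract T (dd t) z + ract T (twist 1 t) (dd z).
    move: t {ht}; apply: (lin_ext (gens_tens (a:=_) (b:=_)) (lin_comp (dd_linear _) (lr _ _ _ z))
     (lin_add (lin_comp (lr _ _ _ _) (dd_linear _)) (lin_comp (lr _ _ _ _) (twist_lin _ _)))).
    move=> n t [c [p [q [x [y [_ hx hy ->]]]]]].
    rewrite (twistE _ _ (homog_tmk hx hy)) (linZ (lr _ _ _ _)) !tens_ractE.
    rewrite !(tens_ddE _ hx) (ract_dd HN _ hy) (linD (lr _ _ _ _)) (linZ (lr _ _ _ _)) !tens_ractE.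
    by rewrite tmkDr tmkZr scalerDr scalerA -sgnD mul1r addrA.
  by rewrite H (twistE _ _ ht) (linZ (lr _ _ _ _)) mul1r.
- move=> a a' a'' b z z'.
  apply: (lin_ext (gens_tens (a:=_) (b:=_)) (ll _ _ _ _) (lin_comp (ll _ _ _ _) (ll _ _ _ _))).
  by move=> n t [c [p [q [x [y [_ hx hy ->]]]]]]; rewrite !tens_lactE (lact_comp HM).
- move=> a b b' b'' t z z'; move: t.
  apply: (lin_ext (gens_tens (a:=_) (b:=_)) (lr _ _ _ _) (lin_comp (lr _ _ _ _) (lr _ _ _ _))).
  by move=> n t [c [p [q [x [y [_ hx hy ->]]]]]]; rewrite !tens_ractE (ract_comp HN).
- move=> a a' b b' z t z'; move: t.
  apply: (lin_ext (gens_tens (a:=_) (b:=_)) (lin_comp (ll _ _ _ _) (lr _ _ _ _)) (lin_comp (lr _ _ _ _) (ll _ _ _ _))).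
  by move=> n t [c [p [q [x [y [_ hx hy ->]]]]]]; rewrite !(tens_lactE, tens_ractE).
- move=> a b; apply: (lin_ext (gens_tens (a:=_) (b:=_)) (ll _ _ _ _) (@lin_id _ _)).
  by move=> n t [c [p [q [x [y [_ hx hy ->]]]]]]; rewrite !tens_lactE (lact1 HM).
- move=> a b; apply: (lin_ext (gens_tens (a:=_) (b:=_)) (lr _ _ _ _) (@lin_id _ _)).
  by move=> n t [c [p [q [x [y [_ hx hy ->]]]]]]; rewrite !tens_ractE (ract1 HN).
Qed.

End TensorTheory.

#[export] Existing Instance tens_bimod.

Arguments tmk_linl {k A B C over M N a b c} y.
Arguments tmk_linr {k A B C over M N a b c} x.
Arguments tmkZl {k A B C over M N a b c} s x y.
Arguments tmkZr {k A B C over M N a b c} s x y.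
Arguments tmkDl {k A B C over M N a b c} x x' y.
Arguments tmkDr {k A B C over M N a b c} x y y'.
Arguments tmk0l {k A B C over M N a b c} y.
Arguments tmk0r {k A B C over M N a b c} x.
Arguments tens_lactE {k A B C over M N HM a a' b c} z x y.
Arguments tens_ractE {k A B C over M N HN a b b' c} z x y.
Arguments tens_ddE {k A B C over M N HM HN a b c p} x y hx : rename.
Arguments homog_tmk {k A B C over M N HM HN a b c p q x y} hx hy : rename.
Arguments tens_prE {k A B C over M N HM HN a b} n {c p x} y hx : rename.
Arguments tgen {k A B C} over M N a b n t.
Arguments gens_tens {k A B C over M N} HM HN a b.

(** * Maps of bimodules *)

Section BimoduleMaps.
Variables (k : fieldType) (A B : dgcat k).
Implicit Types M N P : bimod A B.

Lemma hlin M N n (f : bmap M N) (fh : is_hom n f) a b : linear (f a b).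
Proof. by case: fh. Qed.

Definition bcomp M N P (g : bmap N P) (f : bmap M N) : bmap M P :=
  fun a b x => g a b (f a b x).
Definition bmap_id M : bmap M M := fun a b x => x.

Definition hclosed n M N (f : bmap M N) : Prop :=
  forall a b (x : M a b), dhom n f x = 0.

Lemma is_hom_eq M N m n (f : bmap M N) : m = n -> is_hom m f -> is_hom n f.
Proof. by move=> ->. Qed.

Arguments hlin {M N n f} fh a b.

Lemma homZ M N n (f : bmap M N) : is_hom n f -> forall a b c (x : M a b), f a b (c *: x) = c *: f a b x.
Proof. by move=> fh a b c x; exact: (linZ (hlin fh a b) c x). Qed.
Lemma homD M N n (f : bmap M N) : is_hom n f -> forall a b (x y : M a b), f a b (x + y) = f a b x + f a b y.
Proof. by move=> fh a b x y; exact: (linD (hlin fh a b) x y). Qed.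

Section Calculus.
Variables (M N P : bimod A B).
Hypotheses (HM : is_bimod M) (HN : is_bimod N) (HP : is_bimod P).

Lemma is_hom_gen (G : forall a b, int -> M a b -> Prop) n (f : bmap M N) :
  (forall a b, gens (@G a b)) -> (forall a b i x, @G a b i x -> homog i x) ->
  (forall a b, linear (f a b)) ->
  (forall a b i x, @G a b i x -> homog (n + i) (f a b x)) ->
  (forall a a' b i j (z : mor A a' a) x, homog j z -> @G a' b i x ->
     f a b (lact M z x) = sgn k (n * j) *: lact N z (f a' b x)) ->
  (forall a b b' i j (z : mor B b' b) x, homog j z -> @G a b i x ->
     f a b' (ract M x z) = ract N (f a b x) z) ->
  is_hom n f.
Proof.
move=> gG Gh lf hf laf raf; split=> //.
- by move=> a b; apply: (homog_ext _ _ (gG a b) (Gh a b) (lf a b) (hf a b)).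
- move=> a a' b i z x hz; move: x.
  apply: (lin_ext (gG _ _) (lin_comp (lf _ _) (lact_linearr HM z))
     (lin_scale _ (lin_comp (lact_linearr HN z) (lf _ _)))) => j x Gx.
  exact: laf hz Gx.
- move=> a b b' x z; move: x.
  apply: (lin_ext (gG _ _) (lin_comp (lf _ _) (ract_linearl HM z))
     (lin_comp (ract_linearl HN z) (lf _ _))) => j x Gx; move: z.
  apply: (lin_ext (gens_homog _) (lin_comp (lf _ _) (ract_linearr HM x))
     (ract_linearr HN _)) => i z hz.
  exact: raf hz Gx.
Qed.

Lemma hom_id : is_hom 0 (@bmap_id M).
Proof.
split=> //; rewrite /bmap_id; first by move=> *; rewrite add0r.
by move=> *; rewrite mul0r sgn0 scale1r.
Qed.

Lemma hom_zero n : is_hom n (fun a b (x : M a b) => 0 : N a b).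
Proof.
split.
- by move=> a b; apply: lin_cst0.
- by move=> a b i x _; apply: homog0.
- by move=> *; rewrite (lact0r HN) scaler0.
- by move=> *; rewrite (ract0l HN).
Qed.

Lemma hom_add n (f g : bmap M N) : is_hom n f -> is_hom n g ->
  is_hom n (fun a b x => f a b x + g a b x).
Proof.
move=> [fl fh fla fra] [gl gh gla gra]; split.
- by move=> a b; apply: lin_add.
- by move=> a b i x hx; apply: homogD; auto.
- by move=> a a' b i z x hz; rewrite (fla _ _ _ _ _ _ hz) (gla _ _ _ _ _ _ hz) (lactDr HN) scalerDr.
- by move=> *; rewrite fra gra (ractDl HN).
Qed.

Lemma hom_scale n c (f : bmap M N) : is_hom n f -> is_hom n (fun a b x => c *: f a b x).
Proof.
move=> [fl fh fla fra]; split.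
- by move=> a b; apply: lin_scale.
- by move=> a b i x hx; apply: homogZ; auto.
- move=> a a' b i z x hz.
  by rewrite (fla _ _ _ _ _ _ hz) (lactZr HN) !scalerA mulrC.
- by move=> *; rewrite fra (ractZl HN).
Qed.

Lemma hom_comp m n (g : bmap N P) (f : bmap M N) : is_hom m g -> is_hom n f ->
  is_hom (m + n) (bcomp g f).
Proof.
move=> gh fh; split; rewrite /bcomp.
- by move=> a b; exact: (lin_comp (hlin gh _ _) (hlin fh _ _)).
- by move=> a b i x hx; rewrite -addrA; apply/(hom_homog gh)/(hom_homog fh).
- move=> a a' b i z x hz; rewrite (hom_lact fh _ hz) (homZ gh) (hom_lact gh _ hz).
  by rewrite sgnZZ mulrDl addrC.
- by move=> *; rewrite (hom_ract fh) (hom_ract gh).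
Qed.

Lemma hom_dhom n (f : bmap M N) : is_hom n f -> is_hom (n + 1) (dhom n f).
Proof.
move=> fh; have fl a b : linear (f a b) := hlin fh a b; split; rewrite /dhom.
- move=> a b; apply: lin_sub; first exact: (lin_comp (dd_linear _) (fl _ _)).
  exact/lin_scale/(lin_comp (fl _ _) (dd_linear _)).
- move=> a b i x hx; apply: homogB.
    by rewrite addrAC; apply/dd_homog/(hom_homog fh).
  apply: homogZ; rewrite -addrA [1 + i]addrC; apply/(hom_homog fh).
  exact: dd_homog.
- move=> a a' b i z x hz; rewrite (lact_dd HM _ hz) (homD fh) (homZ fh).
  rewrite (hom_lact fh _ hz) (hom_lact fh _ (dd_homog _ hz)) (hom_lact fh _ hz).
  rewrite (ddZ (bcar_dgvect HN _ _)) (lact_dd HN _ hz).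
  rewrite (linB (lact_linearr HN z)) (lactZr HN) scalerBr !scalerDr !sgnZZ opprD addrACA.
  (* The two contributions of [dd z] cancel, and the remaining terms carry the sign that belongs to
     degree n + 1. *)
  rewrite !NsgnZ; have -> : forall u v w : N a b, u = - v -> u + v + w = w.
      by move=> u v w ->; rewrite addNr add0r.
    congr (sgn k _ *: _ + _ *: _); first by ring.
    by apply: sgn_eq; odd_tac.
  by rewrite NsgnZ; apply: sgnZ_eq; odd_tac.
- move=> a b b' x z.
  move: z; apply: (lin_ext (gens_homog _) (f := fun z => dd (f a b' (ract M x z)) - sgn k n *: f a b' (dd (ract M x z)))
     (g := fun z => ract N (dd (f a b x) - sgn k n *: f a b (dd x)) z)).
  + apply: lin_sub; first exact: (lin_comp (dd_linear _) (lin_comp (fl _ _) (ract_linearr HM x))).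
    exact: (lin_scale _ (lin_comp (fl _ _) (lin_comp (dd_linear _) (ract_linearr HM x)))).
  + exact: ract_linearr.
  move=> j z hz; move: x; apply: (lin_ext (gens_homog (bcar_dgvect HM a b)) (f := fun x => dd (f a b' (ract M x z)) - sgn k n *: f a b' (dd (ract M x z)))
     (g := fun x => ract N (dd (f a b x) - sgn k n *: f a b (dd x)) z)).
  + apply: lin_sub; first exact: (lin_comp (dd_linear _) (lin_comp (fl _ _) (ract_linearl HM z))).
    exact: (lin_scale _ (lin_comp (fl _ _) (lin_comp (dd_linear _) (ract_linearl HM z)))).
  + apply: (lin_comp (ract_linearl HN z)); apply: lin_sub; first exact: (lin_comp (dd_linear _) (fl _ _)).
    exact/lin_scale/(lin_comp (fl _ _) (dd_linear _)).
  move=> i x hx; rewrite (ract_dd HM _ hx) (homD fh) (homZ fh) !(hom_ract fh).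
  rewrite (ract_dd HN _ (hom_homog fh hx)) (linB (ract_linearl HN z)) (ractZl HN).
  rewrite scalerDr opprD scalerA -sgnD addrACA addrN addr0.
  by [].
Qed.

Lemma dhom_comp m n (g : bmap N P) (f : bmap M N) : is_hom m g ->
  forall a b (x : M a b),
  dhom (m + n) (bcomp g f) x = dhom m g (f a b x) + sgn k m *: g a b (dhom n f x).
Proof.
move=> gh a b x; rewrite /dhom /bcomp (linB (hlin gh _ _)) (homZ gh) scalerBr.
by rewrite scalerA -sgnD addrA subrK.
Qed.

Lemma closed0E (f : bmap M N) : hclosed 0 f <-> forall a b (x : M a b), dd (f a b x) = f a b (dd x).
Proof.
split=> cf a b x; last by rewrite /dhom sgn0 scale1r cf subrr.
by apply/eqP; rewrite -subr_eq0 -[X in _ - X]scale1r -(sgn0 k); apply/eqP/cf.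
Qed.

Lemma closed0_gen (G : forall a b, int -> M a b -> Prop) (f : bmap M N) :
  (forall a b, gens (@G a b)) -> (forall a b, linear (f a b)) ->
  (forall a b i x, @G a b i x -> dd (f a b x) = f a b (dd x)) -> hclosed 0 f.
Proof.
move=> gG lf fG; apply/closed0E => a b.
apply: (lin_ext (gG a b) (lin_comp (dd_linear (bcar_dgvect HN a b)) (lf a b))
  (lin_comp (lf a b) (dd_linear (bcar_dgvect HM a b)))); exact: fG.
Qed.

Lemma dhom_comp_closedl n (g : bmap N P) (f : bmap M N) : is_hom 0 g -> hclosed 0 g ->
  forall a b (x : M a b), dhom n (bcomp g f) x = g a b (dhom n f x).
Proof.
move=> gh gc a b x.
by rewrite -{1}[n]add0r (dhom_comp _ _ gh) gc add0r sgn0 scale1r.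
Qed.

Lemma dhom_comp_closedr n (g : bmap N P) (f : bmap M N) : is_hom n g -> hclosed 0 f ->
  forall a b (x : M a b), dhom n (bcomp g f) x = dhom n g (f a b x).
Proof.
move=> gh fc a b x.
by rewrite -{1}[n]addr0 (dhom_comp _ _ gh) fc (lin0 (hlin gh _ _)) scaler0 addr0.
Qed.

Lemma closed_comp (g : bmap N P) (f : bmap M N) : is_hom 0 g -> hclosed 0 g -> hclosed 0 f ->
  hclosed 0 (bcomp g f).
Proof.
move=> gh gc fc a b x.
by rewrite dhom_comp_closedl // fc (lin0 (hlin gh _ _)).
Qed.

Lemma dhom_lin n (f : bmap M N) : is_hom n f -> forall a b, linear (fun x : M a b => dhom n f x).
Proof. by move=> fh; exact: (hlin (hom_dhom fh)). Qed.

End Calculus.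
End BimoduleMaps.

Arguments hlin {k A B M N n f} fh a b.

Section TensorGenerators.
Variables (k : fieldType) (A B C : dgcat k) (over : bool).
Variables (M : bimod A C) (N : bimod C B).
Hypotheses (HM : is_bimod M) (HN : is_bimod N).
Variables (G1 : forall a c, int -> M a c -> Prop) (G2 : forall c b, int -> N c b -> Prop).
Arguments G1 {a c}.
Arguments G2 {c b}.

(** Like [tgen], but with prescribed generators in both factors. With words as generators of the bar
    complex this permits induction on a tensor factor. *)
Definition tprod_gen (a : A) (b : B) (n : int) (t : tens over M N a b) : Prop :=
  exists c p q (x : M a c) (y : N c b), [/\ n = p + q, G1 p x, G2 q y & t = tmk x y].

Lemma gens_tprod : (forall a c, gens (@G1 a c)) -> (forall c b, gens (@G2 c b)) ->
  forall a b, gens (@tprod_gen a b).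
Proof.
move=> g1 g2 a b P P0 PD PG; apply: tens_ind => // c x y.
move: x; apply: (g1 a c); first by rewrite tmk0l.
  by move=> x x' Px Px'; rewrite tmkDl; apply: PD.
move=> p x hx; move: y; apply: (g2 c b); first by rewrite tmk0r.
  by move=> y y' Py Py'; rewrite tmkDr; apply: PD.
by move=> q y hy; apply: (PG (p + q)); exists c, p, q, x, y.
Qed.

Lemma tprod_gen_homog : (forall a c i x, @G1 a c i x -> homog i x) ->
  (forall c b i y, @G2 c b i y -> homog i y) ->
  forall a b i t, @tprod_gen a b i t -> homog i t.
Proof.
move=> h1 h2 a b i t [c [p [q [x [y [-> hx hy ->]]]]]].
by apply: homog_tmk; [exact: h1 | exact: h2].
Qed.

End TensorGenerators.

Section TensorMaps.
Variables (k : fieldType) (A B C : dgcat k).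
Variables (M M' : bimod A C) (N N' : bimod C B).
Hypotheses (HM : is_bimod M) (HN : is_bimod N) (HM' : is_bimod M') (HN' : is_bimod N').

(* f (x) g, for g of degree n *)
Definition tmap n (f : bmap M M') (g : bmap N N') : bmap (tensor M N) (tensor M' N') :=
  fun a b => tlift (fun c x y => tmk (f a c (twist n x)) (g c b y) : tensor M' N' a b).

Section Tmap.
Variables (m n : int) (f : bmap M M') (g : bmap N N').
Hypotheses (fh : is_hom m f) (gh : is_hom n g).
Arguments f : clear implicits.
Arguments g : clear implicits.

Lemma tmap_balanced a b :
  balanced true (fun c (x : M a c) (y : N c b) => tmk (f a c (twist n x)) (g c b y) : tensor M' N' a b).
Proof.
have ll (c : C) (w : N c b) : linear (fun x : M a c => tmk (f a c (twist n x)) (g c b w) : tensor M' N' a b).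
  exact: (lin_comp (tmk_linl _) (lin_comp (hlin fh _ _) (twist_lin _ _))).
have lr (c : C) (x : M a c) : linear (fun w : N c b => tmk (f a c (twist n x)) (g c b w) : tensor M' N' a b).
  exact: (lin_comp (tmk_linr _) (hlin gh _ _)).
split=> [c y|c x|_ c c' x z y] //.
move: x; apply: (lin_ext (gens_homog _) (lin_comp (ll _ y) (ract_linearl HM z)) (ll _ _)) => p x hx.
move: z; apply: (lin_ext (gens_homog _) (lin_comp (ll _ y) (ract_linearr HM x)) (lin_comp (lr _ x) (lact_linearl HN y))).
move=> q z hz; rewrite (twistE _ _ hx) (twistE _ _ (ract_homog HM hx hz)).
rewrite (hom_lact gh _ hz) !(homZ fh) (hom_ract fh) !(tmkZl, tmkZr) tmk_act // sgnZZ.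
by rewrite mulrDr.
Qed.

Lemma tmap_lin a b : linear (@tmap n f g a b).
Proof. exact: (tlift_lin (tmap_balanced a b)). Qed.

Lemma tmapE a b c p (x : M a c) (y : N c b) : homog p x ->
  tmap n f g (tmk x y) = sgn k (n * p) *: tmk (f a c x) (g c b y).
Proof.
move=> hx; rewrite /tmap (tliftE _ _ (tmap_balanced a b)) (twistE _ _ hx) (homZ fh) tmkZl.
by [].
Qed.

Lemma tmap_hom : is_hom (m + n) (tmap n f g).
Proof.
apply: (is_hom_gen _ _ (G := tgen true M N)).
- by move=> a b; apply: gens_tens.
- by move=> a b i x [c [p [q [u [v [-> hu hv ->]]]]]]; apply: homog_tmk.
- exact: tmap_lin.
- move=> a b i x [c [p [q [u [v [-> hu hv ->]]]]]]; rewrite (tmapE _ hu).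
  apply: homogZ; rewrite addrACA; apply: homog_tmk.
    exact: (hom_homog fh hu).
  exact: (hom_homog gh hv).
- move=> a a' b i j z x hz [c [p [q [u [v [_ hu hv ->]]]]]].
  rewrite tens_lactE // (tmapE _ hu) (tmapE _ (lact_homog HM hz hu)) (hom_lact fh _ hz).
  rewrite (lactZr (tens_bimod _ HM' HN')) tens_lactE // tmkZl !sgnZZ.
  by apply: sgnZ_eq; odd_tac.
- move=> a b b' i j z x hz [c [p [q [u [v [_ hu hv ->]]]]]].
  rewrite tens_ractE // !(tmapE _ hu) (ractZl (tens_bimod _ HM' HN')) tens_ractE //.
  by rewrite (hom_ract gh).
Qed.

End Tmap.

Lemma tmap_dhom m n (f : bmap M M') (g : bmap N N') : is_hom m f -> is_hom n g ->
  forall a b (x : tensor M N a b),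
  dhom (m + n) (tmap n f g) x =
    tmap n (dhom m f) g x + sgn k m *: tmap (n + 1) f (dhom n g) x.
Proof.
move=> fh gh a b.
have th := tmap_hom fh gh; have fh' := hom_dhom HM HM' fh; have gh' := hom_dhom HN HN' gh.
have dl := dhom_lin (tens_bimod true HM HN) (tens_bimod true HM' HN') th.
apply: (lin_ext (gens_tens HM HN a b) (dl a b)
  (lin_add (tmap_lin fh' gh (a := a) (b := b)) (lin_scale _ (tmap_lin fh gh' (a:=a) (b:=b))))).
move=> i t [c [p [q [x [y [_ hx hy ->]]]]]].
rewrite (tmapE fh' gh _ hx) (tmapE fh gh' _ hx).
rewrite /dhom (tens_ddE _ _ hx) // (homD th) (homZ th) (tmapE fh gh _ hx) (tmapE fh gh _ hx).
rewrite (tmapE fh gh _ (dd_homog _ hx)) (ddZ (tens_dgvect _ HM' HN' _ _)).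
rewrite (tens_ddE _ _ (hom_homog fh hx)) //.
rewrite (linB (tmk_linl _)) (linB (tmk_linr _)) !(tmkZl, tmkZr) !(scalerDr, scalerN, opprD) !sgnZZ !NsgnZ.
rewrite -!addrA; congr (_ + _).
rewrite [LHS]addrCA; congr (_ + _); first by apply: sgnZ_eq; odd_tac.
by congr (_ + _); apply: sgnZ_eq; odd_tac.
Qed.

End TensorMaps.

Section TensorMapsTheory.
Variables (k : fieldType) (A B C : dgcat k).
Variables (M M' : bimod A C) (N N' : bimod C B).
Hypotheses (HM : is_bimod M) (HN : is_bimod N) (HM' : is_bimod M') (HN' : is_bimod N').

Lemma tmap0E m (f : bmap M M') (g : bmap N N') (fh : is_hom m f) (gh : is_hom 0 g)
  a b c (x : M a c) (y : N c b) : tmap 0 f g (tmk x y) = tmk (f a c x) (g c b y).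
Proof.
move: x; apply: (lin_ext (gens_homog _) (lin_comp (tmap_lin HM HN fh gh (b:=b)) (tmk_linl _))
  (lin_comp (tmk_linl _) (hlin fh _ _))) => p x hx.
by rewrite (tmapE HM HN fh gh _ hx) mul0r sgn0 scale1r.
Qed.

Lemma tmap_dhoml m (f : bmap M M') (g : bmap N N') : is_hom m f -> is_hom 0 g -> hclosed 0 g ->
  forall a b (x : tensor M N a b), dhom m (tmap 0 f g) x = tmap 0 (dhom m f) g x.
Proof.
move=> fh gh gc a b x; rewrite -{1}[m]addr0 (tmap_dhom HM HN HM' HN' fh gh).
have -> : tmap (0 + 1) f (dhom 0 g) x = 0; last by rewrite scaler0 addr0.
have gh' := hom_dhom HN HN' gh.
move: x; apply: (lin_ext (gens_tens HM HN a b) (tmap_lin HM HN fh gh' (b:=b)) (@lin_cst0 _ _ _)).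
move=> i t [c [p [q [u [v [_ hu hv ->]]]]]].
by rewrite (tmapE HM HN fh gh' _ hu) gc tmk0r scaler0.
Qed.

Lemma tmap_dhomr n (f : bmap M M') (g : bmap N N') : is_hom 0 f -> is_hom n g -> hclosed 0 f ->
  forall a b (x : tensor M N a b), dhom n (tmap n f g) x = tmap (n + 1) f (dhom n g) x.
Proof.
move=> fh gh fc a b x; rewrite -{1}[n]add0r (tmap_dhom HM HN HM' HN' fh gh).
have -> : tmap n (dhom 0 f) g x = 0; last by rewrite add0r sgn0 scale1r.
have fh' := hom_dhom HM HM' fh.
move: x; apply: (lin_ext (gens_tens HM HN a b) (tmap_lin HM HN fh' gh (b:=b)) (@lin_cst0 _ _ _)).
move=> i t [c [p [q [u [v [_ hu hv ->]]]]]].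
by rewrite (tmapE HM HN fh' gh _ hu) fc tmk0l scaler0.
Qed.

End TensorMapsTheory.

Lemma bmap_id_closed (k : fieldType) (A B : dgcat k) (M : bimod A B) : hclosed 0 (@bmap_id _ _ _ M).
Proof. by apply/closed0E. Qed.

(** * The associator *)

Section Associator.
Variables (k : fieldType) (A B C D : dgcat k).
Variables (M : bimod A C) (N : bimod C D) (P : bimod D B).
Hypotheses (HM : is_bimod M) (HN : is_bimod N) (HP : is_bimod P).

Definition assoc : bmap (tensor (tensor M N) P) (tensor M (tensor N P)) := fun a b =>
  tlift (fun d (u : tensor M N a d) (z : P d b) =>
    tlift (fun c (x : M a c) (y : N c d) => tmk x (tmk y z : tensor N P c b)
      : tensor M (tensor N P) a b) u).

Definition assoc_inv : bmap (tensor M (tensor N P)) (tensor (tensor M N) P) := fun a b =>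
  tlift (fun c (x : M a c) (v : tensor N P c b) =>
    tlift (fun d (y : N c d) (z : P d b) => tmk (tmk x y : tensor M N a d) z
      : tensor (tensor M N) P a b) v).

Definition gen3l a b : int -> tensor (tensor M N) P a b -> Prop :=
  tprod_gen (tgen true M N) (fun c b => @homog k (P c b)) (a := a) (b := b).

Definition gen3r a b : int -> tensor M (tensor N P) a b -> Prop :=
  tprod_gen (fun a c => @homog k (M a c)) (tgen true N P) (a := a) (b := b).

Lemma gens3l a b : gens (@gen3l a b).
Proof. by apply: gens_tprod => *; [apply: gens_tens | apply: gens_homog]. Qed.
Lemma gens3r a b : gens (@gen3r a b).
Proof. by apply: gens_tprod => *; [apply: gens_homog | apply: gens_tens]. Qed.

Lemma gen3lP a b i t : @gen3l a b i t -> exists c d p q r (x : M a c) (y : N c d) (z : P d b),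
  [/\ i = p + q + r, homog p x, homog q y, homog r z & t = tmk (tmk x y : tensor M N a d) z].
Proof.
case=> d [n [r [u [z [-> [c [p [q [x [y [-> hx hy ->]]]]]] hz ->]]]]].
by exists c, d, p, q, r, x, y, z.
Qed.

Lemma gen3rP a b i t : @gen3r a b i t -> exists c d p q r (x : M a c) (y : N c d) (z : P d b),
  [/\ i = p + (q + r), homog p x, homog q y, homog r z & t = tmk x (tmk y z : tensor N P c b)].
Proof.
case=> c [p [n [x [v [-> hx [d [q [r [y [z [-> hy hz ->]]]]]] ->]]]]].
by exists c, d, p, q, r, x, y, z.
Qed.

Lemma gen3l_homog a b i t : @gen3l a b i t -> homog i t.
Proof. by case/gen3lP => c [d [p [q [r [x [y [z [-> hx hy hz ->]]]]]]]]; apply: homog_tmk => //; apply: homog_tmk. Qed.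
Lemma gen3r_homog a b i t : @gen3r a b i t -> homog i t.
Proof. by case/gen3rP => c [d [p [q [r [x [y [z [-> hx hy hz ->]]]]]]]]; apply: homog_tmk => //; apply: homog_tmk. Qed.

Lemma assoc_inner a b d (z : P d b) :
  balanced true (fun c (x : M a c) (y : N c d) => tmk x (tmk y z : tensor N P c b) : tensor M (tensor N P) a b).
Proof.
split=> [c y|c x|_ c c' x w y].
- exact: tmk_linl.
- exact: (lin_comp (tmk_linr x) (tmk_linl z)).
- by rewrite tmk_act // tens_lactE.
Qed.

Lemma assoc_inv_inner a b c (x : M a c) :
  balanced true (fun d (y : N c d) (z : P d b) => tmk (tmk x y : tensor M N a d) z : tensor (tensor M N) P a b).
Proof.
split=> [d z|d y|_ d d' y w z].
- exact: (lin_comp (tmk_linl z) (tmk_linr x)).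
- exact: tmk_linr.
- by rewrite -tens_ractE tmk_act.
Qed.

Lemma assoc_outer a b : balanced true (fun d (u : tensor M N a d) (z : P d b) =>
    tlift (fun c (x : M a c) (y : N c d) => tmk x (tmk y z : tensor N P c b)
      : tensor M (tensor N P) a b) u).
Proof.
split=> [d z|d u|_ d d' u w z].
- exact: (tlift_lin (assoc_inner a z)).
- move=> s z z'; move: u; have L z := tlift_lin (assoc_inner a (d := d) (b := b) z).
  apply: (lin_ext (gens_tens HM HN _ _) (L _) (lin_add (lin_scale s (L _)) (L _))).
  move=> i t [c [p [q [x [y [_ hx hy ->]]]]]].
  by rewrite !(tliftE _ _ (assoc_inner _ _)) tmk_linr tmk_linr.
- move: u; have L e (z : P e b) := tlift_lin (assoc_inner a z).
  apply: (lin_ext (gens_tens HM HN _ _) (lin_comp (L _ _) (ract_linearl (tens_bimod true HM HN) w)) (L _ _)).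
  move=> i t [c [p [q [x [y [_ hx hy ->]]]]]].
  by rewrite tens_ractE !(tliftE _ _ (assoc_inner _ _)) tmk_act.
Qed.

Lemma assoc_inv_outer a b : balanced true (fun c (x : M a c) (v : tensor N P c b) =>
    tlift (fun d (y : N c d) (z : P d b) => tmk (tmk x y : tensor M N a d) z
      : tensor (tensor M N) P a b) v).
Proof.
have L e (x : M a e) := tlift_lin (assoc_inv_inner b x).
split=> [c v|c x|_ c c' x w v].
- move=> s x x'; move: v.
  apply: (lin_ext (gens_tens HN HP _ _) (L _ _) (lin_add (lin_scale s (L _ _)) (L _ _))).
  move=> i t [d [p [q [y [z [_ hy hz ->]]]]]].
  by rewrite !(tliftE _ _ (assoc_inv_inner _ _)) tmk_linl tmk_linl.
- exact: L.
- move: v.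
  apply: (lin_ext (gens_tens HN HP _ _) (L _ _) (lin_comp (L _ _) (lact_linearr (tens_bimod true HN HP) w))).
  move=> i t [d [p [q [y [z [_ hy hz ->]]]]]].
  by rewrite tens_lactE !(tliftE _ _ (assoc_inv_inner _ _)) tmk_act.
Qed.

Lemma assocE a b c d (x : M a c) (y : N c d) (z : P d b) :
  assoc (tmk (tmk x y : tensor M N a d) z) = tmk x (tmk y z : tensor N P c b).
Proof. by rewrite /assoc (tliftE _ _ (assoc_outer _ _)) (tliftE _ _ (assoc_inner _ _)). Qed.

Lemma assoc_invE a b c d (x : M a c) (y : N c d) (z : P d b) :
  assoc_inv (tmk x (tmk y z : tensor N P c b)) = tmk (tmk x y : tensor M N a d) z.
Proof. by rewrite /assoc_inv (tliftE _ _ (assoc_inv_outer _ _)) (tliftE _ _ (assoc_inv_inner _ _)). Qed.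

Lemma assoc_lin a b : linear (@assoc a b).
Proof. exact: (tlift_lin (assoc_outer a b)). Qed.
Lemma assoc_inv_lin a b : linear (@assoc_inv a b).
Proof. exact: (tlift_lin (assoc_inv_outer a b)). Qed.

Lemma assocK a b (t : tensor (tensor M N) P a b) : assoc_inv (assoc t) = t.
Proof.
move: t; apply: (lin_ext (@gens3l a b) (lin_comp (@assoc_inv_lin a b) (@assoc_lin a b)) (@lin_id _ _)).
by move=> i t /gen3lP [c [d [p [q [r [x [y [z [_ _ _ _ ->]]]]]]]]]; rewrite assocE assoc_invE.
Qed.

Lemma assoc_invK a b (t : tensor M (tensor N P) a b) : assoc (assoc_inv t) = t.
Proof.
move: t; apply: (lin_ext (@gens3r a b) (lin_comp (@assoc_lin a b) (@assoc_inv_lin a b)) (@lin_id _ _)).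
by move=> i t /gen3rP [c [d [p [q [r [x [y [z [_ _ _ _ ->]]]]]]]]]; rewrite assoc_invE assocE.
Qed.

Lemma assoc_hom : is_hom 0 assoc.
Proof.
apply: (is_hom_gen _ _ (G := gen3l) gens3l gen3l_homog assoc_lin).
- move=> a b i t /gen3lP [c [d [p [q [r [x [y [z [-> hx hy hz ->]]]]]]]]].
  by rewrite assocE add0r -addrA; apply: homog_tmk => //; apply: homog_tmk.
- move=> a a' b i j w t hw /gen3lP [c [d [p [q [r [x [y [z [_ hx hy hz ->]]]]]]]]].
  by rewrite !(tens_lactE, assocE) mul0r sgn0 scale1r.
- move=> a b b' i j w t hw /gen3lP [c [d [p [q [r [x [y [z [_ hx hy hz ->]]]]]]]]].
  by rewrite !(tens_ractE, assocE).
Qed.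

Lemma assoc_inv_hom : is_hom 0 assoc_inv.
Proof.
apply: (is_hom_gen _ _ (G := gen3r) gens3r gen3r_homog assoc_inv_lin).
- move=> a b i t /gen3rP [c [d [p [q [r [x [y [z [-> hx hy hz ->]]]]]]]]].
  by rewrite assoc_invE add0r addrA; apply: homog_tmk => //; apply: homog_tmk.
- move=> a a' b i j w t hw /gen3rP [c [d [p [q [r [x [y [z [_ hx hy hz ->]]]]]]]]].
  by rewrite !(tens_lactE, assoc_invE) mul0r sgn0 scale1r.
- move=> a b b' i j w t hw /gen3rP [c [d [p [q [r [x [y [z [_ hx hy hz ->]]]]]]]]].
  by rewrite !(tens_ractE, assoc_invE).
Qed.

Lemma assoc_closed : hclosed 0 assoc.
Proof.
apply/closed0E => a b.
have H3l := tens_bimod true (tens_bimod true HM HN) HP.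
have H3r := tens_bimod true HM (tens_bimod true HN HP).
apply: (lin_ext (@gens3l a b) (lin_comp (dd_linear (bcar_dgvect H3r a b)) (@assoc_lin a b))
  (lin_comp (@assoc_lin a b) (dd_linear (bcar_dgvect H3l a b)))).
move=> i t /gen3lP [c [d [p [q [r [x [y [z [_ hx hy hz ->]]]]]]]]].
rewrite assocE (tens_ddE _ _ hx) (tens_ddE _ _ (homog_tmk hx hy)) !(tens_ddE _ _ hx) !(tens_ddE _ _ hy).
rewrite !(linD (@assoc_lin a b), linZ (@assoc_lin a b), tmkDl, tmkDr, tmkZl, tmkZr, assocE).
by rewrite !scalerDr sgnZZ addrA.
Qed.

Lemma assoc_inv_closed : hclosed 0 assoc_inv.
Proof.
apply/closed0E => a b t; rewrite -{2}[t]assoc_invK.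
by move/closed0E: assoc_closed => ->; rewrite assocK.
Qed.

End Associator.

(** * Direct sums of shifts *)

Section DirectSumMaps.
Variables (k : fieldType) (I : choiceType) (V W : I -> lmodType k).
Variables (F : forall i, V i -> W i) (F0 : forall i, @F i 0 = 0).

Definition dsum_map (x : dsum V) : dsum W := to_dsum (fun i => F (dcomp x i)).

Lemma dcomp_dsum_map x i : dcomp (dsum_map x) i = F (dcomp x i).
Proof.
rewrite dcomp_to_dsum //; have [s [_ s0]] := dcomp_support x.
by exists s => j /s0 ->.
Qed.

Lemma dsum_map_dinj i (v : V i) : dsum_map (dinj i v) = dinj i (F v).
Proof.
apply: dsumP => j; rewrite dcomp_dsum_map.
by have [->|ji] := eqVneq j i; rewrite ?dinj_eq // !dinj_neq.
Qed.

Lemma dsum_map_lin : (forall i, linear (@F i)) -> linear dsum_map.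
Proof. by move=> lF c x y; apply: dsumP => i; rewrite dcomp_lin !dcomp_dsum_map dcomp_lin lF. Qed.

End DirectSumMaps.

Section ShiftSum.
Variables (k : fieldType) (A B : dgcat k) (I : choiceType) (p : I -> int).
Variables (E : I -> bimod A B) (HE : forall i, is_bimod (E i)).
Notation Vs a b := (fun i => E i a b : lmodType k).
Variable delta : forall j a b, dsum (Vs a b) -> E j a b.
Arguments delta : clear implicits.
Notation S := (shift_sum p delta).

(** The conditions under which [shift_sum] is a bimodule, used for the bar complex and for
    convolutions alike. The field [delta_sqr] is the component from i to j of the square of (-1)^p d
    + delta, without the terms in d^2; the signs in [delta_lact] come from the shifted actions. *)
Record is_differential : Prop := IsDifferential {
  delta_lin : forall j a b, linear (delta j a b);
  delta_fin : forall a b x, exists s : seq I, forall j, j \notin s -> delta j a b x = 0;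
  delta_homog : forall i j a b n (v : E i a b), homog n v ->
    homog (n + p i - p j + 1) (delta j a b (dinj i v));
  delta_lact : forall i j a a' b n (z : mor A a' a) (v : E i a' b), homog n z ->
    delta j a b (dinj i (lact (E i) z v)) =
      sgn k ((p i - p j + 1) * n) *: lact (E j) z (delta j a' b (dinj i v));
  delta_ract : forall i j a b b' (v : E i a b) (z : mor B b' b),
    delta j a b' (dinj i (ract (E i) v z)) = ract (E j) (delta j a b (dinj i v)) z;
  delta_sqr : forall i j a b (v : E i a b),
    sgn k (p j) *: dd (delta j a b (dinj i v)) + sgn k (p i) *: delta j a b (dinj i (dd v))
      + delta j a b (to_dsum (fun l => delta l a b (dinj i v))) = 0 }.

Hypothesis Hd : is_differential.

Definition sgen a b (n : int) (x : S a b) : Prop :=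
  exists i q (v : E i a b), [/\ n = q + p i, homog q v & x = dinj i v].

Lemma gens_shift a b : gens (@sgen a b).
Proof.
move=> P P0 PD PG; apply: dsum_ind => // i v.
move: v; apply: (gens_homog (bcar_dgvect (HE i) a b)); first by rewrite (lin0 (@dinj_lin _ _ _ _)).
  by move=> v w Pv Pw; rewrite (linD (@dinj_lin _ _ _ _)); apply: PD.
by move=> q v hv; apply: (PG (q + p i)); exists i, q, v.
Qed.

Lemma shift_prE a b n i (v : E i a b) : pr n (dinj i v : S a b) = dinj i (pr (n - p i) v).
Proof. exact: (dsum_map_dinj (F := fun i (x : E i a b) => pr (n - p i) x)
  (fun i => pr0 (bcar_dgvect (HE i) a b) (n - p i)) v). Qed.

Lemma dcomp_shift_pr a b n (x : S a b) i : dcomp (pr n x) i = pr (n - p i) (dcomp x i).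
Proof.
exact: (dcomp_dsum_map (F := fun i (x : E i a b) => pr (n - p i) x)
  (fun i => pr0 (bcar_dgvect (HE i) a b) (n - p i)) x).
Qed.

Lemma shift_pr_lin a b n : linear (pr n : S a b -> S a b).
Proof.
apply: (dsum_map_lin (F := fun i (x : E i a b) => pr (n - p i) x)) => i.
  exact: pr0.
exact: pr_linear.
Qed.

Lemma homog_dinj a b q i (v : E i a b) : homog q v -> homog (q + p i) (dinj i v : S a b).
Proof. by move=> hv; rewrite /homog shift_prE addrK hv. Qed.

Lemma dcomp_shift_dd a b (x : S a b) j :
  dcomp (dd x) j = sgn k (p j) *: dd (dcomp x j) + delta j a b x.
Proof.
rewrite dcomp_to_dsum //; have [s [_ s0]] := dcomp_support x.
have [t t0] := delta_fin Hd x; exists (s ++ t) => i.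
by rewrite mem_cat => /norP[/s0 -> /t0 ->]; rewrite (dd0 (bcar_dgvect (HE i) a b)) scaler0 addr0.
Qed.

Lemma dcomp_delta a b (x : S a b) j : dcomp (to_dsum (fun l => delta l a b x)) j = delta j a b x.
Proof. by rewrite dcomp_to_dsum //; apply: (delta_fin Hd). Qed.

Lemma shift_dd_lin a b : linear (@dd k (S a b)).
Proof.
move=> c x y; apply: dsumP => j; rewrite dcomp_lin !dcomp_shift_dd dcomp_lin.
rewrite (dd_linear (bcar_dgvect (HE j) a b)) (delta_lin Hd) !scalerDr !scalerA mulrC.
by rewrite addrACA.
Qed.

Lemma shift_ddE a b i (v : E i a b) :
  dd (dinj i v : S a b) = dinj i (sgn k (p i) *: dd v) + to_dsum (fun j => delta j a b (dinj i v)).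
Proof.
apply: dsumP => j; rewrite dcomp_shift_dd (linD (@dcomp_lin _ _ _ _)) dcomp_delta.
have [->|ji] := eqVneq j i; first by rewrite !dinj_eq.
by rewrite !dinj_neq // (dd0 (bcar_dgvect (HE j) a b)) scaler0.
Qed.

Lemma shift_lactE a a' b i (z : mor A a' a) (v : E i a' b) :
  lact S z (dinj i v) = dinj i (lact (E i) (twist (p i) z) v).
Proof. exact: (dsum_map_dinj (F := fun i (x : E i a' b) => lact (E i) (twist (p i) z) x)
  (fun i => lact0r (HE i) b (twist (p i) z)) v). Qed.

Lemma shift_ractE a b b' i (z : mor B b' b) (v : E i a b) :
  ract S (dinj i v) z = dinj i (ract (E i) v z).
Proof. exact: (dsum_map_dinj (F := fun i (x : E i a b) => ract (E i) x z)
  (fun i => ract0l (HE i) a z) v). Qed.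

Lemma dcomp_shift_lact a a' b (z : mor A a' a) (x : S a' b) i :
  dcomp (lact S z x) i = lact (E i) (twist (p i) z) (dcomp x i).
Proof. exact: (dcomp_dsum_map (F := fun i (x : E i a' b) => lact (E i) (twist (p i) z) x)
  (fun i => lact0r (HE i) b (twist (p i) z)) x). Qed.

Lemma dcomp_shift_ract a b b' (z : mor B b' b) (x : S a b) i :
  dcomp (ract S x z) i = ract (E i) (dcomp x i) z.
Proof. exact: (dcomp_dsum_map (F := fun i (x : E i a b) => ract (E i) x z)
  (fun i => ract0l (HE i) a z) x). Qed.

Lemma shift_dgvect a b : is_dgvect (S a b).
Proof.
have fin_homog i n (v : E i a b) : homog n v ->
    pr (n + p i + 1) (to_dsum (fun j => delta j a b (dinj i v)) : S a b) =
    to_dsum (fun j => delta j a b (dinj i v)).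
  move=> hv; apply: dsumP => j.
  rewrite dcomp_shift_pr !dcomp_delta.
  have -> : n + p i + 1 - p j = n + p i - p j + 1 by ring.
  exact: (delta_homog Hd j hv).
have prpr i j (x : S a b) : pr i (pr j x) = if i == j then pr i x else 0.
  apply: dsumP => l; rewrite !dcomp_shift_pr (pr_pr (bcar_dgvect (HE l) a b)).
  have -> : (i - p l == j - p l) = (i == j) by apply/eqP/eqP => [/addIr|->].
  by case: eqP => // _; rewrite dcomp_shift_pr.
split.
- exact: shift_pr_lin.
- exact: prpr.
- apply: (sum_components (@shift_pr_lin a b) prpr (gens_shift (a:=a) (b:=b))).
  by move=> n x [i [q [v [-> hv ->]]]]; apply: homog_dinj.
- exact: shift_dd_lin.
- move=> n x hx; have: pr (n + 1) (dd x) = dd (pr n x); last by rewrite hx.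
  move: x {hx}; apply: (lin_ext (@gens_shift a b) (f := fun x : S a b => pr (n + 1) (dd x))
     (g := fun x : S a b => dd (pr n x))).
  + exact: (lin_comp (@shift_pr_lin _ _ _) (@shift_dd_lin _ _)).
  + exact: (lin_comp (@shift_dd_lin _ _) (@shift_pr_lin _ _ _)).
  move=> m x [i [q [v [_ hv ->]]]]; rewrite shift_prE shift_ddE (linD (@shift_pr_lin _ _ _)).
  rewrite (pr_homog (bcar_dgvect (HE i) a b) _ hv) shift_prE (prZ (bcar_dgvect (HE i) a b)).
  rewrite (pr_homog (bcar_dgvect (HE i) a b) _ (dd_homog (bcar_dgvect (HE i) a b) hv)).
  have -> : (n + 1 - p i == q + 1) = (n - p i == q).
    by rewrite addrAC; apply/eqP/eqP => [/addIr|->].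
  case: eqP => nq.
    rewrite shift_ddE; congr (_ + _).
    by have -> : n = q + p i; [rewrite -nq subrK | apply: fin_homog].
  rewrite scaler0 (lin0 (@dinj_lin _ _ _ _)) add0r (lin0 (@shift_dd_lin a b)).
  apply: dsumP => j.
  rewrite dcomp_shift_pr !dcomp_delta.
  rewrite (pr_homog (bcar_dgvect (HE j) a b) _ (delta_homog Hd j hv)).
  by case: eqP => // e; case: nq; apply/eqP; move/eqP: e; lia.
- apply: (lin_ext (@gens_shift a b) (lin_comp (@shift_dd_lin _ _) (@shift_dd_lin _ _)) (@lin_cst0 _ _ _)).
  move=> m x [i [q [v [_ hv ->]]]]; apply: dsumP => j.
  rewrite dcomp_shift_dd shift_ddE (linD (@dcomp_lin _ _ _ _)) (linD (delta_lin Hd j (a:=a) (b:=b))).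
  rewrite dcomp_delta (ddD (bcar_dgvect (HE j) a b)) scalerDr.
  have -> : dd (dcomp (dinj i (sgn k (p i) *: dd v) : dsum (Vs a b)) j) = 0.
    have [->|ji] := eqVneq j i; last by rewrite dinj_neq // (dd0 (bcar_dgvect (HE j) a b)).
    rewrite dinj_eq (ddZ (bcar_dgvect (HE i) a b)) (dd_dd (bcar_dgvect (HE i) a b)).
    by rewrite scaler0.
  rewrite scaler0 add0r (linZ (@dinj_lin _ _ _ _)) (linZ (delta_lin Hd j (a:=a) (b:=b))) addrA.
  by rewrite (delta_sqr Hd).
Qed.

Lemma shift_lact_linr a a' b (z : mor A a' a) : linear (fun x : S a' b => lact S z x).
Proof.
apply: (dsum_map_lin (F := fun i (x : E i a' b) => lact (E i) (twist (p i) z) x)) => i.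
  exact: lact0r.
exact: lact_linearr.
Qed.

Lemma shift_ract_linl a b b' (z : mor B b' b) : linear (fun x : S a b => ract S x z).
Proof.
apply: (dsum_map_lin (F := fun i (x : E i a b) => ract (E i) x z)) => i.
  exact: ract0l.
exact: ract_linearl.
Qed.

Lemma shift_bimod : is_bimod S.
Proof.
have Sdg := shift_dgvect.
split=> //.
- move=> a a' b x c z z'; apply: dsumP => i.
  by rewrite dcomp_lin !dcomp_shift_lact (twist_lin _ _) (lact_linearl (HE i)).
- exact: shift_lact_linr.
- exact: shift_ract_linl.
- by move=> a b b' x c z z'; apply: dsumP => i; rewrite dcomp_lin !dcomp_shift_ract (ract_linearr (HE i)).
- move=> a a' b i j z x hz hx; move: j x hx.
  apply: (homog_ext (Sdg _ _) (Sdg _ _) (@gens_shift a' b) _ (@shift_lact_linr _ _ _ _)).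
    by move=> n x [l [q [v [-> hv ->]]]]; apply: homog_dinj.
  move=> n x [l [q [v [-> hv ->]]]]; rewrite shift_lactE addrA; apply: homog_dinj.
  by apply: (lact_homog (HE l)) => //; apply: homog_twist.
- move=> a b b' i j x z hx hz; rewrite addrC; move: i x hx.
  apply: (homog_ext (Sdg _ _) (Sdg _ _) (@gens_shift a b) _ (@shift_ract_linl _ _ _ _)).
    by move=> n x [l [q [v [-> hv ->]]]]; apply: homog_dinj.
  move=> n x [l [q [v [-> hv ->]]]]; rewrite shift_ractE addrA [j + q]addrC; apply: homog_dinj.
  exact: (ract_homog (HE l)).
- move=> a a' b i z x hz; move: x.
  have ll (w : mor A a' a) := @shift_lact_linr a a' b w.
  apply: (lin_ext (@gens_shift a' b) (lin_comp (@shift_dd_lin _ _) (ll z))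
     (lin_add (ll (dd z)) (lin_scale _ (lin_comp (ll z) (@shift_dd_lin _ _))))).
  move=> n x [l [q [v [_ hv ->]]]].
  have hzt := twistE (mor_dgvect _ _) (p l) hz.
  rewrite !shift_lactE !shift_ddE (linD (ll z)) shift_lactE.
  rewrite hzt (twistE _ _ (dd_homog _ hz)) (lactZl (HE l)) (ddZ (bcar_dgvect (HE l) _ _)).
  rewrite (lact_dd (HE l) _ hz) !scalerDr (linD (@dinj_lin _ _ _ _)).
  rewrite (lactZl (HE l)) (lactZr (HE l)) (lactZl (HE l)) !(linZ (@dinj_lin _ _ _ _)) !sgnZZ.
  rewrite -!addrA; congr (_ + _); first by apply: sgnZ_eq; odd_tac.
  congr (_ + _); first by apply: sgnZ_eq; odd_tac.
  apply: dsumP => j.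
  rewrite (linZ (dcomp_lin _)) dcomp_shift_lact !dcomp_delta (linZ (delta_lin Hd j (a:=_) (b:=_))).
  rewrite (delta_lact Hd _ _ hz) (twistE _ _ hz) (lactZl (HE j)) !sgnZZ.
  by apply: sgnZ_eq; odd_tac.
- move=> a b b' i x z hx.
  have ll (w : mor B b' b) := @shift_ract_linl a b b' w.
  have H : dd (ract S x z) = ract S (dd x) z + ract S (twist 1 x) (dd z).
    move: x {hx}; apply: (lin_ext (@gens_shift a b) (lin_comp (@shift_dd_lin _ _) (ll z))
     (lin_add (lin_comp (ll z) (@shift_dd_lin _ _)) (lin_comp (ll _) (twist_lin _ _)))).
    move=> n x [l [q [v [_ hv ->]]]].
    rewrite (twistE _ _ (homog_dinj hv)) (linZ (ll _)) !shift_ractE !shift_ddE (linD (ll z)) shift_ractE.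
    rewrite (ract_dd (HE l) _ hv) scalerDr (linD (@dinj_lin _ _ _ _)) (ractZl (HE l)).
    rewrite -!addrA; congr (_ + _); rewrite addrC; congr (_ + _).
      apply: dsumP => j; rewrite dcomp_shift_ract !dcomp_delta.
      by rewrite (delta_ract Hd).
    by rewrite !(linZ (@dinj_lin _ _ _ _)) sgnZZ mul1r; apply: sgnZ_eq; odd_tac.
  rewrite H; congr (_ + _).
  by rewrite (twistE _ _ hx) (linZ (ll _)) mul1r.
- move=> a a' a'' b z z' x; apply: dsumP => i; rewrite !dcomp_shift_lact.
  rewrite -(lact_comp (HE i)); congr (lact _ _ _).
  move: z'; apply: (lin_ext (gens_homog (mor_dgvect _ _)) (lin_comp (twist_lin _ _) (mcomp_linearr z)) (lin_comp (mcomp_linearr _) (twist_lin _ _))).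
  move=> n z' hz'; move: z; apply: (lin_ext (gens_homog (mor_dgvect _ _)) (lin_comp (twist_lin _ _) (mcomp_linearl z')) (lin_comp (mcomp_linearl _) (twist_lin _ _))).
  move=> m z hz; rewrite (twistE _ _ hz) (twistE _ _ hz') (twistE _ _ (mcomp_homog hz hz')).
  by rewrite (linZ (mcomp_linearl _)) (linZ (mcomp_linearr _)) sgnZZ -mulrDr.
- by move=> a b b' b'' x z z'; apply: dsumP => i; rewrite !dcomp_shift_ract (ract_comp (HE i)).
- move=> a a' b b' z x z'; apply: dsumP => i.
  by rewrite !(dcomp_shift_ract, dcomp_shift_lact) (lact_ract (HE i)).
- move=> a b x; apply: dsumP => i; rewrite dcomp_shift_lact.
  by rewrite (twistE (mor_dgvect _ _) _ (idm_homog a)) mulr0 sgn0 scale1r (lact1 (HE i)).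
- by move=> a b x; apply: dsumP => i; rewrite dcomp_shift_ract (ract1 (HE i)).
Qed.

Definition shift_inj i : bmap (E i) S := fun a b v => dinj i v.
Definition shift_proj i : bmap S (E i) := fun a b x => dcomp x i.
Arguments shift_inj i a b v : clear implicits.
Arguments shift_proj i a b x : clear implicits.

Lemma shift_inj_hom i : is_hom (p i) (shift_inj i).
Proof.
split; rewrite /shift_inj.
- by move=> a b; apply: dinj_lin.
- by move=> a b n v hv; rewrite addrC; apply: homog_dinj.
- move=> a a' b n z v hz; rewrite shift_lactE (twistE _ _ hz) (lactZl (HE i)).
  rewrite (linZ (@dinj_lin _ _ _ _)) sgnZZ sgnZ1 //; first by odd_tac.
- by move=> *; rewrite shift_ractE.
Qed.

Lemma shift_proj_hom i : is_hom (- p i) (shift_proj i).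
Proof.
split; rewrite /shift_proj.
- by move=> a b; apply: dcomp_lin.
- move=> a b n x hx; rewrite -hx.
  rewrite dcomp_shift_pr.
  by rewrite addrC; apply: homog_pr.
- move=> a a' b n z x hz; rewrite dcomp_shift_lact (twistE _ _ hz) (lactZl (HE i)).
  by apply: sgnZ_eq; odd_tac.
- by move=> *; rewrite dcomp_shift_ract.
Qed.

End ShiftSum.

Arguments shift_inj {k A B I} p {E} delta i a b v.
Arguments shift_proj {k A B I} p {E} delta i a b x.
Arguments shift_lactE {k A B I p E} HE {delta a a' b i} z v.
Arguments shift_ractE {k A B I p E} HE {delta a b b' i} z v.
Arguments homog_dinj {k A B I p E} HE {delta a b q i v} hv : rename.
Arguments gens_shift {k A B I p E} HE {delta} a b : rename.

Arguments tpow : simpl never.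
Arguments mult_at {k A} n i a b _ : simpl never.

Section DirectSumElim.
Variables (k : fieldType) (I : choiceType) (V : I -> lmodType k) (W : lmodType k).
Variables (F : forall i, V i -> W) (lF : forall i, linear (@F i)).

Lemma dsum_elim_lin : linear (fun x : dsum V => \sum_(i \in [set: I]) F (dcomp x i)).
Proof.
move=> c x y.
have [s [_ s0]] := dcomp_support x; have [t [_ t0]] := dcomp_support y.
have E (z : dsum V) : (forall i, i \notin undup (s ++ t) -> dcomp z i = 0) ->
    \sum_(i \in [set: I]) F (dcomp z i) = \sum_(i <- undup (s ++ t)) F (dcomp z i).
  by move=> z0; rewrite (fssumE (undup_uniq (s ++ t))) // => i /z0 ->; rewrite (lin0 (@lF i)).
have s0' i : i \notin undup (s ++ t) -> dcomp x i = 0.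
  by rewrite mem_undup mem_cat => /norP[/s0].
have t0' i : i \notin undup (s ++ t) -> dcomp y i = 0.
  by rewrite mem_undup mem_cat => /norP[_ /t0].
rewrite !E //; last by move=> i iu; rewrite dcomp_lin s0' // t0' // scaler0 addr0.
rewrite scaler_sumr -big_split; apply: eq_bigr => i _ /=.
by rewrite dcomp_lin lF.
Qed.

Lemma dsum_elim_dinj i (v : V i) :
  \sum_(j \in [set: I]) F (dcomp (dinj i v : dsum V) j) = F v.
Proof.
rewrite (@fssum1 _ _ _ i) ?dinj_eq // => j ji.
by rewrite dinj_neq // (lin0 (@lF j)).
Qed.

End DirectSumElim.

(** * The bar complex as a coalgebra *)

Section TensorPowers.
Variables (k : fieldType) (A : dgcat k).

#[export] Instance tpow_bimod n : is_bimod (tpow A n).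
Proof. by elim: n => [|n IH]; [apply: diag_bimod | apply: tens_bimod]. Qed.

Lemma mult_at_lin n i a b : linear (mult_at (A := A) n i a b).
Proof.
elim: n i a b => [|n IH] i a b.
  apply: tlift_lin; split=> // [c y|c x]; first exact: lact_linearl.
  exact: lact_linearr.
case: i => [|i]; apply: tlift_lin; split=> // [c y|c x].
- exact: (lact_linearl (tpow_bimod n.+1)).
- exact: (lact_linearr (tpow_bimod n.+1)).
- exact: tmk_linl.
- exact: (lin_comp (tmk_linr x) (IH i c b)).
Qed.

Lemma mult_at0E n a c b (x : diag A a c) (y : tpow A n c b) :
  mult_at n 0 _ _ (tmk x y) = lact (tpow A n) x y.
Proof.
have bF : balanced false (fun c (x : diag A a c) (y : tpow A n c b) => lact (tpow A n) x y).
  split=> // [d z|d z]; first exact: (lact_linearl (tpow_bimod n)).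
  exact: (lact_linearr (tpow_bimod n)).
by case: n y bF => [|n] y bF; rewrite /mult_at (tliftE _ _ bF).
Qed.

Lemma mult_atSE n i a c b (x : diag A a c) (y : tpow A n.+1 c b) :
  mult_at n.+1 i.+1 _ _ (tmk x y) = tmk x (mult_at n i _ _ y).
Proof.
have bF : balanced false (fun c (x : diag A a c) (y : tpow A n.+1 c b) =>
    tmk x (mult_at n i c b y) : tpow A n.+1 a b).
  split=> // [d z|d z]; first exact: tmk_linl.
  exact: (lin_comp (tmk_linr z) (@mult_at_lin n i d b)).
by rewrite /mult_at -/mult_at (tliftE _ _ bF).
Qed.

(** The differentials of the bar complex together with one more map at the end, the composition of
    two factors. In this way [bar_tau] and the differential obey a single recursion, b(x ⊗ y) = x y
    - x ⊗ b(y) ([bar_faceSE]), from which their properties follow by induction. *)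
Definition bar_face n : bmap (tpow A n.+1) (tpow A n) := fun a b x =>
  \sum_(i < n.+1) (-1) ^+ i *: mult_at n i a b x.

Lemma bar_face_lin n a b : linear (@bar_face n a b).
Proof. by apply: lin_bigsum => i; apply/lin_scale/mult_at_lin. Qed.

Lemma bar_face0E a c b (x : diag A a c) (y : diag A c b) :
  bar_face (n := 0) (tmk x y) = mcomp x y.
Proof. by rewrite /bar_face big_ord1 expr0 scale1r (@mult_at0E 0). Qed.

Lemma bar_faceSE n a c b (x : diag A a c) (y : tpow A n.+1 c b) :
  bar_face (n := n.+1) (tmk x y) = lact (tpow A n.+1) x y - tmk x (bar_face y).
Proof.
rewrite {1}/bar_face big_ord_recl expr0 scale1r mult_at0E; congr (_ + _).
rewrite /bar_face (lin_sum (tmk_linr x)) -sumrN; apply: eq_bigr => i _.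
by rewrite /= mult_atSE exprS mulN1r scaleNr tmkZr.
Qed.

Lemma bar_face_hom n : is_hom 0 (@bar_face n).
Proof.
elim: n => [|n IH].
  apply: (is_hom_gen (tpow_bimod 1) (tpow_bimod 0) (G := tgen false (diag A) (tpow A 0))
    (gens_tens (diag_bimod A) (tpow_bimod 0)) _ (@bar_face_lin 0)).
  - by move=> a b i t [c [p [q [x [y [-> hx hy ->]]]]]]; apply: homog_tmk.
  - move=> a b i t [c [p [q [x [y [-> hx hy ->]]]]]]; rewrite bar_face0E add0r.
    exact: mcomp_homog.
  - move=> a a' b i j z t hz [c [p [q [x [y [_ hx hy ->]]]]]].
    by rewrite tens_lactE !bar_face0E mul0r sgn0 scale1r; apply/esym/mcompA.
  - move=> a b b' i j z t hz [c [p [q [x [y [_ hx hy ->]]]]]].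
    by rewrite tens_ractE !bar_face0E; apply: mcompA.
apply: (is_hom_gen (tpow_bimod n.+2) (tpow_bimod n.+1) (G := tgen false (diag A) (tpow A n.+1))
    (gens_tens (diag_bimod A) (tpow_bimod n.+1)) _ (@bar_face_lin n.+1)).
- by move=> a b i t [c [p [q [x [y [-> hx hy ->]]]]]]; apply: homog_tmk.
- move=> a b i t [c [p [q [x [y [-> hx hy ->]]]]]]; rewrite bar_faceSE add0r.
  apply: homogB; first exact: lact_homog.
  by apply: homog_tmk => //; rewrite -[q]add0r; apply: (hom_homog IH).
- move=> a a' b i j z t hz [c [p [q [x [y [_ hx hy ->]]]]]].
  rewrite tens_lactE !bar_faceSE mul0r sgn0 scale1r.
  by rewrite (linB (lact_linearr (tpow_bimod n.+1) z)) tens_lactE (lact_comp (tpow_bimod n.+1)).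
- move=> a b b' i j z t hz [c [p [q [x [y [_ hx hy ->]]]]]].
  rewrite tens_ractE !bar_faceSE (linB (ract_linearl (tpow_bimod n.+1) z)) tens_ractE.
  by rewrite (lact_ract (tpow_bimod n.+1)) (hom_ract IH).
Qed.

Lemma bar_face_closed n : hclosed 0 (@bar_face n).
Proof.
elim: n => [|n IH].
  apply: (closed0_gen (tpow_bimod 1) (tpow_bimod 0)
    (gens_tens (diag_bimod A) (tpow_bimod 0)) (@bar_face_lin 0)).
  move=> a b i t [c [p [q [x [y [_ hx hy ->]]]]]].
  rewrite (tens_ddE _ _ hx) (linD (@bar_face_lin _ _ _)) (linZ (@bar_face_lin _ _ _)) !bar_face0E.
  exact: mcomp_dd.
move/closed0E: IH => IH.
apply: (closed0_gen (tpow_bimod n.+2) (tpow_bimod n.+1)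
  (gens_tens (diag_bimod A) (tpow_bimod n.+1)) (@bar_face_lin n.+1)).
move=> a b i t [c [p [q [x [y [_ hx hy ->]]]]]].
rewrite (tens_ddE _ _ hx) (linD (@bar_face_lin _ _ _)) (linZ (@bar_face_lin _ _ _)) !bar_faceSE.
rewrite (ddB (bcar_dgvect (tpow_bimod n.+1) a b)) (lact_dd (tpow_bimod n.+1) _ hx).
by rewrite (tens_ddE _ _ hx) IH scalerBr opprD addrACA.
Qed.

(** By the recursion, b b(x ⊗ y) = b(x y) - x b(y) + x ⊗ b b(y), and the first two terms cancel
    because b commutes with the left action. *)
Lemma bar_face_face n a b (t : tpow A n.+2 a b) : bar_face (bar_face t) = 0.
Proof.
elim: n a b t => [|n IH] a b.
  apply: (lin_ext (gens_tens (diag_bimod A) (tpow_bimod 1) a b)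
    (lin_comp (@bar_face_lin 0 a b) (@bar_face_lin 1 a b)) (@lin_cst0 _ _ _)).
  move=> i t [c [p [q [x [y [_ hx hy ->]]]]]].
  rewrite bar_faceSE (linB (@bar_face_lin _ _ _)) bar_face0E (hom_lact (bar_face_hom 0) _ hx).
  by rewrite mul0r sgn0 scale1r subrr.
apply: (lin_ext (gens_tens (diag_bimod A) (tpow_bimod n.+2) a b)
  (lin_comp (@bar_face_lin n.+1 a b) (@bar_face_lin n.+2 a b)) (@lin_cst0 _ _ _)).
move=> i t [c [p [q [x [y [_ hx hy ->]]]]]].
rewrite bar_faceSE (linB (@bar_face_lin _ _ _)) bar_faceSE (hom_lact (bar_face_hom n.+1) _ hx).
by rewrite mul0r sgn0 scale1r IH tmk0r subr0 subrr.
Qed.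

Definition bar_deg (n : nat) : int := - n%:Z.
Notation Vs a b := (fun n => tpow A n.+1 a b : lmodType k).

Lemma bar_deltaE n a b (x : dsum (Vs a b)) : bar_delta n x = bar_face (dcomp x n.+1).
Proof. by []. Qed.

Lemma bar_delta_dinj n a b (v : tpow A n.+2 a b) : bar_delta n (dinj n.+1 v : dsum (Vs a b)) = bar_face v.
Proof. by rewrite bar_deltaE dinj_eq. Qed.

Lemma bar_delta_dinj0 n m a b (v : tpow A m.+1 a b) : m != n.+1 -> bar_delta n (dinj m v : dsum (Vs a b)) = 0.
Proof. by move=> mn; rewrite bar_deltaE dinj_neq ?(lin0 (@bar_face_lin _ _ _)) // eq_sym. Qed.

Lemma bar_differential : is_differential bar_deg (E := fun n => tpow A n.+1) (@bar_delta k A).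
Proof.
split.
- by move=> n a b; apply: (lin_comp (@bar_face_lin _ _ _) (dcomp_lin _)).
- move=> a b x; have [s [_ s0]] := dcomp_support x; exists [seq n.-1 | n <- s] => n ns.
  rewrite bar_deltaE s0 ?(lin0 (@bar_face_lin _ _ _)) //.
  by apply: contra ns => ns; apply/mapP; exists n.+1.
- move=> i j a b n v hv; have [ij|ij] := eqVneq i j.+1; last first.
    by rewrite bar_delta_dinj0 //; apply: homog0.
  subst i; rewrite bar_delta_dinj.
  have -> : n + bar_deg j.+1 - bar_deg j + 1 = 0 + n by rewrite /bar_deg; lia.
  exact: (hom_homog (bar_face_hom _)).
- move=> i j a a' b n z v hz; have [ij|ij] := eqVneq i j.+1; last first.
    by rewrite !bar_delta_dinj0 // (lact0r (tpow_bimod j.+1)) scaler0.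
  subst i; rewrite !bar_delta_dinj (hom_lact (bar_face_hom _) _ hz).
  by congr (sgn k _ *: _); rewrite /bar_deg; lia.
- move=> i j a b b' v z; have [ij|ij] := eqVneq i j.+1; last first.
    by rewrite !bar_delta_dinj0 // (ract0l (tpow_bimod j.+1)).
  by subst i; rewrite !bar_delta_dinj (hom_ract (bar_face_hom _)).
- move=> i j a b v.
  have fin : exists s : seq nat, forall l, l \notin s -> bar_delta l (dinj i v : dsum (Vs a b)) = 0.
    by exists [:: i.-1] => l; rewrite inE => li; apply: bar_delta_dinj0; apply: contra li => /eqP ->.
  rewrite [X in _ + X]bar_deltaE (dcomp_to_dsum fin).
  (* For i = j + 1 the terms cancel because b commutes with d while adjacent shifts have opposite
     signs; for i = j + 2 the square of b remains, which vanishes. All other components are zero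
     from the outset. *)
  have [ij|ij] := eqVneq i j.+1.
    subst i; rewrite !bar_delta_dinj bar_delta_dinj0; last by apply/eqP; lia.
    rewrite (lin0 (@bar_face_lin _ _ _)) addr0.
    move/closed0E: (bar_face_closed (n := j.+1)) => ->.
    by rewrite -scalerDl !sgnE /bar_deg !oddzN oddzS; case: oddz; rewrite ?addNr ?subrr scale0r.
  rewrite !(bar_delta_dinj0 _ ij) (dd0 (bcar_dgvect (tpow_bimod j.+1) a b)) !scaler0 !add0r.
  have [ij'|ij'] := eqVneq i j.+2; last by rewrite bar_delta_dinj0 // (lin0 (@bar_face_lin _ _ _)).
  by subst i; rewrite bar_delta_dinj bar_face_face.
Qed.

#[export] Instance bar_bimod : is_bimod (bar A).
Proof. exact: (shift_bimod (fun n => tpow_bimod n.+1) bar_differential). Qed.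

End TensorPowers.

(** * The bar complex in terms of words *)

Section BarWords.
Variables (k : fieldType) (A : dgcat k).
Notation X := (bar A).
Notation Vs a b := (fun n => tpow A n.+1 a b : lmodType k).

Let HX : is_bimod X := bar_bimod A.

Definition binj n a b (t : tpow A n.+1 a b) : X a b := dinj n t.

Lemma binj_lin n a b : linear (@binj n a b).
Proof. exact: dinj_lin. Qed.

Lemma bar_dd0 a b (t : tpow A 1 a b) : dd (binj t) = binj (dd t).
Proof.
rewrite -[LHS]/(dd (dinj 0 t : shift_sum bar_deg (@bar_delta k A) a b)).
rewrite (shift_ddE (fun n => tpow_bimod A n.+1) (bar_differential A)).
rewrite [sgn _ _]sgn0 scale1r -[RHS]addr0; congr (_ + _); apply: dsumP => j.
by rewrite (dcomp_delta (bar_differential A)) bar_delta_dinj0.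
Qed.

Lemma bar_ddS n a b (t : tpow A n.+2 a b) :
  dd (binj t) = sgn k n.+1%:Z *: binj (dd t) + binj (bar_face t).
Proof.
rewrite -[LHS]/(dd (dinj n.+1 t : shift_sum bar_deg (@bar_delta k A) a b)).
rewrite (shift_ddE (fun n => tpow_bimod A n.+1) (bar_differential A)).
rewrite (linZ (@dinj_lin _ _ _ _)) (sgn_eq k (m := bar_deg n.+1) (n := n.+1%:Z)); last by rewrite /bar_deg oddzN.
congr (_ + _); apply: dsumP => j.
rewrite (dcomp_delta (bar_differential A)); have [->|jn] := eqVneq j n.
  by rewrite bar_delta_dinj dinj_eq.
by rewrite bar_delta_dinj0 ?dinj_neq // eqSS eq_sym.
Qed.

Lemma bar_lactE n a a' b (z : mor A a' a) (t : tpow A n.+1 a' b) :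
  lact X z (binj t) = binj (lact (tpow A n.+1) (twist n%:Z z) t).
Proof.
rewrite -[LHS]/(lact (shift_sum bar_deg (@bar_delta k A)) z (dinj n t)).
rewrite (shift_lactE (fun n => tpow_bimod A n.+1)); congr (binj (lact _ _ _)).
move: z; apply: (lin_ext (gens_homog (mor_dgvect a' a)) (twist_lin _ _) (twist_lin _ _)).
move=> i z hz; rewrite !(twistE _ _ hz); apply: sgnZ_eq; rewrite /bar_deg; odd_tac.
Qed.

Lemma bar_ractE n a b b' (z : mor A b' b) (t : tpow A n.+1 a b) :
  ract X (binj t) z = binj (ract (tpow A n.+1) t z).
Proof.
rewrite -[LHS]/(ract (shift_sum bar_deg (@bar_delta k A)) (dinj n t) z).
by rewrite (shift_ractE (fun n => tpow_bimod A n.+1)).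
Qed.

Lemma homog_binj n q a b (t : tpow A n.+1 a b) : homog q t -> homog (q - n%:Z) (binj t).
Proof. exact: (homog_dinj (fun n => tpow_bimod A n.+1)). Qed.

Lemma binj_ind a b (P : X a b -> Prop) : P 0 -> (forall x y, P x -> P y -> P (x + y)) ->
  (forall n t, P (@binj n a b t)) -> forall x, P x.
Proof. exact: dsum_ind. Qed.

Lemma binj_ext (W : lmodType k) a b (f g : X a b -> W) : linear f -> linear g ->
  (forall n t, f (@binj n a b t) = g (binj t)) -> forall x, f x = g x.
Proof.
move=> lf lg fg; apply: binj_ind => //; first by rewrite (lin0 lf) (lin0 lg).
by move=> x y fx fy; rewrite (linD lf) (linD lg) fx fy.
Qed.

(* prepending a letter; up to sign, this is the contracting homotopy of the
   augmented bar complex when the letter is an identity *)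
Definition prepend a c b (x : diag A a c) (w : X c b) : X a b :=
  to_dsum (V := Vs a b) (fun m => match m with
    | 0 => 0
    | n.+1 => tmk (twist n%:Z x) (dcomp w n) : tpow A n.+2 a b end).

Lemma dcomp_prepend a c b (x : diag A a c) (w : X c b) m :
  dcomp (prepend x w) m = match m return tpow A m.+1 a b with
    | 0 => 0 | n.+1 => tmk (twist n%:Z x) (dcomp w n) : tpow A n.+2 a b end.
Proof.
rewrite /prepend dcomp_to_dsum; first by case: m.
have [s [_ s0]] := dcomp_support w; exists [seq n.+1 | n <- s] => -[//|n] ns.
rewrite s0 ?tmk0r //; apply: contra ns => ns; apply/mapP; by exists n.
Qed.

Lemma prepend_linr a c b (x : diag A a c) : linear (fun w : X c b => prepend x w).
Proof.
move=> s v w; apply: dsumP => m; rewrite dcomp_lin !dcomp_prepend.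
case: m => [|m]; first by rewrite scaler0 addr0.
by rewrite dcomp_lin tmk_linr.
Qed.

Lemma prepend_linl a c b (w : X c b) : linear (fun x : diag A a c => prepend x w).
Proof.
move=> s x y; apply: dsumP => m; rewrite dcomp_lin !dcomp_prepend.
case: m => [|m]; first by rewrite scaler0 addr0.
by rewrite (twist_lin (bcar_dgvect (diag_bimod A) a c)) tmk_linl.
Qed.

Lemma prepend_binj n a c b (x : diag A a c) (t : tpow A n.+1 c b) :
  prepend x (binj t) = binj (tmk (twist n%:Z x) t : tpow A n.+2 a b).
Proof.
apply: dsumP => m; rewrite dcomp_prepend.
case: m => [|m]; first by rewrite dinj_neq.
have [->|mn] := eqVneq m n; first by rewrite !dinj_eq.
by rewrite !dinj_neq ?tmk0r.
Qed.

Lemma homog_prepend i j a c b (x : diag A a c) (w : X c b) :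
  homog i x -> homog j w -> homog (i - 1 + j) (prepend x w).
Proof.
move=> hx; move: j w.
apply: (homog_ext (bcar_dgvect HX c b) (bcar_dgvect HX a b)
  (gens_shift (p := bar_deg) (fun n => tpow_bimod A n.+1) (delta := @bar_delta k A) c b) _ (@prepend_linr a c b x)).
  by move=> i' w [n [q [t [-> ht ->]]]]; apply: (homog_dinj (fun n => tpow_bimod A n.+1)).
move=> _ w [n [q [t [-> ht ->]]]]; rewrite (prepend_binj (n := n)).
have -> : i - 1 + (q + bar_deg n) = i + q - n.+1%:Z by rewrite /bar_deg; lia.
apply/homog_binj/homog_tmk => //.
exact: (homog_twist (bcar_dgvect (diag_bimod A) a c)).
Qed.

Lemma lact_prepend a a' c b (z : mor A a' a) (x : diag A a' c) (w : X c b) :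
  lact X z (prepend x w) = prepend (mcomp (twist 1 z) x : diag A a c) w.
Proof.
move: w; apply: binj_ext.
- exact: (lin_comp (lact_linearr HX z) (@prepend_linr a' c b x)).
- exact: prepend_linr.
move=> n t; rewrite !prepend_binj bar_lactE tens_lactE; congr (binj (tmk _ _)).
move: x; apply: (lin_ext (gens_homog (mor_dgvect c a')) (lin_comp (mcomp_linearr _) (twist_lin _ _))
  (lin_comp (twist_lin _ _) (mcomp_linearr _))) => i x hx.
move: z; apply: (lin_ext (gens_homog (mor_dgvect a' a)) (lin_comp (mcomp_linearl _) (twist_lin _ _))
  (lin_comp (twist_lin _ _) (lin_comp (mcomp_linearl _) (twist_lin _ _)))) => j z hz.
rewrite (twistE _ _ hx) !(twistE _ _ hz) (linZ (mcomp_linearl _)) (linZ (mcomp_linearr _)).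
rewrite (linZ (mcomp_linearl _)) (linZ (twist_lin _ _)) (twistE _ _ (mcomp_homog hz hx)) !sgnZZ.
by apply: sgnZ_eq; odd_tac.
Qed.

Lemma ract_prepend a c b b' (x : diag A a c) (w : X c b) (z : mor A b' b) :
  ract X (prepend x w) z = prepend x (ract X w z).
Proof.
move: w; apply: binj_ext.
- exact: (lin_comp (ract_linearl HX z) (@prepend_linr a c b x)).
- exact: (lin_comp (@prepend_linr a c b' x) (ract_linearl HX z)).
by move=> n t; rewrite !prepend_binj !bar_ractE prepend_binj tens_ractE.
Qed.

Definition two a c b (x : diag A a c) (y : diag A c b) : X a b := binj (tmk x y : tpow A 1 a b).

Lemma two_linl a c b (y : diag A c b) : linear (fun x : diag A a c => two x y).
Proof. exact: (lin_comp (@binj_lin 0 a b) (tmk_linl y)). Qed.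
Lemma two_linr a c b (x : diag A a c) : linear (fun y : diag A c b => two x y).
Proof. exact: (lin_comp (@binj_lin 0 a b) (tmk_linr x)). Qed.

Lemma homog_two i j a c b (x : diag A a c) (y : diag A c b) :
  homog i x -> homog j y -> homog (i + j) (two x y).
Proof. by move=> hx hy; rewrite -[i + j]subr0; apply/homog_binj/homog_tmk. Qed.

Lemma lact_two a a' c b (z : mor A a' a) (x : diag A a' c) (y : diag A c b) :
  lact X z (two x y) = two (mcomp z x : diag A a c) y.
Proof. by rewrite /two bar_lactE twist_0 tens_lactE. Qed.

Lemma ract_two a c b b' (x : diag A a c) (y : diag A c b) (z : mor A b' b) :
  ract X (two x y) z = two x (mcomp y z : diag A c b').
Proof. by rewrite /two bar_ractE tens_ractE. Qed.

Lemma dd_two i a c b (x : diag A a c) (y : diag A c b) : homog i x ->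
  dd (two x y) = two (dd x : diag A a c) y + sgn k i *: two x (dd y : diag A c b).
Proof.
by move=> hx; rewrite /two bar_dd0 (tens_ddE _ _ hx) (linD (@binj_lin _ _ _)) (linZ (@binj_lin _ _ _)).
Qed.

Lemma bar_tauE a b (x : X a b) : bar_tau x = bar_face (dcomp x 0).
Proof. by rewrite /bar_tau /bar_face big_ord1 expr0 scale1r. Qed.

Lemma bar_tau_lin a b : linear (@bar_tau k A a b).
Proof.
by move=> c x y; rewrite !bar_tauE; apply: (lin_comp (@bar_face_lin _ A 0 a b) (@dcomp_lin _ _ (Vs a b) 0)).
Qed.

Lemma bar_tau_two a c b (x : diag A a c) (y : diag A c b) : bar_tau (two x y) = mcomp x y.
Proof. by rewrite bar_tauE dinj_eq bar_face0E. Qed.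

Lemma bar_tau_prepend a c b (x : diag A a c) (w : X c b) : bar_tau (prepend x w) = 0.
Proof. by rewrite bar_tauE dcomp_prepend (lin0 (@bar_face_lin _ A 0 a b)). Qed.

(** For a word [w] of three or more letters, x ⊗ b(w) is again a prepended word and belongs to the
    last term. For a two-letter word, b(w) is the single letter [bar_tau w], outside the bar
    complex, and x ⊗ b(w) is the two-letter word that appears as a correction. *)
Lemma dd_prepend i a c b (x : diag A a c) (w : X c b) : homog i x ->
  dd (prepend x w) = lact X x w - two x (bar_tau w) - prepend (dd x : diag A a c) w
    - sgn k i *: prepend x (dd w).
Proof.
move=> hx; have lp := @prepend_linr a c b; move: w; apply: binj_ext.
- exact: (lin_comp (dd_linear (bcar_dgvect HX a b)) (@prepend_linr a c b x)).
- apply: lin_sub; last exact/lin_scale/(lin_comp (lp _) (dd_linear (bcar_dgvect HX c b))).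
  apply: lin_sub; last exact: lp.
  apply: lin_sub; first exact: lact_linearr.
  exact: (lin_comp (@two_linr a c b x) (@bar_tau_lin c b)).
have hdx := dd_homog (mor_dgvect _ _) hx.
move=> n t; rewrite !prepend_binj bar_ddS (twistE _ _ hx) (twistE _ _ hdx) !tmkZl bar_lactE (twistE _ _ hx).
rewrite (ddZ (bcar_dgvect (tpow_bimod A n.+2) a b)) (tens_ddE _ _ hx).
have lb m := @binj_lin m a b.
rewrite !(linZ (lb _)) (linD (lb _)) !(linZ (lb _)) (linZ (@bar_face_lin _ A n.+1 a b)) !(linZ (lb _)).
rewrite (lactZl (tpow_bimod A n.+1)) (linZ (lb _)) bar_faceSE (linB (lb _)) scalerBr.
case: n t => [|n] t.
  rewrite bar_dd0 prepend_binj bar_tauE dinj_eq !mul0r !sgn0 !scale1r (twist_0 (bcar_dgvect (diag_bimod A) a c)).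
  by rewrite [sgn k 1%:Z]sgn1 scaleN1r opprD addrC !addrA.
rewrite bar_ddS (linD (lp x)) (linZ (lp x)).
have -> : bar_tau (binj t) = 0 by rewrite bar_tauE dinj_neq // (lin0 (@bar_face_lin _ A 0 c b)).
rewrite (lin0 (@two_linr a c b x)) subr0 !prepend_binj !(twistE _ _ hx) !tmkZl !(linZ (lb _)).
rewrite !scalerDr !sgnZZ !opprD !NsgnZ addrC -!addrA; congr (_ + _).
rewrite [LHS]addrCA; congr (_ + _); first by apply: sgnZ_eq; odd_tac.
by rewrite [LHS]addrC; congr (_ + _); apply: sgnZ_eq; odd_tac.
Qed.

(** Words are built up from their last two letters. Induction on this predicate follows the letters
    while the length-dependent signs of the shifts stay hidden inside [prepend]. *)
Inductive bar_gen : forall a b, int -> X a b -> Prop :=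
  | BarTwo a c b i j (x : diag A a c) (y : diag A c b) :
      homog i x -> homog j y -> bar_gen (i + j) (two x y)
  | BarPrepend a c b i j (x : diag A a c) (w : X c b) :
      homog i x -> bar_gen j w -> bar_gen (i - 1 + j) (prepend x w).

Lemma bar_gen_homog a b i (w : X a b) : bar_gen i w -> homog i w.
Proof. by elim=> *; [apply: homog_two | apply: homog_prepend]. Qed.

Lemma gens_bar a b : gens (@bar_gen a b).
Proof.
move=> P P0 PD PG; apply: binj_ind => // n.
elim: n a b P P0 PD PG => [|n IH] a b P P0 PD PG.
  apply: (gens_tens (diag_bimod A) (tpow_bimod A 0)).
  - by rewrite (lin0 (@binj_lin 0 a b)).
  - by move=> x y Px Py; rewrite (linD (@binj_lin 0 a b)); apply: PD.
  - move=> i t [c [p [q [x [y [_ hx hy ->]]]]]].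
    by apply: (PG (p + q)); apply: BarTwo.
apply: (gens_tens (diag_bimod A) (tpow_bimod A n.+1)).
- by rewrite (lin0 (@binj_lin n.+1 a b)).
- by move=> x y Px Py; rewrite (linD (@binj_lin n.+1 a b)); apply: PD.
- move=> i t [c [p [q [x [y [_ hx hy ->]]]]]].
  (* [prepend] twists its letter by the length of the word, so the letter handed to it has to carry
     the same sign beforehand. *)
  have -> : x = twist n%:Z (sgn k (n%:Z * p) *: x) :> diag A a c.
    rewrite (twistE (bcar_dgvect (diag_bimod A) a c) _ (homogZ _ _ hx)) sgnZZ sgnZ1 //.
    by odd_tac.
  rewrite -prepend_binj; apply: (IH c b (fun w => P (prepend (sgn k (n%:Z * p) *: x) w))).
  + by rewrite (lin0 (@prepend_linr _ _ _ _)).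
  + by move=> u v Pu Pv; rewrite (linD (@prepend_linr _ _ _ _)); apply: PD.
  + move=> j w Gw; apply: (PG (p - 1 + j)); apply: BarPrepend => //.
    exact: (homogZ (bcar_dgvect (diag_bimod A) a c)).
Qed.

Lemma bar_tau_hom : is_hom 0 (@bar_tau k A).
Proof.
apply: (is_hom_gen HX (diag_bimod A) gens_bar bar_gen_homog bar_tau_lin).
- move=> a b i w; rewrite add0r; case=> [a1 c b1 j l x y hx hy|*].
    by rewrite bar_tau_two; apply: mcomp_homog.
  by rewrite bar_tau_prepend; apply: homog0.
- move=> a a' b i j z w hz Gw; rewrite mul0r sgn0 scale1r.
  case: Gw z hz => [a1 c b1 p q x y hx hy|a1 c b1 p q x w' hx _] z hz.
    by rewrite lact_two !bar_tau_two; apply/esym/mcompA.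
  by rewrite lact_prepend !bar_tau_prepend (lact0r (diag_bimod A)).
- move=> a b b' i j z w hz Gw.
  case: Gw z hz => [a1 c b1 p q x y hx hy|a1 c b1 p q x w' hx _] z hz.
    by rewrite ract_two !bar_tau_two; apply: mcompA.
  by rewrite ract_prepend !bar_tau_prepend (ract0l (diag_bimod A)).
Qed.

Lemma bar_tau_closed : hclosed 0 (@bar_tau k A).
Proof.
apply: (closed0_gen HX (diag_bimod A) gens_bar bar_tau_lin) => a b i w.
case=> [a1 c b1 p q x y hx hy|a1 c b1 p q x w' hx Gw].
  rewrite (dd_two _ hx) (linD (@bar_tau_lin _ _)) (linZ (@bar_tau_lin _ _)) !bar_tau_two.
  exact: mcomp_dd.
rewrite (dd_prepend _ hx) !(linB (@bar_tau_lin _ _)) (linZ (@bar_tau_lin _ _)).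
rewrite !bar_tau_prepend bar_tau_two scaler0 !subr0 (dd0 (mor_dgvect _ _)).
by rewrite (hom_lact bar_tau_hom _ hx) mul0r sgn0 scale1r subrr.
Qed.

End BarWords.

Arguments bar_tau_closed {k} A a b x : rename.

Section TauActions.
Variables (k : fieldType) (A B : dgcat k) (M : bimod A B) (HM : is_bimod M).

Definition tau_actl : bmap (tensor (bar A) M) M := fun a b =>
  tlift (fun c (x : bar A a c) (m : M c b) => lact M (bar_tau x) m).
Definition tau_actr : bmap (tensor M (bar B)) M := fun a b =>
  tlift (fun c (m : M a c) (y : bar B c b) => ract M m (bar_tau y)).

Lemma tau_actl_balanced a b :
  balanced true (fun c (x : bar A a c) (m : M c b) => lact M (bar_tau x) m).
Proof.
split=> [c m|c x|_ c c' x z m].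
- exact: (lin_comp (lact_linearl HM m) (@bar_tau_lin _ A a c)).
- exact: lact_linearr.
- by rewrite (hom_ract (bar_tau_hom A)) -(lact_comp HM).
Qed.

Lemma tau_actr_balanced a b :
  balanced true (fun c (m : M a c) (y : bar B c b) => ract M m (bar_tau y)).
Proof.
split=> [c m|c x|_ c c' x z m].
- exact: ract_linearl.
- exact: (lin_comp (ract_linearr HM x) (@bar_tau_lin _ B c b)).
- rewrite -(ract_comp HM); congr (ract _ _ _).
  move: z; apply: (lin_ext (gens_homog (mor_dgvect c' c)) (mcomp_linearl _)
    (lin_comp (@bar_tau_lin _ B c b) (lact_linearl (bar_bimod B) m))) => i z hz.
  by rewrite (hom_lact (bar_tau_hom B) _ hz) mul0r sgn0 scale1r.
Qed.

Lemma tau_actlE a b c (x : bar A a c) (m : M c b) : tau_actl (tmk x m) = lact M (bar_tau x) m.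
Proof. exact: tliftE (tau_actl_balanced a b). Qed.
Lemma tau_actrE a b c (m : M a c) (y : bar B c b) : tau_actr (tmk m y) = ract M m (bar_tau y).
Proof. exact: tliftE (tau_actr_balanced a b). Qed.
Lemma tau_actl_lin a b : linear (@tau_actl a b).
Proof. exact: tlift_lin (tau_actl_balanced a b). Qed.
Lemma tau_actr_lin a b : linear (@tau_actr a b).
Proof. exact: tlift_lin (tau_actr_balanced a b). Qed.

Lemma tau_homog (D : dgcat k) i a b (x : bar D a b) : homog i x -> homog i (bar_tau x).
Proof. by move=> hx; rewrite -[i]add0r; apply: (hom_homog (bar_tau_hom D)). Qed.

Lemma tau_actl_hom : is_hom 0 tau_actl.
Proof.
apply: (is_hom_gen (tens_bimod true (bar_bimod A) HM) HM (G := tgen true (bar A) M)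
  (gens_tens (bar_bimod A) HM) _ tau_actl_lin).
- by move=> a b i t [c [p [q [x [m [-> hx hm ->]]]]]]; apply: homog_tmk.
- move=> a b i t [c [p [q [x [m [-> hx hm ->]]]]]]; rewrite tau_actlE add0r.
  exact/(lact_homog HM)/hm/tau_homog.
- move=> a a' b i j z t hz [c [p [q [x [m [_ hx hm ->]]]]]].
  rewrite tens_lactE !tau_actlE (hom_lact (bar_tau_hom A) _ hz) !mul0r !sgn0 !scale1r.
  by rewrite -(lact_comp HM).
- move=> a b b' i j z t hz [c [p [q [x [m [_ hx hm ->]]]]]].
  by rewrite tens_ractE !tau_actlE (lact_ract HM).
Qed.

Lemma tau_actr_hom : is_hom 0 tau_actr.
Proof.
apply: (is_hom_gen (tens_bimod true HM (bar_bimod B)) HM (G := tgen true M (bar B))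
  (gens_tens HM (bar_bimod B)) _ tau_actr_lin).
- by move=> a b i t [c [p [q [x [m [-> hx hm ->]]]]]]; apply: homog_tmk.
- move=> a b i t [c [p [q [x [m [-> hx hm ->]]]]]]; rewrite tau_actrE add0r.
  exact/(ract_homog HM)/tau_homog.
- move=> a a' b i j z t hz [c [p [q [x [m [_ hx hm ->]]]]]].
  by rewrite tens_lactE !tau_actrE !mul0r !sgn0 !scale1r (lact_ract HM).
- move=> a b b' i j z t hz [c [p [q [x [m [_ hx hm ->]]]]]].
  by rewrite tens_ractE !tau_actrE (hom_ract (bar_tau_hom B)) -(ract_comp HM).
Qed.

Lemma tau_actl_closed : hclosed 0 tau_actl.
Proof.
apply: (closed0_gen (tens_bimod true (bar_bimod A) HM) HM (gens_tens (bar_bimod A) HM) tau_actl_lin).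
move=> a b i t [c [p [q [x [m [_ hx hm ->]]]]]].
rewrite (tens_ddE _ _ hx) (linD (@tau_actl_lin _ _)) (linZ (@tau_actl_lin _ _)) !tau_actlE.
rewrite (lact_dd HM _ (tau_homog hx)); congr (lact _ _ _ + _).
by move/closed0E: (bar_tau_closed A) => ->.
Qed.

Lemma tau_actr_closed : hclosed 0 tau_actr.
Proof.
apply: (closed0_gen (tens_bimod true HM (bar_bimod B)) HM (gens_tens HM (bar_bimod B)) tau_actr_lin).
move=> a b i t [c [p [q [x [m [_ hx hm ->]]]]]].
rewrite (tens_ddE _ _ hx) (linD (@tau_actr_lin _ _)) (linZ (@tau_actr_lin _ _)) !tau_actrE.
rewrite (ract_dd HM _ hx); congr (_ + _ *: ract _ _ _).
by move/closed0E: (bar_tau_closed B) => ->.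
Qed.

(** Prepending to the first tensor factor. The cuts of a word that fall beyond its first letter
    arise in this way from the cuts of the remainder. *)
Definition tprepend a c b (x : diag A a c) : tensor (bar A) M c b -> tensor (bar A) M a b :=
  tlift (fun d (p : bar A c d) (m : M d b) => tmk (prepend x p) m : tensor (bar A) M a b).

Lemma tprepend_balanced a c b (x : diag A a c) :
  balanced true (fun d (p : bar A c d) (m : M d b) => tmk (prepend x p) m : tensor (bar A) M a b).
Proof.
split=> [d m|d p|_ d d' p z m].
- exact: (lin_comp (tmk_linl m) (@prepend_linr _ _ _ _ _ x)).
- exact: tmk_linr.
- by rewrite -ract_prepend tmk_act.
Qed.

Lemma tprependE a c b d (x : diag A a c) (p : bar A c d) (m : M d b) :
  tprepend x (tmk p m) = tmk (prepend x p) m.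
Proof. exact: tliftE (tprepend_balanced b x). Qed.

Lemma tprepend_linr a c b (x : diag A a c) : linear (@tprepend a c b x).
Proof. exact: tlift_lin (tprepend_balanced b x). Qed.

Lemma tprepend_linl a c b (t : tensor (bar A) M c b) : linear (fun x : diag A a c => tprepend x t).
Proof.
move=> s x y; move: t; apply: (lin_ext (gens_tens (bar_bimod A) HM c b) (@tprepend_linr a c b _)
  (lin_add (lin_scale s (@tprepend_linr a c b x)) (@tprepend_linr a c b y))).
move=> i t [d [p [q [u [m [_ hu hm ->]]]]]].
by rewrite !tprependE (prepend_linl u) tmk_linl.
Qed.

Lemma homog_tprepend i j a c b (x : diag A a c) (t : tensor (bar A) M c b) :
  homog i x -> homog j t -> homog (i - 1 + j) (tprepend x t).
Proof.
move=> hx; move: j t.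
apply: (homog_ext (tens_dgvect _ (bar_bimod A) HM c b) (tens_dgvect _ (bar_bimod A) HM a b)
  (gens_tens (bar_bimod A) HM c b) _ (@tprepend_linr a c b x)).
  by move=> i' t [d [p [q [u [m [-> hu hm ->]]]]]]; apply: homog_tmk.
move=> _ t [d [p [q [u [m [-> hu hm ->]]]]]]; rewrite tprependE addrA.
by apply: homog_tmk => //; apply: homog_prepend.
Qed.

Lemma lact_tprepend a a' c b (z : mor A a' a) (x : diag A a' c) (t : tensor (bar A) M c b) :
  lact (tensor (bar A) M) z (tprepend x t) = tprepend (mcomp (twist 1 z) x : diag A a c) t.
Proof.
move: t; apply: (lin_ext (gens_tens (bar_bimod A) HM c b)
  (lin_comp (lact_linearr (tens_bimod true (bar_bimod A) HM) z) (@tprepend_linr a' c b x))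
  (@tprepend_linr a c b _)).
move=> i t [d [p [q [u [m [_ hu hm ->]]]]]].
by rewrite !tprependE tens_lactE lact_prepend.
Qed.

Lemma ract_tprepend a c b b' (x : diag A a c) (t : tensor (bar A) M c b) (z : mor B b' b) :
  ract (tensor (bar A) M) (tprepend x t) z = tprepend x (ract (tensor (bar A) M) t z).
Proof.
move: t; apply: (lin_ext (gens_tens (bar_bimod A) HM c b)
  (lin_comp (ract_linearl (tens_bimod true (bar_bimod A) HM) z) (@tprepend_linr a c b x))
  (lin_comp (@tprepend_linr a c b' x) (ract_linearl (tens_bimod true (bar_bimod A) HM) z))).
move=> i t [d [p [q [u [m [_ hu hm ->]]]]]].
by rewrite tprependE !tens_ractE tprependE.
Qed.

(** The correction in [dd_prepend] ends in the letter [bar_tau p]; moved across the tensor sign,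
    that letter acts on the second factor, which gives [tau_actl]. *)
Lemma dd_tprepend i a c b (x : diag A a c) (t : tensor (bar A) M c b) : homog i x ->
  dd (tprepend x t) = lact (tensor (bar A) M) x t - tmk (two x (idm c)) (tau_actl t)
    - tprepend (dd x : diag A a c) t - sgn k i *: tprepend x (dd t).
Proof.
move=> hx; have HT := tens_bimod true (bar_bimod A) HM; move: t.
have lp := @tprepend_linr a c b.
apply: (lin_ext (gens_tens (bar_bimod A) HM c b)
  (lin_comp (dd_linear (bcar_dgvect HT a b)) (lp x))).
  apply: lin_sub; last exact/lin_scale/(lin_comp (lp x) (dd_linear (bcar_dgvect HT c b))).
  apply: lin_sub; last exact: lp.
  apply: lin_sub; first exact: (lact_linearr HT).
  exact: (lin_comp (tmk_linr _) (@tau_actl_lin c b)).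
move=> n t [d [p [q [u [m [_ hu hm ->]]]]]].
rewrite !tprependE (tens_ddE _ _ (homog_prepend hx hu)) (tens_ddE _ _ hu) (linD (lp x)) (linZ (lp x)).
rewrite !tprependE (dd_prepend _ hx) tau_actlE tens_lactE.
rewrite -tmk_act // ract_two mcomp1l.
rewrite !(linB (tmk_linl m)) (linZ (tmk_linl m)) scalerDr opprD sgnZZ !NsgnZ -!addrA.
by do 4!congr (_ + _); apply: sgnZ_eq; odd_tac.
Qed.

End TauActions.

Arguments tau_actl_closed {k A B M} HM a b x : rename.
Arguments tau_actr_closed {k A B M} HM a b x : rename.
Arguments tau_actl {k A B} M a b _ : rename.
Arguments tau_actr {k A B} M a b _ : rename.

Arguments wtens : simpl never.
Arguments wbar : simpl never.

Lemma twist_twist (k : fieldType) (V : dgvect k) (HV : is_dgvect V) m n (x : V) :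
  twist m (twist n x) = twist (m + n) x.
Proof.
move: x; apply: (lin_ext (gens_homog HV) (lin_comp (twist_lin HV m) (twist_lin HV n)) (twist_lin HV _)).
move=> i x hx; rewrite (twistE _ _ hx) (linZ (twist_lin HV _)) !(twistE _ _ hx) sgnZZ.
by apply: sgnZ_eq; odd_tac.
Qed.

Lemma twist_even (k : fieldType) (V : dgvect k) (HV : is_dgvect V) m n (x : V) :
  oddz m = oddz n -> twist m x = twist n x.
Proof.
move=> mn; move: x; apply: (lin_ext (gens_homog HV) (twist_lin HV m) (twist_lin HV n)).
by move=> i x hx; rewrite !(twistE _ _ hx); apply: sgnZ_eq; rewrite !oddzM mn.
Qed.

Lemma twist_idm (k : fieldType) (A : dgcat k) n (a : A) : twist n (idm a) = idm a.
Proof. by rewrite (twistE (mor_dgvect a a) n (idm_homog a)) mulr0 sgn0 scale1r. Qed.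

Lemma eq_big_all (R : nmodType) (T : Type) (p : pred T) (r : seq T) (F G : T -> R) :
  all p r -> (forall x, p x -> F x = G x) -> \sum_(x <- r) F x = \sum_(x <- r) G x.
Proof.
move=> + FG; elim: r => [|x r IH] /=; first by rewrite !big_nil.
by case/andP=> px pr; rewrite !big_cons FG // IH.
Qed.

(** * The comultiplication of the bar complex *)

Section Comultiplication.
Variables (k : fieldType) (A : dgcat k).
Notation X := (bar A).
Notation XX := (tensor (bar A) (bar A)).
Let HX : is_bimod X := bar_bimod A.

(** A recursive form of the coproduct. A cut falls either right after the first letter, which is the
    second summand, or inside the remainder, in which case the first letter is prepended to the left
    part. The twists are the signs of the shifts. *)
Fixpoint cop n : forall a b, tpow A n.+1 a b -> XX a b :=
  match n return forall a b, tpow A n.+1 a b -> XX a b with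
  | 0 => fun a b => tlift (fun c (x : diag A a c) (y : tpow A 0 c b) =>
      tmk (two x (idm c)) (two (idm c : diag A c c) y) : XX a b)
  | n'.+1 => fun a b => tlift (fun c (x : diag A a c) (t : tpow A n'.+1 c b) =>
      tprepend (twist n'%:Z x) (cop t)
        + tmk (two (twist n'.+1%:Z x) (idm c)) (prepend (idm c : diag A c c) (binj t)) : XX a b)
  end.

Arguments cop : simpl never.

Let cop0F a b c (x : diag A a c) (y : tpow A 0 c b) : XX a b :=
  tmk (two x (idm c)) (two (idm c : diag A c c) y).

Lemma cop0_balanced a b : balanced false (@cop0F a b).
Proof.
split=> // [c y|c x].
  exact: (lin_comp (tmk_linl _) (@two_linl _ A a c c _)).
exact: (lin_comp (tmk_linr _) (@two_linr _ A c c b _)).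
Qed.

Let copSF n a b c (x : diag A a c) (t : tpow A n.+1 c b) : XX a b :=
  tprepend (twist n%:Z x) (cop t)
    + tmk (two (twist n.+1%:Z x) (idm c)) (prepend (idm c : diag A c c) (binj t)).

Lemma copS_balanced n a b : (forall a b, linear (@cop n a b)) -> balanced false (@copSF n a b).
Proof.
move=> lc; split=> // [c y|c x].
- have tl m := twist_lin (bcar_dgvect (diag_bimod A) a c) m.
  apply: lin_add; first exact: (lin_comp (@tprepend_linl _ A A X HX a c b _) (tl _)).
  exact: (lin_comp (tmk_linl _) (lin_comp (@two_linl _ A a c c _) (tl _))).
- apply: lin_add; first exact: (lin_comp (@tprepend_linr _ A A X a c b _) (lc c b)).
  exact: (lin_comp (tmk_linr _) (lin_comp (@prepend_linr _ A c c b _) (@binj_lin _ A n c b))).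
Qed.

Lemma cop_lin n a b : linear (@cop n a b).
Proof.
elim: n a b => [|n IH] a b; first exact: (tlift_lin (cop0_balanced a b)).
exact: (tlift_lin (copS_balanced a b IH)).
Qed.

Lemma cop0E a c b (x : diag A a c) (y : diag A c b) :
  cop (n := 0) (tmk x y) = tmk (two x (idm c)) (two (idm c : diag A c c) y).
Proof. exact: (tliftE _ _ (cop0_balanced a b)). Qed.

Lemma copSE n a c b (x : diag A a c) (t : tpow A n.+1 c b) :
  cop (n := n.+1) (tmk x t) = tprepend (twist n%:Z x) (cop t)
    + tmk (two (twist n.+1%:Z x) (idm c)) (prepend (idm c : diag A c c) (binj t)).
Proof. exact: (tliftE _ _ (copS_balanced a b (@cop_lin n))). Qed.

(** The counterpart of [tlift_eq] for tensor powers: linear candidates on all powers that agree with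
    [F] on words determine the lift, and the balancedness of each layer comes with them. *)
Lemma wlift_wtens n (W : lmodType k) (a b : A) (F : word a b -> W) (G : forall n, tpow A n a b -> W) :
  (forall n, linear (G n)) -> (forall w, F w = G (wsize w) (wtens w)) ->
  forall t, wlift F t = G n t.
Proof.
elim: n a b F G => [|n IH] a b F G lG FG t; first exact: FG (Letter _).
rewrite /wlift -/wlift; apply: (tlift_eq (lG n.+1)) => c x y.
apply: (IH c b (fun w => F (Defs.Cons x w)) (fun m y => G m.+1 (tmk x y : tpow A m.+1 a b))).
  by move=> m; apply: (lin_comp (lG m.+1) (tmk_linr x)).
by move=> w; apply: FG.
Qed.

Lemma wsize_splits (a b : A) (w : word a b) :
  all (fun s : {c : A & (word a c * word c b)%type} => (wsize (tagged s).1 + wsize (tagged s).2).+1 == wsize w) (wsplits w).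
Proof.
elim: w => //= a' c b' x w IH; rewrite add0n eqxx /= all_map.
by apply: sub_all IH => s /= /eqP <-; rewrite addSn.
Qed.

Lemma wsize_twist n (a b : A) (w : word a b) : wsize (wtwist n w) = wsize w.
Proof. by elim: w => //= a' c b' x w ->. Qed.

Lemma wbar_prepend a c d b (x : diag A a c) (u : word c d) (y : diag A d b) :
  wbar (Defs.Cons x (wsnoc u y)) = prepend (twist (wsize u)%:Z x) (wbar (wsnoc u y)).
Proof.
have tx n : twist n%:Z (twist n%:Z x) = x.
  rewrite (twist_twist (bcar_dgvect (diag_bimod A) a c)).
  rewrite (twist_even (bcar_dgvect (diag_bimod A) a c) (n := 0)) ?twist_0 //; odd_tac.
have wsnocS (a' c' : A) (w : word a' c') b' (z : diag A c' b') : wsize (wsnoc w z) = (wsize w).+1.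
  by elim: w b' z => //= *; congr _.+1.
case: u y x tx => [a' b' z|a' c' b' z u] y x tx.
  by rewrite -[RHS]/(prepend _ (binj (n := 0) (tmk z y))) prepend_binj tx.
rewrite -[RHS]/(prepend _ (binj (n := wsize (wsnoc u y)) (tmk z (wtens (wsnoc u y))))).
by rewrite prepend_binj [wsize (Defs.Cons z u)]/= -(wsnocS _ _ u _ y) tx.
Qed.

Lemma coprod_word_Cons (a c b : A) (x : diag A a c) (w : word c b) :
  coprod_word (Defs.Cons x w) =
    tmk (two (twist (wsize w)%:Z x) (idm c)) (wbar (Defs.Cons (idm c : diag A c c) w)) +
    \sum_(s <- wsplits w) let u := (tagged s).1 in let v := (tagged s).2 in
      tmk (wbar (wsnoc (wtwist (wsize v)%:Z (Defs.Cons x u)) (idm (tag s) : diag A _ _)))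
          (wbar (Defs.Cons (idm (tag s) : diag A _ _) v)).
Proof. by rewrite /coprod_word /= big_cons big_map. Qed.

(** The cuts of x w are the cut after x and the cuts of w, the latter with x added to their left
    parts; this is the recursion of [cop]. *)
Lemma coprod_wordE a c b (x : diag A a c) (w : word c b) :
  coprod_word (Defs.Cons x w) = cop (tmk x (wtens w) : tpow A (wsize w).+1 a b).
Proof.
elim: w a x => [a' b' y|a' c' b' y w IH] a x.
  rewrite /coprod_word /= big_seq1 /= (cop0E x (wtens (Letter y))); congr (tmk (two _ _) _).
  exact: (twist_0 (bcar_dgvect (diag_bimod A) a a')).
rewrite copSE -IH coprod_word_Cons addrC; congr (_ + _); last first.
  rewrite prepend_binj twist_idm; congr (tmk _ _).
rewrite (lin_sum (@tprepend_linr _ A A X _ _ _ _)).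
(* The first letter is twisted by the length of the right part in [coprod_word] and by that of the
   left part in [wbar_prepend]. The sum of the two lengths is the same for all cuts, as
   [wsize_splits] records. *)
apply: (eq_big_all (wsize_splits (Defs.Cons y w))) => -[d [u v]] /= /eqP [suv].

rewrite wbar_prepend wsize_twist (twist_twist (bcar_dgvect (diag_bimod A) a a')). rewrite -/(wsize w) -suv.
by rewrite tprependE PoszD.
Qed.

Lemma wlift_coprod n a b (t : tpow A n.+1 a b) : wlift (@coprod_word k A a b) t = cop t.
Proof.
(* The value at power 0 is 0, since a word with one letter has no cut. *)
pose G m a b : tpow A m a b -> XX a b :=
  match m return tpow A m a b -> XX a b with 0 => fun _ => 0 | m'.+1 => @cop m' a b end.
have lG m : linear (G m a b) by case: m => [|m]; [apply: lin_cst0 | apply: cop_lin].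
apply: (wlift_wtens (n := n.+1) lG) => w.
case: w => [a' b' x|a' c' b' x w]; last exact: coprod_wordE.
by rewrite /coprod_word /= big_nil.
Qed.

Lemma coprod_binj n a b (t : tpow A n.+1 a b) : coprod (binj t) = cop t.
Proof.
rewrite /coprod (@fssum1 _ _ _ n) ?dinj_eq ?wlift_coprod // => j jn.
by rewrite dinj_neq // wlift_coprod (lin0 (@cop_lin j a b)).
Qed.

Lemma coprod_lin a b : linear (@coprod k A a b).
Proof.
apply: (dsum_elim_lin (F := fun n (t : tpow A n.+1 a b) => wlift (@coprod_word k A a b) t)) => n s u v.
by rewrite !wlift_coprod cop_lin.
Qed.

Lemma coprod_two a c b (x : diag A a c) (y : diag A c b) :
  coprod (two x y) = tmk (two x (idm c)) (two (idm c : diag A c c) y).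
Proof. by rewrite /two coprod_binj cop0E. Qed.

(** The length-dependent signs of [cop] and of [prepend] cancel, up to a single twist. The coalgebra
    laws are derived by induction from this recursion and from [coprod_two]. *)
Lemma coprod_prepend a c b (x : diag A a c) (w : X c b) :
  coprod (prepend x w) = tprepend x (coprod w)
    + tmk (two (twist 1 x) (idm c)) (prepend (idm c : diag A c c) w).
Proof.
have Hac := bcar_dgvect (diag_bimod A) a c.
move: w; apply: binj_ext.
- exact: (lin_comp (@coprod_lin a b) (@prepend_linr _ A a c b x)).
- apply: lin_add; first exact: (lin_comp (@tprepend_linr _ A A X a c b x) (@coprod_lin c b)).
  exact: (lin_comp (tmk_linr _) (@prepend_linr _ A c c b _)).
move=> n t; rewrite prepend_binj !coprod_binj copSE !(twist_twist Hac).
rewrite (twist_even Hac (m := n%:Z + n%:Z) (n := 0)); last by odd_tac.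
rewrite (twist_even Hac (m := n.+1%:Z + n%:Z) (n := 1)) ?twist_0 //; odd_tac.
Qed.

End Comultiplication.

Lemma twist_mcomp (k : fieldType) (A : dgcat k) n (a b c : A) (x : mor A b c) (y : mor A a b) :
  twist n (mcomp x y) = mcomp (twist n x) (twist n y).
Proof.
move: x; apply: (lin_ext (gens_homog (mor_dgvect b c)) (lin_comp (twist_lin _ n) (mcomp_linearl y))
  (lin_comp (mcomp_linearl _) (twist_lin _ n))) => i x hx.
move: y; apply: (lin_ext (gens_homog (mor_dgvect a b)) (lin_comp (twist_lin _ n) (mcomp_linearr x))
  (lin_comp (mcomp_linearr _) (twist_lin _ n))) => j y hy.
rewrite (twistE _ _ hx) (twistE _ _ hy) (twistE _ _ (mcomp_homog hx hy)).
by rewrite (linZ (mcomp_linearl _)) (linZ (mcomp_linearr _)) sgnZZ mulrDr.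
Qed.

Lemma twist11 (k : fieldType) (V : dgvect k) (HV : is_dgvect V) (x : V) : twist 1 (twist 1 x) = x.
Proof. by rewrite (twist_twist HV) (twist_even HV (n := 0)) // twist_0. Qed.

Section Coalgebra.
Variables (k : fieldType) (A : dgcat k).
Notation X := (bar A).
Notation XX := (tensor (bar A) (bar A)).
Let HX : is_bimod X := bar_bimod A.
Let HXX : is_bimod XX := tens_bimod true HX HX.
Let Hmor (a b : A) : is_dgvect (mor A a b) := mor_dgvect a b.

Lemma tau_actl_tprepend B (M : bimod A B) (HM : is_bimod M) a c b (x : diag A a c)
  (t : tensor (bar A) M c b) : tau_actl M a b (tprepend x t) = 0.
Proof.
move: t; apply: (lin_ext (gens_tens HX HM c b) (lin_comp (@tau_actl_lin _ _ _ M HM a b) (@tprepend_linr _ _ _ M a c b x))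
  (@lin_cst0 _ _ _)).
move=> i t [d [p [q [u [m [_ hu hm ->]]]]]].
by rewrite tprependE tau_actlE // bar_tau_prepend (lact0l HM).
Qed.

Lemma tau_actr_tprepend a c b (x : diag A a c) (t : XX c b) :
  tau_actr X a b (tprepend x t) = prepend x (tau_actr X c b t).
Proof.
move: t; apply: (lin_ext (gens_tens HX HX c b) (lin_comp (@tau_actr_lin _ _ _ X HX a b) (@tprepend_linr _ _ _ X a c b x))
  (lin_comp (@prepend_linr _ A a c b x) (@tau_actr_lin _ _ _ X HX c b))).
move=> i t [d [p [q [u [m [_ hu hm ->]]]]]].
by rewrite tprependE !tau_actrE // ract_prepend.
Qed.

(** [bar_tau] kills every prepended word, so only the cut after the first letter survives; there x 1
    acts on the word that begins with 1. For the right counit it is the last cut that survives, and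
    the induction has to descend to it. *)
Lemma coprod_counitl a b (w : X a b) : tau_actl X a b (coprod w) = w.
Proof.
move: w; apply: (lin_ext (@gens_bar _ A a b) (lin_comp (@tau_actl_lin _ _ _ X HX a b) (@coprod_lin _ A a b)) (@lin_id _ _)).
move=> i w; case=> [a1 c b1 p q x y hx hy|a1 c b1 p q x w' hx _].
  by rewrite coprod_two tau_actlE // bar_tau_two lact_two !mcomp1r.
rewrite coprod_prepend (linD (@tau_actl_lin _ _ _ X HX _ _)) tau_actl_tprepend // add0r.
rewrite tau_actlE // bar_tau_two lact_prepend !mcomp1r; congr (prepend _ _).
exact: (twist11 (Hmor c a1)).
Qed.

Lemma coprod_counitr a b (w : X a b) : tau_actr X a b (coprod w) = w.
Proof.
move: w; apply: (lin_ext (@gens_bar _ A a b) (lin_comp (@tau_actr_lin _ _ _ X HX a b) (@coprod_lin _ A a b)) (@lin_id _ _)).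
move=> i w; elim=> [a1 c b1 p q x y hx hy|a1 c b1 p q x w' hx _ IH].
  by rewrite coprod_two tau_actrE // bar_tau_two ract_two !mcomp1l.
rewrite coprod_prepend (linD (@tau_actr_lin _ _ _ X HX _ _)) tau_actr_tprepend // IH.
by rewrite tau_actrE // bar_tau_prepend (ract0r HX) addr0.
Qed.

Lemma coprod_hom : is_hom 0 (@coprod k A).
Proof.
apply: (is_hom_gen HX HXX (@gens_bar _ A) (@bar_gen_homog _ A) (@coprod_lin _ A)).
- move=> a b i w; rewrite add0r; elim=> [a1 c b1 p q x y hx hy|a1 c b1 p q x w' hx Gw IH].
    rewrite coprod_two -[p]addr0 -[q]add0r.
    by apply: homog_tmk; apply: homog_two => //; apply: idm_homog.
  rewrite coprod_prepend; apply: (homogD (bcar_dgvect HXX _ _)); first exact: homog_tprepend.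
  rewrite -addrA -[-1 + q]/(-1 + q) -[-1]sub0r -[p]addr0; apply: homog_tmk.
    by apply: homog_two; [apply: (homog_twist (Hmor _ _)) | apply: idm_homog].
  by apply: homog_prepend; [apply: idm_homog | apply: bar_gen_homog].
- move=> a a' b i j z w hz Gw; rewrite mul0r sgn0 scale1r.
  case: Gw z hz => [a1 c b1 p q x y hx hy|a1 c b1 p q x w' hx _] z hz.
    by rewrite lact_two !coprod_two tens_lactE lact_two.
  rewrite lact_prepend !coprod_prepend (lactDr HXX) lact_tprepend // tens_lactE lact_two.
  by rewrite (twist_mcomp 1) (twist11 (Hmor _ _)).
- move=> a b b' i j z w hz Gw.
  elim: Gw b' z hz => [a1 c b1 p q x y hx hy|a1 c b1 p q x w' hx _ IH] b' z hz.
    by rewrite ract_two !coprod_two tens_ractE ract_two.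
  rewrite ract_prepend !coprod_prepend (ractDl HXX) ract_tprepend // tens_ractE ract_prepend.
  by rewrite IH.
Qed.

Lemma coprod_closed : hclosed 0 (@coprod k A).
Proof.
apply: (closed0_gen HX HXX (@gens_bar _ A) (@coprod_lin _ A)) => a b i w.
have lc a' b' := @coprod_lin _ A a' b'.
elim=> [a1 c b1 p q x y hx hy|a1 c b1 p q x w' hx Gw IH].
  rewrite coprod_two (dd_two _ hx) (linD (lc _ _)) (linZ (lc _ _)) !coprod_two.
  have hx1 : homog p (two x (idm c : diag A c c)).
    by rewrite -[p]addr0; apply: homog_two => //; apply: idm_homog.
  rewrite (tens_ddE _ _ hx1) (dd_two _ hx) (dd_two _ (idm_homog c)) !idm_dd.
  rewrite (lin0 (@two_linr _ A _ _ _ _)) scaler0 addr0 (lin0 (@two_linl _ A _ _ _ _)) add0r.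
  by rewrite sgn0 scale1r.
have hdx := dd_homog (Hmor _ _) hx.
have hx1 : homog p (two (twist 1 x) (idm c : diag A c c)).
  by rewrite -[p]addr0; apply: homog_two; [apply: (homog_twist (Hmor _ _)) | apply: idm_homog].
have tx : twist 1 x = sgn k p *: x :> diag A a1 c by rewrite (twistE (Hmor _ _) _ hx) mul1r.
have tdx : twist 1 (dd x) = - (sgn k p *: dd x) :> diag A a1 c.
  by rewrite (twistE (Hmor _ _) _ hdx) mul1r NsgnZ.
rewrite (dd_prepend _ hx) !(linB (lc _ _)) (linZ (lc _ _)) coprod_two !coprod_prepend.
rewrite (hom_lact coprod_hom _ hx) mul0r sgn0 scale1r -IH.
(* The correction in [dd_tprepend] contains the left counit applied to the coproduct and hence
   equals (x ⊗ 1) ⊗ w. It cancels against the term that 1 w contributes to the differential of the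
   cut after the first letter. *)
rewrite (ddD (bcar_dgvect HXX a1 b1)) (dd_tprepend HX _ hx) coprod_counitl (tens_ddE _ _ hx1).
rewrite (dd_prepend _ (idm_homog c)) (lact1 HX) idm_dd (lin0 (@prepend_linl _ A _ _ _ _)) subr0.
rewrite sgn0 scale1r tdx tx.
have l2l := @two_linl _ A a1 c c (idm c).
rewrite (linN l2l) !(linZ l2l) (ddZ (bcar_dgvect HX _ _)) (dd_two _ hx) idm_dd (lin0 (@two_linr _ A _ _ _ _)) scaler0 addr0.
rewrite !tmkZl (linN (tmk_linl _)) !tmkZl !(linB (tmk_linr _)) !scalerBr !sgnZZ.
rewrite scalerDr !sgnZZ !(sgnZ1 (m := p + p)); try odd_tac.
set u := _ *: tprepend x (dd _); abelian.
Qed.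

(** Both iterated coproducts obey the same recursion under [prepend]. The facts [lK] and [rK]
    isolate how each of them treats a tensor whose first factor has a letter prepended. *)
Lemma coprod_coassoc a b (w : X a b) :
  assoc (tmap 0 (@coprod k A) (@bmap_id _ _ _ X) (coprod w)) =
    tmap 0 (@bmap_id _ _ _ X) (@coprod k A) (coprod w) :> tensor X XX a b.
Proof.
have hid := @hom_id k A A X.
have tl := @tmap_lin _ _ _ _ _ _ _ _ HX HX 0 0 _ _ coprod_hom hid.
have tr := @tmap_lin _ _ _ _ _ _ _ _ HX HX 0 0 _ _ hid coprod_hom.
have al := @assoc_lin _ _ _ _ _ X X X HX HX.
have lK a' c' b' (x : diag A a' c') (t : XX c' b') :
    assoc (tmap 0 (@coprod k A) (@bmap_id _ _ _ X) (tprepend x t)) =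
    tprepend x (assoc (tmap 0 (@coprod k A) (@bmap_id _ _ _ X) t))
      + tmk (two (twist 1 x) (idm c')) (tprepend (idm c' : diag A c' c') t) :> tensor X XX a' b'.
  have lp := @tprepend_linr _ A A.
  move: t; apply: (lin_ext (gens_tens HX HX c' b')).
  - exact: (lin_comp (@al a' b') (lin_comp (@tl a' b') (lp X _ _ _ x))).
  - apply: lin_add; first exact: (lin_comp (lp XX _ _ _ x) (lin_comp (@al c' b') (@tl c' b'))).
    exact: (lin_comp (tmk_linr _) (lp X _ _ _ _)).
  move=> i t [d [p [q [u [m [_ hu hm ->]]]]]].
  rewrite !tprependE !(tmap0E HX HX coprod_hom hid) coprod_prepend tmkDl.
  rewrite (linD (@al a' b')) assocE; congr (_ + _).
  move: (coprod u) => v.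
  move: v; apply: (lin_ext (gens_tens HX HX c' d)).
  - exact: (lin_comp (@al a' b') (lin_comp (tmk_linl _) (lp X _ _ _ x))).
  - exact: (lin_comp (lp XX _ _ _ x) (lin_comp (@al c' b') (tmk_linl _))).
  move=> j v [e [p' [q' [u' [m' [_ hu' hm' ->]]]]]].
  by rewrite tprependE !assocE tprependE.
have rK a' c' b' (x : diag A a' c') (t : XX c' b') :
    tmap 0 (@bmap_id _ _ _ X) (@coprod k A) (tprepend x t) =
    tprepend x (tmap 0 (@bmap_id _ _ _ X) (@coprod k A) t) :> tensor X XX a' b'.
  have lp := @tprepend_linr _ A A.
  move: t; apply: (lin_ext (gens_tens HX HX c' b')).
  - exact: (lin_comp (@tr a' b') (lp X _ _ _ x)).
  - exact: (lin_comp (lp XX _ _ _ x) (@tr c' b')).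
  move=> i t [d [p [q [u [m [_ hu hm ->]]]]]].
  by rewrite tprependE !(tmap0E HX HX hid coprod_hom) tprependE.
move: w; apply: (lin_ext (@gens_bar _ A a b)).
- exact: (lin_comp (@al a b) (lin_comp (@tl a b) (@coprod_lin _ A a b))).
- exact: (lin_comp (@tr a b) (@coprod_lin _ A a b)).
move=> i w; elim=> [a1 c b1 p q x y hx hy|a1 c b1 p q x w' hx Gw IH].
  by rewrite coprod_two (tmap0E HX HX coprod_hom hid) (tmap0E HX HX hid coprod_hom) !coprod_two assocE.
rewrite !coprod_prepend (linD (@tl a1 b1)) (linD (@tr a1 b1)) (linD (@al a1 b1)) lK rK IH.
rewrite (tmap0E HX HX coprod_hom hid) (tmap0E HX HX hid coprod_hom) coprod_two coprod_prepend assocE.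
by rewrite twist_idm tmkDr addrA.
Qed.

End Coalgebra.

Lemma lactNr (k : fieldType) (A B : dgcat k) (M : bimod A B) (HM : is_bimod M) a a' b
  (z : mor A a' a) (m : M a' b) : lact M z (- m) = - lact M z m.
Proof. exact: (linN (lact_linearr HM z)). Qed.

Lemma ractNl (k : fieldType) (A B : dgcat k) (M : bimod A B) (HM : is_bimod M) a b b'
  (z : mor B b' b) (m : M a b) : ract M (- m) z = - ract M m z.
Proof. exact: (linN (ract_linearl HM z)). Qed.

(** * Concatenation, a homotopy between the two counits *)

Section Concatenation.
Variables (k : fieldType) (A : dgcat k).
Notation X := (bar A).
Notation XX := (tensor (bar A) (bar A)).
Let HX : is_bimod X := bar_bimod A.
Let HXX : is_bimod XX := tens_bimod true HX HX.
Let Hmor (a b : A) : is_dgvect (mor A a b) := mor_dgvect a b.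

(** The last letter of the first word acts on the second word, and the remaining letters are
    prepended one after the other. Each of them contributes the sign of passing a map of degree -1
    over a shifted letter, as [concat_prepend] makes visible. *)
Fixpoint concat_at n : forall a c b, tpow A n.+1 a c -> X c b -> X a b :=
  match n return forall a c b, tpow A n.+1 a c -> X c b -> X a b with
  | 0 => fun a c b t q => tlift (fun d (x : diag A a d) (y : tpow A 0 d c) =>
      prepend x (lact X (y : diag A d c) q)) t
  | n'.+1 => fun a c b t q => tlift (fun d (x : diag A a d) (u : tpow A n'.+1 d c) =>
      - prepend (twist n'.+1%:Z x) (concat_at u q)) t
  end.
Arguments concat_at : simpl never.

Lemma concat_at0_balanced a c b (q : X c b) : balanced false
  (fun d (x : diag A a d) (y : tpow A 0 d c) => prepend x (lact X (y : diag A d c) q)).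
Proof.
split=> // [d y|d x]; first exact: prepend_linl.
exact: (lin_comp (@prepend_linr _ A _ _ _ x) (lact_linearl HX q)).
Qed.

Lemma concat_atS_balanced n a c b (q : X c b) :
  (forall d, linear (fun u : tpow A n.+1 d c => concat_at u q)) ->
  balanced false (fun d (x : diag A a d) (u : tpow A n.+1 d c) =>
    - prepend (twist n.+1%:Z x) (concat_at u q)).
Proof.
move=> lc; split=> // [d y|d x]; apply: lin_opp.
  exact: (lin_comp (@prepend_linl _ A _ _ _ _) (twist_lin (bcar_dgvect (diag_bimod A) a d) _)).
exact: (lin_comp (@prepend_linr _ A _ _ _ _) (lc d)).
Qed.

Lemma concat_at_linl n a c b (q : X c b) : linear (fun t : tpow A n.+1 a c => concat_at t q).
Proof.
elim: n a => [|n IH] a; first exact: (tlift_lin (concat_at0_balanced a q)).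
exact: (tlift_lin (concat_atS_balanced a IH)).
Qed.

Lemma concat_at0E a d c b (x : diag A a d) (y : diag A d c) (q : X c b) :
  concat_at (n := 0) (tmk x y) q = prepend x (lact X y q).
Proof. exact: (tliftE _ _ (concat_at0_balanced a q)). Qed.

Lemma concat_atSE n a d c b (x : diag A a d) (u : tpow A n.+1 d c) (q : X c b) :
  concat_at (n := n.+1) (tmk x u) q = - prepend (twist n.+1%:Z x) (concat_at u q).
Proof. exact: (tliftE _ _ (concat_atS_balanced a (fun d => @concat_at_linl n d c b q))). Qed.

Lemma concat_at_linr n a c b (t : tpow A n.+1 a c) : linear (fun q : X c b => concat_at t q).
Proof.
elim: n a t => [|n IH] a t s u v; move: t.
  apply: (lin_ext (gens_tens (diag_bimod A) (tpow_bimod A 0) a c) (@concat_at_linl 0 a c b _)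
    (lin_add (lin_scale s (@concat_at_linl 0 a c b _)) (@concat_at_linl 0 a c b _))).
  move=> i t [d [p [q [x [y [_ hx hy ->]]]]]]; rewrite !concat_at0E.
  by rewrite (lact_linearr HX) prepend_linr.
apply: (lin_ext (gens_tens (diag_bimod A) (tpow_bimod A n.+1) a c) (@concat_at_linl n.+1 a c b _)
    (lin_add (lin_scale s (@concat_at_linl n.+1 a c b _)) (@concat_at_linl n.+1 a c b _))).
move=> i t [d [p [q [x [y [_ hx hy ->]]]]]]; rewrite !concat_atSE.
by rewrite IH prepend_linr opprD scalerN.
Qed.

Lemma concat_at_act n a c c' b (t : tpow A n.+1 a c) (z : mor A c' c) (q : X c' b) :
  concat_at (ract (tpow A n.+1) t z) q = concat_at t (lact X z q).
Proof.
elim: n a t => [|n IH] a.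
  apply: (lin_ext (gens_tens (diag_bimod A) (tpow_bimod A 0) a c)
    (lin_comp (@concat_at_linl 0 a c' b q) (ract_linearl (tpow_bimod A 1) z)) (@concat_at_linl 0 a c b _)).
  move=> i t [d [p [r [x [y [_ hx hy ->]]]]]]; rewrite tens_ractE !concat_at0E.
  by rewrite -(lact_comp HX).
apply: (lin_ext (gens_tens (diag_bimod A) (tpow_bimod A n.+1) a c)
    (lin_comp (@concat_at_linl n.+1 a c' b q) (ract_linearl (tpow_bimod A n.+2) z)) (@concat_at_linl n.+1 a c b _)).
move=> i t [d [p [r [x [y [_ hx hy ->]]]]]]; rewrite tens_ractE !concat_atSE.
by rewrite IH.
Qed.

(* (a_1 (x) .. (x) a_n) (x) (b_1 (x) .. (x) b_m) goes, up to sign, to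
   a_1 (x) .. (x) a_n b_1 (x) .. (x) b_m *)
Definition concat : bmap XX X := fun a b =>
  tlift (fun c (p : X a c) (q : X c b) => \sum_(n \in [set: nat]) concat_at (dcomp p n) q).

Lemma concat_balanced a b : balanced true (fun c (p : X a c) (q : X c b) =>
  \sum_(n \in [set: nat]) concat_at (dcomp p n) q).
Proof.
have ll c (q : X c b) := dsum_elim_lin (fun n => @concat_at_linl n a c b q).
have li c (q : X c b) := dsum_elim_dinj (fun n => @concat_at_linl n a c b q).
split=> [c q|c p|_ c c' p z q]; first exact: ll.
- move=> s u v; move: p; apply: (binj_ext (ll c _) (lin_add (lin_scale s (ll c u)) (ll c v))) => n t.
  by rewrite !li concat_at_linr.
- move: p; apply: (binj_ext (lin_comp (ll c' q) (ract_linearl HX z)) (ll c _)) => n t.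
  by rewrite bar_ractE !li concat_at_act.
Qed.

Lemma concat_lin a b : linear (@concat a b).
Proof. exact: (tlift_lin (concat_balanced a b)). Qed.

Lemma concat_binj n a c b (t : tpow A n.+1 a c) (q : X c b) : concat (tmk (binj t) q) = concat_at t q.
Proof.
rewrite /concat (tliftE _ _ (concat_balanced a b)).
exact: (dsum_elim_dinj (fun n => @concat_at_linl n a c b q)).
Qed.

Lemma concat_two a d c b (x : diag A a d) (y : diag A d c) (q : X c b) :
  concat (tmk (two x y) q) = prepend x (lact X y q).
Proof. by rewrite /two concat_binj concat_at0E. Qed.

Lemma concat_prepend a c b (x : diag A a c) (t : XX c b) :
  concat (tprepend x t) = - prepend (twist 1 x) (concat t).
Proof.
have Hac := bcar_dgvect (diag_bimod A) a c.
move: t; apply: (lin_ext (gens_tens HX HX c b)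
  (lin_comp (@concat_lin a b) (@tprepend_linr _ A A X a c b x))
  (lin_opp (lin_comp (@prepend_linr _ A a c b _) (@concat_lin c b)))).
move=> i t [d [p [r [u [q [_ hu hq ->]]]]]]; rewrite tprependE; move: u {hu}.
apply: (binj_ext (lin_comp (@concat_lin a b) (lin_comp (tmk_linl q) (@prepend_linr _ A a c d x)))
  (lin_opp (lin_comp (@prepend_linr _ A a c b _) (lin_comp (@concat_lin c b) (tmk_linl q))))) => n s.
rewrite prepend_binj !concat_binj concat_atSE (twist_twist Hac).
by rewrite (twist_even Hac (m := n.+1%:Z + n%:Z) (n := 1)) //; odd_tac.
Qed.

Lemma concat_prependE a d c b (x : diag A a d) (w : X d c) (q : X c b) :
  concat (tmk (prepend x w) q) = - prepend (twist 1 x) (concat (tmk w q)).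
Proof. by rewrite -tprependE concat_prepend. Qed.

Let G a b : int -> XX a b -> Prop := tprod_gen (@bar_gen k A) (fun c b => @homog k (X c b)) (a := a) (b := b).
Let gG a b : gens (@G a b).
Proof. by apply: gens_tprod => *; [apply: gens_bar | apply: gens_homog]. Qed.
Let hG a b i t : @G a b i t -> homog i t.
Proof. by apply: tprod_gen_homog => // *; apply: bar_gen_homog. Qed.

Lemma concat_hom : is_hom (-1) concat.
Proof.
apply: (is_hom_gen HXX HX gG hG concat_lin).
- move=> a b _ t [c [p [r [u [q [-> Gu hq ->]]]]]].
  elim: Gu q hq => [a1 d c1 i j x y hx hy|a1 d c1 i j x w hx Gw IH] q hq.
    rewrite concat_two; have -> : -1 + (i + j + r) = i - 1 + (j + r) by ring.
    by apply: homog_prepend => //; apply: (lact_homog HX).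
  rewrite concat_prependE; apply: (homogN (bcar_dgvect HX _ _)).
  have -> : -1 + (i - 1 + j + r) = i - 1 + (-1 + (j + r)) by ring.
  by apply: homog_prepend; [apply: (homog_twist (bcar_dgvect (diag_bimod A) _ _)) | apply: IH].
- move=> a a' b i n z t hz [c [p [r [u [q [_ Gu hq ->]]]]]].
  have tz : twist 1 z = sgn k n *: z by rewrite (twistE (Hmor _ _) _ hz) mul1r.
  case: Gu z hz q hq tz => [a1 d c1 i1 j x y hx hy|a1 d c1 i1 j x w hx Gw] z hz q hq tz.
    rewrite tens_lactE lact_two !concat_two lact_prepend tz.
    rewrite (linZ (mcomp_linearl _)) (linZ (@prepend_linl _ A _ _ _ _)) sgnZZ.
    by rewrite sgnZ1 //; odd_tac.
  rewrite tens_lactE (lact_prepend z x w) 2!(concat_prependE _ w q) (lactNr HX) (lact_prepend z (twist 1 x)).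
  rewrite (twist_mcomp 1) (twist11 (Hmor _ _)) tz (linZ (mcomp_linearl _)) (linZ (@prepend_linl _ A _ _ _ _)).
  by rewrite scalerN sgnZZ [in RHS]sgnZ1 //; odd_tac.
- move=> a b b' i n z t hz [c [p [r [u [q [_ Gu hq ->]]]]]].
  elim: Gu q hq => [a1 d c1 i1 j x y hx hy|a1 d c1 i1 j x w hx Gw IH] q hq.
    by rewrite tens_ractE !concat_two ract_prepend (lact_ract HX).
  rewrite tens_ractE 2!(concat_prependE _ w) (ractNl HX) (ract_prepend (twist 1 x)).
  by rewrite -(IH _ hq) tens_ractE.
Qed.

(** Up to sign, a concatenation of words is a prepended word, hence has at least three letters. *)
Lemma bar_tau_concat a b (t : XX a b) : bar_tau (concat t) = 0.
Proof.
move: t; apply: (lin_ext (@gG a b) (lin_comp (@bar_tau_lin _ A a b) (@concat_lin a b)) (@lin_cst0 _ _ _)).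
move=> n t [c [p [r [u [q [_ Gu hq ->]]]]]].
case: Gu q hq => [a1 d c1 i j x y hx hy|a1 d c1 i j x w hx Gw] q hq.
  by rewrite concat_two bar_tau_prepend.
by rewrite concat_prependE (linN (@bar_tau_lin _ A _ _)) bar_tau_prepend oppr0.
Qed.

(** The concatenation of x ⊗ y with q is x prepended to y q, and [dd_prepend] supplies the two
    actions: x y q, and x ⊗ y tau(q). Prepending further letters preserves the formula because
    [bar_tau_concat] suppresses the correction. All homotopies for the bar resolution are built from
    this one. *)
Lemma dhom_concat a b (t : XX a b) :
  dhom (-1) concat t = tau_actl X a b t - tau_actr X a b t.
Proof.
have ll := tau_actl_lin HX; have lr := tau_actr_lin HX.
move: t; apply: (lin_ext (@gG a b) (dhom_lin HXX HX concat_hom (a:=a) (b:=b)) (lin_sub (ll a b) (lr a b))).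
move=> n t [c [p [r [u [q [_ Gu hq ->]]]]]].
have dhE a' b' (t' : XX a' b') : dhom (-1) concat t' = dd (concat t') + concat (dd t').
  by rewrite /dhom (_ : sgn k (-1) = -1) ?scaleN1r ?opprK // sgnE.
elim: Gu q hq => [a1 d c1 i j x y hx hy|a1 d c1 i j x w hx Gw IH] q hq.
  rewrite dhE concat_two (dd_prepend _ hx) (tens_ddE _ _ (homog_two hx hy)) (dd_two _ hx).
  rewrite tmkDl tmkZl !(linD (@concat_lin _ _)) !(linZ (@concat_lin _ _)) !concat_two.
  rewrite tau_actlE // tau_actrE // bar_tau_two ract_two (lact_dd HX _ hy) (lact_comp HX).
  rewrite (hom_lact (bar_tau_hom A) _ hy) mul0r sgn0 scale1r.
  rewrite (linD (@prepend_linr _ A _ _ _ _)) (linZ (@prepend_linr _ A _ _ _ _)).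
  rewrite scalerDr sgnZZ; set u1 := _ *: prepend x (lact X (dd y) q).
  set u2 := _ *: prepend x (lact X y (dd q)); set u3 := two x (mcomp _ _); abelian.
have hdx := dd_homog (Hmor _ _) hx.
have tx : twist 1 x = sgn k i *: x :> diag A a1 d by rewrite (twistE (Hmor _ _) _ hx) mul1r.
have tdx : twist 1 (dd x) = - (sgn k i *: dd x) :> diag A a1 d.
  by rewrite (twistE (Hmor _ _) _ hdx) mul1r NsgnZ.
rewrite -tprependE; move: (IH q hq); move: (tmk w q) => {IH} t; rewrite !dhE => IH.
rewrite tau_actl_tprepend // tau_actr_tprepend sub0r concat_prepend (dd_tprepend HX _ hx).
have lc := @concat_lin a1 b.
have lpl w' := @prepend_linl _ A a1 d b w'.
have lpr x' := @prepend_linr _ A a1 d b x'.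
rewrite !(linB lc) (linZ lc) !concat_prepend concat_two (lact1 HX) (hom_lact concat_hom _ hx).
rewrite tx tdx (linN (lpl _)) !(linZ (lpl _)).
have Hab := bcar_dgvect HX a1 b.
rewrite (linN (dd_linear Hab)) (ddZ Hab) (dd_prepend _ hx) bar_tau_concat.
rewrite (lin0 (@two_linr _ A _ _ _ _)) subr0 !scalerBr !scalerN !sgnZZ !(sgnZ1 (m := i + i)); try odd_tac.
have -> : tau_actr X d b t = tau_actl X d b t - (dd (concat t) + concat (dd t)) by rewrite IH; abelian.
rewrite (linB (lpr x)) (linD (lpr x)) (sgn_eq k (m := -1 * i) (n := i)); last by odd_tac.
set u1 := _ *: lact X x (concat t); abelian.
Qed.

End Concatenation.

Lemma tmapTE (k : fieldType) (A B C : dgcat k) (M M' : bimod A C) (N N' : bimod C B)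
  (HM : is_bimod M) (HN : is_bimod N) m n (f : bmap M M') (g : bmap N N') (fh : is_hom m f) (gh : is_hom n g)
  a b c (x : M a c) (y : N c b) : tmap n f g (tmk x y) = tmk (f a c (twist n x)) (g c b y).
Proof. exact: (tliftE _ _ (tmap_balanced HM HN fh gh a b)). Qed.

Lemma hom0_twist (k : fieldType) (A B : dgcat k) (M N : bimod A B) (HM : is_bimod M) (HN : is_bimod N)
  (f : bmap M N) (fh : is_hom 0 f) n a b (x : M a b) : f a b (twist n x) = twist n (f a b x).
Proof.
move: x; apply: (lin_ext (gens_homog (bcar_dgvect HM a b)) (lin_comp (hlin fh a b) (twist_lin _ n))
  (lin_comp (twist_lin (bcar_dgvect HN a b) n) (hlin fh a b))) => i x hx.
have hfx : homog i (f a b x) by rewrite -[i]add0r; apply: (hom_homog fh).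
by rewrite (twistE (bcar_dgvect HM a b) _ hx) (twistE (bcar_dgvect HN a b) _ hfx) (homZ fh).
Qed.

(** * The bar category *)

Section CofreeExtension.
Variables (k : fieldType) (A B : dgcat k).
Notation X := (bar A).
Notation Y := (bar B).
Let HX : is_bimod X := bar_bimod A.
Let HY : is_bimod Y := bar_bimod B.
Let HXX := tens_bimod true HX HX.
Let HYY := tens_bimod true HY HY.

Section Left.
Variables (Q : bimod A B) (HQ : is_bimod Q).
Let HXQ := tens_bimod true HX HQ.

Definition comultl : bmap (tensor X Q) (tensor X (tensor X Q)) :=
  bcomp (@assoc _ _ _ _ _ X X Q) (tmap 0 (@coprod k A) (@bmap_id _ _ _ Q)).

Lemma comultl_hom : is_hom 0 comultl.
Proof.
apply: (is_hom_eq (m := 0 + 0)); first by [].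
exact: (hom_comp (assoc_hom HX HX HQ) (tmap_hom HX HQ HXX HQ (coprod_hom A) (hom_id Q))).
Qed.

Lemma comultl_closed : hclosed 0 comultl.
Proof.
apply: closed_comp; [exact: assoc_hom | exact: assoc_closed |] => a b x.
rewrite (tmap_dhoml HX HQ HXX HQ (coprod_hom A) (hom_id Q) (@bmap_id_closed _ _ _ Q)).
have ch := hom_dhom HX HXX (coprod_hom A).
move: x; apply: (lin_ext (gens_tens HX HQ a b) (tmap_lin HX HQ ch (hom_id Q) (a:=a) (b:=b)) (@lin_cst0 _ _ _)).
move=> i t [c [p [q [x [y [_ hx hy ->]]]]]].
by rewrite (tmapE HX HQ ch (hom_id Q) _ hx) coprod_closed tmk0l scaler0.
Qed.

Lemma comultlE a b c (x : X a c) (q : Q c b) :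
  comultl (tmk x q) = assoc (tmk (coprod x) q).
Proof. by rewrite /comultl /bcomp (tmap0E HX HQ (coprod_hom A) (hom_id Q)). Qed.

Lemma comultl_counit a b (t : tensor X Q a b) : tau_actl (tensor X Q) a b (comultl t) = t.
Proof.
have al := @assoc_lin _ _ _ _ _ X X Q HX HX.
have ll := tau_actl_lin HXQ.
move: t; apply: (lin_ext (gens_tens HX HQ a b) (lin_comp (ll a b) (hlin comultl_hom a b)) (@lin_id _ _)).
move=> i t [c [p [q [x [y [_ hx hy ->]]]]]]; rewrite comultlE.
rewrite -[in RHS](coprod_counitl x); move: (coprod x).
apply: (lin_ext (gens_tens HX HX a c) (lin_comp (ll a b) (lin_comp (@al a b) (tmk_linl y)))
  (lin_comp (tmk_linl y) (@tau_actl_lin _ _ _ X HX a c))).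
move=> j t' [d [p' [q' [x' [y' [_ hx' hy' ->]]]]]].
by rewrite assocE !tau_actlE // tens_lactE.
Qed.

End Left.

Arguments comultl : clear implicits.

Section LeftExt.
Variables (Q N : bimod A B) (HQ : is_bimod Q) (HN : is_bimod N).
Let HXQ := tens_bimod true HX HQ.

(* the extension of g to a map of cofree comodules over the bar complex *)
Definition lext n (g : bmap (tensor X Q) N) : bmap (tensor X Q) (tensor X N) :=
  bcomp (tmap n (@bmap_id _ _ _ X) g) (comultl Q).

Variables (n : int) (g : bmap (tensor X Q) N) (gh : is_hom n g).

Lemma lext_hom : is_hom n (lext n g).
Proof.
apply: (is_hom_eq (m := 0 + n + 0)); first by rewrite add0r addr0.
exact: (hom_comp (tmap_hom HX HXQ HX HN (hom_id X) gh) (comultl_hom HQ)).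
Qed.

Lemma lext_dhom a b (t : tensor X Q a b) : dhom n (lext n g) t = lext (n + 1) (dhom n g) t.
Proof.
rewrite /lext (dhom_comp_closedr _ (comultl_closed HQ)).
  by rewrite (tmap_dhomr HX HXQ HX HN (hom_id X) gh (@bmap_id_closed _ _ _ X)).
apply: (is_hom_eq (m := 0 + n)); first by rewrite add0r.
exact: (tmap_hom HX HXQ HX HN (hom_id X) gh).
Qed.

Lemma tau_actl_tmap a b (t : tensor X (tensor X Q) a b) :
  tau_actl N a b (tmap n (@bmap_id _ _ _ X) g t) = @g a b (tau_actl (tensor X Q) a b t).
Proof.
move: t; apply: (lin_ext (gens_tens HX HXQ a b)
  (lin_comp (tau_actl_lin HN (a:=a) (b:=b)) (tmap_lin HX HXQ (hom_id X) gh (a:=a) (b:=b)))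
  (lin_comp (hlin gh a b) (tau_actl_lin HXQ (a:=a) (b:=b)))).
move=> i t [c [p [q [x [y [_ hx hy ->]]]]]].
rewrite (tmapE HX HXQ (hom_id X) gh _ hx) (linZ (tau_actl_lin HN (a:=_) (b:=_))) !tau_actlE //.
by rewrite (hom_lact gh _ (tau_homog hx)).
Qed.

Lemma tau_actl_lext a b (t : tensor X Q a b) : tau_actl N a b (lext n g t) = @g a b t.
Proof. by rewrite /lext /bcomp tau_actl_tmap comultl_counit. Qed.

Lemma lextE a b c (x : X a c) (q : Q c b) :
  lext n g (tmk x q) = tmap n (@bmap_id _ _ _ X) g (assoc (tmk (coprod x) q)).
Proof. by rewrite /lext /bcomp comultlE. Qed.

End LeftExt.

(** A map of cofree comodules is determined by its corestriction. Concretely, the two sides are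
    built from the two iterated coproducts of the bar factor, and coassociativity identifies
    them. *)
Lemma lext_comp (Q N P : bimod A B) (HQ : is_bimod Q) (HN : is_bimod N) (HP : is_bimod P)
  m n (h : bmap (tensor X N) P) (g : bmap (tensor X Q) N) : is_hom m h -> is_hom n g ->
  forall a b (t : tensor X Q a b), lext (m + n) (bcomp h (lext n g)) t = lext m h (lext n g t).
Proof.
move=> hh gh a b.
have HXQ := tens_bimod true HX HQ; have HXN := tens_bimod true HX HN; have HXXQ := tens_bimod true HX HXQ.
have lgh := lext_hom HQ HN gh; have lhh := lext_hom HN HP hh.
have hgh := hom_comp hh lgh; have lhgh := lext_hom HQ HP hgh.
apply: (lin_ext (gens_tens HX HQ a b) (hlin lhgh a b) (lin_comp (hlin lhh a b) (hlin lgh a b))).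
move=> i t [c [p [q [x [y [_ hx hy ->]]]]]].
have al (P' : bimod A B) := @assoc_lin _ _ _ _ _ X X P' HX HX.
(* both sides are functions of the iterated coproduct of x *)
pose D (u : tensor X (tensor X X) a c) : tensor X (tensor X (tensor X Q)) a b :=
  tmap 0 (@bmap_id _ _ _ X) (@assoc _ _ _ _ _ X X Q) (assoc (tmk u y)).
pose F (v : tensor X (tensor X (tensor X Q)) a b) : tensor X P a b :=
  tmap (m + n) (@bmap_id _ _ _ X) (bcomp h (tmap n (@bmap_id _ _ _ X) g)) v.
have hg' : is_hom (m + n) (bcomp h (tmap n (@bmap_id _ _ _ X) g)).
  rewrite -[n in X in is_hom X]add0r; exact: (hom_comp hh (tmap_hom HX HXQ HX HN (hom_id X) gh)).
have Fl : linear F := tmap_lin HX HXXQ (hom_id X) hg' (a:=a) (b:=b).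
have HaQ : is_hom 0 (@assoc _ _ _ _ _ X X Q) := assoc_hom HX HX HQ.
have Dl : linear D.
  apply: (lin_comp (tmap_lin HX (tens_bimod true HXX HQ) (hom_id X) HaQ (a:=a) (b:=b))).
  exact: (lin_comp (@assoc_lin _ _ _ _ _ X (tensor X X) Q HX HXX a b) (tmk_linl y)).
transitivity (F (D (tmap 0 (@bmap_id _ _ _ X) (@coprod k A) (coprod x)))).
  rewrite (lextE HQ); move: (coprod x).
  apply: (lin_ext (gens_tens HX HX a c)).
  - exact: (lin_comp (tmap_lin HX HXQ (hom_id X) hgh (a:=a) (b:=b)) (lin_comp (@al Q a b) (tmk_linl y))).
  - exact: (lin_comp Fl (lin_comp Dl (tmap_lin HX HX (hom_id X) (coprod_hom A) (a:=a) (b:=c)))).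
  move=> j t' [d [p' [q' [x1 [x2 [_ hx1 hx2 ->]]]]]].
  rewrite assocE (tmapTE HX HXQ (hom_id X) hgh) (tmap0E HX HX (hom_id X) (coprod_hom A)).
  rewrite /D assocE (tmap0E HX (tens_bimod true HXX HQ) (hom_id X) HaQ) /F.
  by rewrite (tmapTE HX HXXQ (hom_id X) hg') /bmap_id /bcomp (lextE HQ).
rewrite -coprod_coassoc (lextE HQ).
move: (coprod x).
apply: (lin_ext (gens_tens HX HX a c)).
- apply: (lin_comp Fl (lin_comp Dl _)).
  exact: (lin_comp (@assoc_lin _ _ _ _ _ X X X HX HX a c) (tmap_lin HX HX (coprod_hom A) (hom_id X) (a:=a) (b:=c))).
- apply: (lin_comp (hlin lhh a b)).
  exact: (lin_comp (tmap_lin HX HXQ (hom_id X) gh (a:=a) (b:=b)) (lin_comp (@al Q a b) (tmk_linl y))).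
move=> j t' [d [p' [q' [x1 [x2 [_ hx1 hx2 ->]]]]]].
rewrite (tmap0E HX HX (coprod_hom A) (hom_id X)) assocE (tmapTE HX HXQ (hom_id X) gh).
rewrite (lextE HN) /bmap_id (hom0_twist HX HXX (coprod_hom A)).
move: (coprod x1).
apply: (lin_ext (gens_tens HX HX a d)).
- apply: (lin_comp Fl (lin_comp Dl _)).
  exact: (lin_comp (@assoc_lin _ _ _ _ _ X X X HX HX a c) (tmk_linl x2)).
- apply: (lin_comp (tmap_lin HX HXN (hom_id X) hh (a:=a) (b:=b))).
  exact: (lin_comp (@al N a b) (lin_comp (tmk_linl _) (twist_lin (bcar_dgvect HXX a d) n))).
move=> l t'' [e [p1 [p2 [w1 [w2 [_ hw1 hw2 ->]]]]]].
rewrite (twistE (bcar_dgvect HXX a d) n (homog_tmk hw1 hw2)) tmkZl (linZ (@al N a b)).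
rewrite (linZ (tmap_lin HX HXN (hom_id X) hh (a:=a) (b:=b))) !assocE /D assocE.
rewrite (tmap0E HX (tens_bimod true HXX HQ) (hom_id X) HaQ) assocE /F.
rewrite (tmapE HX HXXQ (hom_id X) hg' _ hw1) (tmapE HX HXN (hom_id X) hh _ hw1) /bmap_id /bcomp.
rewrite (tmapE HX HXQ (hom_id X) gh _ hw2) (homZ hh) tmkZr !sgnZZ /bmap_id.
by apply: sgnZ_eq; odd_tac.
Qed.

(** The action contracts the second part of the coproduct of [x], so this is the right counit law;
    the left one yields [tau_actl_lext]. *)
Lemma lext_tau_actl (Q : bimod A B) (HQ : is_bimod Q) a b (t : tensor X Q a b) :
  lext 0 (tau_actl Q) t = t.
Proof.
have HXQ := tens_bimod true HX HQ; have th := tau_actl_hom HQ.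
have lh := lext_hom HQ HQ th.
move: t; apply: (lin_ext (gens_tens HX HQ a b) (hlin lh a b) (@lin_id _ _)).
move=> i t [c [p [q [x [y [_ hx hy ->]]]]]]; rewrite (lextE HQ).
rewrite -[in RHS](coprod_counitr x); move: (coprod x).
apply: (lin_ext (gens_tens HX HX a c)
  (lin_comp (tmap_lin HX HXQ (hom_id X) th (a:=a) (b:=b)) (lin_comp (@assoc_lin _ _ _ _ _ X X Q HX HX a b) (tmk_linl y)))
  (lin_comp (tmk_linl y) (tau_actr_lin HX (a:=a) (b:=c)))).
move=> j t' [d [p' [q' [x' [y' [_ hx' hy' ->]]]]]].
by rewrite assocE (tmap0E HX HXQ (hom_id X) th) tau_actlE // tau_actrE // tmk_act.
Qed.

Section Right.
Variables (P : bimod A B) (HP : is_bimod P).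

Definition comultr : bmap (tensor P Y) (tensor (tensor P Y) Y) :=
  bcomp (@assoc_inv _ _ _ _ _ P Y Y) (tmap 0 (@bmap_id _ _ _ P) (@coprod k B)).

Lemma comultr_hom : is_hom 0 comultr.
Proof.
apply: (is_hom_eq (m := 0 + 0)); first by [].
exact: (hom_comp (assoc_inv_hom HP HY HY) (tmap_hom HP HY HP HYY (hom_id P) (coprod_hom B))).
Qed.

Lemma comultr_closed : hclosed 0 comultr.
Proof.
apply: closed_comp; [exact: assoc_inv_hom | exact: assoc_inv_closed |] => a b x.
rewrite (tmap_dhomr HP HY HP HYY (hom_id P) (coprod_hom B) (@bmap_id_closed _ _ _ P)).
have ch := hom_dhom HY HYY (coprod_hom B).
move: x; apply: (lin_ext (gens_tens HP HY a b) (tmap_lin HP HY (hom_id P) ch (a:=a) (b:=b)) (@lin_cst0 _ _ _)).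
move=> i t [c [p [q [x [y [_ hx hy ->]]]]]].
by rewrite (tmapE HP HY (hom_id P) ch _ hx) coprod_closed tmk0r scaler0.
Qed.

Lemma comultrE a b c (x : P a c) (y : Y c b) :
  comultr (tmk x y) = assoc_inv (tmk x (coprod y)).
Proof. by rewrite /comultr /bcomp (tmap0E HP HY (hom_id P) (coprod_hom B)). Qed.

End Right.

Arguments comultr : clear implicits.

Section RightExt.
Variables (P N : bimod A B) (HP : is_bimod P) (HN : is_bimod N).
Let HPY := tens_bimod true HP HY.
Let il := @assoc_inv_lin _ _ _ _ _ P Y Y HY HY.

(** In contrast to [lext], no degree enters: [g] stands to the left of the coacting factor, so it
    passes nothing and causes no sign. *)
Definition rext (g : bmap (tensor P Y) N) : bmap (tensor P Y) (tensor N Y) :=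
  bcomp (tmap 0 g (@bmap_id _ _ _ Y)) (comultr P).

Variables (n : int) (g : bmap (tensor P Y) N) (gh : is_hom n g).

Lemma rext_hom : is_hom n (rext g).
Proof.
apply: (is_hom_eq (m := n + 0 + 0)); first by rewrite !addr0.
exact: (hom_comp (tmap_hom HPY HY HN HY gh (hom_id Y)) (comultr_hom HP)).
Qed.

Lemma rext_dhom a b (t : tensor P Y a b) : dhom n (rext g) t = rext (dhom n g) t.
Proof.
rewrite /rext (dhom_comp_closedr _ (comultr_closed HP)).
  by rewrite (tmap_dhoml HPY HY HN HY gh (hom_id Y) (@bmap_id_closed _ _ _ Y)).
apply: (is_hom_eq (m := n + 0)); first by rewrite addr0.
exact: (tmap_hom HPY HY HN HY gh (hom_id Y)).
Qed.

Lemma rextE a b c (x : P a c) (y : Y c b) :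
  rext g (tmk x y) = tmap 0 g (@bmap_id _ _ _ Y) (assoc_inv (tmk x (coprod y))).
Proof. by rewrite /rext /bcomp comultrE. Qed.

Lemma tau_actr_rext a b (t : tensor P Y a b) : tau_actr N a b (rext g t) = @g a b t.
Proof.
move: t; apply: (lin_ext (gens_tens HP HY a b)
  (lin_comp (tau_actr_lin HN (a:=a) (b:=b)) (hlin rext_hom a b)) (hlin gh a b)).
move=> i t [c [p [q [x [y [_ hx hy ->]]]]]]; rewrite rextE.
rewrite -[in RHS](coprod_counitr y); move: (coprod y).
apply: (lin_ext (gens_tens HY HY c b)
  (lin_comp (tau_actr_lin HN (a:=a) (b:=b)) (lin_comp (tmap_lin HPY HY gh (hom_id Y) (a:=a) (b:=b)) (lin_comp (@il a b) (tmk_linr x))))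
  (lin_comp (hlin gh a b) (lin_comp (tmk_linr x) (tau_actr_lin HY (a:=c) (b:=b))))).
move=> j t' [d [p' [q' [y1 [y2 [_ hy1 hy2 ->]]]]]].
by rewrite assoc_invE (tmap0E HPY HY gh (hom_id Y)) !tau_actrE // -(hom_ract gh) tens_ractE.
Qed.

End RightExt.

Lemma rext_comp (P N Q : bimod A B) (HP : is_bimod P) (HN : is_bimod N) (HQ : is_bimod Q)
  m n (h : bmap (tensor N Y) Q) (g : bmap (tensor P Y) N) : is_hom m h -> is_hom n g ->
  forall a b (t : tensor P Y a b), rext (bcomp h (rext g)) t = rext h (rext g t).
Proof.
move=> hh gh a b.
have HPY := tens_bimod true HP HY; have HNY := tens_bimod true HN HY; have HPYY := tens_bimod true HPY HY.
have rgh := rext_hom HP HN gh; have rhh := rext_hom HN HQ hh.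
have hgh := hom_comp hh rgh; have rhgh := rext_hom HP HQ hgh.
have il (M' : bimod A B) := @assoc_inv_lin _ _ _ _ _ M' Y Y HY HY.
apply: (lin_ext (gens_tens HP HY a b) (hlin rhgh a b) (lin_comp (hlin rhh a b) (hlin rgh a b))).
move=> i t [c [p [q [x [y [_ hx hy ->]]]]]].
pose D (u : tensor (tensor Y Y) Y c b) : tensor (tensor (tensor P Y) Y) Y a b :=
  tmap 0 (@assoc_inv _ _ _ _ _ P Y Y) (@bmap_id _ _ _ Y) (assoc_inv (tmk x u)).
pose F (v : tensor (tensor (tensor P Y) Y) Y a b) : tensor Q Y a b :=
  tmap 0 (bcomp h (tmap 0 g (@bmap_id _ _ _ Y))) (@bmap_id _ _ _ Y) v.
have hg' : is_hom (m + (n + 0)) (bcomp h (tmap 0 g (@bmap_id _ _ _ Y))).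
  exact: (hom_comp hh (tmap_hom HPY HY HN HY gh (hom_id Y))).
have Fl : linear F := tmap_lin HPYY HY hg' (hom_id Y) (a:=a) (b:=b).
have HaP : is_hom 0 (@assoc_inv _ _ _ _ _ P Y Y) := assoc_inv_hom HP HY HY.
have Dl : linear D.
  apply: (lin_comp (tmap_lin (tens_bimod true HP HYY) HY HaP (hom_id Y) (a:=a) (b:=b))).
  exact: (lin_comp (@assoc_inv_lin _ _ _ _ _ P (tensor Y Y) Y HYY HY a b) (tmk_linr x)).
transitivity (F (D (tmap 0 (@coprod k B) (@bmap_id _ _ _ Y) (coprod y)))).
  rewrite (rextE HP); move: (coprod y).
  apply: (lin_ext (gens_tens HY HY c b)).
  - exact: (lin_comp (tmap_lin HPY HY hgh (hom_id Y) (a:=a) (b:=b)) (lin_comp (@il P a b) (tmk_linr x))).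
  - exact: (lin_comp Fl (lin_comp Dl (tmap_lin HY HY (coprod_hom B) (hom_id Y) (a:=c) (b:=b)))).
  move=> j t' [d [p' [q' [y1 [y2 [_ hy1 hy2 ->]]]]]].
  rewrite assoc_invE (tmap0E HPY HY hgh (hom_id Y)) (tmap0E HY HY (coprod_hom B) (hom_id Y)).
  rewrite /D assoc_invE (tmap0E (tens_bimod true HP HYY) HY HaP (hom_id Y)) /F.
  by rewrite (tmap0E HPYY HY hg' (hom_id Y)) /bmap_id /bcomp (rextE HP).
rewrite -[tmap 0 _ _ (coprod y)](assocK HY HY HY) coprod_coassoc (rextE HP).
move: (coprod y).
apply: (lin_ext (gens_tens HY HY c b)).
- apply: (lin_comp Fl (lin_comp Dl _)).
  exact: (lin_comp (@assoc_inv_lin _ _ _ _ _ Y Y Y HY HY c b) (tmap_lin HY HY (hom_id Y) (coprod_hom B) (a:=c) (b:=b))).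
- apply: (lin_comp (hlin rhh a b)).
  exact: (lin_comp (tmap_lin HPY HY gh (hom_id Y) (a:=a) (b:=b)) (lin_comp (@il P a b) (tmk_linr x))).
move=> j t' [d [p' [q' [y1 [y2 [_ hy1 hy2 ->]]]]]].
rewrite (tmap0E HY HY (hom_id Y) (coprod_hom B)) assoc_invE (tmap0E HPY HY gh (hom_id Y)).
rewrite (rextE HN) /bmap_id.
move: (coprod y2).
apply: (lin_ext (gens_tens HY HY d b)).
- apply: (lin_comp Fl (lin_comp Dl _)).
  exact: (lin_comp (@assoc_inv_lin _ _ _ _ _ Y Y Y HY HY c b) (tmk_linr y1)).
- apply: (lin_comp (tmap_lin HNY HY hh (hom_id Y) (a:=a) (b:=b))).
  exact: (lin_comp (@il N a b) (tmk_linr _)).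
move=> l t'' [e [p1 [p2 [w1 [w2 [_ hw1 hw2 ->]]]]]].
rewrite !assoc_invE /D assoc_invE (tmap0E (tens_bimod true HP HYY) HY HaP (hom_id Y)) assoc_invE /F.
rewrite (tmap0E HPYY HY hg' (hom_id Y)) (tmap0E HNY HY hh (hom_id Y)) /bmap_id /bcomp.
by rewrite (tmap0E HPY HY gh (hom_id Y)).
Qed.

Lemma rext_tau_actr (P : bimod A B) (HP : is_bimod P) a b (t : tensor P Y a b) :
  rext (tau_actr P) t = t.
Proof.
have HPY := tens_bimod true HP HY; have th := tau_actr_hom HP.
have rh := rext_hom HP HP th.
move: t; apply: (lin_ext (gens_tens HP HY a b) (hlin rh a b) (@lin_id _ _)).
move=> i t [c [p [q [x [y [_ hx hy ->]]]]]]; rewrite (rextE HP).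
rewrite -[in RHS](coprod_counitl y); move: (coprod y).
apply: (lin_ext (gens_tens HY HY c b)
  (lin_comp (tmap_lin HPY HY th (hom_id Y) (a:=a) (b:=b)) (lin_comp (@assoc_inv_lin _ _ _ _ _ P Y Y HY HY a b) (tmk_linr x)))
  (lin_comp (tmk_linr x) (tau_actl_lin HY (a:=c) (b:=b)))).
move=> j t' [d [p' [q' [x' [y' [_ hx' hy' ->]]]]]].
by rewrite assoc_invE (tmap0E HPY HY th (hom_id Y)) tau_actrE // tau_actlE // tmk_act.
Qed.

End CofreeExtension.

Lemma bmap_ext (k : fieldType) (A B : dgcat k) (M N : bimod A B) (f g : bmap M N) :
  (forall a b x, f a b x = g a b x) -> f = g.
Proof.
move=> fg; apply: functional_extensionality_dep => a.
by apply: functional_extensionality_dep => b; apply/funext => x.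
Qed.

(** * Composition in the bar category *)

Section BarMorphisms.
Variables (k : fieldType) (A B : dgcat k).
Notation X := (bar A).
Notation Y := (bar B).
Let HX : is_bimod X := bar_bimod A.
Let HY : is_bimod Y := bar_bimod B.
Let HXX := tens_bimod true HX HX.

#[export] Instance tilde_bimod (M : bimod A B) : is_bimod M -> is_bimod (tilde M).
Proof. by move=> HM; apply: (tens_bimod true (tens_bimod true HX HM) HY). Qed.

Section OneMap.
Variables (M N : bimod A B) (HM : is_bimod M) (HN : is_bimod N).
Let HXM := tens_bimod true HX HM.
Let HXN := tens_bimod true HX HN.
Let HMY := tens_bimod true HM HY.
Let HNY := tens_bimod true HN HY.
Let HT : is_bimod (tilde M) := tilde_bimod HM.
Let al := @assoc_lin _ _ _ _ _ X M Y HX HM.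

(** Half of [tilde_map]: only the left bar factor is comultiplied, with [tensor M Y] as
    cogenerators. The other half, [rhalf], treats the right bar factor in the same way. Each
    dualising functor sees just one of these halves. *)
Definition lhalf n (f : bmap (tilde M) N) : bmap (tilde M) (tensor X N) :=
  bcomp (lext n (bcomp f (@assoc_inv _ _ _ _ _ X M Y))) (@assoc _ _ _ _ _ X M Y).

Definition rhalf (f : bmap (tilde M) N) : bmap (tensor X (tensor M Y)) (tensor N Y) :=
  bcomp (rext f) (@assoc_inv _ _ _ _ _ X M Y).

Variables (n : int) (f : bmap (tilde M) N) (fh : is_hom n f).

Let fah : is_hom n (bcomp f (@assoc_inv _ _ _ _ _ X M Y)).
Proof.
apply: (is_hom_eq (m := n + 0)); first by rewrite addr0.
exact: (hom_comp fh (assoc_inv_hom HX HM HY)).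
Qed.

Lemma lhalf_hom : is_hom n (lhalf n f).
Proof.
apply: (is_hom_eq (m := n + 0)); first by rewrite addr0.
exact: (hom_comp (lext_hom HMY HN fah) (assoc_hom HX HM HY)).
Qed.

Lemma rhalf_hom : is_hom n (rhalf f).
Proof.
apply: (is_hom_eq (m := n + 0)); first by rewrite addr0.
exact: (hom_comp (rext_hom HXM HN fh) (assoc_inv_hom HX HM HY)).
Qed.

Lemma lhalf_dhom : dhom n (lhalf n f) = lhalf (n + 1) (dhom n f).
Proof.
apply: bmap_ext => a b t; rewrite /lhalf.
rewrite (dhom_comp_closedr (lext_hom HMY HN fah) (assoc_closed HX HM HY)).
rewrite (lext_dhom HMY HN fah).
have -> // : dhom n (bcomp f (@assoc_inv _ _ _ _ _ X M Y)) = bcomp (dhom n f) (@assoc_inv _ _ _ _ _ X M Y).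
by apply: bmap_ext => a' b' u; rewrite (dhom_comp_closedr fh (assoc_inv_closed HX HM HY)).
Qed.

Lemma rhalf_dhom : dhom n (rhalf f) = rhalf (dhom n f).
Proof.
apply: bmap_ext => a b t; rewrite /rhalf.
rewrite (dhom_comp_closedr (rext_hom HXM HN fh) (assoc_inv_closed HX HM HY)).
by rewrite (rext_dhom HXM HN fh).
Qed.

(* the common value of both sides below on x1 (x) x2, m, y1 (x) y2 *)
Let K : bmap (tensor (tensor (tensor X X) M) Y) (tensor X N) :=
  bcomp (tmap n (@bmap_id _ _ _ X) (bcomp f (@assoc_inv _ _ _ _ _ X M Y)))
    (bcomp (@assoc _ _ _ _ _ X X (tensor M Y)) (@assoc _ _ _ _ _ (tensor X X) M Y)).

Let Kh : is_hom (0 + n + (0 + 0)) K.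
Proof.
exact: (hom_comp (tmap_hom HX (tens_bimod true HX HMY) HX HN (hom_id X) fah)
  (hom_comp (assoc_hom HX HX HMY) (assoc_hom HXX HM HY))).
Qed.

Let Kp a b c e (t : tensor X X a c) (m : M c e) (s : tensor Y Y e b) : tensor (tensor X N) Y a b :=
  tmap 0 K (@bmap_id _ _ _ Y) (assoc_inv (tmk (tmk t m : tensor (tensor X X) M a e) s)).

Let Kp_linl a b c e m s : linear (fun t => @Kp a b c e t m s).
Proof.
apply: (lin_comp (tmap_lin (tens_bimod true (tens_bimod true HXX HM) HY) HY Kh (hom_id Y) (a:=a) (b:=b))).
apply: (lin_comp (@assoc_inv_lin _ _ _ _ _ (tensor (tensor X X) M) Y Y HY HY a b)).
exact: (lin_comp (tmk_linl s) (tmk_linl m)).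
Qed.

Let Kp_linr a b c e t m : linear (fun s => @Kp a b c e t m s).
Proof.
apply: (lin_comp (tmap_lin (tens_bimod true (tens_bimod true HXX HM) HY) HY Kh (hom_id Y) (a:=a) (b:=b))).
apply: (lin_comp (@assoc_inv_lin _ _ _ _ _ (tensor (tensor X X) M) Y Y HY HY a b)).
exact: tmk_linr.
Qed.

Let KE a b c e (t : tensor X X a c) (m : M c e) (y : Y e b) :
  K (tmk (tmk t m : tensor (tensor X X) M a e) y) =
  tmap n (@bmap_id _ _ _ X) (bcomp f (@assoc_inv _ _ _ _ _ X M Y)) (assoc (tmk t (tmk m y : tensor M Y c b))).
Proof. by rewrite /K /bcomp assocE. Qed.

Let KpE a b c c' e e' (x1 : X a c') (x2 : X c' c) (m : M c e) (y1 : Y e e') (y2 : Y e' b) :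
  Kp (tmk x1 x2) m (tmk y1 y2) =
    tmk (tmk (twist n x1) (f (tmk (tmk x2 m : tensor X M c' e) y1)) : tensor X N a e') y2.
Proof.
rewrite /Kp assoc_invE (tmap0E (tens_bimod true (tens_bimod true HXX HM) HY) HY Kh (hom_id Y)) KE assocE.
by rewrite (tmapTE HX (tens_bimod true HX HMY) (hom_id X) fah) /bcomp assoc_invE.
Qed.

Let lhalfE a b c e (x : X a c) (m : M c e) (y : Y e b) :
  lhalf n f (tmk (tmk x m : tensor X M a e) y) = K (tmk (tmk (coprod x) m : tensor (tensor X X) M a e) y).
Proof. by rewrite /lhalf /bcomp assocE (lextE HMY) KE. Qed.

Let tilde_mapKE a b c e (x : X a c) (m : M c e) (y : Y e b) :
  rext (lhalf n f) (tmk (tmk x m : tensor X M a e) y) = Kp (coprod x) m (coprod y).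
Proof.
rewrite (rextE HXM); move: (coprod y).
apply: (lin_ext (gens_tens HY HY e b) _ (Kp_linr _ _)).
  apply: (lin_comp (tmap_lin HT HY lhalf_hom (hom_id Y) (a:=a) (b:=b))).
  exact: (lin_comp (@assoc_inv_lin _ _ _ _ _ (tensor X M) Y Y HY HY a b) (tmk_linr _)).
move=> i s [e' [p [q [y1 [y2 [_ _ _ ->]]]]]].
rewrite assoc_invE (tmap0E HT HY lhalf_hom (hom_id Y)) lhalfE.
by rewrite /Kp assoc_invE (tmap0E (tens_bimod true (tens_bimod true HXX HM) HY) HY Kh (hom_id Y)).
Qed.

(** The nested lifts of the definition split into a left and a right cofree extension, so that the
    properties of [tilde_map] reduce to those of [lext] and [rext]. *)
Lemma tilde_mapE : tilde_map n f = rext (lhalf n f).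
Proof.
have rh := rext_hom HXM HXN lhalf_hom.
apply: bmap_ext => a b t; rewrite /tilde_map.
apply: (tlift_eq (hlin rh a b)) => e u y.
apply: (tlift_eq (G := fun u => rext (lhalf n f) (tmk u y))) => [|c x m].
  exact: (lin_comp (hlin rh a b) (tmk_linl y)).
rewrite tilde_mapKE.
apply: (tlift_eq (G := fun t => Kp t m (coprod y))) => [|c' x1 x2]; first exact: Kp_linl.
apply: (tlift_eq (G := fun s => Kp (tmk x1 x2) m s)) => [|e' y1 y2]; first exact: Kp_linr.
by rewrite KpE.
Qed.

Lemma tilde_map_hom : is_hom n (tilde_map n f).
Proof. by rewrite tilde_mapE; apply: (rext_hom HXM HXN lhalf_hom). Qed.

(** The two coproducts concern different tensor factors, so the extensions can equally be performed
    in the other order, right before left. *)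
Lemma assoc_tilde_map a b (t : tilde M a b) :
  assoc (tilde_map n f t) = lext n (rhalf f) (assoc t).
Proof.
have lrh := lext_hom HMY HNY rhalf_hom.
have aN := @assoc_lin _ _ _ _ _ X N Y HX HN.
rewrite tilde_mapE; move: t; apply: (lin_ext (@gens3l _ _ _ _ _ X M Y HX HM HY a b)).
- exact: (lin_comp (@aN a b) (hlin (rext_hom HXM HXN lhalf_hom) a b)).
- exact: (lin_comp (hlin lrh a b) (@al a b)).
move=> i t /gen3lP [c [e [p [q [r [x [m [y [_ _ _ _ ->]]]]]]]]].
rewrite tilde_mapKE assocE (lextE HMY); move: (coprod x).
apply: (lin_ext (gens_tens HX HX a c)).
- exact: (lin_comp (@aN a b) (Kp_linl _ _)).
- apply: (lin_comp (tmap_lin HX (tens_bimod true HX HMY) (hom_id X) rhalf_hom (a:=a) (b:=b))).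
  exact: (lin_comp (@assoc_lin _ _ _ _ _ X X (tensor M Y) HX HX a b) (tmk_linl _)).
move=> j u [c' [p' [q' [x1 [x2 [_ _ _ ->]]]]]].
rewrite assocE (tmapTE HX (tens_bimod true HX HMY) (hom_id X) rhalf_hom) /rhalf /bcomp assoc_invE.
rewrite (rextE HXM); move: (coprod y).
apply: (lin_ext (gens_tens HY HY e b)).
- exact: (lin_comp (@aN a b) (Kp_linr _ _)).
- apply: (lin_comp (tmk_linr _)).
  apply: (lin_comp (tmap_lin HT HY fh (hom_id Y) (a:=c') (b:=b))).
  exact: (lin_comp (@assoc_inv_lin _ _ _ _ _ (tensor X M) Y Y HY HY c' b) (tmk_linr _)).
move=> l s [e' [p1 [q1 [y1 [y2 [_ _ _ ->]]]]]].
by rewrite KpE assocE assoc_invE (tmap0E HT HY fh (hom_id Y)).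
Qed.

End OneMap.

Lemma tilde_map_dhom (M N : bimod A B) (HM : is_bimod M) (HN : is_bimod N) n (f : bmap (tilde M) N) :
  is_hom n f -> dhom n (tilde_map n f) = tilde_map (n + 1) (dhom n f).
Proof.
move=> fh; have HXM := tens_bimod true HX HM; have HXN := tens_bimod true HX HN.
have fh' := hom_dhom (tilde_bimod HM) HN fh.
rewrite (tilde_mapE HM HN fh) (tilde_mapE HM HN fh').
apply: bmap_ext => a b t; rewrite (rext_dhom HXM HXN (lhalf_hom HM HN fh)).
by rewrite (lhalf_dhom HM HN fh).
Qed.

Section Composition.
Variables (L M N : bimod A B) (HL : is_bimod L) (HM : is_bimod M) (HN : is_bimod N).
Variables (m n : int) (g : bmap (tilde M) N) (f : bmap (tilde L) M).
Hypotheses (gh : is_hom m g) (fh : is_hom n f).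
Let HXL := tens_bimod true HX HL.
Let HXM := tens_bimod true HX HM.
Let HLY := tens_bimod true HL HY.
Let HMY := tens_bimod true HM HY.

Lemma bar_compE : bar_comp n g f = bcomp g (tilde_map n f).
Proof. by []. Qed.

Lemma bar_comp_hom : is_hom (m + n) (bar_comp n g f).
Proof. exact: (hom_comp gh (tilde_map_hom HL HM fh)). Qed.

(** After reassociation, [tilde_map n f] is itself a left extension, by [assoc_tilde_map], and
    [lext_comp] applies. *)
Lemma lhalf_comp : lhalf (m + n) (bar_comp n g f) = bcomp (lhalf m g) (tilde_map n f).
Proof.
apply: bmap_ext => a b t; rewrite /lhalf /bcomp (assoc_tilde_map HL HM fh).
have gah : is_hom (m + 0) (bcomp g (@assoc_inv _ _ _ _ _ X M Y)).
  exact: (hom_comp gh (assoc_inv_hom HX HM HY)).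
rewrite addr0 in gah.
rewrite -(lext_comp HLY HMY HN gah (rhalf_hom HL HM fh)).
have -> // : bcomp (bcomp g (@assoc_inv _ _ _ _ _ X M Y)) (lext n (rhalf f)) =
  bcomp (bar_comp n g f) (@assoc_inv _ _ _ _ _ X L Y).
apply: bmap_ext => a' b' u; rewrite /bcomp -{1}[u](assoc_invK HX HL HY).
by rewrite -(assoc_tilde_map HL HM fh) (assocK HX HM HY).
Qed.

Lemma rhalf_comp : rhalf (bar_comp n g f) = bcomp (rhalf g) (lext n (rhalf f)).
Proof.
apply: bmap_ext => a b t; rewrite /rhalf /bcomp -{2}[t](assoc_invK HX HL HY).
rewrite -(assoc_tilde_map HL HM fh) (assocK HX HM HY) (tilde_mapE HL HM fh).
rewrite -(rext_comp HXL HXM HN gh (lhalf_hom HL HM fh)).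
by rewrite -(tilde_mapE HL HM fh).
Qed.

(** The bar category is in effect a category of cofree bicomodules; this functoriality is the
    associativity of its composition. *)
Lemma tilde_map_comp : tilde_map (m + n) (bar_comp n g f) = bcomp (tilde_map m g) (tilde_map n f).
Proof.
rewrite (tilde_mapE HL HN bar_comp_hom) lhalf_comp (tilde_mapE HM HN gh) (tilde_mapE HL HM fh).
apply: bmap_ext => a b t.
by rewrite (rext_comp HXL HXM (tens_bimod true HX HN) (lhalf_hom HM HN gh) (lhalf_hom HL HM fh)).
Qed.

Lemma bar_comp_dhom a b (t : tilde L a b) :
  dhom (m + n) (bar_comp n g f) t =
    bar_comp n (dhom m g) f t + sgn k m *: bar_comp (n + 1) g (dhom n f) t.
Proof.
rewrite bar_compE (dhom_comp _ _ gh); congr (_ + _ *: @g _ _ _).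
by rewrite (tilde_map_dhom HL HM fh).
Qed.

End Composition.

Lemma bar_compA (K L M N : bimod A B) (HK : is_bimod K) (HL : is_bimod L) (HM : is_bimod M) (HN : is_bimod N)
  m n (h : bmap (tilde M) N) (g : bmap (tilde L) M) (f : bmap (tilde K) L) :
  is_hom m g -> is_hom n f ->
  bar_comp n (bar_comp m h g) f = bar_comp (m + n) h (bar_comp n g f).
Proof. by move=> gh fh; apply: bmap_ext => a b t; rewrite /bar_comp (tilde_map_comp HK HL HM gh fh). Qed.

Section Identity.
Variables (M : bimod A B) (HM : is_bimod M).
Let HXM := tens_bimod true HX HM.
Let HMY := tens_bimod true HM HY.

Lemma bar_idE : @bar_id k A B M = bcomp (tau_actl M) (tau_actr (tensor X M)).
Proof.
have rh := tau_actr_hom HXM; have lh := tau_actl_hom HM.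
have hh := hom_comp lh rh.
apply: bmap_ext => a b t; apply: (tlift_eq (hlin hh a b)) => e u y.
apply: (tlift_eq (G := fun u => bcomp (tau_actl M) (tau_actr (tensor X M)) (tmk u y))) => [|c x m].
  exact: (lin_comp (hlin hh a b) (tmk_linl y)).
by rewrite /bcomp tau_actrE // tens_ractE tau_actlE // (lact_ract HM).
Qed.

Lemma bar_id_hom : is_hom 0 (@bar_id k A B M).
Proof. by rewrite bar_idE; apply: (hom_comp (tau_actl_hom HM) (tau_actr_hom HXM)). Qed.

Lemma bar_id_closed : hclosed 0 (@bar_id k A B M).
Proof.
by rewrite bar_idE; apply: closed_comp; [apply: tau_actl_hom | apply: tau_actl_closed | apply: tau_actr_closed].
Qed.

Lemma lhalf_id : lhalf 0 (@bar_id k A B M) = tau_actr (tensor X M).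
Proof.
apply: bmap_ext => a b.
have lh := tau_actl_hom HM.
have bah : is_hom (0 + 0) (bcomp (@bar_id k A B M) (@assoc_inv _ _ _ _ _ X M Y)).
  exact: (hom_comp bar_id_hom (assoc_inv_hom HX HM HY)).
apply: (lin_ext (@gens3l _ _ _ _ _ X M Y HX HM HY a b) (hlin (lhalf_hom HM HM bar_id_hom) a b)
  (tau_actr_lin HXM (a:=a) (b:=b))).
move=> i t /gen3lP [c [e [p [q [r [x [m [y [_ _ _ _ ->]]]]]]]]].
rewrite /lhalf /bcomp assocE (lextE HMY) tau_actrE // tens_ractE.
rewrite -[in RHS](lext_tau_actl HM (tmk x (ract M m (bar_tau y)))) (lextE HM); move: (coprod x).
apply: (lin_ext (gens_tens HX HX a c)).
- exact: (lin_comp (tmap_lin HX (tens_bimod true HX HMY) (hom_id X) bah (a:=a) (b:=b))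
    (lin_comp (@assoc_lin _ _ _ _ _ X X (tensor M Y) HX HX a b) (tmk_linl _))).
- exact: (lin_comp (tmap_lin HX HXM (hom_id X) lh (a:=a) (b:=b))
    (lin_comp (@assoc_lin _ _ _ _ _ X X M HX HX a b) (tmk_linl _))).
move=> j u [c' [p' [q' [x1 [x2 [_ _ _ ->]]]]]].
rewrite !assocE (tmap0E HX (tens_bimod true HX HMY) (hom_id X) bah) (tmap0E HX HXM (hom_id X) lh).
by rewrite /bcomp assoc_invE bar_idE /bcomp tau_actrE // tens_ractE.
Qed.

Lemma tilde_map_id : tilde_map 0 (@bar_id k A B M) = @bmap_id _ _ _ (tilde M).
Proof.
rewrite (tilde_mapE HM HM bar_id_hom) lhalf_id.
by apply: bmap_ext => a b t; rewrite (rext_tau_actr HXM).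
Qed.

Lemma bar_comp_idr N (f : bmap (tilde M) N) : bar_comp 0 f (@bar_id k A B M) = f.
Proof. by apply: bmap_ext => a b t; rewrite /bar_comp tilde_map_id. Qed.

End Identity.

(** The right counit undoes the right extension and the left counit undoes the left half. *)
Lemma bar_comp_idl (M N : bimod A B) (HM : is_bimod M) (HN : is_bimod N) n (f : bmap (tilde M) N) :
  is_hom n f -> bar_comp n (@bar_id k A B N) f = f.
Proof.
move=> fh; have HXM := tens_bimod true HX HM; have HXN := tens_bimod true HX HN.
have HMY := tens_bimod true HM HY.
apply: bmap_ext => a b t; rewrite /bar_comp (bar_idE HN) /bcomp (tilde_mapE HM HN fh).
rewrite (tau_actr_rext HXM HXN (lhalf_hom HM HN fh)) /lhalf /bcomp.
have fah : is_hom (n + 0) (bcomp f (@assoc_inv _ _ _ _ _ X M Y)).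
  exact: (hom_comp fh (assoc_inv_hom HX HM HY)).
rewrite addr0 in fah.
by rewrite (tau_actl_lext HMY HN fah) /bcomp (assocK HX HM HY).
Qed.

End BarMorphisms.

(** * Hom bimodules *)

Section LinearSpan.
Variables (k : fieldType) (V : lmodType k) (P : V -> Prop).

Lemma lspan_gen x : P x -> lspan P x.
Proof.
move=> Px; exists [:: (1, x)]; split; last by rewrite big_seq1 scale1r.
by move=> p; rewrite inE => /eqP ->.
Qed.

Lemma lspan0 : lspan P 0.
Proof. by apply/asboolP; apply: (rpred0 (lspanb P)). Qed.

Lemma lspanD x y : lspan P x -> lspan P y -> lspan P (x + y).
Proof. by move=> /asboolP Px /asboolP Py; apply/asboolP; apply: (rpredD (S := lspanb P)). Qed.

Lemma spanned_ind (Q : spanned P -> Prop) : Q 0 -> (forall x y, Q x -> Q y -> Q (x + y)) ->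
  (forall c x, lspan P x -> P x -> Q (c *: to_span P x)) -> forall x, Q x.
Proof.
move=> Q0 QD QP x; have /asboolP [s [sP xE]] := valP x.
have -> : x = \sum_(p <- s) p.1 *: to_span P p.2.
  apply: val_inj; rewrite xE raddf_sum big_seq [RHS]big_seq; apply: eq_bigr => p ps.
  transitivity (p.1 *: val (to_span P p.2)); last by [].
  by rewrite to_spanK //; apply/lspan_gen/sP.
rewrite big_seq; apply: big_ind => // p ps.
by apply: QP; [apply/lspan_gen/sP | apply: sP].
Qed.

End LinearSpan.

Section HomSpace.
Variables (k : fieldType) (T : Type) (U W : T -> dgvect k).
Hypotheses (HU : forall t, is_dgvect (U t)) (HW : forall t, is_dgvect (W t)).
Notation fam := (dprod (fun t => dprod (fun _ : U t => W t : lmodType k) : lmodType k)).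
Variable H : int -> fam -> Prop.
Notation mkfam F := (DProd (fun t => DProd (F t)) : fam).

(** A graded Hom space, cut out of a product of function spaces by a condition in each degree. It is
    treated once for three uses: the fibres of [homR], those of [homL], and the morphism complexes
    of the bar category, indexed by the objects of one category or by pairs of objects. *)
Record hom_space_axioms : Prop := HomSpaceAxioms {
  hsp_lin : forall n (f : fam), H n f -> forall t, linear (f t : U t -> W t);
  hsp_homog : forall n (f : fam), H n f -> forall t i (x : U t), homog i x -> homog (n + i) (f t x : W t);
  hsp0 : forall n, H n 0;
  hspD : forall n f g, H n f -> H n g -> H n (f + g);
  hspZ : forall n c f, H n f -> H n (c *: f);
  hsp_dd : forall n (f : fam), H n f ->
    H (n + 1) (mkfam (fun t x => dd (f t x : W t) - sgn k n *: (f t (dd x) : W t))) }.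
Hypothesis HH : hom_space_axioms.

Definition hom_space : lmodType k := spanned (fun f : fam => exists n, H n f).
Definition hsp_mk (F : forall t, U t -> W t) : hom_space := to_span _ (mkfam F).
Definition hsp_app (f : hom_space) t (x : U t) : W t := val f t x.
Definition hsp_gr : grvect k := @GrVect k hom_space (fun n f =>
  hsp_mk (fun t x => hsum x (fun i x' => pr (n + i) (hsp_app f x')))).
Definition hsp_dg : dgvect k := @DgVect k hsp_gr (fun f =>
  hsp_mk (fun t x => dd (hsp_app f x) - hsp_app (twist 1 (f : hsp_gr)) (dd x))).

Lemma hsp_ext (f g : hom_space) : (forall t x, @hsp_app f t x = hsp_app g x) -> f = g.
Proof. by move=> fg; apply/val_inj/dprodP => t; apply: dprodP => x; apply: fg. Qed.

Lemma hsp_app_linf t (x : U t) : linear (fun f : hom_space => hsp_app f x).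
Proof. by []. Qed.

Definition hsp_gen (n : int) (f : hom_space) : Prop := H n (val f).

Lemma hsp_mk_span F : lspan (fun f : fam => exists n, H n f) (mkfam F) ->
  forall t x, hsp_app (hsp_mk F) x = F t x.
Proof. by move=> sF t x; rewrite /hsp_app /hsp_mk to_spanK. Qed.

Lemma hsp_mkE n F : H n (mkfam F) -> forall t x, hsp_app (hsp_mk F) x = F t x.
Proof. by move=> hF; apply: hsp_mk_span; apply: lspan_gen; exists n. Qed.

Lemma gens_hsp (P : hom_space -> Prop) : P 0 -> (forall x y, P x -> P y -> P (x + y)) ->
  (forall n x, hsp_gen n x -> P x) -> forall x, P x.
Proof.
move=> P0 PD PG; apply: spanned_ind => // c x sx [n hx]; apply: (PG n).
rewrite /hsp_gen; have -> : val (c *: to_span _ x : hom_space) = c *: val (to_span _ x : hom_space) by [].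
by rewrite to_spanK //; apply: (hspZ HH).
Qed.

Lemma hsp_app_lin (f : hom_space) t : linear (fun x : U t => hsp_app f x).
Proof.
move: f; apply: gens_hsp.
- by move=> c x y; rewrite /hsp_app /= scaler0 addr0.
- move=> f g lf lg c x y; rewrite !(linD (@hsp_app_linf t _)) lf lg.
  by rewrite scalerDr addrACA.
- by move=> n f hf; apply: (hsp_lin HH hf).
Qed.

(** [to_span] sends families outside the span to 0, so every operation on a Hom space must be shown
    to stay in the span. For an operation that is linear in [f], homogeneous elements suffice. *)
Lemma hsp_op_span (F : hom_space -> forall t, U t -> W t) :
  (forall t x, linear (fun f => F f t x)) ->
  (forall n f, hsp_gen n f -> exists m, H m (mkfam (F f))) ->
  forall f t x, hsp_app (hsp_mk (F f)) x = F f t x.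
Proof.
move=> lF hF f; apply: hsp_mk_span; move: f; apply: gens_hsp.
- have -> : mkfam (F 0) = 0; last exact: lspan0.
  by apply: dprodP => t; apply: dprodP => x /=; rewrite (lin0 (lF t x)).
- move=> f g sf sg.
  have -> : mkfam (F (f + g)) = mkfam (F f) + mkfam (F g); last exact: lspanD.
  by apply: dprodP => t; apply: dprodP => x /=; rewrite (linD (lF t x)).
- by move=> n f /hF [m hm]; apply: lspan_gen; exists m.
Qed.

Lemma hsp_pr_gen n m (f : hom_space) t (x : U t) : hsp_gen m f ->
  hsum x (fun i x' => pr (n + i) (hsp_app f x')) = if n == m then hsp_app f x else 0.
Proof.
move=> hf; have lf := hsp_app_lin f.
move: x; apply: (lin_ext (gens_homog (HU t))).
- apply: (hsum_lin (HU t) (F := fun i x' => pr (n + i) (hsp_app f x'))) => i.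
  exact: (lin_comp (pr_linear (HW t) _) (lf t)).
- by case: eqP => _; [apply: lf | apply: lin_cst0].
move=> i x hx; rewrite (hsum_homog (HU t) hx); last first.
  by move=> j; rewrite (lin0 (lf t)) (pr0 (HW t)).
rewrite (pr_homog (HW t) _ (hsp_homog HH hf hx)).
by have -> : (n + i == m + i) = (n == m) by apply/eqP/eqP => [/addIr|->].
Qed.

Lemma hsp_app_pr n (f : hom_space) t (x : U t) :
  hsp_app (pr n (f : hsp_gr)) x = hsum x (fun i x' => pr (n + i) (hsp_app f x')).
Proof.
apply: (hsp_op_span (F := fun f t x => hsum x (fun i x' => pr (n + i) (hsp_app f x')))).
- move=> t' x'; apply: (hsum_lin_param (HU t') (F := fun i y f => pr (n + i) (hsp_app f y))).
    by move=> m y; apply: (lin_comp (pr_linear (HW t') _) (@hsp_app_linf t' y)).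
  by move=> m g; rewrite (lin0 (hsp_app_lin g (t := t'))) (pr0 (HW t')).
- move=> m g hg; exists m.
  have -> : mkfam (fun t x => hsum x (fun i x' => pr (n + i) (hsp_app g x'))) =
            if n == m then val g else 0.
    apply: dprodP => t'; apply: dprodP => x' /=; rewrite (hsp_pr_gen n x' hg).
    by case: eqP.
  by case: eqP => _; [exact: hg | apply: hsp0].
Qed.

Lemma hsp_prE n m (f : hom_space) : hsp_gen m f -> pr n (f : hsp_gr) = if n == m then f else 0.
Proof.
by move=> hf; apply: hsp_ext => t x; rewrite hsp_app_pr (hsp_pr_gen n x hf); case: eqP.
Qed.

(** The lemmas on [twist] are stated for complexes, yet the differential of [hsp_dg] is itself
    defined through a twist. The same graded space with zero differential breaks the circle. *)
Let V0 : dgvect k := @DgVect k hsp_gr (fun _ => 0).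

Lemma hsp_pr_lin n : linear (pr n : hsp_gr -> hsp_gr).
Proof.
move=> c f g; apply: hsp_ext => t x; rewrite hsp_app_linf !hsp_app_pr.
apply: (hsum_lin_param (HU t) (F := fun i y f => pr (n + i) (hsp_app f y))).
  by move=> m y; apply: (lin_comp (pr_linear (HW t) _) (@hsp_app_linf t y)).
by move=> m h; rewrite (lin0 (hsp_app_lin h (t := t))) (pr0 (HW t)).
Qed.

Lemma hsp_homogP n (f : hsp_gr) : homog n f <-> hsp_gen n f.
Proof.
split=> [|hf]; last by rewrite /homog (hsp_prE n hf) eqxx.
rewrite /homog => <-; move: f; apply: gens_hsp.
- by rewrite (lin0 (hsp_pr_lin n)); apply: hsp0.
- by move=> f g hf hg; rewrite (linD (hsp_pr_lin n)); apply: (hspD HH).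
- by move=> m f hf; rewrite (hsp_prE n hf); case: eqP => [->|_] //; apply: hsp0.
Qed.

Let HV0 : is_dgvect V0.
Proof.
have prpr i j (f : hsp_gr) : pr i (pr j f) = if i == j then pr i f else 0.
  move: f; apply: gens_hsp => [|f g fE gE|m f hf].
  - by rewrite !(lin0 (hsp_pr_lin _)); case: eqP.
  - by rewrite !(linD (hsp_pr_lin _)) fE gE; case: eqP; rewrite ?addr0.
  - rewrite (hsp_prE j hf).
    case: eqP => [->|/eqP jm]; first by rewrite (hsp_prE i hf); case: eqP.
    rewrite (lin0 (hsp_pr_lin _)); case: eqP => // ->.
    by rewrite (hsp_prE j hf) (negPf jm).
split.
- exact: hsp_pr_lin.
- exact: prpr.
- apply: (@sum_components k hsp_gr hsp_gen hsp_pr_lin prpr gens_hsp) => n f hf.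
  exact/hsp_homogP.
- by move=> c x y; rewrite scaler0 addr0.
- by move=> i x _; apply: (lin0 (hsp_pr_lin _)).
- by [].
Qed.

Lemma hsp_twistE n m (f : hsp_gr) : hsp_gen m f -> twist n f = sgn k (n * m) *: f.
Proof. by move/hsp_homogP => hf; apply: (twistE (V := V0) HV0 n hf). Qed.

Lemma hsp_ddE (f : hom_space) t (x : U t) :
  hsp_app (dd (f : hsp_dg)) x = dd (hsp_app f x) - hsp_app (twist 1 (f : hsp_gr)) (dd x).
Proof.
apply: (hsp_op_span (F := fun f t x => dd (hsp_app f x) - hsp_app (twist 1 (f : hsp_gr)) (dd x))).
- move=> t' x'; apply: lin_sub; first exact: (lin_comp (dd_linear (HW t')) (@hsp_app_linf t' x')).
  exact: (lin_comp (@hsp_app_linf t' _) (@twist_lin k V0 HV0 1)).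
- move=> n g hg; exists (n + 1); rewrite (hsp_twistE 1 hg) mul1r.
  exact: (hsp_dd HH hg).
Qed.

Lemma hsp_ddE_homog n (f : hom_space) t (x : U t) : hsp_gen n f ->
  hsp_app (dd (f : hsp_dg)) x = dd (hsp_app f x) - sgn k n *: hsp_app f (dd x).
Proof. by move=> hf; rewrite hsp_ddE (hsp_twistE 1 hf) mul1r. Qed.

Lemma hsp_dgvect : is_dgvect hsp_dg.
Proof.
have ddl : linear (@dd k hsp_dg).
  move=> c f g; apply: hsp_ext => t x; rewrite hsp_app_linf !hsp_ddE hsp_app_linf.
  rewrite (@twist_lin k V0 HV0 1) hsp_app_linf (dd_linear (HW t)) scalerBr opprD addrACA.
  by [].
have ddg n (f : hsp_dg) : hsp_gen n f -> hsp_gen (n + 1) (dd f).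
  move=> hf; rewrite /hsp_gen; have -> : val (dd f) =
      mkfam (fun t x => dd (val f t x : W t) - sgn k n *: (val f t (dd x) : W t)).
    by apply: dprodP => t; apply: dprodP => x; apply: (hsp_ddE_homog x hf).
  exact: (hsp_dd HH hf).
case: HV0 => prl prp prs _ _ _; split=> //.
- by move=> i f /hsp_homogP hf; apply/hsp_homogP/ddg.
- apply: gens_hsp.
  + by rewrite !(lin0 ddl).
  + by move=> f g hf hg; rewrite !(linD ddl) hf hg addr0.
  + move=> n f hf; apply: hsp_ext => t x; rewrite (hsp_ddE_homog x (ddg _ _ hf)).
    rewrite !(hsp_ddE_homog _ hf) (dd_dd (HU t)) (lin0 (hsp_app_lin f (t := t))) scaler0 subr0.
    rewrite (ddB (HW t)) (dd_dd (HW t)) (ddZ (HW t)) sub0r.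
    by rewrite sgnD sgn1 mulrN1 scaleNr opprK addNr.
Qed.

End HomSpace.

(** Staying in the span is preserved by sums, so an argument on which a family depends linearly,
    such as the functional or the acting element, may be taken from a generating set. *)
Lemma lspan_family (k : fieldType) (T : Type) (U W : T -> lmodType k)
  (P : dprod (fun t => dprod (fun _ : U t => W t) : lmodType k) -> Prop)
  (V : grvect k) (G : int -> V -> Prop) (F : V -> forall t, U t -> W t) :
  gens G -> (forall t x, linear (fun v => F v t x)) ->
  (forall n v, G n v -> lspan P (DProd (fun t => DProd (F v t)))) ->
  forall v, lspan P (DProd (fun t => DProd (F v t))).
Proof.
move=> gG lF PF; apply: gG => //.
- have -> : DProd (fun t => DProd (F 0 t)) = 0; last exact: lspan0.
  by apply: dprodP => t; apply: dprodP => x /=; rewrite (lin0 (lF t x)).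
- move=> f g sf sg.
  have -> : DProd (fun t => DProd (F (f + g) t)) = DProd (fun t => DProd (F f t)) + DProd (fun t => DProd (F g t)).
    by apply: dprodP => t; apply: dprodP => x /=; rewrite (linD (lF t x)).
  exact: lspanD.
Qed.

(** * The bimodule of right-module maps *)

Section RightHom.
Variables (k : fieldType) (A B C : dgcat k) (M : bimod A B) (N : bimod C B).
Hypotheses (HM : is_bimod M) (HN : is_bimod N).
Notation R := (homR M N).

Section Fibre.
Variables (c : C) (a : A).

Lemma rhom_axioms : hom_space_axioms (U := fun b => M a b) (W := fun b => N c b) (@is_rhom k A B C M N c a).
Proof.
split.
- by move=> n f [].
- by move=> n f [].
- split=> [b|b i x hx|b b' x z] /=; first exact: lin_cst0; first exact: homog0.
  by rewrite (ract0l HN).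
- move=> n f g [fl fh fr] [gl gh gr]; split=> [b|b i x hx|b b' x z] /=.
  + exact: lin_add.
  + by apply: homogD; auto.
  + by rewrite fr gr (ractDl HN).
- move=> n s f [fl fh fr]; split=> [b|b i x hx|b b' x z] /=.
  + exact: lin_scale.
  + by apply: homogZ; auto.
  + by rewrite fr (ractZl HN).
- move=> n f [fl fh fr]; split=> [b|b i x hx|b b' x z] /=.
  + apply: lin_sub; first exact: (lin_comp (dd_linear (bcar_dgvect HN c b)) (fl b)).
    exact/lin_scale/(lin_comp (fl b) (dd_linear (bcar_dgvect HM a b))).
  + apply: homogB; first by rewrite addrAC; apply/dd_homog/fh.
    apply: homogZ; rewrite -addrA [1 + i]addrC; apply: fh; exact: dd_homog.
  + have lf := fl b.
    move: x; apply: (lin_ext (gens_homog (bcar_dgvect HM a b)) (f := fun x => dd (f b' (ract M x z)) - sgn k n *: f b' (dd (ract M x z)))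
      (g := fun x => ract N (dd (f b x) - sgn k n *: f b (dd x)) z)).
    * apply: lin_sub; first exact: (lin_comp (dd_linear (bcar_dgvect HN c b')) (lin_comp (fl b') (ract_linearl HM z))).
      exact: (lin_scale _ (lin_comp (fl b') (lin_comp (dd_linear (bcar_dgvect HM a b')) (ract_linearl HM z)))).
    * apply: (lin_comp (ract_linearl HN z)); apply: lin_sub; first exact: (lin_comp (dd_linear (bcar_dgvect HN c b)) lf).
      exact/lin_scale/(lin_comp lf (dd_linear (bcar_dgvect HM a b))).
    move=> i x hx; rewrite (ract_dd HM _ hx) fr (linD (fl b')) (linZ (fl b')) !fr.
    rewrite (ract_dd HN _ (fh _ _ _ hx)) (linB (ract_linearl HN z)) (ractZl HN).
    by rewrite scalerDr opprD scalerA -sgnD addrACA addrN addr0.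
Qed.

Let HU b : is_dgvect (M a b) := bcar_dgvect HM a b.
Let HW b : is_dgvect (N c b) := bcar_dgvect HN c b.

Lemma rhom_dgvect : is_dgvect (R c a).
Proof. exact: (hsp_dgvect HU HW rhom_axioms). Qed.

Definition rgen (n : int) (f : R c a) : Prop := is_rhom n (val f).

Lemma rgenP n (f : R c a) : homog n f <-> rgen n f.
Proof. exact: (hsp_homogP HU HW rhom_axioms). Qed.

Lemma rhom_ext (f g : R c a) : (forall b (x : M a b), rapp f x = rapp g x) -> f = g.
Proof. exact: hsp_ext. Qed.

Lemma rapp_linf b (x : M a b) : linear (fun f : R c a => rapp f x).
Proof. by []. Qed.

Lemma rapp_lin (f : R c a) b : linear (fun x : M a b => rapp f x).
Proof. exact: (hsp_app_lin rhom_axioms f). Qed.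

Lemma rapp_ract (f : R c a) b b' (x : M a b) (z : mor B b' b) : rapp f (ract M x z) = ract N (rapp f x) z.
Proof.
move: f; apply: (lin_ext (gens_homog rhom_dgvect) (@rapp_linf b' _) (lin_comp (ract_linearl HN z) (@rapp_linf b x))).
by move=> n f /rgenP [_ _]; apply.
Qed.

Lemma rapp_homog n i (f : R c a) b (x : M a b) : homog n f -> homog i x -> homog (n + i) (rapp f x).
Proof. by move=> /rgenP [_ fh _]; apply: fh. Qed.

Lemma rapp_dd n (f : R c a) b (x : M a b) : homog n f ->
  rapp (dd f) x = dd (rapp f x) - sgn k n *: rapp f (dd x).
Proof. by move=> /rgenP hf; apply: (hsp_ddE_homog HU HW rhom_axioms x hf). Qed.

Lemma to_rhom_span (F : forall b, M a b -> N c b) :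
  lspan (fun f => exists n, is_rhom n f) (DProd (fun b => DProd (F b)) : rfam M N c a) ->
  forall b (x : M a b), rapp (to_rhom F) x = F b x.
Proof. by move=> sF b x; rewrite /rapp /to_rhom to_spanK. Qed.

Lemma homog_rhom n (f : R c a) : (forall b i (x : M a b), homog i x -> homog (n + i) (rapp f x)) -> homog n f.
Proof.
move=> fh; apply/rgenP; split=> [b|b|b b' x z]; [exact: (@rapp_lin f) | exact: fh | exact: rapp_ract].
Qed.

End Fibre.

Lemma rapp_lact c c' a (z : mor C c' c) (f : R c' a) b (x : M a b) :
  rapp (lact R z f) x = lact N z (rapp f x).
Proof.
apply: to_rhom_span; move: z b x.
pose F z (f : R c' a) b (x : M a b) := lact N z (rapp f x) : N c b.
move=> z _ _; apply: (lspan_family (G := @homog k (R c' a)) (F := F z) (gens_homog (@rhom_dgvect c' a))).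
  by move=> b x; apply: (lin_comp (lact_linearr HN z) (@rapp_linf c' a b x)).
move=> n {}f hf; move: z; apply: (lspan_family (G := @homog k (mor C c' c)) (F := F^~ f) (gens_homog (mor_dgvect c' c))).
  by move=> b x; apply: (lact_linearl HN).
move=> i z hz; apply: lspan_gen; exists (i + n); split=> [b|b j x hx|b b' x y] /=.
- exact: (lin_comp (lact_linearr HN z) (rapp_lin f (b:=b))).
- by rewrite -addrA; apply: (lact_homog HN) => //; apply: rapp_homog.
- by rewrite /F rapp_ract (lact_ract HN).
Qed.

Lemma rapp_ractr c a a' (f : R c a) (z : mor A a' a) b (x : M a' b) :
  rapp (ract R f z) x = rapp f (lact M z x).
Proof.
apply: to_rhom_span; move: z b x.
pose F z (f : R c a) b (x : M a' b) := rapp f (lact M z x) : N c b.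
move=> z _ _; apply: (lspan_family (G := @homog k (R c a)) (F := F z) (gens_homog (@rhom_dgvect c a))).
  by move=> b x; apply: rapp_linf.
move=> n {}f hf; move: z; apply: (lspan_family (G := @homog k (mor A a' a)) (F := F^~ f) (gens_homog (mor_dgvect a' a))).
  by move=> b x; apply: (lin_comp (rapp_lin f (b:=b)) (lact_linearl HM x)).
move=> i z hz; apply: lspan_gen; exists (n + i); split=> [b|b j x hx|b b' x y] /=.
- exact: (lin_comp (rapp_lin f (b:=b)) (lact_linearr HM z)).
- by rewrite -addrA; apply: rapp_homog => //; apply: (lact_homog HM).
- by rewrite /F (lact_ract HM) rapp_ract.
Qed.

#[export] Instance homR_bimod : is_bimod R.
Proof.
split.
- exact: rhom_dgvect.
- by move=> c c' a f s z z'; apply: rhom_ext => b x; rewrite rapp_linf !rapp_lact (lact_linearl HN).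
- by move=> c c' a z s f g; apply: rhom_ext => b x; rewrite rapp_linf !rapp_lact rapp_linf (lact_linearr HN).
- by move=> c a a' z s f g; apply: rhom_ext => b x; rewrite rapp_linf !rapp_ractr rapp_linf.
- by move=> c a a' f s z z'; apply: rhom_ext => b x; rewrite rapp_linf !rapp_ractr (lact_linearl HM) rapp_lin.
- move=> c c' a i j z f hz hf; apply: homog_rhom => b n x hx; rewrite rapp_lact -addrA.
  by apply: (lact_homog HN) => //; apply: rapp_homog.
- move=> c a a' i j f z hf hz; apply: homog_rhom => b n x hx; rewrite rapp_ractr -addrA.
  by apply: rapp_homog => //; apply: (lact_homog HM).
- move=> c c' a i z f hz.
  have ll (w : mor C c' c) : linear (fun f : R c' a => lact R w f).
    by move=> s g h; apply: rhom_ext => b x; rewrite rapp_linf !rapp_lact rapp_linf (lact_linearr HN).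
  move: f; apply: (lin_ext (gens_homog (@rhom_dgvect c' a))
    (lin_comp (dd_linear (@rhom_dgvect c a)) (ll z))
    (lin_add (ll _) (lin_scale _ (lin_comp (ll z) (dd_linear (@rhom_dgvect c' a)))))).
  move=> n f hf.
  have hzf : homog (i + n) (lact R z f).
    apply: homog_rhom => b j x hx; rewrite rapp_lact -addrA.
    by apply: (lact_homog HN) => //; apply: rapp_homog.
  apply: rhom_ext => b x.
  rewrite (linD (rapp_linf _)) (linZ (rapp_linf _)) (rapp_dd _ hzf) !rapp_lact (rapp_dd _ hf).
  rewrite (lact_dd HN _ hz) (linB (lact_linearr HN z)) (lactZr HN) scalerBr scalerA -sgnD.
  by rewrite addrA.
- move=> c a a' n f z hf.
  have lr : linear (fun z : mor A a' a => ract R f z).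
    by move=> s w w'; apply: rhom_ext => b x; rewrite rapp_linf !rapp_ractr (lact_linearl HM) rapp_lin.
  have lr' : linear (fun z : mor A a' a => ract R (dd f) z).
    by move=> s w w'; apply: rhom_ext => b x; rewrite rapp_linf !rapp_ractr (lact_linearl HM) rapp_lin.
  move: z; apply: (lin_ext (gens_homog (mor_dgvect a' a)) (lin_comp (dd_linear (@rhom_dgvect c a')) lr)
    (lin_add lr' (lin_scale _ (lin_comp lr (dd_linear (mor_dgvect a' a)))))).
  move=> i z hz.
  have hfz : homog (n + i) (ract R f z).
    apply: homog_rhom => b j x hx; rewrite rapp_ractr -addrA.
    by apply: rapp_homog => //; apply: (lact_homog HM).
  apply: rhom_ext => b x.
  rewrite (linD (rapp_linf _)) (linZ (rapp_linf _)) (rapp_dd _ hfz) !rapp_ractr (rapp_dd _ hf).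
  rewrite (lact_dd HM _ hz) (linD (rapp_lin f (b:=b))) (linZ (rapp_lin f (b:=b))) scalerDr scalerA -sgnD.
  by abelian.
- by move=> *; apply: rhom_ext => b x; rewrite !rapp_lact (lact_comp HN).
- by move=> *; apply: rhom_ext => b x; rewrite !rapp_ractr (lact_comp HM).
- by move=> *; apply: rhom_ext => b x; rewrite !(rapp_ractr, rapp_lact).
- by move=> *; apply: rhom_ext => b x; rewrite rapp_lact (lact1 HN).
- by move=> *; apply: rhom_ext => b x; rewrite rapp_ractr (lact1 HM).
Qed.

End RightHom.

(** * The bimodule of left-module maps, with its Koszul signs *)

Section LeftHom.
Variables (k : fieldType) (A B C : dgcat k) (M : bimod A B) (N : bimod A C).
Hypotheses (HM : is_bimod M) (HN : is_bimod N).
Notation L := (homL M N).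

Section Fibre.
Variables (b : B) (c : C).

Lemma lhom_axioms : hom_space_axioms (U := fun a => M a b) (W := fun a => N a c) (@is_lhom k A B C M N b c).
Proof.
split.
- by move=> n f [].
- by move=> n f [].
- split=> [a|a i x hx|a a' i z x hz] /=; first exact: lin_cst0; first exact: homog0.
  by rewrite (lact0r HN) scaler0.
- move=> n f g [fl fh fr] [gl gh gr]; split=> [a|a i x hx|a a' i z x hz] /=.
  + exact: lin_add.
  + by apply: homogD; auto.
  + by rewrite (fr _ _ _ _ _ hz) (gr _ _ _ _ _ hz) (lactDr HN) scalerDr.
- move=> n s f [fl fh fr]; split=> [a|a i x hx|a a' i z x hz] /=.
  + exact: lin_scale.
  + by apply: homogZ; auto.
  + by rewrite (fr _ _ _ _ _ hz) (lactZr HN) !scalerA mulrC.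
- move=> n f [fl fh fr]; split=> [a|a i x hx|a a' i z x hz] /=.
  + apply: lin_sub; first exact: (lin_comp (dd_linear (bcar_dgvect HN a c)) (fl a)).
    exact/lin_scale/(lin_comp (fl a) (dd_linear (bcar_dgvect HM a b))).
  + apply: homogB; first by rewrite addrAC; apply/dd_homog/fh.
    apply: homogZ; rewrite -addrA [1 + i]addrC; apply: fh; exact: dd_homog.
  + rewrite (lact_dd HM _ hz) (linD (fl a)) (linZ (fl a)) !(fr _ _ _ _ _ hz).
    rewrite (fr _ _ _ _ _ (dd_homog (mor_dgvect _ _) hz)) (ddZ (bcar_dgvect HN a c)) (lact_dd HN _ hz).
    rewrite (linB (lact_linearr HN z)) (lactZr HN) scalerBr !scalerDr !sgnZZ.
    rewrite (sgn_eq k (m := n + n * (i + 1)) (n := n * i)); last by odd_tac.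
    rewrite (sgn_eq k (m := n + i + n * i) (n := (n + 1) * i + n)); last by odd_tac.
    rewrite (sgn_eq k (m := n * i + i) (n := (n + 1) * i)); last by odd_tac.
    set u := _ *: lact N z (f _ (dd x)).
    by abelian.
Qed.

Let HU a : is_dgvect (M a b) := bcar_dgvect HM a b.
Let HW a : is_dgvect (N a c) := bcar_dgvect HN a c.

Lemma lhom_dgvect : is_dgvect (L b c).
Proof. exact: (hsp_dgvect HU HW lhom_axioms). Qed.

Definition lgen (n : int) (f : L b c) : Prop := is_lhom n (val f).

Lemma lgenP n (f : L b c) : homog n f <-> lgen n f.
Proof. exact: (hsp_homogP HU HW lhom_axioms). Qed.

Lemma lhom_ext (f g : L b c) : (forall a (x : M a b), lapp f x = lapp g x) -> f = g.
Proof. exact: hsp_ext. Qed.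

Lemma lapp_linf a (x : M a b) : linear (fun f : L b c => lapp f x).
Proof. by []. Qed.

Lemma lapp_lin (f : L b c) a : linear (fun x : M a b => lapp f x).
Proof. exact: (hsp_app_lin lhom_axioms f). Qed.

(** The signs of both actions on [homL] depend on the degree of the argument, so equalities are
    checked on homogeneous arguments. *)
Lemma lhom_ext_homog (f g : L b c) :
  (forall a i (x : M a b), homog i x -> lapp f x = lapp g x) -> f = g.
Proof.
move=> fg; apply: lhom_ext => a.
by apply: (lin_ext (gens_homog (HU a)) (lapp_lin f (a:=a)) (lapp_lin g (a:=a))) => i x; apply: fg.
Qed.

Lemma lapp_lactl n i (f : L b c) a a' (z : mor A a' a) (x : M a' b) : homog n f -> homog i z ->
  lapp f (lact M z x) = sgn k (n * i) *: lact N z (lapp f x).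
Proof. by move=> /lgenP [_ _ fr] hz; apply: fr. Qed.

Lemma lapp_homog n i (f : L b c) a (x : M a b) : homog n f -> homog i x -> homog (n + i) (lapp f x).
Proof. by move=> /lgenP [_ fh _]; apply: fh. Qed.

Lemma lapp_dd n (f : L b c) a (x : M a b) : homog n f ->
  lapp (dd f) x = dd (lapp f x) - sgn k n *: lapp f (dd x).
Proof. by move=> /lgenP hf; apply: (hsp_ddE_homog HU HW lhom_axioms x hf). Qed.

Lemma to_lhom_span (F : forall a, M a b -> N a c) :
  lspan (fun f => exists n, is_lhom n f) (DProd (fun a => DProd (F a)) : lfam M N b c) ->
  forall a (x : M a b), lapp (to_lhom F) x = F a x.
Proof. by move=> sF a x; rewrite /lapp /to_lhom to_spanK. Qed.

Lemma homog_lhom n (f : L b c) : (forall a i (x : M a b), homog i x -> homog (n + i) (lapp f x)) ->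
  (forall a a' i (z : mor A a' a) (x : M a' b), homog i z ->
    lapp f (lact M z x) = sgn k (n * i) *: lact N z (lapp f x)) -> homog n f.
Proof. by move=> fh fr; apply/lgenP; split=> [a|a|//]; [exact: (@lapp_lin f) | exact: fh]. Qed.

End Fibre.

Let lactF b b' c (z : mor B b' b) (f : L b' c) a (x : M a b) : N a c :=
  hsum z (fun i z' => hsum (f : lhom_gr M N b' c) (fun n f' => hsum x (fun j x' =>
         sgn k (i * (n + j)) *: lapp f' (ract M x' z')))).

Let lactF_linf b b' c (z : mor B b' b) a (x : M a b) : linear (fun f : L b' c => lactF z f x).
Proof.
apply: (hsum_lin_param (mor_dgvect b' b) (F := fun i z' f => hsum (f : lhom_gr M N b' c) (fun n f' => hsum x (fun j x' =>
         sgn k (i * (n + j)) *: lapp f' (ract M x' z'))))) => [i w|i f].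
  apply: (hsum_lin (lhom_dgvect b' c) (F := fun n f' => hsum x (fun j x' =>
         sgn k (i * (n + j)) *: lapp f' (ract M x' w)))) => n.
  apply: (hsum_lin_param (bcar_dgvect HM a b) (F := fun j x' f' => sgn k (i * (n + j)) *: lapp f' (ract M x' w))) => [j y|j g].
    exact: (lin_scale _ (lapp_linf (c:=c) (ract M y w))).
  by rewrite (ract0l HM) (lin0 (lapp_lin g (a:=a))) scaler0.
rewrite /hsum fssum0 // => n; rewrite fssum0 // => j.
by rewrite (ract0r HM) (lin0 (lapp_lin _ (a:=a))) scaler0.
Qed.

Let lactF_linz b b' c (f : L b' c) a (x : M a b) : linear (fun z : mor B b' b => lactF z f x).
Proof.
apply: (hsum_lin (mor_dgvect b' b) (F := fun i z' => hsum (f : lhom_gr M N b' c) (fun n f' => hsum x (fun j x' =>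
         sgn k (i * (n + j)) *: lapp f' (ract M x' z'))))) => i.
apply: (hsum_lin_param (lhom_dgvect b' c) (F := fun n f' z' => hsum x (fun j x' =>
         sgn k (i * (n + j)) *: lapp f' (ract M x' z')))) => [n g|n w].
  apply: (hsum_lin_param (bcar_dgvect HM a b) (F := fun j x' z' => sgn k (i * (n + j)) *: lapp g (ract M x' z'))) => [j y|j w].
    exact: (lin_scale _ (lin_comp (lapp_lin g (a:=a)) (ract_linearr HM y))).
  by rewrite (ract0l HM) (lin0 (lapp_lin g (a:=a))) scaler0.
by rewrite /hsum fssum0 // => j; rewrite (lin0 (lapp_linf _)) scaler0.
Qed.

Let lactF_homog b b' c i n (z : mor B b' b) (f : L b' c) a (x : M a b) : homog i z -> homog n f ->
  lactF z f x = hsum x (fun j x' => sgn k (i * (n + j)) *: lapp f (ract M x' z)).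
Proof.
move=> hz hf; rewrite /lactF (hsum_homog (mor_dgvect b' b) hz).
  by rewrite (hsum_homog (lhom_dgvect b' c) hf) // => m; rewrite /hsum fssum0 // => j; rewrite (lin0 (lapp_linf _)) scaler0.
move=> m; rewrite /hsum fssum0 // => n'; rewrite fssum0 // => j.
by rewrite (ract0r HM) (lin0 (lapp_lin _ (a:=a))) scaler0.
Qed.

Let lactF_homog3 b b' c i n j (z : mor B b' b) (f : L b' c) a (x : M a b) :
  homog i z -> homog n f -> homog j x ->
  lactF z f x = sgn k (i * (n + j)) *: lapp f (ract M x z).
Proof.
move=> hz hf hx; rewrite (lactF_homog x hz hf) (hsum_homog (bcar_dgvect HM a b) hx) // => m.
by rewrite (ract0l HM) (lin0 (lapp_lin f (a:=a))) scaler0.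
Qed.

Let lactF_linx b b' c i n (z : mor B b' b) (f : L b' c) a : homog i z -> homog n f ->
  linear (fun x : M a b => lactF z f x).
Proof.
move=> hz hf s x y; rewrite !(lactF_homog _ hz hf).
apply: (hsum_lin (bcar_dgvect HM a b) (F := fun j x' => sgn k (i * (n + j)) *: lapp f (ract M x' z))) => j.
exact: (lin_scale _ (lin_comp (lapp_lin f (a:=a)) (ract_linearl HM z))).
Qed.

Let lapp_lactE b b' c (z : mor B b' b) (f : L b' c) a (x : M a b) :
  lapp (lact L z f) x = lactF z f x.
Proof.
apply: to_lhom_span.
apply: (lspan_family (G := @homog k (L b' c)) (F := lactF z) (gens_homog (lhom_dgvect b' c))).
  by move=> a' x'; apply: lactF_linf.
move=> n {}f hf; move: z.
apply: (lspan_family (G := @homog k (mor B b' b)) (F := (@lactF b b' c)^~ f) (gens_homog (mor_dgvect b' b))).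
  by move=> a' x'; apply: lactF_linz.
move=> i z hz; apply: lspan_gen; exists (i + n); split=> [a'|a' j y hy|a1 a2 j w y hw] /=.
- exact: (lactF_linx hz hf).
- rewrite (lactF_homog3 hz hf hy); apply: homogZ.
  have -> : i + n + j = n + (j + i) by ring.
  by apply: lapp_homog => //; apply: (ract_homog HM).
- move: y; apply: (lin_ext (gens_homog (bcar_dgvect HM a2 b))
    (lin_comp (lactF_linx hz hf (a:=a1)) (lact_linearr HM w))
    (lin_scale _ (lin_comp (lact_linearr HN w) (lactF_linx hz hf (a:=a2))))).
  move=> l y hy; rewrite (lactF_homog3 hz hf (lact_homog HM hw hy)) (lactF_homog3 hz hf hy).
  rewrite -(lact_ract HM) (lapp_lactl _ hf hw) (lactZr HN) !sgnZZ.
  by apply: sgnZ_eq; odd_tac.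
Qed.

Lemma lapp_lact b b' c i n j (z : mor B b' b) (f : L b' c) a (x : M a b) :
  homog i z -> homog n f -> homog j x ->
  lapp (lact L z f) x = sgn k (i * (n + j)) *: lapp f (ract M x z).
Proof. by move=> hz hf hx; rewrite lapp_lactE; apply: lactF_homog3. Qed.

Let ractF b c c' (f : L b c) (z : mor C c' c) a (x : M a b) : N a c' :=
  hsum z (fun i z' => ract N (lapp f (twist i x)) z').

Let ractF_homog b c c' i (f : L b c) (z : mor C c' c) a (x : M a b) : homog i z ->
  ractF f z x = ract N (lapp f (twist i x)) z.
Proof.
by move=> hz; rewrite /ractF (hsum_homog (mor_dgvect c' c) hz) // => m; rewrite (ract0r HN).
Qed.

Let ractF_linf b c c' (z : mor C c' c) a (x : M a b) : linear (fun f : L b c => ractF f z x).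
Proof.
apply: (hsum_lin_param (mor_dgvect c' c) (F := fun i z' f => ract N (lapp f (twist i x)) z')) => [i w|i f].
  exact: (lin_comp (ract_linearl HN w) (lapp_linf (c:=c) _)).
by rewrite (ract0r HN).
Qed.

Let ractF_linz b c c' (f : L b c) a (x : M a b) : linear (fun z : mor C c' c => ractF f z x).
Proof.
apply: (hsum_lin (mor_dgvect c' c) (F := fun i z' => ract N (lapp f (twist i x)) z')) => i.
exact: ract_linearr.
Qed.

Let lapp_ractE b c c' (f : L b c) (z : mor C c' c) a (x : M a b) :
  lapp (ract L f z) x = ractF f z x.
Proof.
apply: to_lhom_span.
apply: (lspan_family (G := @homog k (L b c)) (F := (@ractF b c c')^~ z) (gens_homog (lhom_dgvect b c))).
  by move=> a' x'; apply: ractF_linf.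
move=> n {}f hf; move: z.
apply: (lspan_family (G := @homog k (mor C c' c)) (F := @ractF b c c' f) (gens_homog (mor_dgvect c' c))).
  by move=> a' x'; apply: ractF_linz.
have Hab a' := bcar_dgvect HM a' b.
move=> i z hz; apply: lspan_gen; exists (n + i).
have lx a' : linear (fun y : M a' b => ractF f z y).
  move=> s y y'; rewrite !(ractF_homog _ _ hz).
  exact: (lin_comp (ract_linearl HN z) (lin_comp (lapp_lin f (a:=a')) (twist_lin (Hab a') i)) s y y').
split=> [a'|a' j y hy|a1 a2 j w y hw] /=.
- exact: lx.
- rewrite (ractF_homog _ _ hz) (twistE (Hab a') _ hy) (linZ (lapp_lin f (a:=a'))) (ractZl HN).
  apply: homogZ; have -> : n + i + j = n + j + i by ring.
  by apply: (ract_homog HN) => //; apply: lapp_homog.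
- move: y; apply: (lin_ext (gens_homog (Hab a2)) (lin_comp (lx a1) (lact_linearr HM w))
    (lin_scale _ (lin_comp (lact_linearr HN w) (lx a2)))).
  move=> l y hy; rewrite !(ractF_homog _ _ hz) (twistE (Hab a2) _ hy) (twistE (Hab a1) _ (lact_homog HM hw hy)).
  rewrite (linZ (lapp_lin f (a:=a1))) (linZ (lapp_lin f (a:=a2))) (lapp_lactl _ hf hw) !(ractZl HN) (lactZr HN).
  rewrite (lact_ract HN) !sgnZZ; apply: sgnZ_eq; odd_tac.
Qed.

Lemma lapp_ractr b c c' i j (f : L b c) (z : mor C c' c) a (x : M a b) : homog i z -> homog j x ->
  lapp (ract L f z) x = sgn k (i * j) *: ract N (lapp f x) z.
Proof.
move=> hz hx; rewrite lapp_ractE (ractF_homog _ _ hz) (twistE (bcar_dgvect HM a b) _ hx).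
by rewrite (linZ (lapp_lin f (a:=a))) (ractZl HN).
Qed.

#[export] Instance homL_bimod : is_bimod L.
Proof.
have Hab a b := bcar_dgvect HM a b.
have Hac a c := bcar_dgvect HN a c.
have l1 b b' c (f : L b' c) : linear (fun z : mor B b' b => lact L z f).
  by move=> s z z'; apply: lhom_ext => a x; rewrite lapp_linf !lapp_lactE lactF_linz.
have l2 b b' c (z : mor B b' b) : linear (fun f : L b' c => lact L z f).
  by move=> s f g; apply: lhom_ext => a x; rewrite lapp_linf !lapp_lactE lactF_linf.
have l3 b c c' (z : mor C c' c) : linear (fun f : L b c => ract L f z).
  by move=> s f g; apply: lhom_ext => a x; rewrite lapp_linf !lapp_ractE ractF_linf.
have l4 b c c' (f : L b c) : linear (fun z : mor C c' c => ract L f z).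
  by move=> s z z'; apply: lhom_ext => a x; rewrite lapp_linf !lapp_ractE ractF_linz.
have hl b b' c i n (z : mor B b' b) (f : L b' c) : homog i z -> homog n f -> homog (i + n) (lact L z f).
  move=> hz hf; apply: homog_lhom => [a j x hx|a a' j w x hw].
    rewrite (lapp_lact hz hf hx); apply: homogZ.
    have -> : i + n + j = n + (j + i) by ring.
    by apply: lapp_homog => //; apply: (ract_homog HM).
  move: x; apply: (lin_ext (gens_homog (Hab a' b)) (lin_comp (lapp_lin _ (a:=a)) (lact_linearr HM w))
    (lin_scale _ (lin_comp (lact_linearr HN w) (lapp_lin _ (a:=a'))))) => l x hx.
  rewrite (lapp_lact hz hf hx) (lapp_lact hz hf (lact_homog HM hw hx)) -(lact_ract HM) (lapp_lactl _ hf hw).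
  by rewrite (lactZr HN) !sgnZZ; apply: sgnZ_eq; odd_tac.
have hr b c c' i n (f : L b c) (z : mor C c' c) : homog n f -> homog i z -> homog (n + i) (ract L f z).
  move=> hf hz; apply: homog_lhom => [a j x hx|a a' j w x hw].
    rewrite (lapp_ractr _ hz hx); apply: homogZ.
    have -> : n + i + j = n + j + i by ring.
    by apply: (ract_homog HN) => //; apply: lapp_homog.
  move: x; apply: (lin_ext (gens_homog (Hab a' b)) (lin_comp (lapp_lin _ (a:=a)) (lact_linearr HM w))
    (lin_scale _ (lin_comp (lact_linearr HN w) (lapp_lin _ (a:=a'))))) => l x hx.
  rewrite (lapp_ractr _ hz hx) (lapp_ractr _ hz (lact_homog HM hw hx)) (lapp_lactl _ hf hw).
  by rewrite (lactZr HN) (ractZl HN) (lact_ract HN) !sgnZZ; apply: sgnZ_eq; odd_tac.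
split=> //.
- exact: lhom_dgvect.
- by move=> a b b' i j m y hm hy; exact: (hr _ _ _ _ _ _ _ hm hy).
- move=> b b' c i z f hz; move: f.
  apply: (lin_ext (gens_homog (lhom_dgvect b' c)) (lin_comp (dd_linear (lhom_dgvect b c)) (l2 _ _ _ z))
    (lin_add (l2 _ _ _ _) (lin_scale _ (lin_comp (l2 _ _ _ z) (dd_linear (lhom_dgvect b' c)))))) => n f hf.
  have hdf := dd_homog (lhom_dgvect b' c) hf; have hdz := dd_homog (mor_dgvect _ _) hz.
  apply: lhom_ext_homog => a j x hx; have hdx := dd_homog (Hab a b) hx.
  rewrite (linD (lapp_linf _)) (linZ (lapp_linf _)) (lapp_dd _ (hl _ _ _ _ _ _ _ hz hf)).
  rewrite (lapp_lact hz hf hx) (lapp_lact hz hf hdx) (lapp_lact hdz hf hx) (lapp_lact hz hdf hx).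
  rewrite (lapp_dd _ hf) (ract_dd HM _ hx) (linD (lapp_lin f (a:=a))) (linZ (lapp_lin f (a:=a))) (ddZ (Hac a c)).
  rewrite !scalerBr !scalerDr !sgnZZ.
  rewrite (sgn_eq k (m := i + n + i * (n + (j + 1))) (n := i + i * (n + 1 + j) + n)); last by odd_tac.
  rewrite (sgn_eq k (m := i + i * (n + 1 + j) + n + j) (n := (i + 1) * (n + j))); last by odd_tac.
  rewrite (sgn_eq k (m := i + i * (n + 1 + j)) (n := i * (n + j))); last by odd_tac.
  by abelian.
- move=> b c c' n f z hf.
  move: z; apply: (lin_ext (gens_homog (mor_dgvect c' c)) (lin_comp (dd_linear (lhom_dgvect b c')) (l4 _ _ _ f))
    (lin_add (l4 _ _ _ _) (lin_scale _ (lin_comp (l4 _ _ _ f) (dd_linear (mor_dgvect c' c)))))) => i z hz.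
  have hdz := dd_homog (mor_dgvect _ _) hz.
  apply: lhom_ext_homog => a j x hx; have hdx := dd_homog (Hab a b) hx.
  rewrite (linD (lapp_linf _)) (linZ (lapp_linf _)) (lapp_dd _ (hr _ _ _ _ _ _ _ hf hz)).
  rewrite (lapp_ractr _ hz hx) (lapp_ractr _ hz hdx) (lapp_ractr _ hz hx) (lapp_ractr _ hdz hx).
  rewrite (lapp_dd _ hf) (ddZ (Hac a c')) (ract_dd HN _ (lapp_homog hf hx)) (linB (ract_linearl HN z)) (ractZl HN).
  rewrite !scalerBr !scalerDr !sgnZZ.
  by rewrite addrAC; congr (_ - _ + _); apply: sgnZ_eq; odd_tac.
- move=> b b' b'' c z z' f; move: f.
  apply: (lin_ext (gens_homog (lhom_dgvect b'' c)) (l2 _ _ _ _) (lin_comp (l2 _ _ _ z) (l2 _ _ _ z'))) => n f hf.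
  move: z; apply: (lin_ext (gens_homog (mor_dgvect b' b)) (lin_comp (l1 _ _ _ f) (mcomp_linearl z')) (l1 _ _ _ _)) => i z hz.
  move: z'; apply: (lin_ext (gens_homog (mor_dgvect b'' b')) (lin_comp (l1 _ _ _ f) (mcomp_linearr z)) (lin_comp (l2 _ _ _ z) (l1 _ _ _ f))) => i' z' hz'.
  apply: lhom_ext_homog => a j x hx.
  rewrite (lapp_lact (mcomp_homog hz hz') hf hx) (lapp_lact hz (hl _ _ _ _ _ _ _ hz' hf) hx).
  rewrite (lapp_lact hz' hf (ract_homog HM hx hz)) (ract_comp HM) sgnZZ.
  by apply: sgnZ_eq; odd_tac.
- move=> b c c' c'' f z z'.
  move: z; apply: (lin_ext (gens_homog (mor_dgvect c' c)) (lin_comp (l4 _ _ _ f) (mcomp_linearl z')) (lin_comp (l3 _ _ _ z') (l4 _ _ _ f))) => i z hz.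
  move: z'; apply: (lin_ext (gens_homog (mor_dgvect c'' c')) (lin_comp (l4 _ _ _ f) (mcomp_linearr z)) (l4 _ _ _ _)) => i' z' hz'.
  apply: lhom_ext_homog => a j x hx.
  rewrite (lapp_ractr _ (mcomp_homog hz hz') hx) !(lapp_ractr _ hz' hx) (lapp_ractr _ hz hx).
  by rewrite (ractZl HN) (ract_comp HN) sgnZZ; apply: sgnZ_eq; odd_tac.
- move=> b b' c c' z f z'; move: f.
  apply: (lin_ext (gens_homog (lhom_dgvect b' c)) (lin_comp (l2 _ _ _ z) (l3 _ _ _ z')) (lin_comp (l3 _ _ _ z') (l2 _ _ _ z))) => n f hf.
  move: z; apply: (lin_ext (gens_homog (mor_dgvect b' b)) (l1 _ _ _ _) (lin_comp (l3 _ _ _ z') (l1 _ _ _ f))) => i z hz.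
  move: z'; apply: (lin_ext (gens_homog (mor_dgvect c' c)) (lin_comp (l2 _ _ _ z) (l4 _ _ _ f)) (l4 _ _ _ _)) => i' z' hz'.
  apply: lhom_ext_homog => a j x hx.
  rewrite (lapp_lact hz (hr _ _ _ _ _ _ _ hf hz') hx) (lapp_ractr _ hz' (ract_homog HM hx hz)).
  rewrite (lapp_ractr _ hz' hx) (lapp_lact hz hf hx) (ractZl HN) !sgnZZ.
  by apply: sgnZ_eq; odd_tac.
- move=> b c f; move: f; apply: (lin_ext (gens_homog (lhom_dgvect b c)) (l2 _ _ _ _) (@lin_id _ _)) => n f hf.
  apply: lhom_ext_homog => a j x hx; rewrite (lapp_lact (idm_homog b) hf hx) (ract1 HM).
  by rewrite mul0r sgn0 scale1r.
- move=> b c f; apply: lhom_ext_homog => a j x hx; rewrite (lapp_ractr _ (idm_homog c) hx) (ract1 HN).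
  by rewrite mul0r sgn0 scale1r.
Qed.

End LeftHom.

(** * The dualising functors *)

Section HsumCongruence.
Variables (k : fieldType) (V : dgvect k) (HV : is_dgvect V) (W : lmodType k).

Lemma eq_hsum (F G : int -> V -> W) (x : V) :
  (forall i y, homog i y -> F i y = G i y) -> hsum x F = hsum x G.
Proof.
by move=> FG; rewrite /hsum; apply: eq_fsbigr => i _; apply/FG/(homog_pr HV).
Qed.

(** Once the signs of a formula are absorbed into a linear expression, this removes the sum over
    homogeneous components; the definitions of [dualB_map] and [dualA_map] are simplified by it. *)
Lemma hsum_linear (f : V -> W) (x : V) : linear f -> hsum x (fun _ y => f y) = f x.
Proof.
move=> lf; move: x; apply: (lin_ext (gens_homog HV) (hsum_lin HV (F := fun _ y => f y) (fun _ => lf)) lf) => i x hx.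
by rewrite (hsum_homog HV hx) // => _; apply: lin0.
Qed.

End HsumCongruence.

(** * Precomposition on right-module maps *)

Section StarRight.
Variables (k : fieldType) (A B C : dgcat k).
Notation X := (bar A).
Let HX : is_bimod X := bar_bimod A.

Section One.
Variables (M' M : bimod A B) (N : bimod C B) (HM' : is_bimod M') (HM : is_bimod M) (HN : is_bimod N).
Let HR := homR_bimod HM HN.
Let HR' := homR_bimod HM' HN.

(* g (x) y goes to p |-> (-1)^(n deg g) g(phi(y (x) p)) *)
Definition starR n (phi : bmap (tensor X M') M) : bmap (tensor (homR M N) X) (homR M' N) :=
  fun c a => tlift (fun a' (g : homR M N c a') (y : X a' a) =>
    to_rhom (M := M') (N := N) (c := c) (a := a) (fun b p => rapp (twist n g) (phi a' b (tmk y p)))).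

Variables (n : int) (phi : bmap (tensor X M') M) (ph : is_hom n phi).
Arguments phi : clear implicits.

Lemma starR_app c a a' (g : homR M N c a') (y : X a' a) b (p : M' a b) :
  rapp (to_rhom (M := M') (N := N) (c := c) (a := a)
    (fun b p => rapp (twist n g) (phi a' b (tmk y p)))) p = rapp (twist n g) (phi a' b (tmk y p)).
Proof.
have Hg := rhom_dgvect HM HN c a'.
apply: to_rhom_span.
apply: (lspan_family (G := @homog k (homR M N c a'))
  (F := fun g b p => rapp (twist n g) (phi a' b (tmk y p))) (gens_homog Hg)).
  by move=> b' p'; apply: (lin_comp (@rapp_linf _ _ _ _ M N c a' b' _) (twist_lin Hg n)).
move=> j {}g hg; move: y.
apply: (lspan_family (G := @homog k (X a' a))
  (F := fun y b p => rapp (twist n g) (phi a' b (tmk y p))) (gens_homog (bcar_dgvect HX a' a))).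
  move=> b' p'; apply: (lin_comp (rapp_lin HM HN (twist n g) (b:=b'))).
  exact: (lin_comp (hlin ph a' b') (tmk_linl p')).
move=> l y hy; apply: lspan_gen; exists (n + j + l); split=> [b'|b' i q hq|b1 b2 q z] /=.
- apply: (lin_comp (rapp_lin HM HN (twist n g) (b:=b'))).
  exact: (lin_comp (hlin ph a' b') (tmk_linr y)).
- have -> : n + j + l + i = j + (n + (l + i)) by ring.
  apply: rapp_homog => //; first exact: homog_twist.
  by apply: (hom_homog ph); apply: homog_tmk.
- by rewrite -tens_ractE (hom_ract ph) rapp_ract.
Qed.

Lemma starR_balanced c a : balanced true (fun a' (g : homR M N c a') (y : X a' a) =>
    to_rhom (M := M') (N := N) (c := c) (a := a) (fun b p => rapp (twist n g) (phi a' b (tmk y p)))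
      : homR M' N c a).
Proof.
split=> [a' y|a' g|_ a1 a2 g z y].
- move=> s g g'; apply: rhom_ext => b p; rewrite rapp_linf !starR_app.
  by rewrite (twist_lin (rhom_dgvect HM HN c a') n) rapp_linf.
- move=> s y y'; apply: rhom_ext => b p; rewrite rapp_linf !starR_app.
  by rewrite tmk_linl (hlin ph) (rapp_lin HM HN).
- apply: rhom_ext => b p; rewrite !starR_app.
  have Hg1 := rhom_dgvect HM HN c a1; have Hg2 := rhom_dgvect HM HN c a2.
  move: g; apply: (lin_ext (gens_homog Hg1)
    (lin_comp (@rapp_linf _ _ _ _ M N c a2 b _) (lin_comp (twist_lin Hg2 n) (ract_linearl HR z)))
    (lin_comp (@rapp_linf _ _ _ _ M N c a1 b _) (twist_lin Hg1 n))) => j g hg.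
  move: z; apply: (lin_ext (gens_homog (mor_dgvect a2 a1))
    (lin_comp (@rapp_linf _ _ _ _ M N c a2 b _) (lin_comp (twist_lin Hg2 n) (ract_linearr HR g)))
    (lin_comp (rapp_lin HM HN (twist n g) (b:=b)) (lin_comp (hlin ph a1 b)
       (lin_comp (tmk_linl p) (lact_linearl HX y))))) => i z hz.
  rewrite (twistE Hg1 _ hg) (twistE Hg2 _ (ract_homog HR hg hz)) !(linZ (rapp_linf _)).
  rewrite rapp_ractr // -tens_lactE (hom_lact ph _ hz) (linZ (rapp_lin HM HN g (b:=b))) sgnZZ.
  by apply: sgnZ_eq; odd_tac.
Qed.

Lemma starRE c a a' (g : homR M N c a') (y : X a' a) b (p : M' a b) :
  rapp (starR n phi (tmk g y)) p = rapp (twist n g) (phi a' b (tmk y p)).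
Proof. by rewrite /starR (tliftE _ _ (starR_balanced c a)) starR_app. Qed.

Lemma starRE_homog c a a' j (g : homR M N c a') (y : X a' a) b (p : M' a b) : homog j g ->
  rapp (starR n phi (tmk g y)) p = sgn k (n * j) *: rapp g (phi a' b (tmk y p)).
Proof. by move=> hg; rewrite starRE (twistE (rhom_dgvect HM HN c a') n hg). Qed.

Lemma starR_lin c a : linear (@starR n phi c a).
Proof. exact: (tlift_lin (starR_balanced c a)). Qed.

Lemma starR_hom : is_hom n (starR n phi).
Proof.
apply: (is_hom_gen (tens_bimod true HR HX) HR' (gens_tens HR HX) _ starR_lin).
- by move=> c a i t [a' [p [q [g [y [-> hg hy ->]]]]]]; apply: homog_tmk.
- move=> c a i t [a' [j [l [g [y [-> hg hy ->]]]]]]; apply: (homog_rhom HM' HN) => b r p hp.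
  rewrite (starRE_homog _ _ hg); apply: homogZ.
  have -> : n + (j + l) + r = j + (n + (l + r)) by ring.
  by apply: rapp_homog => //; apply: (hom_homog ph); apply: homog_tmk.
- move=> c c' a i m z t hz [a' [j [l [g [y [_ hg hy ->]]]]]]; apply: rhom_ext => b p.
  rewrite tens_lactE (linZ (rapp_linf _)) rapp_lact // (starRE_homog _ _ hg).
  rewrite (starRE_homog _ _ (lact_homog HR hz hg)) rapp_lact // (lactZr HN) sgnZZ.
  by apply: sgnZ_eq; odd_tac.
- move=> c a a2 i m z t hz [a' [j [l [g [y [_ hg hy ->]]]]]]; apply: rhom_ext => b p.
  by rewrite tens_ractE rapp_ractr // !starRE tmk_act.
Qed.

End One.

Section Calculus.
Variables (M' M : bimod A B) (N : bimod C B) (HM' : is_bimod M') (HM : is_bimod M) (HN : is_bimod N).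
Let HXM' := tens_bimod true HX HM'.
Let HR := homR_bimod HM HN.
Let HR' := homR_bimod HM' HN.

(** The terms in which d is applied to a value of g cancel between the differential of the source
    and that of the target, and so do those in dy and dp apart from the ones that make up D phi. *)
Lemma starR_dhom n (phi : bmap (tensor X M') M) : is_hom n phi ->
  dhom n (starR (N := N) n phi) = starR (n + 1) (dhom n phi).
Proof.
move=> ph; have ph' := hom_dhom HXM' HM ph.
have sh := starR_hom HM' HM HN ph; have sh' := starR_hom HM' HM HN ph'.
apply: bmap_ext => c a.
apply: (lin_ext (gens_tens HR HX c a) (dhom_lin (tens_bimod true HR HX) HR' sh (a:=c) (b:=a)) (hlin sh' c a)).
move=> _ t [a' [j [l [g [y [_ hg hy ->]]]]]]; apply: rhom_ext => b p.
move: p; apply: (lin_ext (gens_homog (bcar_dgvect HM' a b)) (rapp_lin HM' HN _ (b:=b)) (rapp_lin HM' HN _ (b:=b))) => r p hp.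
have hdg := dd_homog (bcar_dgvect HR c a') hg.
have hs : homog (n + (j + l)) (starR n phi (tmk g y)) by apply: (hom_homog sh); apply: homog_tmk.
rewrite (starRE_homog HM' HM HN ph' _ _ hg) /dhom (tens_ddE _ _ hg) (homD sh) (homZ sh).
rewrite (linB (rapp_linf _)) (linZ (rapp_linf _)) (linD (rapp_linf _)) (linZ (rapp_linf _)).
rewrite (rapp_dd HM' HN _ hs) !(starRE_homog HM' HM HN ph _ _ hg) (starRE_homog HM' HM HN ph _ _ hdg).
rewrite (rapp_dd HM HN _ hg) (ddZ (bcar_dgvect HN c b)) (tens_ddE _ _ hy) (homD ph) (homZ ph).
rewrite (linB (rapp_lin HM HN g (b:=b))) (linZ (rapp_lin HM HN g (b:=b))) (linD (rapp_lin HM HN g (b:=b))) (linZ (rapp_lin HM HN g (b:=b))).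
rewrite !(scalerBr, scalerDr) !sgnZZ.
rewrite (sgn_eq k (m := n + n * (j + 1)) (n := n * j)); last by odd_tac.
rewrite (sgn_eq k (m := n + n * (j + 1) + j) (n := (n + 1) * j)); last by odd_tac.
rewrite (sgn_eq k (m := n + j + n * j) (n := (n + 1) * j + n)); last by odd_tac.
rewrite (sgn_eq k (m := n + (j + l) + n * j) (n := (n + 1) * j + n + l)); last by odd_tac.
set u1 := _ *: dd _; set u2 := _ *: rapp g (phi a' b (tmk y (dd p))).
set u3 := _ *: rapp g (dd _); set u4 := _ *: rapp g (phi a' b (tmk (dd y) p)).
by abelian.
Qed.
End Calculus.
End StarRight.

(** * Naturality of the cofree extensions *)

Section Naturality.
Variables (k : fieldType) (A B : dgcat k).
Notation X := (bar A).
Notation Y := (bar B).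
Let HX : is_bimod X := bar_bimod A.
Let HY : is_bimod Y := bar_bimod B.

Lemma tmap_id_rext (P N N' : bimod A B) (HP : is_bimod P) (HN : is_bimod N) (HN' : is_bimod N') m n
  (h : bmap N N') (g : bmap (tensor P Y) N) : is_hom m h -> is_hom n g ->
  forall a b (t : tensor P Y a b), tmap 0 h (@bmap_id _ _ _ Y) (rext g t) = rext (bcomp h g) t.
Proof.
move=> hh gh a b t; rewrite /rext /bcomp; move: (comultr t) => {}t.
have HPY := tens_bimod true HP HY; have hgh := hom_comp hh gh.
move: t; apply: (lin_ext (gens_tens HPY HY a b)
  (lin_comp (tmap_lin HN HY hh (hom_id Y) (a:=a) (b:=b)) (tmap_lin HPY HY gh (hom_id Y) (a:=a) (b:=b)))
  (tmap_lin HPY HY hgh (hom_id Y) (a:=a) (b:=b))).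
move=> i t [c [p [q [x [y [_ hx hy ->]]]]]].
by rewrite (tmap0E HPY HY gh (hom_id Y)) (tmap0E HN HY hh (hom_id Y)) (tmap0E HPY HY hgh (hom_id Y)).
Qed.

Lemma rext_tmap (P P' N : bimod A B) (HP : is_bimod P) (HP' : is_bimod P') (HN : is_bimod N) n
  (g : bmap (tensor P' Y) N) (f : bmap P P') : is_hom n g -> is_hom 0 f ->
  forall a b (t : tensor P Y a b),
  rext (bcomp g (tmap 0 f (@bmap_id _ _ _ Y))) t = rext g (tmap 0 f (@bmap_id _ _ _ Y) t).
Proof.
move=> gh fh a b t.
have HPY := tens_bimod true HP HY; have HPY' := tens_bimod true HP' HY.
have th := tmap_hom HP HY HP' HY fh (hom_id Y); have gth := hom_comp gh th.
move: t; apply: (lin_ext (gens_tens HP HY a b) (hlin (rext_hom HP HN gth) a b)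
  (lin_comp (hlin (rext_hom HP' HN gh) a b) (hlin th a b))).
move=> i t [c [p [q [x [y [_ hx hy ->]]]]]].
rewrite (tmap0E HP HY fh (hom_id Y)) (rextE HP) (rextE HP'); move: (coprod y).
have il (Q : bimod A B) := @assoc_inv_lin _ _ _ _ _ Q Y Y HY HY.
apply: (lin_ext (gens_tens HY HY c b)
  (lin_comp (tmap_lin HPY HY gth (hom_id Y) (a:=a) (b:=b)) (lin_comp (@il P a b) (tmk_linr x)))
  (lin_comp (tmap_lin HPY' HY gh (hom_id Y) (a:=a) (b:=b)) (lin_comp (@il P' a b) (tmk_linr _)))).
move=> j s [d [p' [q' [y1 [y2 [_ _ _ ->]]]]]].
rewrite !assoc_invE (tmap0E HPY HY gth (hom_id Y)) (tmap0E HPY' HY gh (hom_id Y)).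
by rewrite /bcomp (tmap0E HP HY fh (hom_id Y)).
Qed.

Lemma lext_tmap (P P' N : bimod A B) (HP : is_bimod P) (HP' : is_bimod P') (HN : is_bimod N) n
  (g : bmap (tensor X P') N) (f : bmap P P') : is_hom n g -> is_hom 0 f ->
  forall a b (t : tensor X P a b),
  lext n (bcomp g (tmap 0 (@bmap_id _ _ _ X) f)) t = lext n g (tmap 0 (@bmap_id _ _ _ X) f t).
Proof.
move=> gh fh a b t.
have HXP := tens_bimod true HX HP; have HXP' := tens_bimod true HX HP'.
have th := tmap_hom HX HP HX HP' (hom_id X) fh.
have gth : is_hom n (bcomp g (tmap 0 (@bmap_id _ _ _ X) f)).
  by apply: (is_hom_eq (m := n + (0 + 0))); [rewrite !addr0 | apply: hom_comp].
move: t; apply: (lin_ext (gens_tens HX HP a b) (hlin (lext_hom HP HN gth) a b)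
  (lin_comp (hlin (lext_hom HP' HN gh) a b) (hlin th a b))).
move=> i t [c [p [q [x [y [_ hx hy ->]]]]]].
rewrite (tmap0E HX HP (hom_id X) fh) (lextE HP) (lextE HP'); move: (coprod x).
have al (Q : bimod A B) := @assoc_lin _ _ _ _ _ X X Q HX HX.
apply: (lin_ext (gens_tens HX HX a c)
  (lin_comp (tmap_lin HX HXP (hom_id X) gth (a:=a) (b:=b)) (lin_comp (@al P a b) (tmk_linl y)))
  (lin_comp (tmap_lin HX HXP' (hom_id X) gh (a:=a) (b:=b)) (lin_comp (@al P' a b) (tmk_linl _)))).
move=> j s [d [p' [q' [x1 [x2 [_ _ _ ->]]]]]].
rewrite !assocE (tmapTE HX HXP (hom_id X) gth) (tmapTE HX HXP' (hom_id X) gh).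
by rewrite /bcomp (tmap0E HX HP (hom_id X) fh).
Qed.

Lemma tau_actl_lhalf (M N : bimod A B) (HM : is_bimod M) (HN : is_bimod N) n (f : bmap (tilde M) N) :
  is_hom n f -> bcomp (tau_actl N) (lhalf n f) = f.
Proof.
move=> fh; apply: bmap_ext => a b t; rewrite /lhalf /bcomp.
have fah : is_hom n (bcomp f (@assoc_inv _ _ _ _ _ X M Y)).
  apply: (is_hom_eq (m := n + 0)); first by rewrite addr0.
  exact: (hom_comp fh (assoc_inv_hom HX HM HY)).
by rewrite (tau_actl_lext (tens_bimod true HM HY) HN fah) /bcomp (assocK HX HM HY).
Qed.

Lemma rhalf_id (M : bimod A B) (HM : is_bimod M) : rhalf (@bar_id k A B M) = tau_actl (tensor M Y).
Proof.
have HXM := tens_bimod true HX HM; have HMY := tens_bimod true HM HY.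
have lh := tau_actl_hom HM; have rh := tau_actr_hom HM; have lh' := tau_actl_hom HMY.
(* The two actions on M commute, so the left counit may be applied before the right one. *)
have bE : @bar_id k A B M = bcomp (tau_actr M) (tmap 0 (tau_actl M) (@bmap_id _ _ _ Y)).
  apply: bmap_ext => a b; rewrite bar_idE //.
  apply: (lin_ext (gens_tens HXM HY a b)
    (lin_comp (hlin lh a b) (tau_actr_lin HXM (a:=a) (b:=b)))
    (lin_comp (hlin rh a b) (tmap_lin HXM HY lh (hom_id Y) (a:=a) (b:=b)))).
  move=> i t [c [p [q [u [y [_ hu hy ->]]]]]]; rewrite (tmap0E HXM HY lh (hom_id Y)).
  by rewrite /bcomp !tau_actrE // (hom_ract lh).
apply: bmap_ext => a b t; rewrite /rhalf {1}/bcomp bE.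
rewrite (rext_tmap HXM HM HM rh lh) (rext_tau_actr HM); move: t.
apply: (lin_ext (gens3r (M:=X) (N:=M) (P:=Y) HX HM HY (a:=a) (b:=b))
  (lin_comp (tmap_lin HXM HY lh (hom_id Y) (a:=a) (b:=b)) (@assoc_inv_lin _ _ _ _ _ X M Y HM HY a b)) (hlin lh' a b)).
move=> i t /gen3rP [c [d [p [q [r [x [m [y [_ hx hm hy ->]]]]]]]]].
by rewrite assoc_invE (tmap0E HXM HY lh (hom_id Y)) !tau_actlE // tens_lactE.
Qed.
End Naturality.


Section StarRightCalculus.
Variables (k : fieldType) (A B C : dgcat k).
Notation X := (bar A).
Let HX : is_bimod X := bar_bimod A.

Lemma starR_tmk (M' M : bimod A B) (N : bimod C B) (HM' : is_bimod M') (HM : is_bimod M) (HN : is_bimod N)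
  n (phi : bmap (tensor X M') M) : is_hom n phi -> forall c a a' (g : homR M N c a') (y : X a' a),
  starR n phi (tmk g y) = to_rhom (M := M') (N := N) (c := c) (a := a)
    (fun b p => rapp (twist n g) (phi a' b (tmk y p))).
Proof. by move=> ph c a a' g y; rewrite /starR (tliftE _ _ (starR_balanced HM' HM HN ph c a)). Qed.

(** Up to sign, both sides send g ⊗ y and p to g(psi(y_1 ⊗ phi(y_2 ⊗ p))): the right coaction on the
    dual is the left coaction on the argument. The sign is that of exchanging two maps of degrees m
    and n. *)
Lemma starR_comp (M'' M' M : bimod A B) (N : bimod C B) (HM'' : is_bimod M'') (HM' : is_bimod M')
  (HM : is_bimod M) (HN : is_bimod N) m n (psi : bmap (tensor X M') M) (phi : bmap (tensor X M'') M') :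
  is_hom m psi -> is_hom n phi -> forall c a (t : tensor (homR M N) X c a),
  starR n phi (rext (starR m psi) t) = sgn k (n * m) *: starR (N := N) (m + n) (bcomp psi (lext n phi)) t.
Proof.
move=> sh ph c a t.
have HR := homR_bimod HM HN; have HR' := homR_bimod HM' HN.
have HRX := tens_bimod true HR HX; have HXM'' := tens_bimod true HX HM''.
have lh := lext_hom HM'' HM' ph; have slh := hom_comp sh lh.
have s1 := starR_hom HM' HM HN sh; have s2 := starR_hom HM'' HM' HN ph.
have s3 := starR_hom HM'' HM HN slh.
move: t; apply: (lin_ext (gens_tens HR HX c a)
  (lin_comp (hlin s2 c a) (hlin (rext_hom HR HR' s1) c a)) (lin_scale _ (hlin s3 c a))).
move=> i t [a' [j [l [g [y [_ hg hy ->]]]]]]; apply: rhom_ext => b p.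
rewrite (linZ (rapp_linf _)) (starRE_homog HM'' HM HN slh _ _ hg) (rextE HR) {1}/bcomp (lextE HM'').
move: (coprod y).
have il := @assoc_inv_lin _ _ _ _ _ (homR M N) X X HX HX c a.
have al := @assoc_lin _ _ _ _ _ X X M'' HX HX a' b.
apply: (lin_ext (gens_tens HX HX a' a)
  (lin_comp (@rapp_linf _ _ _ _ M'' N c a b p) (lin_comp (hlin s2 c a) (lin_comp
    (tmap_lin HRX HX s1 (hom_id X) (a:=c) (b:=a)) (lin_comp il (tmk_linr g)))))
  (lin_scale _ (lin_scale _ (lin_comp (rapp_lin HM HN g (b:=b)) (lin_comp (hlin sh a' b)
    (lin_comp (tmap_lin HX HXM'' (hom_id X) ph (a:=a') (b:=b)) (lin_comp al (tmk_linl p)))))))).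
move=> r s [d [q1 [q2 [y1 [y2 [_ h1 h2 ->]]]]]].
have hs : homog (m + (j + q1)) (starR m psi (tmk g y1)) by apply: (hom_homog s1); apply: homog_tmk.
rewrite assoc_invE assocE (tmap0E HRX HX s1 (hom_id X)) (tmapE HX HXM'' (hom_id X) ph _ h1).
rewrite (starRE_homog HM'' HM' HN ph _ _ hs) (starRE_homog HM' HM HN sh _ _ hg).
rewrite (homZ sh) (linZ (rapp_lin HM HN g (b:=b))) !sgnZZ.
by apply: sgnZ_eq; odd_tac.
Qed.

Lemma starR_tau_actl (M : bimod A B) (N : bimod C B) (HM : is_bimod M) (HN : is_bimod N) :
  starR 0 (tau_actl M) = tau_actr (homR M N).
Proof.
have HR := homR_bimod HM HN; have lh := tau_actl_hom HM.
apply: bmap_ext => c a; apply: (lin_ext (gens_tens HR HX c a)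
  (hlin (starR_hom HM HM HN lh) c a) (tau_actr_lin HR (a:=c) (b:=a))).
move=> i t [a' [j [l [g [y [_ hg hy ->]]]]]]; apply: rhom_ext => b p.
by rewrite (starRE_homog HM HM HN lh _ _ hg) mul0r sgn0 scale1r tau_actlE // tau_actrE // rapp_ractr.
Qed.

Lemma starR_linear (M' M : bimod A B) (N : bimod C B) (HM' : is_bimod M') (HM : is_bimod M) (HN : is_bimod N)
  n (s : k) (phi psi : bmap (tensor X M') M) : is_hom n phi -> is_hom n psi ->
  forall c a (t : tensor (homR M N) X c a),
  starR n (fun a b x => s *: phi a b x + psi a b x) t = s *: starR n phi t + starR n psi t.
Proof.
move=> ph sh c a t.
have HR := homR_bimod HM HN; have h := hom_add HM (hom_scale HM s ph) sh.
move: t; apply: (lin_ext (gens_tens HR HX c a) (hlin (starR_hom HM' HM HN h) c a)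
  (lin_add (lin_scale s (hlin (starR_hom HM' HM HN ph) c a)) (hlin (starR_hom HM' HM HN sh) c a))).
move=> i t [a' [j [l [g [y [_ hg hy ->]]]]]]; apply: rhom_ext => b p.
rewrite (linD (rapp_linf _)) (linZ (rapp_linf _)).
by rewrite !(starRE HM' HM HN) // (linD (rapp_lin HM HN _ (b:=b))) (linZ (rapp_lin HM HN _ (b:=b))).
Qed.

End StarRightCalculus.

(** * The dual with respect to B *)

Section DualRight.
Variables (k : fieldType) (A B : dgcat k).
Notation X := (bar A).
Notation Y := (bar B).
Let HX : is_bimod X := bar_bimod A.
Let HY : is_bimod Y := bar_bimod B.
Let HD := diag_bimod B.

#[export] Instance dualB_bimod (M : bimod A B) : is_bimod M -> is_bimod (dualB M).
Proof. by move=> HM; apply: (homR_bimod (tens_bimod true HM HY) HD). Qed.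

(** In the dual of alpha the bar factor x enters only through tau(x), and the coproduct is taken on
    the bar factor inside the argument m' ⊗ z. This is precomposition with the right half of alpha,
    preceded by the left counit. *)
Lemma dualB_mapE (M' M : bimod A B) (HM' : is_bimod M') (HM : is_bimod M) n (alpha : bmap (tilde M') M) :
  is_hom n alpha ->
  dualB_map n alpha = bcomp (starR n (rhalf alpha)) (tmap 0 (tau_actl (dualB M)) (@bmap_id _ _ _ X)).
Proof.
move=> ah; have HMY := tens_bimod true HM HY; have HMY' := tens_bimod true HM' HY.
have HXM' := tens_bimod true HX HM'; have HT := tens_bimod true HXM' HY.
have HDM := dualB_bimod HM; have HYD := tens_bimod true HY HDM.
have ph := rhalf_hom HM' HM ah; have sh := starR_hom HMY' HMY HD ph.
have lh := tau_actl_hom HDM.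
have th := tmap_hom HYD HX HDM HX lh (hom_id X).
apply: bmap_ext => b a t; rewrite /dualB_map.
apply: (tlift_eq (lin_comp (hlin sh b a) (hlin th b a))) => a' u y.
apply: (tlift_eq (G := fun u : tensor Y (dualB M) b a' => starR n (rhalf alpha) (tmap 0 (tau_actl (dualB M)) (@bmap_id _ _ _ X) (tmk u y)))).
  exact: (lin_comp (hlin sh b a) (lin_comp (hlin th b a) (tmk_linl y))).
move=> b' x g; rewrite /bcomp (tmap0E HYD HX lh (hom_id X)) tau_actlE //.
set S := fun (x' : Y b b') (g' : dualB M b' a') => starR n (rhalf alpha) (tmk (lact (dualB M) (bar_tau x') g') y).
have Sl x' : linear (S x').
  exact: (lin_comp (hlin sh b a) (lin_comp (tmk_linl y) (lact_linearr HDM (bar_tau x')))).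
have Sr g' : linear (S^~ g').
  apply: (lin_comp (hlin sh b a) (lin_comp (tmk_linl y) (lin_comp (lact_linearl HDM g') _))).
  exact: (hlin (bar_tau_hom B)).
rewrite -[RHS]/(S x g) -(hsum_linear (bcar_dgvect HY b b') x (Sr g)).
apply: (eq_hsum (bcar_dgvect HY b b')) => i {}x hx.
rewrite -(hsum_linear (bcar_dgvect HDM b' a') g (Sl x)).
apply: (eq_hsum (bcar_dgvect HDM b' a')) => j {}g hg.
have htg : homog (i + j) (lact (dualB M) (bar_tau x) g) by apply: (lact_homog HDM) => //; apply: tau_homog.
set F := to_rhom _.
(* The explicit sign n (i + j) in the definition is the one that [starR] attaches to tau(x) g, an
   element of degree i + j. *)
have -> : F = starR n (rhalf alpha) (tmk (sgn k (n * (i + j)) *: lact (dualB M) (bar_tau x) g) y).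
  rewrite (starR_tmk HMY' HMY HD ph) (linZ (twist_lin (bcar_dgvect HDM b a') n)).
  rewrite (twistE (bcar_dgvect HDM b a') n htg) sgnZZ (sgn_eq k (n := 0)); last by odd_tac.
  rewrite sgn0 scale1r /F; congr to_rhom; apply: functional_extensionality_dep => b1; apply/funext => p.
  rewrite (rapp_lact HMY HD).
  have ll : linear (fun p : tensor M' Y a b1 => lact (diag B) (bar_tau x) (rapp g (rhalf alpha (tmk y p)))).
    apply: (lin_comp (lact_linearr HD (bar_tau x)) (lin_comp (rapp_lin HMY HD g (b:=b1)) _)).
    exact: (lin_comp (hlin ph a' b1) (tmk_linr y)).
  move: p; apply: (tlift_eq ll) => e m z; rewrite /rhalf {1}/bcomp assoc_invE (rextE HXM').
  apply: (tlift_eq (G := fun v => lact (diag B) (bar_tau x)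
    (rapp g (tmap 0 alpha (@bmap_id _ _ _ Y) (assoc_inv (tmk (tmk y m : tensor X M' a' e) v)))))).
    apply: (lin_comp (lact_linearr HD (bar_tau x)) (lin_comp (rapp_lin HMY HD g (b:=b1)) _)).
    apply: (lin_comp (tmap_lin HT HY ah (hom_id Y) (a:=a') (b:=b1))).
    exact: (lin_comp (@assoc_inv_lin _ _ _ _ _ (tensor X M') Y Y HY HY a' b1) (tmk_linr _)).
  by move=> e' z1 z2; rewrite assoc_invE (tmap0E HT HY ah (hom_id Y)).
rewrite tmkZl (linZ (hlin sh b a)) sgnZZ (sgn_eq k (n := 0)); last by odd_tac.
by rewrite sgn0 scale1r.
Qed.
End DualRight.

Section TensorLinear.
Variables (k : fieldType) (A B C : dgcat k) (M M' : bimod A C) (N N' : bimod C B).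
Variables (HM : is_bimod M) (HM' : is_bimod M') (HN : is_bimod N) (HN' : is_bimod N').

Lemma tmap_linearl m s (f f' : bmap M M') (g : bmap N N') : is_hom m f -> is_hom m f' -> is_hom 0 g ->
  forall a b (t : tensor M N a b),
  tmap 0 (fun a b x => s *: f a b x + f' a b x) g t = s *: tmap 0 f g t + tmap 0 f' g t.
Proof.
move=> fh fh' gh a b; have h := hom_add HM' (hom_scale HM' s fh) fh'.
apply: (lin_ext (gens_tens HM HN a b) (tmap_lin HM HN h gh (a:=a) (b:=b))
  (lin_add (lin_scale s (tmap_lin HM HN fh gh (a:=a) (b:=b))) (tmap_lin HM HN fh' gh (a:=a) (b:=b)))).
move=> i t [c [p [q [x [y [_ hx hy ->]]]]]].
by rewrite (tmap0E HM HN h gh) (tmap0E HM HN fh gh) (tmap0E HM HN fh' gh) tmk_linl.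
Qed.

Lemma tmap_linearr n s (f : bmap M M') (g g' : bmap N N') : is_hom 0 f -> is_hom n g -> is_hom n g' ->
  forall a b (t : tensor M N a b),
  tmap n f (fun a b x => s *: g a b x + g' a b x) t = s *: tmap n f g t + tmap n f g' t.
Proof.
move=> fh gh gh' a b; have h := hom_add HN' (hom_scale HN' s gh) gh'.
apply: (lin_ext (gens_tens HM HN a b) (tmap_lin HM HN fh h (a:=a) (b:=b))
  (lin_add (lin_scale s (tmap_lin HM HN fh gh (a:=a) (b:=b))) (tmap_lin HM HN fh gh' (a:=a) (b:=b)))).
move=> i t [c [p [q [x [y [_ hx hy ->]]]]]].
by rewrite (tmapTE HM HN fh h) (tmapTE HM HN fh gh) (tmapTE HM HN fh gh') tmk_linr.
Qed.

Lemma tmap_closed (f : bmap M M') (g : bmap N N') : is_hom 0 f -> is_hom 0 g -> hclosed 0 f -> hclosed 0 g ->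
  hclosed 0 (tmap 0 f g).
Proof.
move=> fh gh fc gc a b x; rewrite (tmap_dhoml HM HN HM' HN' fh gh gc).
have fh' := hom_dhom HM HM' fh.
move: x; apply: (lin_ext (gens_tens HM HN a b) (tmap_lin HM HN fh' gh (a:=a) (b:=b)) (@lin_cst0 _ _ _)).
move=> i t [c [p [q [x [y [_ hx hy ->]]]]]].
by rewrite (tmap0E HM HN fh' gh) fc tmk0l.
Qed.
End TensorLinear.

Section HalvesLinear.
Variables (k : fieldType) (A B : dgcat k) (M N : bimod A B) (HM : is_bimod M) (HN : is_bimod N).
Notation X := (bar A).
Notation Y := (bar B).
Let HX : is_bimod X := bar_bimod A.
Let HY : is_bimod Y := bar_bimod B.
Let HXM := tens_bimod true HX HM.
Let HMY := tens_bimod true HM HY.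
Variables (n : int) (s : k) (f g : bmap (tilde M) N) (fh : is_hom n f) (gh : is_hom n g).
Arguments f : clear implicits.
Arguments g : clear implicits.

Lemma rhalf_linear : rhalf (fun a b x => s *: f a b x + g a b x) =
  (fun a b x => s *: rhalf f x + rhalf g x).
Proof.
apply: bmap_ext => a b t; rewrite /rhalf /rext /bcomp.
by rewrite (tmap_linearl (tens_bimod true HXM HY) HN HY s fh gh (hom_id Y)).
Qed.

Lemma lhalf_linear : lhalf n (fun a b x => s *: f a b x + g a b x) =
  (fun a b x => s *: lhalf n f x + lhalf n g x).
Proof.
apply: bmap_ext => a b t; rewrite /lhalf /lext /bcomp.
have ih := assoc_inv_hom HX HM HY.
have fih := hom_comp fh ih; have gih := hom_comp gh ih; rewrite addr0 in fih gih.
by rewrite (tmap_linearr HX (tens_bimod true HX HMY) HN s (hom_id X) fih gih).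
Qed.

Lemma tilde_map_linear : tilde_map n (fun a b x => s *: f a b x + g a b x) =
  (fun a b x => s *: tilde_map n f x + tilde_map n g x).
Proof.
have h := hom_add HN (hom_scale HN s fh) gh.
rewrite (tilde_mapE HM HN h) (tilde_mapE HM HN fh) (tilde_mapE HM HN gh).
apply: bmap_ext => a b t; rewrite lhalf_linear /rext /bcomp.
by rewrite (tmap_linearl (tilde_bimod HM) (tens_bimod true HX HN) HY s
  (lhalf_hom HM HN fh) (lhalf_hom HM HN gh) (hom_id Y)).
Qed.
End HalvesLinear.

Section DualRightFunctor.
Variables (k : fieldType) (A B : dgcat k).
Notation X := (bar A).
Notation Y := (bar B).
Let HX : is_bimod X := bar_bimod A.
Let HY : is_bimod Y := bar_bimod B.
Let HD := diag_bimod B.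
Variables (M'' M' M : bimod A B) (HM'' : is_bimod M'') (HM' : is_bimod M') (HM : is_bimod M).
Let HDM := dualB_bimod HM.
Let HDM' := dualB_bimod HM'.
Let HMY := tens_bimod true HM HY.
Let HMY' := tens_bimod true HM' HY.
Let HMY'' := tens_bimod true HM'' HY.
Let HYD := tens_bimod true HY HDM.
Let HYD' := tens_bimod true HY HDM'.
Let tl := tau_actl_hom HDM.
Let th := tmap_hom HYD HX HDM HX tl (hom_id X).

Lemma dualB_map_hom n (alpha : bmap (tilde M') M) : is_hom n alpha -> is_hom n (dualB_map n alpha).
Proof.
move=> ah; rewrite (dualB_mapE HM' HM ah).
apply: (is_hom_eq (m := n + (0 + 0))); first by rewrite !addr0.
exact: (hom_comp (starR_hom HMY' HMY HD (rhalf_hom HM' HM ah)) th).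
Qed.

Lemma dualB_map_dhom n (alpha : bmap (tilde M') M) : is_hom n alpha ->
  dhom n (dualB_map n alpha) = dualB_map (n + 1) (dhom n alpha).
Proof.
move=> ah; have ah' := hom_dhom (tilde_bimod HM') HM ah; have ph := rhalf_hom HM' HM ah.
rewrite (dualB_mapE HM' HM ah) (dualB_mapE HM' HM ah') -(rhalf_dhom HM' HM ah) -(starR_dhom HMY' HMY HD ph).
have c0 : hclosed 0 (tmap 0 (tau_actl (dualB M)) (@bmap_id _ _ _ X)).
  exact: (tmap_closed HYD HDM HX HX tl (hom_id X) (tau_actl_closed HDM) (@bmap_id_closed _ _ _ X)).
apply: bmap_ext => b a t.
by rewrite (dhom_comp_closedr (starR_hom HMY' HMY HD ph) c0).
Qed.

Lemma dualB_map_id : dualB_map 0 (@bar_id k A B M) = @bar_id k B A (dualB M).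
Proof.
rewrite (dualB_mapE HM HM (bar_id_hom HM)) rhalf_id // (starR_tau_actl HMY HD) bar_idE //.
have rh := tau_actr_hom HDM.
apply: bmap_ext => b a.
apply: (lin_ext (gens_tens HYD HX b a) (lin_comp (hlin rh b a) (hlin th b a))
  (lin_comp (hlin tl b a) (tau_actr_lin HYD (a:=b) (b:=a)))).
move=> i t [c [p [q [u [y [_ hu hy ->]]]]]]; rewrite (tmap0E HYD HX tl (hom_id X)).
by rewrite /bcomp !tau_actrE // (hom_ract tl).
Qed.

Lemma dualB_map_linear n (s : k) (f g : bmap (tilde M') M) : is_hom n f -> is_hom n g ->
  dualB_map n (fun a b x => s *: f a b x + g a b x) =
  (fun a b x => s *: dualB_map n f x + dualB_map n g x).
Proof.
move=> fh gh; have h := hom_add HM (hom_scale HM s fh) gh.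
rewrite (dualB_mapE HM' HM h) (dualB_mapE HM' HM fh) (dualB_mapE HM' HM gh) (rhalf_linear HM' HM s fh gh).
apply: bmap_ext => b a t; rewrite /bcomp.
by rewrite (starR_linear HMY' HMY HD s (rhalf_hom HM' HM fh) (rhalf_hom HM' HM gh)).
Qed.

(** The counit in front of the outer dual absorbs the left half of the inner one ([tau_actl_lhalf]).
    What remains is [starR_comp], combined with the functoriality [rhalf_comp] of the right half. *)
Lemma dualB_map_comp m n (beta : bmap (tilde M') M) (alpha : bmap (tilde M'') M') :
  is_hom m beta -> is_hom n alpha ->
  bar_comp m (dualB_map n alpha) (dualB_map m beta) =
  (fun b a x => sgn k (n * m) *: dualB_map (m + n) (bar_comp n beta alpha) x).
Proof.
move=> bh ah; have bah := bar_comp_hom HM'' HM' bh ah.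
have pb := rhalf_hom HM' HM bh; have pa := rhalf_hom HM'' HM' ah.
have sb := starR_hom HMY' HMY HD pb.
have dbh := dualB_map_hom bh.
apply: bmap_ext => b a t.
rewrite bar_compE (dualB_mapE HM'' HM' ah) (tilde_mapE HDM HDM' dbh) /bcomp.
rewrite (tmap_id_rext HYD HYD' HDM' (tau_actl_hom HDM') (lhalf_hom HDM HDM' dbh)) (tau_actl_lhalf HDM HDM' dbh).
rewrite (dualB_mapE HM' HM bh) (rext_tmap HYD HDM HDM' sb tl) (dualB_mapE HM'' HM bah).
by rewrite (starR_comp HMY'' HMY' HMY HD pb pa) (rhalf_comp HM'' HM' HM bh ah).
Qed.
End DualRightFunctor.

(** * Precomposition on left-module maps *)

Section StarLeft.
Variables (k : fieldType) (A B C : dgcat k).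
Notation Y := (bar B).
Let HY : is_bimod Y := bar_bimod B.

Section One.
Variables (P' P : bimod A B) (N : bimod A C) (HP' : is_bimod P') (HP : is_bimod P) (HN : is_bimod N).
Let HL := homL_bimod HP HN.
Let HL' := homL_bimod HP' HN.

(* x (x) g goes to p |-> (-1)^(n deg g + deg x (deg g + deg p)) g(phi(p (x) x)) *)
Definition starL_fun n (phi : bmap (tensor P' Y) P) b b' c (x : Y b b') (g : homL P N b' c) a (p : P' a b) : N a c :=
  hsum x (fun i x' => lapp (twist (n + i) g) (phi a b' (tmk (twist i p) x'))).

Definition starL n (phi : bmap (tensor P' Y) P) : bmap (tensor Y (homL P N)) (homL P' N) :=
  fun b c => tlift (fun b' (x : Y b b') (g : homL P N b' c) =>
    to_lhom (M := P') (N := N) (b := b) (c := c) (@starL_fun n phi b b' c x g)).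

Variables (n : int) (phi : bmap (tensor P' Y) P) (ph : is_hom n phi).
Arguments phi : clear implicits.

Lemma starL_fun_linx b b' c (g : homL P N b' c) a (p : P' a b) : linear (fun x : Y b b' => starL_fun n phi x g p).
Proof.
apply: (hsum_lin (bcar_dgvect HY b b') (F := fun i x' => lapp (twist (n + i) g) (phi a b' (tmk (twist i p) x')))) => i.
exact: (lin_comp (lapp_lin HP HN _ (a:=a)) (lin_comp (hlin ph a b') (tmk_linr _))).
Qed.

Lemma starL_fun_ling b b' c (x : Y b b') a (p : P' a b) : linear (fun g : homL P N b' c => starL_fun n phi x g p).
Proof.
rewrite /starL_fun; apply: (hsum_lin_param (bcar_dgvect HY b b')
  (F := fun i x' (g : homL P N b' c) => lapp (twist (n + i) g) (phi a b' (tmk (twist i p) x')))) => [i y|i g].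
  exact: (lin_comp (lapp_linf (c:=c) _) (twist_lin (bcar_dgvect HL b' c) _)).
by rewrite tmk0r (lin0 (hlin ph a b')) (lin0 (lapp_lin HP HN _ (a:=a))).
Qed.

Lemma starL_fun_linp b b' c (x : Y b b') (g : homL P N b' c) a : linear (fun p : P' a b => starL_fun n phi x g p).
Proof.
rewrite /starL_fun; apply: (hsum_lin_param (bcar_dgvect HY b b')
  (F := fun i x' (p : P' a b) => lapp (twist (n + i) g) (phi a b' (tmk (twist i p) x')))) => [i y|i p].
  exact: (lin_comp (lapp_lin HP HN _ (a:=a)) (lin_comp (hlin ph a b') (lin_comp (tmk_linl y) (twist_lin (bcar_dgvect HP' a b) i)))).
by rewrite tmk0r (lin0 (hlin ph a b')) (lin0 (lapp_lin HP HN _ (a:=a))).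
Qed.

Lemma starL_fun_homog b b' c i j r (x : Y b b') (g : homL P N b' c) a (p : P' a b) :
  homog i x -> homog j g -> homog r p ->
  starL_fun n phi x g p = sgn k (n * j + i * (j + r)) *: lapp g (phi a b' (tmk p x)).
Proof.
move=> hx hg hp; rewrite /starL_fun (hsum_homog (bcar_dgvect HY b b') hx) => [|m]; last first.
  by rewrite tmk0r (lin0 (hlin ph a b')) (lin0 (lapp_lin HP HN _ (a:=a))).
rewrite (twistE (bcar_dgvect HL b' c) _ hg) (twistE (bcar_dgvect HP' a b) _ hp) tmkZl (homZ ph).
rewrite (linZ (lapp_linf _)) (linZ (lapp_lin HP HN _ (a:=a))) sgnZZ.
by apply: sgnZ_eq; odd_tac.
Qed.

Lemma starL_app b c b' (x : Y b b') (g : homL P N b' c) a (p : P' a b) :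
  lapp (to_lhom (M := P') (N := N) (b := b) (c := c) (@starL_fun n phi b b' c x g)) p = starL_fun n phi x g p.
Proof.
apply: to_lhom_span; move: x.
apply: (lspan_family (G := @homog k (Y b b'))
  (F := fun x a p => starL_fun n phi x g p) (gens_homog (bcar_dgvect HY b b'))).
  by move=> a' p'; apply: starL_fun_linx.
move=> i x hx; move: g.
apply: (lspan_family (G := @homog k (homL P N b' c))
  (F := fun g a p => starL_fun n phi x g p) (gens_homog (bcar_dgvect HL b' c))).
  by move=> a' p'; apply: starL_fun_ling.
move=> j g hg; apply: lspan_gen; exists (n + i + j); split=> [a'|a' r q hq|a1 a2 l z q hz] /=.
- exact: starL_fun_linp.
- rewrite (starL_fun_homog hx hg hq); apply: homogZ.
  have -> : n + i + j + r = j + (n + (r + i)) by ring.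
  by apply: lapp_homog => //; apply: (hom_homog ph); apply: homog_tmk.
- move: q; apply: (lin_ext (gens_homog (bcar_dgvect HP' a2 b))
    (lin_comp (starL_fun_linp x g (a:=a1)) (lact_linearr HP' z))
    (lin_scale _ (lin_comp (lact_linearr HN z) (starL_fun_linp x g (a:=a2))))) => r q hq.
  rewrite (starL_fun_homog hx hg hq) (starL_fun_homog hx hg (lact_homog HP' hz hq)).
  rewrite -tens_lactE (hom_lact ph _ hz) (linZ (lapp_lin HP HN _ (a:=a1))) (lapp_lactl HP HN _ hg hz).
  by rewrite (lactZr HN) !sgnZZ; apply: sgnZ_eq; odd_tac.
Qed.

Lemma starL_balanced b c : balanced true (fun b' (x : Y b b') (g : homL P N b' c) =>
    to_lhom (M := P') (N := N) (b := b) (c := c) (@starL_fun n phi b b' c x g) : homL P' N b c).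
Proof.
split=> [b' g|b' x|_ b1 b2 x z g].
- by move=> s x x'; apply: lhom_ext => a p; rewrite lapp_linf !starL_app starL_fun_linx.
- by move=> s g g'; apply: lhom_ext => a p; rewrite lapp_linf !starL_app starL_fun_ling.
- apply: (lhom_ext_homog HP' HN) => a r p hp; rewrite !starL_app; move: x.
  apply: (lin_ext (gens_homog (bcar_dgvect HY b b1))
    (lin_comp (starL_fun_linx g p) (ract_linearl HY z)) (starL_fun_linx (lact (homL P N) z g) p)) => i x hx.
  move: g; apply: (lin_ext (gens_homog (bcar_dgvect HL b2 c))
    (starL_fun_ling (ract Y x z) p) (lin_comp (starL_fun_ling x p) (lact_linearr HL z))) => j g hg.
  move: z; apply: (lin_ext (gens_homog (mor_dgvect b2 b1))
    (lin_comp (starL_fun_linx g p) (ract_linearr HY x)) (lin_comp (starL_fun_ling x p) (lact_linearl HL g))) => l z hz.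
  rewrite (starL_fun_homog (ract_homog HY hx hz) hg hp) (starL_fun_homog hx (lact_homog HL hz hg) hp).
  have hq : homog (n + (r + i)) (phi a b1 (tmk p x)) by apply: (hom_homog ph); apply: homog_tmk.
  rewrite (lapp_lact HP HN hz hg hq) -tens_ractE (hom_ract ph) sgnZZ.
  by apply: sgnZ_eq; odd_tac.
Qed.

Lemma starLE b c b' (x : Y b b') (g : homL P N b' c) a (p : P' a b) :
  lapp (starL n phi (tmk x g)) p = starL_fun n phi x g p.
Proof. by rewrite /starL (tliftE _ _ (starL_balanced b c)) starL_app. Qed.

Lemma starL_tmk b c b' (x : Y b b') (g : homL P N b' c) :
  starL n phi (tmk x g) = to_lhom (M := P') (N := N) (b := b) (c := c) (@starL_fun n phi b b' c x g).
Proof. by rewrite /starL (tliftE _ _ (starL_balanced b c)). Qed.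

Lemma starLE_homog b c b' i j r (x : Y b b') (g : homL P N b' c) a (p : P' a b) :
  homog i x -> homog j g -> homog r p ->
  lapp (starL n phi (tmk x g)) p = sgn k (n * j + i * (j + r)) *: lapp g (phi a b' (tmk p x)).
Proof. by move=> hx hg hp; rewrite starLE; apply: starL_fun_homog. Qed.

Lemma starL_lin b c : linear (@starL n phi b c).
Proof. exact: (tlift_lin (starL_balanced b c)). Qed.

Lemma starL_homog b b' c i j (x : Y b b') (g : homL P N b' c) : homog i x -> homog j g ->
  homog (n + (i + j)) (starL n phi (tmk x g)).
Proof.
move=> hx hg; apply: (homog_lhom HP' HN) => [a r p hp|a a' l z p hz].
  rewrite (starLE_homog hx hg hp); apply: homogZ.
  have -> : n + (i + j) + r = j + (n + (r + i)) by ring.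
  by apply: lapp_homog => //; apply: (hom_homog ph); apply: homog_tmk.
move: p; apply: (lin_ext (gens_homog (bcar_dgvect HP' a' b))
  (lin_comp (lapp_lin HP' HN _ (a:=a)) (lact_linearr HP' z))
  (lin_scale _ (lin_comp (lact_linearr HN z) (lapp_lin HP' HN _ (a:=a'))))) => r p hp.
rewrite (starLE_homog hx hg hp) (starLE_homog hx hg (lact_homog HP' hz hp)).
rewrite -tens_lactE (hom_lact ph _ hz) (linZ (lapp_lin HP HN _ (a:=a))) (lapp_lactl HP HN _ hg hz).
by rewrite (lactZr HN) !sgnZZ; apply: sgnZ_eq; odd_tac.
Qed.

Lemma starL_hom : is_hom n (starL n phi).
Proof.
apply: (is_hom_gen (tens_bimod true HY HL) HL' (gens_tens HY HL) _ starL_lin).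
- by move=> b c i t [b' [p [q [x [g [-> hx hg ->]]]]]]; apply: homog_tmk.
- by move=> b c s t [b' [i [j [x [g [-> hx hg ->]]]]]]; apply: starL_homog.
- move=> b b0 c s l z t hz [b' [i [j [x [g [_ hx hg ->]]]]]]; apply: (lhom_ext_homog HP' HN) => a r p hp.
  rewrite tens_lactE (linZ (lapp_linf _)) (lapp_lact HP' HN hz (starL_homog hx hg) hp).
  rewrite (starLE_homog (lact_homog HY hz hx) hg hp) (starLE_homog hx hg (ract_homog HP' hp hz)).
  by rewrite tmk_act // !sgnZZ; apply: sgnZ_eq; odd_tac.
- move=> b c c0 s l z t hz [b' [i [j [x [g [_ hx hg ->]]]]]]; apply: (lhom_ext_homog HP' HN) => a r p hp.
  rewrite tens_ractE (lapp_ractr HP' HN _ hz hp) (starLE_homog hx hg hp) (starLE_homog hx (ract_homog HL hg hz) hp).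
  have hq : homog (n + (r + i)) (phi a b' (tmk p x)) by apply: (hom_homog ph); apply: homog_tmk.
  by rewrite (lapp_ractr HP HN _ hz hq) (ractZl HN) !sgnZZ; apply: sgnZ_eq; odd_tac.
Qed.
End One.

Section Calculus.
Variables (P' P : bimod A B) (N : bimod A C) (HP' : is_bimod P') (HP : is_bimod P) (HN : is_bimod N).
Let HPY' := tens_bimod true HP' HY.
Let HL := homL_bimod HP HN.
Let HL' := homL_bimod HP' HN.

Lemma starL_dhom n (phi : bmap (tensor P' Y) P) : is_hom n phi ->
  dhom n (starL (N := N) n phi) = starL (n + 1) (dhom n phi).
Proof.
move=> ph; have ph' := hom_dhom HPY' HP ph.
have sh := starL_hom HP' HP HN ph; have sh' := starL_hom HP' HP HN ph'.
apply: bmap_ext => b c.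
apply: (lin_ext (gens_tens HY HL b c) (dhom_lin (tens_bimod true HY HL) HL' sh (a:=b) (b:=c)) (hlin sh' b c)).
move=> _ t [b' [i [j [x [g [_ hx hg ->]]]]]]; apply: (lhom_ext_homog HP' HN) => a r p hp.
have hdg := dd_homog (bcar_dgvect HL b' c) hg.
have hdx := dd_homog (bcar_dgvect HY b b') hx.
have hdp := dd_homog (bcar_dgvect HP' a b) hp.
have hs := starL_homog HP' HP HN ph hx hg.
rewrite (starLE_homog HP' HP HN ph' hx hg hp) /dhom (tens_ddE _ _ hx) (homD sh) (homZ sh).
rewrite (linB (lapp_linf _)) (linZ (lapp_linf _)) (linD (lapp_linf _)) (linZ (lapp_linf _)).
rewrite (lapp_dd HP' HN _ hs) (starLE_homog HP' HP HN ph hx hg hp) (starLE_homog HP' HP HN ph hx hg hdp).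
rewrite (starLE_homog HP' HP HN ph hdx hg hp) (starLE_homog HP' HP HN ph hx hdg hp).
rewrite (lapp_dd HP HN _ hg) (ddZ (bcar_dgvect HN a c)) (tens_ddE _ _ hp) (homD ph) (homZ ph).
rewrite (linB (lapp_lin HP HN g (a:=a))) (linZ (lapp_lin HP HN g (a:=a))) (linD (lapp_lin HP HN g (a:=a))) (linZ (lapp_lin HP HN g (a:=a))).
rewrite !(scalerBr, scalerDr) !sgnZZ.
rewrite (sgn_eq k (m := n + i + (n * (j + 1) + i * (j + 1 + r))) (n := n * j + i * (j + r))); last by odd_tac.
rewrite (sgn_eq k (m := n + (i + j) + (n * j + i * (j + (r + 1)))) (n := (n + 1) * j + i * (j + r) + n)); last by odd_tac.
rewrite (sgn_eq k (m := n + (n * j + (i + 1) * (j + r))) (n := (n + 1) * j + i * (j + r) + n + r)); last by odd_tac.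
rewrite (sgn_eq k (m := n + i + (n * (j + 1) + i * (j + 1 + r)) + j) (n := (n + 1) * j + i * (j + r))); last by odd_tac.
set u1 := _ *: dd (lapp _ _); set u2 := _ *: lapp g (phi a b' (tmk (dd p) x)).
set u3 := _ *: lapp g (phi a b' (tmk p (dd x))); set u4 := _ *: lapp g (dd _).
by abelian.
Qed.
End Calculus.

Lemma starL_comp (P'' P' P : bimod A B) (N : bimod A C) (HP'' : is_bimod P'') (HP' : is_bimod P')
  (HP : is_bimod P) (HN : is_bimod N) m n (psi : bmap (tensor P' Y) P) (phi : bmap (tensor P'' Y) P') :
  is_hom m psi -> is_hom n phi -> forall b c (t : tensor Y (homL P N) b c),
  starL n phi (lext m (starL m psi) t) = sgn k (n * m) *: starL (N := N) (m + n) (bcomp psi (rext phi)) t.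
Proof.
move=> sh ph b c t.
have HL := homL_bimod HP HN; have HL' := homL_bimod HP' HN.
have HYL := tens_bimod true HY HL; have HPY'' := tens_bimod true HP'' HY.
have rh := rext_hom HP'' HP' ph; have srh := hom_comp sh rh.
have s1 := starL_hom HP' HP HN sh; have s2 := starL_hom HP'' HP' HN ph.
have s3 := starL_hom HP'' HP HN srh.
move: t; apply: (lin_ext (gens_tens HY HL b c)
  (lin_comp (hlin s2 b c) (hlin (lext_hom HL HL' s1) b c)) (lin_scale _ (hlin s3 b c))).
move=> e t [b' [i [j [x [g [_ hx hg ->]]]]]]; apply: (lhom_ext_homog HP'' HN) => a r p hp.
rewrite (linZ (lapp_linf _)) (starLE_homog HP'' HP HN srh hx hg hp) (lextE HL) {1}/bcomp (rextE HP'').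
have hc : homog i (coprod x) by rewrite -[i]add0r; apply: (hom_homog (coprod_hom B)).
have HYY := tens_bimod true HY HY; have HT := bcar_dgvect HYY b b'.
have il := @assoc_inv_lin _ _ _ _ _ P'' Y Y HY HY a b'.
have al := @assoc_lin _ _ _ _ _ Y Y (homL P N) HY HY b c.
(* The signs involve the degrees of both parts of the coproduct of [x]. A twist of the whole
   coproduct collects them in an expression linear in it, which can then be compared on
   generators. *)
pose R (v : tensor Y Y b b') := sgn k (n * m + (m + n) * j) *:
  lapp g (psi a b' (tmap 0 phi (@bmap_id _ _ _ Y) (assoc_inv (tmk p (twist (j + r) v))))).
have lR : linear (fun v : tensor Y Y b b' =>
    lapp g (psi a b' (tmap 0 phi (@bmap_id _ _ _ Y) (assoc_inv (tmk p v))))).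
  apply: (lin_comp (lapp_lin HP HN g (a:=a)) (lin_comp (hlin sh a b') _)).
  exact: (lin_comp (tmap_lin HPY'' HY ph (hom_id Y) (a:=a) (b:=b')) (lin_comp il (tmk_linr p))).
transitivity (R (coprod x)); last first.
  rewrite /R (twistE HT _ hc) (linZ lR) !sgnZZ.
  by apply: sgnZ_eq; odd_tac.
move: (coprod x); apply: (lin_ext (gens_tens HY HY b b')
  (lin_comp (@lapp_linf _ _ _ _ P'' N b c a p) (lin_comp (hlin s2 b c) (lin_comp
    (tmap_lin HY HYL (hom_id Y) s1 (a:=b) (b:=c)) (lin_comp al (tmk_linl g)))))
  (lin_scale _ (lin_comp lR (twist_lin HT (j + r))))).
move=> l v [d [q1 [q2 [y1 [y2 [_ h1 h2 ->]]]]]].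
have hs := starL_homog HP' HP HN sh h2 hg.
have hq : homog (n + (r + q1)) (phi a d (tmk p y1)) by apply: (hom_homog ph); apply: homog_tmk.
have hv : homog (q1 + q2) (tmk y1 y2 : tensor Y Y b b') by apply: homog_tmk.
rewrite (twistE HT _ hv) (linZ lR).
rewrite assoc_invE assocE (tmap0E HPY'' HY ph (hom_id Y)) (tmapE HY HYL (hom_id Y) s1 _ h1).
rewrite (linZ (hlin s2 b c)) (linZ (lapp_linf _)).
rewrite (starLE_homog HP'' HP' HN ph h1 hs hp) (starLE_homog HP' HP HN sh h2 hg hq) !sgnZZ.
by apply: sgnZ_eq; odd_tac.
Qed.

Lemma starL_tau_actr (P : bimod A B) (N : bimod A C) (HP : is_bimod P) (HN : is_bimod N) :
  starL 0 (tau_actr P) = tau_actl (homL P N).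
Proof.
have HL := homL_bimod HP HN; have rh := tau_actr_hom HP.
apply: bmap_ext => b c; apply: (lin_ext (gens_tens HY HL b c)
  (hlin (starL_hom HP HP HN rh) b c) (tau_actl_lin HL (a:=b) (b:=c))).
move=> e t [b' [i [j [x [g [_ hx hg ->]]]]]]; apply: (lhom_ext_homog HP HN) => a r p hp.
rewrite (starLE_homog HP HP HN rh hx hg hp) tau_actlE // (lapp_lact HP HN (tau_homog hx) hg hp) tau_actrE //.
by rewrite mul0r add0r.
Qed.

Lemma starL_linear (P' P : bimod A B) (N : bimod A C) (HP' : is_bimod P') (HP : is_bimod P) (HN : is_bimod N)
  n (s : k) (phi psi : bmap (tensor P' Y) P) : is_hom n phi -> is_hom n psi ->
  forall b c (t : tensor Y (homL P N) b c),
  starL n (fun a b x => s *: phi a b x + psi a b x) t = s *: starL n phi t + starL n psi t.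
Proof.
move=> ph sh b c t.
have HL := homL_bimod HP HN; have h := hom_add HP (hom_scale HP s ph) sh.
move: t; apply: (lin_ext (gens_tens HY HL b c) (hlin (starL_hom HP' HP HN h) b c)
  (lin_add (lin_scale s (hlin (starL_hom HP' HP HN ph) b c)) (hlin (starL_hom HP' HP HN sh) b c))).
move=> e t [b' [i [j [x [g [_ hx hg ->]]]]]]; apply: (lhom_ext_homog HP' HN) => a r p hp.
rewrite (linD (lapp_linf _)) (linZ (lapp_linf _)) (starLE_homog HP' HP HN h hx hg hp).
rewrite (starLE_homog HP' HP HN ph hx hg hp) (starLE_homog HP' HP HN sh hx hg hp).
rewrite (linD (lapp_lin HP HN g (a:=a))) (linZ (lapp_lin HP HN g (a:=a))) scalerDr; congr (_ + _).
by rewrite !scalerA mulrC.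
Qed.
End StarLeft.

(** * The dual with respect to A *)

Section DualLeft.
Variables (k : fieldType) (A B : dgcat k).
Notation X := (bar A).
Notation Y := (bar B).
Let HX : is_bimod X := bar_bimod A.
Let HY : is_bimod Y := bar_bimod B.
Let HXX := tens_bimod true HX HX.
Let HD := diag_bimod A.

#[export] Instance dualA_bimod (M : bimod A B) : is_bimod M -> is_bimod (dualA M).
Proof. by move=> HM; apply: (homL_bimod (tens_bimod true HX HM) HD). Qed.

Section Evaluation.
Variables (M' M : bimod A B) (HM' : is_bimod M') (HM : is_bimod M) (n : int) (alpha : bmap (tilde M') M).
Arguments alpha : clear implicits.
Hypothesis ah : is_hom n alpha.
Let HMY' := tens_bimod true HM' HY.
Let HXM' := tens_bimod true HX HM'.
Let HXM := tens_bimod true HX HM.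
Let HDM := dualA_bimod HM.
Let HYD := tens_bimod true HY HDM.
Let ph := lhalf_hom HM' HM ah.
Let aih : is_hom n (bcomp alpha (@assoc_inv _ _ _ _ _ X M' Y)).
Proof.
apply: (is_hom_eq (m := n + 0)); first by rewrite addr0.
exact: (hom_comp ah (assoc_inv_hom HX HM' HY)).
Qed.

Let phiE a b' b a1 (z : X a a1) (m : M' a1 b') (x : Y b' b) :
  lhalf n alpha (tmk (tmk z m : tensor X M' a b') x) =
  tmap n (@bmap_id _ _ _ X) (bcomp alpha (@assoc_inv _ _ _ _ _ X M' Y)) (assoc (tmk (coprod z) (tmk m x : tensor M' Y a1 b))).
Proof. by rewrite /lhalf {1}/bcomp assocE (lextE HMY'). Qed.

Section Fixed.
Variables (b : B) (a : A) (a' : A) (b' : B).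
Variables (x : Y b b') (g : dualA M b' a') (y : X a' a) (i j l : int).
Hypotheses (hx : homog i x) (hg : homog j g) (hy : homog l y).

(** The expression under the sums of [dualA_map] for fixed degrees i, j, l, with the other signs
    written as twists by i + l and as the sign of [tmap]. In this form it is linear in [v] and
    [m]. *)
Let K a1 e (v : tensor X X a1 e) (m : M' e b) : diag A a1 a :=
  sgn k (n * j + i * j) *: ract (diag A) (lapp g (tmap n (@bmap_id _ _ _ X) (bcomp alpha (@assoc_inv _ _ _ _ _ X M' Y))
    (assoc (tmk (twist (i + l) v) (tmk (twist (i + l) m) x : tensor M' Y e b'))))) (bar_tau y).

Let Kl a1 e m : linear (fun v => @K a1 e v m).
Proof.
apply: lin_scale; apply: (lin_comp (ract_linearl HD (bar_tau y)) (lin_comp (lapp_lin HXM HD g (a:=a1)) _)).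
apply: (lin_comp (tmap_lin HX (tens_bimod true HX HMY') (hom_id X) aih (a:=a1) (b:=b'))).
apply: (lin_comp (@assoc_lin _ _ _ _ _ X X (tensor M' Y) HX HX a1 b')).
exact: (lin_comp (tmk_linl _) (twist_lin (bcar_dgvect HXX a1 e) _)).
Qed.

Let Km a1 e v : linear (fun m => @K a1 e v m).
Proof.
apply: lin_scale; apply: (lin_comp (ract_linearl HD (bar_tau y)) (lin_comp (lapp_lin HXM HD g (a:=a1)) _)).
apply: (lin_comp (tmap_lin HX (tens_bimod true HX HMY') (hom_id X) aih (a:=a1) (b:=b'))).
apply: (lin_comp (@assoc_lin _ _ _ _ _ X X (tensor M' Y) HX HX a1 b')).
exact: (lin_comp (tmk_linr _) (lin_comp (tmk_linl x) (twist_lin (bcar_dgvect HM' e b) _))).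
Qed.

Let KE a1 e' e p q r (z1 : X a1 e') (z2 : X e' e) (m : M' e b) : homog p z1 -> homog q z2 -> homog r m ->
  K (tmk z1 z2) m = sgn k (n * (j + p) + i * (j + (p + q) + r) + l * ((p + q) + r)) *:
                mcomp (lapp g (tmk z1 (alpha e' b' (tmk (tmk z2 m) x)))) (bar_tau y).
Proof.
move=> h1 h2 hm; rewrite /K.
have hz : homog (p + q) (tmk z1 z2 : tensor X X a1 e) by apply: homog_tmk.
rewrite (twistE (bcar_dgvect HXX a1 e) _ hz) (twistE (bcar_dgvect HM' e b) _ hm) !tmkZl tmkZr.
have al := @assoc_lin _ _ _ _ _ X X (tensor M' Y) HX HX a1 b'.
have tl := tmap_lin HX (tens_bimod true HX HMY') (hom_id X) aih (a:=a1) (b:=b').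
rewrite (linZ al) (linZ al) assocE (linZ tl) (linZ tl) (tmapE HX (tens_bimod true HX HMY') (hom_id X) aih _ h1).
rewrite !(linZ (lapp_lin HXM HD g (a:=a1))) !(ractZl HD) !sgnZZ /bcomp assoc_invE.
by apply: sgnZ_eq; odd_tac.
Qed.

Let G a1 (p : tensor X M' a1 b) : diag A a1 a :=
  starL_fun n (lhalf n alpha) x (ract (dualA M) g (bar_tau y)) p.

Let hgy : homog (j + l) (ract (dualA M) g (bar_tau y)).
Proof. by apply: (ract_homog HDM) => //; apply: tau_homog. Qed.

Let Gl a1 : linear (@G a1).
Proof. exact: (starL_fun_linp HXM' HXM HD ph). Qed.

Let GE a1 e (z : X a1 e) (m : M' e b) : G (tmk z m) = K (coprod z) m.
Proof.
move: z; apply: (lin_ext (gens_homog (bcar_dgvect HX a1 e)) (lin_comp (@Gl a1) (tmk_linl m))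
  (lin_comp (@Kl a1 e m) (coprod_lin (a:=a1) (b:=e)))) => p z hz.
move: m; apply: (lin_ext (gens_homog (bcar_dgvect HM' e b)) (lin_comp (@Gl a1) (tmk_linr z)) (@Km a1 e _)) => r m hm.
have hzm : homog (p + r) (tmk z m : tensor X M' a1 b) by apply: homog_tmk.
rewrite /G (starL_fun_homog HXM' HXM HD ph hx hgy hzm).
have hq : homog (n + (p + r + i)) (lhalf n alpha (tmk (tmk z m : tensor X M' a1 b) x)).
  by apply: (hom_homog ph); apply: homog_tmk.
rewrite (lapp_ractr HXM HD _ (tau_homog hy) hq) phiE /K.
have hc : homog p (coprod z) by rewrite -[p]add0r; apply: (hom_homog (coprod_hom A)).
rewrite (twistE (bcar_dgvect HXX a1 e) _ hc) (twistE (bcar_dgvect HM' e b) _ hm) !tmkZl tmkZr.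
have al := @assoc_lin _ _ _ _ _ X X (tensor M' Y) HX HX a1 b'.
have tl := tmap_lin HX (tens_bimod true HX HMY') (hom_id X) aih (a:=a1) (b:=b').
rewrite (linZ al) (linZ al) (linZ tl) (linZ tl) !(linZ (lapp_lin HXM HD g (a:=a1))) !(ractZl HD) !sgnZZ.
by apply: sgnZ_eq; odd_tac.
Qed.

Lemma dualA_map_inner :
  to_lhom (M := tensor X M') (N := diag A) (b := b) (c := a) (fun a'' =>
          tlift (fun e (z : bar A a'' e) (m : M' e b) =>
            tlift (fun e' (z1 : bar A a'' e') (z2 : bar A e' e) =>
              hsum z1 (fun p z1' => hsum z2 (fun q z2' => hsum m (fun r m' =>
                sgn k (n * (j + p) + i * (j + (p + q) + r) + l * ((p + q) + r)) *:
                mcomp (lapp g (tmk z1' (alpha e' b' (tmk (tmk z2' m') x))))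
                     (bar_tau y)))))
            (coprod z))) = starL n (lhalf n alpha) (tmk x (ract (dualA M) g (bar_tau y))).
Proof.
rewrite (starL_tmk HXM' HXM HD ph); congr to_lhom.
apply: functional_extensionality_dep => a1; apply/funext => p; rewrite -[RHS]/(G p).
move: p; apply: (tlift_eq (@Gl a1)) => e z m; rewrite GE.
apply: (tlift_eq (@Kl a1 e m)) => e' z1 z2.
rewrite -[RHS](hsum_linear (bcar_dgvect HX a1 e') z1 (lin_comp (@Kl a1 e m) (tmk_linl z2))).
apply: (eq_hsum (bcar_dgvect HX a1 e')) => p {}z1 h1.
rewrite -[RHS](hsum_linear (bcar_dgvect HX e' e) z2 (lin_comp (@Kl a1 e m) (tmk_linr z1))).
apply: (eq_hsum (bcar_dgvect HX e' e)) => q {}z2 h2.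
rewrite -[RHS](hsum_linear (bcar_dgvect HM' e b) m (@Km a1 e (tmk z1 z2))).
by apply: (eq_hsum (bcar_dgvect HM' e b)) => r {}m hm; rewrite (KE h1 h2 hm).
Qed.
End Fixed.

(** The mirror image of [dualB_mapE]: the bar factor y enters only through tau(y), and the coproduct
    is taken on the bar factor to the left of the argument, which calls for the left half of
    alpha. *)
Lemma dualA_mapE :
  dualA_map n alpha = bcomp (starL n (lhalf n alpha)) (tau_actr (tensor Y (dualA M))).
Proof.
have sh := starL_hom HXM' HXM HD ph; have rh := tau_actr_hom HYD.
apply: bmap_ext => b a t; rewrite /dualA_map.
apply: (tlift_eq (lin_comp (hlin sh b a) (hlin rh b a))) => a' u y.
apply: (tlift_eq (G := fun u : tensor Y (dualA M) b a' => starL n (lhalf n alpha) (tau_actr _ _ _ (tmk u y)))).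
  exact: (lin_comp (hlin sh b a) (lin_comp (hlin rh b a) (tmk_linl y))).
move=> b' x g; rewrite tau_actrE // tens_ractE.
pose S (x' : Y b b') (g' : dualA M b' a') (y' : X a' a) := starL n (lhalf n alpha) (tmk x' (ract (dualA M) g' (bar_tau y'))).
have Sx g' y' : linear (fun x' => S x' g' y') by exact: (lin_comp (hlin sh b a) (tmk_linl _)).
have Sg x' y' : linear (fun g' => S x' g' y').
  exact: (lin_comp (hlin sh b a) (lin_comp (tmk_linr x') (ract_linearl HDM _))).
have Sy x' g' : linear (fun y' => S x' g' y').
  apply: (lin_comp (hlin sh b a) (lin_comp (tmk_linr x') (lin_comp (ract_linearr HDM g') _))).
  exact: (hlin (bar_tau_hom A)).
rewrite -[RHS]/(S x g y) -(hsum_linear (bcar_dgvect HY b b') x (Sx g y)).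
apply: (eq_hsum (bcar_dgvect HY b b')) => i {}x hx.
rewrite -(hsum_linear (bcar_dgvect HDM b' a') g (Sg x y)).
apply: (eq_hsum (bcar_dgvect HDM b' a')) => j {}g hg.
rewrite -(hsum_linear (bcar_dgvect HX a' a) y (Sy x g)).
apply: (eq_hsum (bcar_dgvect HX a' a)) => l {}y hy.
exact: (dualA_map_inner hx hg hy).
Qed.
End Evaluation.
End DualLeft.

Lemma tau_actr_assoc_inv (k : fieldType) (A B C : dgcat k) (M : bimod A B) (N : bimod B C)
  (HM : is_bimod M) (HN : is_bimod N) a c (t : tensor M (tensor N (bar C)) a c) :
  tau_actr (tensor M N) a c (assoc_inv t) = tmap 0 (@bmap_id _ _ _ M) (tau_actr N) t.
Proof.
have HY := bar_bimod C; have HMN := tens_bimod true HM HN; have HNY := tens_bimod true HN HY.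
move: t; apply: (lin_ext (gens3r HM HN HY (a:=a) (b:=c))
  (lin_comp (tau_actr_lin HMN (a:=a) (b:=c)) (@assoc_inv_lin _ _ _ _ _ M N (bar C) HN HY a c))
  (tmap_lin HM HNY (hom_id M) (tau_actr_hom HN) (a:=a) (b:=c))).
move=> i t /gen3rP [d [e [p [q [r [x [m [y [_ hx hm hy ->]]]]]]]]].
by rewrite assoc_invE (tmap0E HM HNY (hom_id M) (tau_actr_hom HN)) !tau_actrE // tens_ractE.
Qed.

Section DualLeftFunctor.
Variables (k : fieldType) (A B : dgcat k).
Notation X := (bar A).
Notation Y := (bar B).
Let HX : is_bimod X := bar_bimod A.
Let HY : is_bimod Y := bar_bimod B.
Let HD := diag_bimod A.
Variables (M'' M' M : bimod A B) (HM'' : is_bimod M'') (HM' : is_bimod M') (HM : is_bimod M).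
Let HDM := dualA_bimod HM.
Let HDM' := dualA_bimod HM'.
Let HXM := tens_bimod true HX HM.
Let HXM' := tens_bimod true HX HM'.
Let HXM'' := tens_bimod true HX HM''.
Let HYD := tens_bimod true HY HDM.
Let HYD' := tens_bimod true HY HDM'.
Let HDX := tens_bimod true HDM HX.
Let rh := tau_actr_hom HYD.

Lemma dualA_map_hom n (alpha : bmap (tilde M') M) : is_hom n alpha -> is_hom n (dualA_map n alpha).
Proof.
move=> ah; rewrite (dualA_mapE HM' HM ah).
apply: (is_hom_eq (m := n + 0)); first by rewrite !addr0.
exact: (hom_comp (starL_hom HXM' HXM HD (lhalf_hom HM' HM ah)) rh).
Qed.

Lemma dualA_map_dhom n (alpha : bmap (tilde M') M) : is_hom n alpha ->
  dhom n (dualA_map n alpha) = dualA_map (n + 1) (dhom n alpha).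
Proof.
move=> ah; have ah' := hom_dhom (tilde_bimod HM') HM ah; have ph := lhalf_hom HM' HM ah.
rewrite (dualA_mapE HM' HM ah) (dualA_mapE HM' HM ah') -(lhalf_dhom HM' HM ah) -(starL_dhom HXM' HXM HD ph).
apply: bmap_ext => b a t.
by rewrite (dhom_comp_closedr (starL_hom HXM' HXM HD ph) (tau_actr_closed HYD)).
Qed.

Lemma dualA_map_id : dualA_map 0 (@bar_id k A B M) = @bar_id k B A (dualA M).
Proof. by rewrite (dualA_mapE HM HM (bar_id_hom HM)) lhalf_id // (starL_tau_actr HXM HD) bar_idE. Qed.

Lemma dualA_map_linear n (s : k) (f g : bmap (tilde M') M) : is_hom n f -> is_hom n g ->
  dualA_map n (fun a b x => s *: f a b x + g a b x) =
  (fun a b x => s *: dualA_map n f x + dualA_map n g x).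
Proof.
move=> fh gh; have h := hom_add HM (hom_scale HM s fh) gh.
rewrite (dualA_mapE HM' HM h) (dualA_mapE HM' HM fh) (dualA_mapE HM' HM gh) (lhalf_linear HM' HM s fh gh).
apply: bmap_ext => b a t; rewrite /bcomp.
by rewrite (starL_linear HXM' HXM HD s (lhalf_hom HM' HM fh) (lhalf_hom HM' HM gh)).
Qed.

Lemma dualA_map_comp m n (beta : bmap (tilde M') M) (alpha : bmap (tilde M'') M') :
  is_hom m beta -> is_hom n alpha ->
  bar_comp m (dualA_map n alpha) (dualA_map m beta) =
  (fun b a x => sgn k (n * m) *: dualA_map (m + n) (bar_comp n beta alpha) x).
Proof.
move=> bh ah; have bah := bar_comp_hom HM'' HM' bh ah.
have pb := lhalf_hom HM' HM bh; have pa := lhalf_hom HM'' HM' ah.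
have sb := starL_hom HXM' HXM HD pb.
have dbh := dualA_map_hom bh; have th := tau_actr_hom HDM.
apply: bmap_ext => b a t.
rewrite bar_compE (dualA_mapE HM'' HM' ah) (tilde_mapE HDM HDM' dbh) /bcomp.
rewrite (tau_actr_rext HYD HYD' (lhalf_hom HDM HDM' dbh)).
(* The right counit in front of [starL] commutes with the left extension, so the left half of the
   dual is the extension of [starL] after that counit. *)
have -> : lhalf m (dualA_map m beta) t = lext m (starL m (lhalf m beta)) (tau_actr (tensor Y (dualA M)) b a t).
  rewrite -[in RHS](assocK HY HDM HX t) tau_actr_assoc_inv // -(lext_tmap HDX HDM HDM' sb th).
  have -> : bcomp (starL m (lhalf m beta)) (tmap 0 (@bmap_id _ _ _ Y) (tau_actr (dualA M))) =
      bcomp (dualA_map m beta) (@assoc_inv _ _ _ _ _ Y (dualA M) X) => //.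
  by rewrite (dualA_mapE HM' HM bh); apply: bmap_ext => b' a' t'; rewrite /bcomp tau_actr_assoc_inv.
by rewrite (starL_comp HXM'' HXM' HXM HD pb pa) (dualA_mapE HM'' HM bah) (lhalf_comp HM'' HM' HM bh ah) (tilde_mapE HM'' HM' ah).
Qed.
End DualLeftFunctor.

(** * Homotopy equivalences and formal convolutions *)

(* a copy of [dgcat] whose objects live in a larger universe, as the bimodules do *)
Record dgc (k : fieldType) := Dgc {
  dob :> Type;
  dmor : dob -> dob -> dgvect k;
  dcompo : forall a b c, dmor b c -> dmor a b -> dmor a c;
  did : forall a, dmor a a;
  dmor_dgvect : forall a b, is_dgvect (dmor a b);
  dcompo_linearl : forall a b c (f : dmor a b), linear (fun g : dmor b c => dcompo g f);
  dcompo_linearr : forall a b c (g : dmor b c), linear (fun f : dmor a b => dcompo g f);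
  dcompo_homog : forall a b c (i j : int) (g : dmor b c) (f : dmor a b),
    homog i g -> homog j f -> homog (i + j) (dcompo g f);
  dcompo_dd : forall a b c (i : int) (g : dmor b c) (f : dmor a b), homog i g ->
    dd (dcompo g f) = dcompo (dd g) f + sgn k i *: dcompo g (dd f);
  dcompoA : forall a b c d (h : dmor c d) (g : dmor b c) (f : dmor a b),
    dcompo h (dcompo g f) = dcompo (dcompo h g) f;
  dcompo1l : forall a b (f : dmor a b), dcompo (did b) f = f;
  dcompo1r : forall a b (f : dmor a b), dcompo f (did a) = f;
  did_homog : forall a, homog 0 (did a);
  did_dd : forall a, dd (did a) = 0 }.
Arguments dmor {k} _ _ _.
Arguments dcompo {k _ a b c} _ _.
Arguments did {k _} _.
#[export] Existing Instance dmor_dgvect.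

Section CompositionAlgebra.
Variables (k : fieldType) (D : dgc k).
Implicit Types a b c : D.

Definition compo a b c (g : dmor D b c) (f : dmor D a b) : dmor D a c := dcompo g f.
Local Infix "\c" := compo (at level 40, left associativity).

Lemma compoDl a b c (f : dmor D a b) (g h : dmor D b c) : (g + h) \c f = g \c f + h \c f.
Proof. exact: (linD (dcompo_linearl f)). Qed.
Lemma compoDr a b c (g : dmor D b c) (f h : dmor D a b) : g \c (f + h) = g \c f + g \c h.
Proof. exact: (linD (dcompo_linearr g)). Qed.
Lemma compoNl a b c (f : dmor D a b) (g : dmor D b c) : (- g) \c f = - (g \c f).
Proof. exact: (linN (dcompo_linearl f)). Qed.
Lemma compoNr a b c (g : dmor D b c) (f : dmor D a b) : g \c (- f) = - (g \c f).
Proof. exact: (linN (dcompo_linearr g)). Qed.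
Lemma compoZl a b c s (f : dmor D a b) (g : dmor D b c) : (s *: g) \c f = s *: (g \c f).
Proof. exact: (linZ (dcompo_linearl f)). Qed.
Lemma compoZr a b c s (g : dmor D b c) (f : dmor D a b) : g \c (s *: f) = s *: (g \c f).
Proof. exact: (linZ (dcompo_linearr g)). Qed.
Lemma compo0l a b c (f : dmor D a b) : (0 : dmor D b c) \c f = 0.
Proof. exact: (lin0 (dcompo_linearl f)). Qed.
Lemma compo0r a b c (g : dmor D b c) : g \c (0 : dmor D a b) = 0.
Proof. exact: (lin0 (dcompo_linearr g)). Qed.
Lemma compoA a b c d (h : dmor D c d) (g : dmor D b c) (f : dmor D a b) : h \c (g \c f) = h \c g \c f.
Proof. exact: dcompoA. Qed.
Lemma compo1l a b (f : dmor D a b) : (did b : dmor D b b) \c f = f.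
Proof. exact: dcompo1l. Qed.
Lemma compo1r a b (f : dmor D a b) : f \c (did a : dmor D a a) = f.
Proof. exact: dcompo1r. Qed.
Lemma compo_suml a b c (I : Type) (s : seq I) (G : I -> dmor D b c) (f : dmor D a b) :
  (\sum_(i <- s) G i) \c f = \sum_(i <- s) (G i \c f).
Proof. exact: (lin_sum (dcompo_linearl f)). Qed.
Lemma compo_sumr a b c (I : Type) (s : seq I) (G : I -> dmor D a b) (f : dmor D b c) :
  f \c (\sum_(i <- s) G i) = \sum_(i <- s) (f \c G i).
Proof. exact: (lin_sum (dcompo_linearr f)). Qed.
Lemma compo_homog a b c i j (g : dmor D b c) (f : dmor D a b) :
  homog i g -> homog j f -> homog (i + j) (g \c f).
Proof. exact: dcompo_homog. Qed.
Lemma compo_dd a b c i (g : dmor D b c) (f : dmor D a b) : homog i g ->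
  dd (g \c f) = dd g \c f + sgn k i *: (g \c dd f).
Proof. exact: dcompo_dd. Qed.

Definition compoE := (compoDl, compoDr, compoNl, compoNr).

(* the opposite signs in f g = 1 + D l and g f = 1 - D h make h, g, - l entries of a contraction of the cone of f *)
Record equiv_data a b (f : dmor D a b) (g : dmor D b a) (h : dmor D a a) (l : dmor D b b) : Prop := EquivData {
  eqd_f : homog 0 f; eqd_g : homog 0 g; eqd_h : homog (-1) h; eqd_l : homog (-1) l;
  eqd_df : dd f = 0; eqd_dg : dd g = 0;
  eqd_dh : dd h = did a - g \c f; eqd_dl : dd l = f \c g - did b }.

Definition hequiv a b (f : dmor D a b) : Prop := exists g h l, equiv_data f g h l.

Lemma hequiv_comp a b c (f : dmor D a b) (f' : dmor D b c) : hequiv f -> hequiv f' -> hequiv (f' \c f).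
Proof.
move=> [g [h [l [f0 g0 h1 l1 df dg dh dl]]]] [g' [h' [l' [f0' g0' h1' l1' df' dg' dh' dl']]]].
exists (g \c g'), (h + g \c h' \c f), (l' + f' \c l \c g'); split.
- by rewrite -[0]addr0; apply: compo_homog.
- by rewrite -[0]addr0; apply: compo_homog.
- by apply: homogD => //; have := compo_homog (compo_homog g0 h1') f0; rewrite add0r addr0.
- by apply: homogD => //; have := compo_homog (compo_homog f0' l1) g0'; rewrite add0r addr0.
- by rewrite (compo_dd _ f0') df df' compo0l compo0r scaler0 addr0.
- by rewrite (compo_dd _ g0) dg dg' compo0l compo0r scaler0 addr0.
- have hg := compo_homog g0 h1'; rewrite add0r in hg.
  rewrite (ddD (dmor_dgvect a a)) (compo_dd _ hg) (compo_dd _ g0) dg df dh dh' !(compo0l, compo0r) scaler0 addr0.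
  rewrite sgn0 scale1r add0r compoDr compoDl compo1r compoNr compoNl !compoA.
  by abelian.
- have hg := compo_homog f0' l1; rewrite add0r in hg.
  rewrite (ddD (dmor_dgvect c c)) (compo_dd _ hg) (compo_dd _ f0') df' dg' dl dl' !(compo0l, compo0r) scaler0 addr0.
  rewrite sgn0 scale1r add0r compoDr compoDl compoNr compoNl compo1r !compoA.
  by abelian.
Qed.
End CompositionAlgebra.
Notation "g \c f" := (compo g f) (at level 40, left associativity).

(** * Perturbation of an approximate contraction of a cone *)

Section Perturbation.
Variables (k : fieldType) (D : dgc k).
Variables (X : bool -> D) (P : nat -> forall b c, dmor D (X b) (X c) -> Prop).
Hypotheses (PD : forall v b c (f g : dmor D (X b) (X c)), P v f -> P v g -> P v (f + g))
  (PN : forall v b c (f : dmor D (X b) (X c)), P v f -> P v (- f))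
  (PM : forall v w b c e (g : dmor D (X c) (X e)) (f : dmor D (X b) (X c)), P v g -> P w f -> P (v + w) (g \c f))
  (Ple : forall v w b c (f : dmor D (X b) (X c)), (w <= v)%N -> P v f -> P w f)
  (Pfin : exists v, forall b c (f : dmor D (X b) (X c)), P v f -> f = 0).
Variable f : dmor D (X false) (X true).
Hypotheses (f0 : homog 0 f) (df : dd f = 0).

Record contraction := Contraction {
  ct_g : dmor D (X true) (X false); ct_h : dmor D (X false) (X false);
  ct_l : dmor D (X true) (X true); ct_r : dmor D (X false) (X true) }.

Record contraction_axioms (C : contraction) : Prop := ContractionAxioms {
  ct_g0 : homog 0 (ct_g C); ct_h1 : homog (-1) (ct_h C); ct_l1 : homog (-1) (ct_l C); ct_r2 : homog (-2) (ct_r C);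
  ct_Pg : P 0 (ct_g C); ct_Ph : P 0 (ct_h C); ct_Pl : P 0 (ct_l C); ct_Pr : P 0 (ct_r C) }.

(* The entries of D H - 1, where H is the endomorphism of the cone of f with entries (h, g, r, - l).  They vanish *)
(* iff H contracts the cone; the step H |-> H - H (D H - 1) turns the error n into - n^2.                         *)
Definition errMM C := dd (ct_h C) + ct_g C \c f - did (X false).
Definition errNM C := dd (ct_g C).
Definition errNN C := f \c ct_g C - dd (ct_l C) - did (X true).
Definition errMN C := dd (ct_r C) + f \c ct_h C + ct_l C \c f.

Definition newton C := Contraction
  (ct_g C - ct_h C \c errNM C - ct_g C \c errNN C)
  (ct_h C - ct_h C \c errMM C - ct_g C \c errMN C)
  (ct_l C - ct_l C \c errNN C + ct_r C \c errNM C)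
  (ct_r C + ct_l C \c errMN C - ct_r C \c errMM C).

Section Step.
Variable C : contraction.
Hypothesis HC : contraction_axioms C.
Let g := ct_g C.
Let h := ct_h C.
Let l := ct_l C.
Let r := ct_r C.
Let g0 : homog 0 g := ct_g0 HC.
Let h1 : homog (-1) h := ct_h1 HC.
Let l1 : homog (-1) l := ct_l1 HC.
Let r2 : homog (-2) r := ct_r2 HC.

Let dcomp0 b c e (u : dmor D (X c) (X e)) (v : dmor D (X b) (X c)) : homog 0 u ->
  dd (u \c v) = dd u \c v + u \c dd v.
Proof. by move=> hg; rewrite (compo_dd _ hg) sgn0 scale1r. Qed.

Let dcomp1 b c e (u : dmor D (X c) (X e)) (v : dmor D (X b) (X c)) : homog (-1) u ->
  dd (u \c v) = dd u \c v - u \c dd v.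
Proof. by move=> hg; rewrite (compo_dd _ hg) (sgn_eq k (n := 1)) ?sgn1 ?scaleN1r. Qed.

Let dcomp2 b c e (u : dmor D (X c) (X e)) (v : dmor D (X b) (X c)) : homog (-2) u ->
  dd (u \c v) = dd u \c v + u \c dd v.
Proof. by move=> hg; rewrite (compo_dd _ hg) (sgn_eq k (n := 0)) ?sgn0 ?scale1r. Qed.

Let DB b c (u v : dmor D (X b) (X c)) : dd (u - v) = dd u - dd v := ddB (dmor_dgvect _ _) u v.
Let DA b c (u v : dmor D (X b) (X c)) : dd (u + v) = dd u + dd v := ddD (dmor_dgvect _ _) u v.
Let D0 b c (u : dmor D (X b) (X c)) : dd (dd u) = 0 := dd_dd (dmor_dgvect _ _) u.
Let D1 b : dd (did (X b) : dmor D (X b) (X b)) = 0 := did_dd _.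

(** The error D H - 1 is a cycle in the endomorphism complex of the cone; the four formulas are the
    entries of this statement. *)
Lemma dd_errMM : dd (errMM C) = errNM C \c f.
Proof. by rewrite /errMM DB DA D0 D1 subr0 add0r (dcomp0 _ g0) df compo0r addr0. Qed.

Lemma dd_errNM : dd (errNM C) = 0.
Proof. exact: D0. Qed.

Lemma dd_errNN : dd (errNN C) = f \c errNM C.
Proof. by rewrite /errNN !DB D0 D1 !subr0 (dcomp0 _ f0) df compo0l add0r. Qed.

Lemma dd_errMN : dd (errMN C) = f \c errMM C - errNN C \c f.
Proof.
rewrite /errMN !DA D0 add0r (dcomp0 _ f0) (dcomp1 _ l1) df compo0l compo0r add0r subr0.
rewrite /errMM /errNN !compoE compo1r compo1l !compoA.
set u1 := f \c dd _; set u2 := dd _ \c f; set u3 := f \c _ \c f.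
by abelian.
Qed.

Let dhE : dd h = errMM C + did (X false) - g \c f.
Proof. by rewrite /errMM -/g -/h; abelian. Qed.

Let fgE : f \c g = errNN C + dd l + did (X true).
Proof. by rewrite /errNN -/g -/l; abelian. Qed.

Let drE : dd r = errMN C - f \c h - l \c f.
Proof. by rewrite /errMN -/r -/h -/l; abelian. Qed.

Let expand := (compoE, compo1l, compo1r).

(** With n = D H - 1 closed, D(H - H n) - 1 = n - (1 + n) n = - n^2. The four formulas are the
    entries of this matrix product. *)
Lemma newton_errMM : errMM (newton C) = - (errMM C \c errMM C + errNM C \c errMN C).
Proof.
rewrite {1}/errMM /newton /= -/g -/h !DB (dcomp1 _ h1) (dcomp0 _ g0) dd_errMM dd_errMN dhE -/(errNM C).
rewrite !expand !compoA; move: (errMM C) (errNM C) (errNN C) (errMN C) => n m q p.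
by abelian.
Qed.

Lemma newton_errNM : errNM (newton C) = - (errMM C \c errNM C + errNM C \c errNN C).
Proof.
rewrite {1}/errNM /newton /= -/g -/h !DB (dcomp1 _ h1) (dcomp0 _ g0) dd_errNM dd_errNN dhE -/(errNM C).
rewrite !expand compo0r !compoA; move: (errMM C) (errNM C) (errNN C) => n m q.
by abelian.
Qed.

Lemma newton_errNN : errNN (newton C) = - (errNN C \c errNN C + errMN C \c errNM C).
Proof.
rewrite {1}/errNN /newton /= -/g -/h -/l -/r DA DB (dcomp1 _ l1) (dcomp2 _ r2) dd_errNM dd_errNN drE.
rewrite !expand compo0r !compoA fgE !expand; move: (errNM C) (errNN C) (errMN C) => m q p.
by abelian.
Qed.

Lemma newton_errMN : errMN (newton C) = - (errMN C \c errMM C + errNN C \c errMN C).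
Proof.
rewrite {1}/errMN /newton /= -/g -/h -/l -/r DB DA (dcomp1 _ l1) (dcomp2 _ r2) dd_errMM dd_errMN drE.
rewrite !expand !compoA fgE !expand; move: (errMM C) (errNM C) (errNN C) (errMN C) => n m q p.
by abelian.
Qed.

Let nE : homog 0 (errMM C).
Proof.
apply: homogB; last exact: did_homog; apply: homogD; first by have := dd_homog (dmor_dgvect _ _) h1; rewrite addNr.
by have := compo_homog g0 f0; rewrite addr0.
Qed.
Let mE : homog 1 (errNM C).
Proof. by have := dd_homog (dmor_dgvect _ _) g0; rewrite add0r. Qed.
Let qE : homog 0 (errNN C).
Proof.
apply: homogB; last exact: did_homog; apply: homogB; last by have := dd_homog (dmor_dgvect _ _) l1; rewrite addNr.
by have := compo_homog f0 g0; rewrite addr0.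
Qed.
Let pE : homog (-1) (errMN C).
Proof.
apply: homogD; last by have := compo_homog l1 f0; rewrite addr0.
apply: homogD; last by have := compo_homog f0 h1; rewrite add0r.
exact: (dd_homog (dmor_dgvect _ _) r2).
Qed.

Let PM0 v w b c e (u : dmor D (X c) (X e)) (t : dmor D (X b) (X c)) : P v u -> P w t -> P 0 (u \c t).
Proof. by move=> hu ht; apply: Ple (PM hu ht). Qed.

Lemma newton_axioms v w x y : P v (errMM C) -> P w (errNM C) -> P x (errNN C) -> P y (errMN C) ->
  contraction_axioms (newton C).
Proof.
move=> hn hm hq hp; split; rewrite /newton /= -/g -/h -/l -/r.
- apply: homogB; last by have := compo_homog g0 qE; rewrite addr0.
  by apply: homogB => //; have := compo_homog h1 mE; rewrite addNr.
- apply: homogB; last by have := compo_homog g0 pE; rewrite add0r.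
  by apply: homogB => //; have := compo_homog h1 nE; rewrite addr0.
- apply: homogD; last exact: (compo_homog r2 mE).
  by apply: homogB => //; have := compo_homog l1 qE; rewrite addr0.
- apply: homogB; last by have := compo_homog r2 nE; rewrite addr0.
  by apply: homogD => //; apply: (compo_homog l1 pE).
- apply/PD; [apply/PD; [exact: (ct_Pg HC) | apply/PN/(PM0 (ct_Ph HC) hm)] | apply/PN/(PM0 (ct_Pg HC) hq)].
- apply/PD; [apply/PD; [exact: (ct_Ph HC) | apply/PN/(PM0 (ct_Ph HC) hn)] | apply/PN/(PM0 (ct_Pg HC) hp)].
- apply/PD; [apply/PD; [exact: (ct_Pl HC) | apply/PN/(PM0 (ct_Pl HC) hq)] | apply/(PM0 (ct_Pr HC) hm)].
- apply/PD; [apply/PD; [exact: (ct_Pr HC) | apply/(PM0 (ct_Pl HC) hp)] | apply/PN/(PM0 (ct_Pr HC) hn)].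
Qed.

End Step.

(** The orders of the entries of n^2: a diagonal entry receives its own square and a product of the
    two off-diagonal entries, whereas both summands of an off-diagonal entry contain one diagonal
    factor. *)
Lemma newton_order u v w x C : contraction_axioms C ->
  P v (errMM C) -> P u (errNM C) -> P v (errNN C) -> P w (errMN C) -> (x <= v + v)%N -> (x <= u + w)%N ->
  contraction_axioms (newton C) /\ [/\ P x (errMM (newton C)), P (v + u) (errNM (newton C)),
    P x (errNN (newton C)) & P (v + w) (errMN (newton C))].
Proof.
move=> HC hn hm hq hp xv xu; split; first exact: (newton_axioms HC hn hm hq hp).
rewrite (newton_errMM HC) (newton_errNM HC) (newton_errNN HC) (newton_errMN HC).
split; apply/PN/PD.
- exact: Ple xv (PM hn hn).
- exact: Ple xu (PM hm hp).
- exact: (PM hn hm).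
- by rewrite addnC; apply: (PM hm hq).
- exact: Ple xv (PM hq hq).
- by apply: Ple (PM hp hm); rewrite addnC.
- by rewrite addnC; apply: (PM hp hn).
- exact: (PM hq hp).
Qed.

(** The Newton steps push the errors to an order at which the filtration has only zero. Vanishing of
    the errors MM, NM and NN says that g is a homotopy inverse of f, with homotopies h and l. *)
Lemma perturbation C : contraction_axioms C ->
  P 1 (errMM C) -> P 1 (errNM C) -> P 1 (errNN C) -> P 0 (errMN C) -> hequiv f.
Proof.
(* As soon as every entry has positive order, each step raises all the orders by at least one. *)
have order_ge v : forall C, contraction_axioms C ->
    P v.+1 (errMM C) -> P v.+2 (errNM C) -> P v.+1 (errNN C) -> P v.+1 (errMN C) -> forall w, exists C',
    contraction_axioms C' /\ [/\ P (v + w) (errMM C'), P (v + w) (errNM C') & P (v + w) (errNN C')].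
  move=> C0 HC0 hn hm hq hp w; elim: w v C0 HC0 hn hm hq hp => [|w IHw] v C0 HC0 hn hm hq hp.
    by exists C0; split=> //; rewrite addn0; split; [apply: Ple hn | apply: Ple hm | apply: Ple hq]; lia.
  case: (newton_order (x := v.+2) HC0 hn hm hq hp) => [||HC' [hn' hm' hq' hp']]; [lia|lia|].
  have {IHw} := IHw v.+1 (newton C0) HC'; rewrite addSnnS; apply.
  - exact: hn'.
  - by apply: Ple hm'; lia.
  - exact: hq'.
  - by apply: Ple hp'; lia.
move=> HC hn hm hq hp.
(* The entry MN starts with order 0. One step makes it positive, and the diagonal keeps order 1
   because the product of the off-diagonal entries still has that order. *)
case: (newton_order (x := 1) HC hn hm hq hp) => [//|//|HC' [hn' hm' hq' hp']].
have [v P0] := Pfin.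
have [[g h l r] [[g0 h1 l1 _ _ _ _ _] [hn2 hm2 hq2]]] := order_ge 0 _ HC' hn' hm' hq' hp' v.
rewrite add0n in hn2 hm2 hq2.
exists g, h, l; split=> //.
- exact: (P0 _ _ _ hm2).
- by apply/eqP; rewrite -subr_eq0; apply/eqP; rewrite -(P0 _ _ _ hn2) /errMM /=; abelian.
- apply/eqP; rewrite -subr_eq0; apply/eqP.
  by have := congr1 -%R (P0 _ _ _ hq2); rewrite oppr0 /errNN /= => <-; abelian.
Qed.
End Perturbation.

(** * Convolutions in an abstract DG-category *)

Section FormalConvolution.
Variables (k : fieldType) (D : dgc k).

(* X is a convolution of (E, a); iota i has degree i because E i is placed in degree i *)
Record fconv (s : seq int) (E : int -> D) (a : forall i j, dmor D (E i) (E j)) (X : D)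
    (iota : forall i, dmor D (E i) X) (pi : forall i, dmor D X (E i)) : Prop := FConv {
  fc_uniq : uniq s;
  fc_a : forall i j : int, homog (i - j + 1) (a i j);
  fc_iota : forall i : int, homog i (iota i);
  fc_pi : forall i : int, homog (- i) (pi i);
  fc_orth : forall i j, i != j -> pi j \c iota i = 0;
  fc_id : forall i, pi i \c iota i = did (E i);
  fc_sum : \sum_(i <- s) iota i \c pi i = did X;
  fc_dd : forall i, dd (iota i) = \sum_(j <- s) iota j \c a i j }.

Section Components.
Variables (s : seq int) (E : int -> D) (a : forall i j, dmor D (E i) (E j)) (X : D).
Variables (iota : forall i, dmor D (E i) X) (pi : forall i, dmor D X (E i)).
Hypothesis H : fconv s a iota pi.

(** The identity of [E i] factors through the sum over [s], each term of which vanishes by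
    orthogonality. Sums over [s] hence behave like sums over all indices. *)
Lemma fc_out i : i \notin s -> did (E i) = 0 :> dmor D (E i) (E i).
Proof.
move=> si; rewrite -(fc_id H) -[iota i]compo1l -(fc_sum H) compo_suml compo_sumr big_seq big1 // => l ls.
by rewrite -compoA compoA (fc_orth H) ?compo0l //; apply: contraNneq si => <-.
Qed.

Lemma sum_pickr (T : D) (i : int) (u : forall l, dmor D (E l) T) :
  \sum_(l <- s) u l \c (pi l \c iota i) = u i.
Proof.
case: (boolP (i \in s)) => si; last first.
  rewrite -[RHS]compo1r fc_out // compo0r big_seq big1 // => l ls.
  by rewrite (fc_orth H) ?compo0r //; apply: contraNneq si => ->.
rewrite (bigD1_seq i) ?(fc_uniq H) //= (fc_id H) compo1r big1 ?addr0 // => l li.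
by rewrite (fc_orth H) ?compo0r // eq_sym.
Qed.

Lemma sum_pickl (T : D) (j : int) (u : forall l, dmor D T (E l)) :
  \sum_(l <- s) (pi j \c iota l) \c u l = u j.
Proof.
case: (boolP (j \in s)) => sj; last first.
  rewrite -[RHS]compo1l fc_out // compo0l big_seq big1 // => l ls.
  by rewrite (fc_orth H) ?compo0l //; apply: contraNneq sj => <-.
rewrite (bigD1_seq j) ?(fc_uniq H) //= (fc_id H) compo1l big1 ?addr0 // => l li.
by rewrite (fc_orth H) ?compo0l.
Qed.

Lemma fc_resolver (T : D) (u : dmor D X T) : u = \sum_(l <- s) u \c iota l \c pi l.
Proof. by rewrite -{1}[u]compo1r -(fc_sum H) compo_sumr; apply: eq_bigr => l _; rewrite compoA. Qed.

Lemma fc_resolvel (T : D) (u : dmor D T X) : u = \sum_(l <- s) iota l \c (pi l \c u).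
Proof. by rewrite -{1}[u]compo1l -(fc_sum H) compo_suml; apply: eq_bigr => l _; rewrite compoA. Qed.

Lemma fc_pi_dd i j : pi j \c dd (iota i) = a i j.
Proof.
rewrite (fc_dd H) compo_sumr -[RHS](sum_pickl j (fun l => a i l)).
by apply: eq_bigr => l _; rewrite compoA.
Qed.

(** The composite of pi_j and iota_i is zero or an identity, hence closed; the Leibniz rule then
    expresses the differential of the projections through that of the injections. *)
Lemma fc_dd_pi i j : dd (pi j) \c iota i = - (sgn k j *: a i j).
Proof.
have D0 : dd (pi j \c iota i) = 0.
  case: (eqVneq i j) => [-> | ij]; first by rewrite (fc_id H) did_dd.
  by rewrite (fc_orth H ij) (dd0 (dmor_dgvect _ _)).
by move: D0; rewrite (compo_dd _ (fc_pi H j)) fc_pi_dd (sgn_eq k (n := j)) ?oddzN // => /eqP; rewrite addr_eq0 => /eqP.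
Qed.
End Components.

Lemma fc_ext s (E E' : int -> D) a a' X X' iota iota' pi pi' :
  @fconv s E a X iota pi -> @fconv s E' a' X' iota' pi' -> forall u v : dmor D X X',
  (forall i j, pi' j \c u \c iota i = pi' j \c v \c iota i) -> u = v.
Proof.
move=> H H' u v uv; rewrite (fc_resolver H u) (fc_resolver H v); apply: eq_bigr => i _; congr (_ \c _).
rewrite (fc_resolvel H' (u \c _)) (fc_resolvel H' (v \c _)); apply: eq_bigr => j _; congr (_ \c _).
by rewrite !compoA.
Qed.

Section ConvolutionMap.
Variables (s : seq int) (E : bool -> int -> D) (a : forall b i j, dmor D (E b i) (E b j)) (X : bool -> D).
Variables (iota : forall b i, dmor D (E b i) (X b)) (pi : forall b i, dmor D (X b) (E b i)).
Hypothesis H : forall b, fconv s (a b) (iota b) (pi b).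
Hypothesis a1 : forall b (i j : int), (j <= i)%R -> a b i j = 0.

Definition diagm b c (u : forall i, dmor D (E b i) (E c i)) : dmor D (X b) (X c) :=
  \sum_(l <- s) iota c l \c u l \c pi b l.

Lemma diagm_pi b c (u : forall i, dmor D (E b i) (E c i)) j : pi c j \c diagm u = u j \c pi b j.
Proof.
rewrite compo_sumr -[RHS](sum_pickl (H c) j (fun l => u l \c pi b l)).
by apply: eq_bigr => l _; rewrite !compoA.
Qed.

Lemma diagm_iota b c (u : forall i, dmor D (E b i) (E c i)) i : diagm u \c iota b i = iota c i \c u i.
Proof.
rewrite compo_suml -[RHS](sum_pickr (H b) i (fun l => iota c l \c u l)).
by apply: eq_bigr => l _; rewrite !compoA.
Qed.

Lemma diagm_homog b c n (u : forall i, dmor D (E b i) (E c i)) :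
  (forall i, homog n (u i)) -> homog n (diagm u).
Proof.
move=> hu; apply: homog_sum => l _.
have := compo_homog (compo_homog (fc_iota (H c) l) (hu l)) (fc_pi (H b) l).
by rewrite addrAC addrN add0r.
Qed.

(** An entry of the differential of a matrix is the differential of the entry, with the sign of the
    degree of the projection, plus the graded commutator with the differentials of the twisted
    complexes. *)
Lemma diagm_dd b c n (u : forall i, dmor D (E b i) (E c i)) i j : (forall i, homog n (u i)) ->
  pi c j \c dd (diagm u) \c iota b i =
  sgn k j *: dd (pi c j \c diagm u \c iota b i) + a c i j \c u i - sgn k n *: (u j \c a b i j).
Proof.
move=> hu; have hp := fc_pi (H c) j; have hpd := compo_homog hp (diagm_homog hu).
rewrite (compo_dd _ hpd) (compo_dd _ hp) compoDl compoZl !scalerDr -!compoA.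
have -> : dd (pi c j) \c (diagm u \c iota b i) = - (sgn k j *: (a c i j \c u i)).
  by rewrite diagm_iota compoA (fc_dd_pi (H c)) compoNl compoZl.
have -> : pi c j \c (diagm u \c dd (iota b i)) = u j \c a b i j.
  by rewrite compoA diagm_pi -compoA (fc_pi_dd (H b)).
rewrite scalerN !scalerA -!sgnD.
rewrite (sgnZ1 (m := j + j)); last by odd_tac.
rewrite (sgnZ1 (m := j + - j)); last by odd_tac.
rewrite (sgn_eq k (m := j + (- j + n)) (n := n)); last by odd_tac.
by set u1 := sgn k n *: _; abelian.
Qed.

(* maps which raise the index by at least v *)
Definition fil (v : nat) b c (u : dmor D (X b) (X c)) : Prop :=
  forall i j : int, (j < i + v%:Z)%R -> pi c j \c u \c iota b i = 0.

Lemma filD v b c (u w : dmor D (X b) (X c)) : fil v u -> fil v w -> fil v (u + w).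
Proof. by move=> hu hw i j ij; rewrite compoDr compoDl hu // hw // addr0. Qed.

Lemma filN v b c (u : dmor D (X b) (X c)) : fil v u -> fil v (- u).
Proof. by move=> hu i j ij; rewrite compoNr compoNl hu // oppr0. Qed.

(** For each intermediate index, one of the two factors would have to raise the index by less than
    its order, and so vanishes. *)
Lemma filM v w b c e (u : dmor D (X c) (X e)) (t : dmor D (X b) (X c)) : fil v u -> fil w t -> fil (v + w) (u \c t).
Proof.
move=> hu ht i j ij; rewrite (fc_resolver (H c) u) compo_suml compo_sumr compo_suml big1 // => l _.
have -> : pi e j \c (u \c iota c l \c pi c l \c t) \c iota b i =
  (pi e j \c u \c iota c l) \c (pi c l \c t \c iota b i) by rewrite !compoA.
case: (boolP (l < i + w%:Z)%R) => li; first by rewrite ht // compo0r.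
by rewrite hu ?compo0l //; move: ij li; lia.
Qed.

Lemma fil_le v w b c (u : dmor D (X b) (X c)) : (w <= v)%N -> fil v u -> fil w u.
Proof. by move=> wv hu i j ij; apply: hu; lia. Qed.

Lemma fil_fin : exists v, forall b c (u : dmor D (X b) (X c)), fil v u -> u = 0.
Proof.
(* Indices in [s] lie between -B and B, so a map that raises the index by more than 2 B is zero. *)
pose B := \sum_(i <- s) `|i|%N.
have sB i : i \in s -> (`|i|%N <= B)%N.
  by move=> si; rewrite /B (bigD1_seq i) ?(fc_uniq (H true)) //= leq_addr.
exists (B + B).+1 => b c u hu; apply: (fc_ext (H b) (H c)) => i j; rewrite compo0r compo0l.
case: (boolP (i \in s)) => si; last by rewrite -[LHS]compo1r (fc_out (H b) si) compo0r.
case: (boolP (j \in s)) => sj; last by rewrite -[LHS]compo1l (fc_out (H c) sj) compo0l.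
by apply: hu; have := sB i si; have := sB j sj; lia.
Qed.

Lemma fil_diagm b c (u : forall i, dmor D (E b i) (E c i)) : fil 0 (diagm u).
Proof.
move=> i j ij; rewrite diagm_pi -compoA (fc_orth (H b)) ?compo0r //.
by apply/eqP => ij'; move: ij; rewrite ij'; lia.
Qed.

(** Here one-sidedness enters: the commutator with [a] raises the index strictly, so modulo order 1
    the differential of a diagonal matrix is computed entry by entry. *)
Lemma fil_diagm_dd b c n (u v : forall i, dmor D (E b i) (E c i)) : (forall i, homog n (u i)) ->
  (forall i, sgn k i *: dd (u i) = v i) -> fil 1 (dd (diagm u) - diagm v).
Proof.
move=> hu uv i j ij; rewrite compoDr compoDl compoNr compoNl (diagm_dd i j hu).
have ji : (j <= i)%R by move: ij; lia.
rewrite !(a1 _ ji) compo0l compo0r scaler0 subr0 addr0 !diagm_pi -!compoA.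
case: (eqVneq i j) => [<-|nij]; first by rewrite !(fc_id (H b)) !compo1r uv subrr.
by rewrite !(fc_orth (H b)) // !compo0r (dd0 (dmor_dgvect _ _)) scaler0 subr0.
Qed.

Lemma diagmM b c e (u : forall i, dmor D (E c i) (E e i)) (v : forall i, dmor D (E b i) (E c i)) :
  diagm u \c diagm v = diagm (fun i => u i \c v i).
Proof.
rewrite [RHS]/diagm [diagm v]/diagm compo_sumr; apply: eq_bigr => l _.
by rewrite !compoA diagm_iota.
Qed.

Lemma diagm1 b : diagm (fun i => did (E b i)) = did (X b).
Proof. by rewrite -(fc_sum (H b)); apply: eq_bigr => l _; rewrite compo1r. Qed.

Lemma diagmB b c (u v : forall i, dmor D (E b i) (E c i)) : diagm (fun i => u i - v i) = diagm u - diagm v.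
Proof. by rewrite -sumrB; apply: eq_bigr => l _; rewrite compoDr compoDl compoNr compoNl. Qed.

(** The entries of [f] commute with the differentials of the twisted complexes, which makes
    [diagm f] closed. The inverses and homotopies, placed on the diagonal, contract its cone up to
    the error that [perturbation] removes. *)
Theorem conv_hequiv (f : forall i, dmor D (E false i) (E true i)) :
  (forall i, hequiv (f i)) -> (forall i j, a true i j \c f i = f j \c a false i j) -> hequiv (diagm f).
Proof.
move=> hf fa.
(* [hequiv] is an existence statement, so choice supplies the data for all indices at once. *)
pose g i := sval (cid (hf i)); pose h i := sval (cid (svalP (cid (hf i)))).
pose l i := sval (cid (svalP (cid (svalP (cid (hf i)))))).
have efg i : equiv_data (f i) (g i) (h i) (l i) := svalP (cid (svalP (cid (svalP (cid (hf i)))))).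
move: (g) (h) (l) efg => {}g {}h {}l {hf} efg.
(* The differential of a diagonal matrix has diagonal entries (-1)^i D u_i; the signs on the
   homotopies compensate for this. *)
pose h' i := sgn k i *: h i; pose l' i := sgn k i *: l i.
have f0 i : homog 0 (f i) := eqd_f (efg i).
have g0 i : homog 0 (g i) := eqd_g (efg i).
have h1 i : homog (-1) (h' i) by apply: homogZ; apply: (eqd_h (efg i)).
have l1 i : homog (-1) (l' i) by apply: homogZ; apply: (eqd_l (efg i)).
have df : dd (diagm f) = 0.
  apply: (fc_ext (H false) (H true)) => i j; rewrite (diagm_dd i j f0) sgn0 scale1r fa addrK diagm_pi -compoA.
  rewrite compo0r compo0l; case: (eqVneq i j) => [<-|nij].
    by rewrite (fc_id (H false)) compo1r (eqd_df (efg i)) scaler0.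
  by rewrite (fc_orth (H false)) // compo0r (dd0 (dmor_dgvect _ _)) scaler0.
(* The entry r is 0 at the start. Its error MN is f h + l f, a diagonal matrix, for which order 0 is
   all that is available. *)
apply: (perturbation (X := X) (P := fil) filD filN filM fil_le fil_fin (diagm_homog f0) df
  (C := Contraction (diagm g) (diagm h') (diagm l') 0)).
- split; rewrite /=; try exact: fil_diagm; try exact: diagm_homog; first exact: homog0.
  by move=> i j ij; rewrite compo0r compo0l.
- rewrite /errMM /= diagmM -(diagm1 false).
  have -> : dd (diagm h') + diagm (fun i => g i \c f i) - diagm (fun i => did (E false i)) =
      dd (diagm h') - diagm (fun i => did (E false i) - g i \c f i) by rewrite diagmB; abelian.
  apply: (fil_diagm_dd h1) => i.
  by rewrite /h' (ddZ (dmor_dgvect _ _)) sgnZZ sgnZ1 ?(eqd_dh (efg i)); last odd_tac.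
- rewrite /errNM /= -[dd _]subr0 -(subrr (diagm g)) -diagmB.
  by apply: (fil_diagm_dd g0) => i; rewrite (eqd_dg (efg i)) scaler0 subrr.
- rewrite /errNN /= diagmM -(diagm1 true).
  have -> : diagm (fun i => f i \c g i) - dd (diagm l') - diagm (fun i => did (E true i)) =
      - (dd (diagm l') - diagm (fun i => f i \c g i - did (E true i))) by rewrite diagmB; abelian.
  apply/filN/(fil_diagm_dd l1) => i.
  by rewrite /l' (ddZ (dmor_dgvect _ _)) sgnZZ sgnZ1 ?(eqd_dl (efg i)); last odd_tac.
- rewrite /errMN /= (dd0 (dmor_dgvect _ _)) add0r !diagmM.
  by apply: filD; apply: fil_diagm.
Qed.
End ConvolutionMap.
End FormalConvolution.

(** * Contravariant DG-functors *)

Section Contravariant.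
Variables (k : fieldType) (D D' : dgc k) (F : D -> D') (Fm : forall a b : D, dmor D a b -> dmor D' (F b) (F a)).

Record cfunctor : Prop := CFunctor {
  cf_lin : forall a b, linear (@Fm a b);
  cf_homog : forall a b n (f : dmor D a b), homog n f -> homog n (Fm f);
  cf_dd : forall a b (f : dmor D a b), Fm (dd f) = dd (Fm f);
  cf_id : forall a, Fm (did a : dmor D a a) = did (F a);
  cf_comp : forall a b c m n (g : dmor D b c) (f : dmor D a b), homog m g -> homog n f ->
    Fm (g \c f) = sgn k (m * n) *: (Fm f \c Fm g) }.
Hypothesis HF : cfunctor.

Lemma cf_sum a b (I : Type) (s : seq I) (G : I -> dmor D a b) : Fm (\sum_(i <- s) G i) = \sum_(i <- s) Fm (G i).
Proof. exact: (lin_sum (cf_lin HF (a:=a) (b:=b))). Qed.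

(** Contravariance exchanges the roles of the two homotopies, and the opposite conventions for h and
    l lead to the minus signs. *)
Lemma cf_hequiv a b (f : dmor D a b) : hequiv f -> hequiv (Fm f).
Proof.
move=> [g [h [l [f0 g0 h1 l1 df dg dh dl]]]].
have F0 u v : Fm (0 : dmor D u v) = 0 := lin0 (cf_lin HF (a:=u) (b:=v)).
exists (Fm g), (- Fm l), (- Fm h); split.
- exact: (cf_homog HF).
- exact: (cf_homog HF).
- by apply/homogN/(cf_homog HF).
- by apply/homogN/(cf_homog HF).
- by rewrite -(cf_dd HF) df F0.
- by rewrite -(cf_dd HF) dg F0.
- rewrite (linN (dd_linear (dmor_dgvect _ _))) -(cf_dd HF) dl (linB (cf_lin HF (a:=b) (b:=b))) (cf_id HF) opprB.
  by rewrite (cf_comp HF f0 g0) sgn0 scale1r.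
- rewrite (linN (dd_linear (dmor_dgvect _ _))) -(cf_dd HF) dh (linB (cf_lin HF (a:=a) (b:=a))) (cf_id HF) opprB.
  by rewrite (cf_comp HF g0 f0) sgn0 scale1r.
Qed.

Lemma cf_compV a b c m n (g : dmor D b c) (f : dmor D a b) : homog m g -> homog n f ->
  Fm f \c Fm g = sgn k (m * n) *: Fm (g \c f).
Proof. by move=> hg hf; rewrite (cf_comp HF hg hf) sgnZZ sgnZ1 //; odd_tac. Qed.

Section Dual.
Variables (s : seq int) (E : int -> D) (a : forall i j, dmor D (E i) (E j)).

Definition dual_diff (i j : int) : dmor D' (F (E (- i))) (F (E (- j))) :=
  sgn k (j ^+ 2 + i * j + 1) *: Fm (a (- j) (- i)).

Hypothesis a_homog : forall i j : int, homog (i - j + 1) (a i j).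

Lemma dual_diff_homog (i j : int) : homog (i - j + 1) (dual_diff i j).
Proof.
apply: homogZ; apply: (cf_homog HF).
have -> : i - j + 1 = - j - - i + 1 by ring.
exact: a_homog.
Qed.

Lemma big_oppz (V : zmodType) (G : int -> V) : \sum_(l <- map -%R s) G l = \sum_(l <- s) G (- l).
Proof. by rewrite big_map. Qed.

Lemma dual_twisted :
  (forall i j, sgn k j *: dd (a i j) + \sum_(l <- s) a l j \c a i l = 0) ->
  forall i j, sgn k j *: dd (dual_diff i j) + \sum_(l <- map -%R s) dual_diff l j \c dual_diff i l = 0.
Proof.
move=> tw i j; rewrite big_oppz.
(* The image of the equation from -j to -i, multiplied by this sign, is the equation for the dual
   complex term by term: the summand i of the exponent removes the sign of the original equation,
   the last summand j supplies the new one, and the rest is the exponent in [dual_diff]. *)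
have := congr1 (fun u => sgn k (i + j ^+ 2 + i * j + 1 + j) *: Fm u) (tw (- j) (- i)).
rewrite (lin0 (cf_lin HF (a:=_) (b:=_))) scaler0 => tw'; rewrite -[RHS]tw'.
rewrite (linD (cf_lin HF (a:=_) (b:=_))) (linZ (cf_lin HF (a:=_) (b:=_))) scalerDr; congr (_ + _).
  rewrite /dual_diff (ddZ (dmor_dgvect _ _)) -(cf_dd HF) !sgnZZ.
  by apply: sgnZ_eq; odd_tac.
rewrite cf_sum scaler_sumr. apply: eq_bigr => l _.
rewrite (cf_comp HF (a_homog _ _) (a_homog _ _)) /dual_diff compoZl compoZr opprK !sgnZZ.
by apply: sgnZ_eq; odd_tac.
Qed.

Variables (X : D) (iota : forall i, dmor D (E i) X) (pi : forall i, dmor D X (E i)).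

(** Projections of X become injections of F(X). Since D pi_j = - (-1)^j times the sum of the a_lj
    pi_l, the sign (-1)^i put on the new injections and the Koszul sign of F together give the
    exponent j^2 + ij + 1. *)
Lemma fconv_dual : fconv s a iota pi ->
  fconv (map -%R s) dual_diff (fun i => sgn k i *: Fm (pi (- i))) (fun i => Fm (iota (- i))).
Proof.
move=> H; split.
- by rewrite map_inj_uniq ?(fc_uniq H) //; apply: oppr_inj.
- exact: dual_diff_homog.
- by move=> i; apply: homogZ; apply: (cf_homog HF); have := fc_pi H (- i); rewrite opprK.
- by move=> i; apply: (cf_homog HF); apply: (fc_iota H).
- move=> i j ij; rewrite compoZr (cf_compV (fc_pi H _) (fc_iota H _)) (fc_orth H) ?eqr_opp 1?eq_sym //.
  by rewrite (lin0 (cf_lin HF (a:=_) (b:=_))) !scaler0.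
- move=> i; rewrite compoZr (cf_compV (fc_pi H _) (fc_iota H _)) (fc_id H) (cf_id HF) sgnZZ sgnZ1 //.
  by odd_tac.
- rewrite big_oppz -(cf_id HF) -(fc_sum H) cf_sum; apply: eq_bigr => i _; rewrite opprK compoZl.
  rewrite (cf_compV (fc_iota H _) (fc_pi H _)) sgnZZ sgnZ1 //; odd_tac.
- move=> i; rewrite big_oppz (ddZ (dmor_dgvect _ _)) -(cf_dd HF).
  have -> : dd (pi (- i)) = - (sgn k i *: \sum_(l <- s) a l (- i) \c pi l).
    rewrite [LHS](fc_resolver H) scaler_sumr -sumrN; apply: eq_bigr => l _.
    by rewrite (fc_dd_pi H) compoNl compoZl (sgn_eq k (n := i)) ?oddzN.
  rewrite (linN (cf_lin HF (a:=_) (b:=_))) (linZ (cf_lin HF (a:=_) (b:=_))) scalerN sgnZZ sgnZ1; last by odd_tac.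
  rewrite cf_sum -sumrN; apply: eq_bigr => l _; rewrite /dual_diff opprK.
  rewrite (cf_comp HF (a_homog _ _) (fc_pi H _)) compoZl compoZr sgnZZ NsgnZ.
  by apply: sgnZ_eq; odd_tac.
Qed.
End Dual.
End Contravariant.

(** * The bar resolution *)

Section BarDGCategory.
Variables (k : fieldType) (A B : dgcat k).

Definition bobj : Type := {M : bimod A B | is_bimod M}.
Implicit Types L M N : bobj.
Definition bobj_bimod M : is_bimod (sval M) := svalP M.

Section Hom.
Variables M N : bobj.
Let HM := bobj_bimod M.
Let HN := bobj_bimod N.
Let U (t : A * B) : dgvect k := tilde (sval M) t.1 t.2.
Let W (t : A * B) : dgvect k := sval N t.1 t.2.
Let HU t : is_dgvect (U t) := bcar_dgvect (tilde_bimod HM) t.1 t.2.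
Let HW t : is_dgvect (W t) := bcar_dgvect HN t.1 t.2.

(** A morphism of the bar category as a single family indexed by pairs of objects, the form to which
    the lemmas on Hom spaces apply. *)
Definition bhom_pred (n : int) (f : dprod (fun t => dprod (fun _ : U t => W t : lmodType k) : lmodType k)) : Prop :=
  is_hom (M := tilde (sval M)) (N := sval N) n (fun a b x => f (a, b) x).

Lemma bhom_axioms : hom_space_axioms bhom_pred.
Proof.
split.
- by move=> n f fh [a b]; apply: (hlin fh).
- by move=> n f fh [a b]; apply: (hom_homog fh).
- by move=> n; apply: hom_zero.
- by move=> n f g fh gh; apply: (hom_add HN fh gh).
- by move=> n c f fh; apply: (hom_scale HN c fh).
- by move=> n f fh; apply: (hom_dhom (tilde_bimod HM) HN fh).
Qed.

Definition bhom : dgvect k := hsp_dg bhom_pred.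

Definition bapp (f : bhom) : bmap (tilde (sval M)) (sval N) := fun a b x => hsp_app f (t := (a, b)) x.
Definition bmk (f : bmap (tilde (sval M)) (sval N)) : bhom := hsp_mk bhom_pred (fun t x => f t.1 t.2 x).

Lemma bhom_dgvect : is_dgvect bhom.
Proof. exact: (hsp_dgvect HU HW bhom_axioms). Qed.

Lemma bapp_inj (f g : bhom) : bapp f = bapp g -> f = g.
Proof. by move=> fg; apply: hsp_ext => -[a b] x; rewrite -/(bapp f x) fg. Qed.

Lemma bmkK n f : is_hom n f -> bapp (bmk f) = f.
Proof. by move=> fh; apply: bmap_ext => a b x; rewrite /bapp /bmk (hsp_mkE (n := n)). Qed.

Lemma bapp_hom n (f : bhom) : homog n f <-> is_hom n (bapp f).
Proof. exact: (hsp_homogP HU HW bhom_axioms). Qed.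

Lemma bapp_linf a b (x : tilde (sval M) a b) : linear (fun f : bhom => bapp f x).
Proof. by []. Qed.

Lemma bapp_lin (f : bhom) a b : linear (@bapp f a b).
Proof. exact: (hsp_app_lin bhom_axioms f (t := (a, b))). Qed.

Lemma bapp_dd n (f : bhom) : homog n f -> bapp (dd f) = dhom n (bapp f).
Proof.
move=> /(hsp_homogP HU HW bhom_axioms) hf; apply: bmap_ext => a b x.
exact: (hsp_ddE_homog HU HW bhom_axioms (t := (a, b)) x hf).
Qed.
End Hom.

Arguments bapp : clear implicits.
Arguments bapp {M N} f [a b] x.

Section Composition.
Variables L M N : bobj.
Let HL := bobj_bimod L.
Let HM := bobj_bimod M.

(* homogeneous components are taken once more, so that the summand is linear in f *)
Definition bcomp_app (g : bhom M N) (f : bhom L M) : bmap (tilde (sval L)) (sval N) := fun a b x =>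
  hsum f (fun n f' => bapp g (tilde_map n (bapp (pr n f')) x)).

Definition bcmp (g : bhom M N) (f : bhom L M) : bhom L N := bmk (bcomp_app g f).

Let tilde_pr_lin n a b (x : tilde (sval L) a b) : linear (fun f : bhom L M => tilde_map n (bapp (pr n f)) x).
Proof.
have prh (f : bhom L M) : is_hom n (bapp (pr n f)) by apply/bapp_hom/(homog_pr (bhom_dgvect L M)).
move=> s f g.
have -> : bapp (pr n (s *: f + g)) = fun a b x => s *: bapp (pr n f) x + bapp (pr n g) x.
  by rewrite (pr_linear (bhom_dgvect L M)); apply: bmap_ext => a' b' x'; rewrite bapp_linf.
by rewrite (tilde_map_linear HL HM s (prh f) (prh g)).
Qed.

Lemma bcomp_app_linl f a b (x : tilde (sval L) a b) : linear (fun g => bcomp_app g f x).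
Proof.
apply: (hsum_lin_param (bhom_dgvect L M) (F := fun n f' g => bapp g (tilde_map n (bapp (pr n f')) x))) => [n h|n g].
  exact: bapp_linf.
by rewrite (lin0 (tilde_pr_lin n x)) (lin0 (bapp_lin g (a:=a) (b:=b))).
Qed.

Lemma bcomp_app_linr g a b (x : tilde (sval L) a b) : linear (fun f => bcomp_app g f x).
Proof.
apply: (hsum_lin (bhom_dgvect L M) (F := fun n f' => bapp g (tilde_map n (bapp (pr n f')) x))) => n.
exact: (lin_comp (bapp_lin g (a:=a) (b:=b)) (tilde_pr_lin n x)).
Qed.

Lemma bcomp_appE n g f : homog n f -> bcomp_app g f = bar_comp n (bapp g) (bapp f).
Proof.
move=> hf; apply: bmap_ext => a b x; rewrite /bcomp_app (hsum_homog (bhom_dgvect L M) hf) ?hf // => m.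
by rewrite (lin0 (tilde_pr_lin m x)) (lin0 (bapp_lin g (a:=a) (b:=b))).
Qed.

Lemma bcmp_app g f : bapp (bcmp g f) = bcomp_app g f.
Proof.
apply: bmap_ext => a b x.
rewrite /bapp /bcmp /bmk hsp_mk_span //; move: {a b x} g.
apply: (lspan_family (G := @homog k (bhom M N)) (F := fun g t x => bcomp_app g f x) (gens_homog (bhom_dgvect M N))).
  by move=> t x; apply: bcomp_app_linl.
move=> m g hg; move: f.
apply: (lspan_family (G := @homog k (bhom L M)) (F := fun f t x => bcomp_app g f x) (gens_homog (bhom_dgvect L M))).
  by move=> t x; apply: bcomp_app_linr.
move=> n f hf; apply: lspan_gen; exists (m + n); rewrite /bhom_pred /= (bcomp_appE _ hf).
by apply: (bar_comp_hom HL HM); apply/bapp_hom.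
Qed.

Lemma bcmpE n g f : homog n f -> bapp (bcmp g f) = bar_comp n (bapp g) (bapp f).
Proof. by move=> hf; rewrite bcmp_app; apply: bcomp_appE. Qed.

Lemma bcmp_linl f : linear (fun g => bcmp g f).
Proof.
move=> s g h; apply: bapp_inj; apply: bmap_ext => a b x.
transitivity (s *: bapp (bcmp g f) x + bapp (bcmp h f) x); last by [].
by rewrite !bcmp_app bcomp_app_linl.
Qed.

Lemma bcmp_linr g : linear (fun f => bcmp g f).
Proof.
move=> s f h; apply: bapp_inj; apply: bmap_ext => a b x.
have G u : bapp (bcmp g u) x = bcomp_app g u x by rewrite bcmp_app.
apply: (etrans (G _)); apply: (etrans (bcomp_app_linr g x s f h)).
by symmetry; congr (s *: _ + _); apply: G.
Qed.

Lemma bcmp_homog m n g f : homog m g -> homog n f -> homog (m + n) (bcmp g f).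
Proof.
by move=> hg hf; apply/bapp_hom; rewrite (bcmpE _ hf); apply: (bar_comp_hom HL HM); apply/bapp_hom.
Qed.

Lemma bcmp_dd m g f : homog m g -> dd (bcmp g f) = bcmp (dd g) f + sgn k m *: bcmp g (dd f).
Proof.
move=> hg; move: f; apply: (lin_ext (gens_homog (bhom_dgvect L M))
  (lin_comp (dd_linear (bhom_dgvect L N)) (bcmp_linr g))
  (lin_add (bcmp_linr (dd g)) (lin_scale _ (lin_comp (bcmp_linr g) (dd_linear (bhom_dgvect L M)))))).
move=> n f hf; apply: bapp_inj; apply: bmap_ext => a b x.
have gh : is_hom m (bapp g) by apply/bapp_hom.
have fh : is_hom n (bapp f) by apply/bapp_hom.
have e0 : bapp (dd (bcmp g f)) x = dhom (m + n) (bar_comp n (bapp g) (bapp f)) x.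
  by rewrite (bapp_dd (bcmp_homog hg hf)) (bcmpE _ hf).
have e1 : bapp (bcmp (dd g) f) x = bar_comp n (dhom m (bapp g)) (bapp f) x.
  by rewrite (bcmpE _ hf) (bapp_dd hg).
have e2 : bapp (bcmp g (dd f)) x = bar_comp (n + 1) (bapp g) (dhom n (bapp f)) x.
  by rewrite (bcmpE _ (dd_homog (bhom_dgvect L M) hf)) (bapp_dd hf).
apply: (etrans e0); apply: (etrans (bar_comp_dhom HL HM gh fh x)).
by symmetry; apply: (congr2 (fun u v => u + sgn k m *: v) e1 e2).
Qed.
End Composition.

Definition bid M : bhom M M := bmk (@bar_id k A B (sval M)).

Lemma bid_app M : bapp (bid M) = @bar_id k A B (sval M).
Proof. exact: (bmkK (bar_id_hom (bobj_bimod M))). Qed.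

Lemma bid_homog M : homog 0 (bid M).
Proof. by apply/bapp_hom; rewrite bid_app; apply: (bar_id_hom (bobj_bimod M)). Qed.

Lemma bid_dd M : dd (bid M) = 0.
Proof.
apply: bapp_inj; apply: bmap_ext => a b x; rewrite (bapp_dd (bid_homog M)) bid_app.
exact: (bar_id_closed (bobj_bimod M)).
Qed.

Lemma bcmpA K L M N (h : bhom M N) (g : bhom L M) (f : bhom K L) :
  bcmp h (bcmp g f) = bcmp (bcmp h g) f.
Proof.
move: f; apply: (lin_ext (gens_homog (bhom_dgvect K L)) (lin_comp (bcmp_linr h) (bcmp_linr g)) (bcmp_linr _)).
move=> n f hf; move: g; apply: (lin_ext (gens_homog (bhom_dgvect L M))
  (lin_comp (bcmp_linr h) (bcmp_linl f)) (lin_comp (bcmp_linl f) (bcmp_linr h))).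
move=> m g hg; apply: bapp_inj.
rewrite (bcmpE _ (bcmp_homog hg hf)) !(bcmpE _ hf) (bcmpE _ hg).
by rewrite (bar_compA (bobj_bimod K) (bobj_bimod L) (bobj_bimod M) (bobj_bimod N)) //; apply/bapp_hom.
Qed.

Lemma bcmp1r M N (f : bhom M N) : bcmp f (bid M) = f.
Proof. by apply: bapp_inj; rewrite (bcmpE _ (bid_homog M)) bid_app (bar_comp_idr (bobj_bimod M)). Qed.

Lemma bcmp1l M N (f : bhom M N) : bcmp (bid N) f = f.
Proof.
move: f; apply: (lin_ext (gens_homog (bhom_dgvect M N)) (bcmp_linr _) (@lin_id _ _)) => n f hf.
apply: bapp_inj; rewrite (bcmpE _ hf) bid_app.
by apply: (bar_comp_idl (bobj_bimod M) (bobj_bimod N)); apply/bapp_hom.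
Qed.

Definition bar_cat : dgc k := @Dgc k bobj bhom bcmp bid bhom_dgvect bcmp_linl bcmp_linr
  bcmp_homog bcmp_dd bcmpA bcmp1l bcmp1r bid_homog bid_dd.
End BarDGCategory.
Arguments bapp {k A B M N} f [a b] x.

(** * Strict morphisms and the bar unit *)

Section Strict.
Variables (k : fieldType) (A B : dgcat k).
Notation C := (bar_cat A B).
Notation X := (bar A).
Notation Y := (bar B).
Let HX : is_bimod X := bar_bimod A.
Let HY : is_bimod Y := bar_bimod B.

Definition mkb (M : bimod A B) (HM : is_bimod M) : C := exist _ M HM.

Lemma bapp_compo (L M N : C) n (g : dmor C M N) (f : dmor C L M) : homog n f ->
  bapp (g \c f) = bar_comp n (bapp g) (bapp f).
Proof. exact: bcmpE. Qed.

Lemma bapp_did (M : C) : bapp (did M) = @bar_id k A B (sval M).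
Proof. exact: bid_app. Qed.

Lemma bapp0 (M N : C) : bapp (0 : dmor C M N) = fun a b x => 0.
Proof. by []. Qed.

Lemma bappD (M N : C) (f g : dmor C M N) : bapp (f + g) = fun a b x => bapp f x + bapp g x.
Proof. by []. Qed.

Lemma bappN (M N : C) (f : dmor C M N) : bapp (- f) = fun a b x => - bapp f x.
Proof. by []. Qed.

Lemma bappZ (M N : C) s (f : dmor C M N) : bapp (s *: f) = fun a b x => s *: bapp f x.
Proof. by []. Qed.

Section Map.
Variables (M N : C) (phi : bmap (sval M) (sval N)).
Arguments phi : clear implicits.
Let HM : is_bimod (sval M) := svalP M.

(** A map of bimodules seen in the bar category. Postcomposition with it is plain composition of the
    underlying maps ([bapp_strict_compo]). *)
Definition strict : dmor C M N := bmk (bcomp phi (@bar_id k A B (sval M))).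

Lemma strict_is_hom n : is_hom n phi -> is_hom n (bcomp phi (@bar_id k A B (sval M))).
Proof.
move=> ph; apply: (is_hom_eq (m := n + 0)); first by rewrite addr0.
exact: (hom_comp ph (bar_id_hom HM)).
Qed.

Lemma bapp_strict n : is_hom n phi -> bapp strict = bcomp phi (@bar_id k A B (sval M)).
Proof. by move=> ph; apply: (bmkK (strict_is_hom ph)). Qed.

Lemma strict_homog n : is_hom n phi -> homog n strict.
Proof. by move=> ph; apply/bapp_hom; rewrite (bapp_strict ph); apply: strict_is_hom. Qed.

Lemma bapp_strict_compo (L : C) m n (f : dmor C L M) : is_hom m phi -> homog n f ->
  bapp (strict \c f) = bcomp phi (bapp f).
Proof.
move=> ph hf; rewrite (bapp_compo _ hf) (bapp_strict ph).
have fh : is_hom n (bapp f) by apply/bapp_hom.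
by rewrite -{2}(bar_comp_idl (svalP L) HM fh).
Qed.

Lemma strict_dd n : is_hom n phi -> bapp (dd strict) = bcomp (dhom n phi) (@bar_id k A B (sval M)).
Proof.
move=> ph; rewrite (bapp_dd (strict_homog ph)) (bapp_strict ph); apply: bmap_ext => a b x.
exact: (dhom_comp_closedr ph (bar_id_closed HM)).
Qed.
End Map.

Lemma strict_comp (L M N : C) m n (psi : bmap (sval M) (sval N)) (phi : bmap (sval L) (sval M)) :
  is_hom m psi -> is_hom n phi -> strict psi \c strict phi = strict (bcomp psi phi) :> dmor C L N.
Proof.
move=> sh ph; apply: bapp_inj; rewrite (bapp_strict_compo sh (strict_homog ph)) (bapp_strict ph).
by rewrite (bapp_strict (hom_comp sh ph)).
Qed.

Definition bar_l (M : C) : C := mkb (tens_bimod true HX (svalP M)).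
Definition bar_r (M : C) : C := mkb (tens_bimod true (svalP M) HY).
Definition tilde_obj (M : C) : C := bar_r (bar_l M).

(** Composition with this morphism replaces f by [tilde_map] of f, so it links the morphisms of the
    twisted complex with the differential of the convolution. *)
Definition bar_unit (M : C) : dmor C M (tilde_obj M) := @bmk k A B M (tilde_obj M) (@bmap_id _ _ _ (tilde (sval M))).

Lemma bapp_bar_unit M : bapp (bar_unit M) = @bmap_id _ _ _ (tilde (sval M)).
Proof. exact: (@bmkK k A B M (tilde_obj M) 0 _ (hom_id (tilde (sval M)))). Qed.

Lemma bar_unit_homog M : homog 0 (bar_unit M).
Proof. by apply/bapp_hom; rewrite bapp_bar_unit; apply: hom_id. Qed.

Lemma bar_unit_dd M : dd (bar_unit M) = 0.
Proof.
apply: bapp_inj; rewrite (bapp_dd (bar_unit_homog M)) bapp_bar_unit; apply: bmap_ext => a b x.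
exact: bmap_id_closed.
Qed.

(** The underlying map of both composites is [tilde_map n (bapp f)]. Naturality is therefore strict
    and holds in every degree, not just for closed morphisms. *)
Lemma bar_unit_natural (M N : C) n (f : dmor C M N) : homog n f ->
  strict (M := tilde_obj M) (N := tilde_obj N) (tilde_map n (bapp f)) \c bar_unit M = bar_unit N \c f.
Proof.
move=> hf; have fh : is_hom n (bapp f) by apply/bapp_hom.
have th := tilde_map_hom (svalP M) (svalP N) fh.
apply: bapp_inj; rewrite (bapp_strict_compo (M := tilde_obj M) (N := tilde_obj N) th (bar_unit_homog M)).
by rewrite (bapp_compo _ hf) !bapp_bar_unit.
Qed.

Lemma bar_unit_section (M : C) : strict (M := tilde_obj M) (N := M) (@bar_id k A B (sval M)) \c bar_unit M = did M.
Proof.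
apply: bapp_inj.
by rewrite (bapp_strict_compo (M := tilde_obj M) (bar_id_hom (svalP M)) (bar_unit_homog M)) bapp_bar_unit bapp_did.
Qed.
End Strict.

Lemma hequiv_section (k : fieldType) (D : dgc k) (a b : D) (e : dmor D b a) (f : dmor D a b) :
  hequiv e -> homog 0 f -> dd f = 0 -> e \c f = did a -> hequiv f.
Proof.
move=> [g [h [l [e0 g0 h1 l1 de dg dh dl]]]] f0 df ef.
have fe0 := compo_homog f0 e0; rewrite addr0 in fe0.
have hfe := compo_homog h1 fe0; rewrite addr0 in hfe.
have dfe : dd (f \c e) = 0 by rewrite (compo_dd _ f0) df de compo0l compo0r scaler0 addr0.
(* With D h = 1 - g e, the differential of h f e - h is f e - 1 because e f = 1; for the same reason
   the other homotopy is 0. *)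
exists e, 0, (h \c (f \c e) - h); split=> //; first exact: homog0.
- by apply: homogB.
- by rewrite (dd0 (dmor_dgvect _ _)) ef subrr.
- rewrite (ddB (dmor_dgvect _ _)) (compo_dd _ h1) dfe compo0r scaler0 addr0 dh compoDl compoNl compo1l.
  rewrite -compoA [e \c (f \c e)]compoA ef compo1l.
  by abelian.
Qed.

#[export] Instance bobj_sval_bimod (k : fieldType) (A B : dgcat k) (M : bobj A B) : is_bimod (sval M) := svalP M.

(** * The bar unit is a homotopy equivalence *)

Section Resolution.
Variables (k : fieldType) (A B : dgcat k).
Notation C := (bar_cat A B).
Notation X := (bar A).
Notation Y := (bar B).
Let HX : is_bimod X := bar_bimod A.
Let HY : is_bimod Y := bar_bimod B.
Let HXX := tens_bimod true HX HX.
Let HYY := tens_bimod true HY HY.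


Section One.
Variable M : C.
Let HM : is_bimod (sval M) := svalP M.
Let HXM := tens_bimod true HX HM.
Let HMY := tens_bimod true HM HY.

Lemma bar_idE' : @bar_id k A B (sval M) = bcomp (tau_actr (sval M)) (tmap 0 (tau_actl (sval M)) (@bmap_id _ _ _ Y)).
Proof.
have lh := tau_actl_hom HM; have rh := tau_actr_hom HM.
apply: bmap_ext => a b; rewrite (bar_idE HM).
apply: (lin_ext (gens_tens HXM HY a b)
  (lin_comp (hlin lh a b) (tau_actr_lin HXM (a:=a) (b:=b)))
  (lin_comp (hlin rh a b) (tmap_lin HXM HY lh (hom_id Y) (a:=a) (b:=b)))).
move=> i t [c [p [q [u [y [_ hu hy ->]]]]]]; rewrite (tmap0E HXM HY lh (hom_id Y)).
by rewrite /bcomp (tau_actrE HXM) (tau_actrE HM) (hom_ract lh).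
Qed.

(** Concatenation of the two bar factors: a homotopy between contracting the first one and
    contracting the second one. *)
Definition htpy_l : bmap (tensor X (tensor X (sval M))) (tensor X (sval M)) :=
  bcomp (tmap 0 (@concat k A) (@bmap_id _ _ _ (sval M))) (@assoc_inv _ _ _ _ _ X X (sval M)).

Lemma htpy_l_hom : is_hom (-1) htpy_l.
Proof.
exact: (hom_comp (tmap_hom HXX HM HX HM (concat_hom A) (hom_id (sval M))) (assoc_inv_hom HX HX HM)).
Qed.

Lemma htpy_l_dhom a b (t : tensor X (tensor X (sval M)) a b) :
  dhom (-1) htpy_l t = tau_actl (tensor X (sval M)) a b t - tmap 0 (@bmap_id _ _ _ X) (tau_actl (sval M)) t.
Proof.
have ch := concat_hom A; have ch' := hom_dhom HXX HX ch.
have lh := tau_actl_hom HXM; have lh' := tau_actl_hom HM.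
have kh := tmap_hom HXX HM HX HM ch (hom_id (sval M)).
rewrite /htpy_l (dhom_comp_closedr kh (assoc_inv_closed HX HX HM)).
rewrite (tmap_dhoml HXX HM HX HM ch (hom_id (sval M)) (@bmap_id_closed _ _ _ _)); move: t.
apply: (lin_ext (gens3r HX HX HM (a:=a) (b:=b))
  (lin_comp (tmap_lin HXX HM ch' (hom_id (sval M)) (a:=a) (b:=b)) (@assoc_inv_lin _ _ _ _ _ X X (sval M) HX HM a b))
  (lin_sub (hlin lh a b) (tmap_lin HX HXM (hom_id X) lh' (a:=a) (b:=b)))).
move=> i t /gen3rP [c [d [p [q [r [x [x' [m [_ hx hx' hm ->]]]]]]]]].
rewrite assoc_invE (tmap0E HXX HM ch' (hom_id (sval M))) (tmap0E HX HXM (hom_id X) lh') dhom_concat.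
by rewrite (linB (tmk_linl m)) (tau_actlE HX) (tau_actlE HXM) (tau_actlE HM) (tau_actrE HX) tens_lactE tmk_act.
Qed.

Lemma bar_comp_tau_actr (N : C) n (f : bmap (tilde (sval M)) (sval N)) : is_hom n f ->
  bar_comp n (tau_actr (tensor X (sval N))) f = lhalf n f.
Proof.
move=> fh; have HN : is_bimod (sval N) := svalP N; have hh := lhalf_hom HM HN fh.
apply: bmap_ext => a b t; rewrite bar_compE (tilde_mapE HM HN fh) /bcomp.
exact: (tau_actr_rext HXM (tens_bimod true HX HN) hh).
Qed.

(** A strict morphism factors through the bar identity, whose left half is the right counit by
    [lhalf_id]; only [phi] on the second tensor factor remains. *)
Lemma lhalf_strict (N : C) n (phi : bmap (sval M) (sval N)) : is_hom n phi ->
  lhalf n (bcomp phi (@bar_id k A B (sval M))) = bcomp (tmap n (@bmap_id _ _ _ X) phi) (tau_actr (tensor X (sval M))).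
Proof.
move=> ph; rewrite -(lhalf_id HM); apply: bmap_ext => a b t; rewrite /lhalf /lext.
set g := bcomp (@bar_id k A B (sval M)) (@assoc_inv _ _ _ _ _ X (sval M) Y).
have gh : is_hom 0 g by exact: (hom_comp (bar_id_hom HM) (assoc_inv_hom HX HM HY)).
have pgh : is_hom n (bcomp phi g).
  by apply: (is_hom_eq (m := n + 0)); [rewrite addr0 | apply: (hom_comp ph gh)].
rewrite -[LHS]/(tmap n (@bmap_id _ _ _ X) (bcomp phi g) (comultl (assoc t))).
rewrite -[RHS]/(tmap n (@bmap_id _ _ _ X) phi (tmap 0 (@bmap_id _ _ _ X) g (comultl (assoc t)))).
move: (comultl _) => {}t.
move: t; apply: (lin_ext (gens_tens HX (tens_bimod true HX HMY) a b)
  (tmap_lin HX (tens_bimod true HX HMY) (hom_id X) pgh (a:=a) (b:=b))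
  (lin_comp (tmap_lin HX HM (hom_id X) ph (a:=a) (b:=b))
    (tmap_lin HX (tens_bimod true HX HMY) (hom_id X) gh (a:=a) (b:=b)))).
move=> i t [c [p [q [x [y [_ hx hy ->]]]]]].
by rewrite (tmapTE HX (tens_bimod true HX HMY) (hom_id X) pgh) (tmap0E HX (tens_bimod true HX HMY) (hom_id X) gh)
  (tmapTE HX HM (hom_id X) ph).
Qed.

End One.

Section Left.
Variable M : C.
Let HM : is_bimod (sval M) := svalP M.
Let HXM := tens_bimod true HX HM.

(* the homotopy inverse of the action X (x) M -> M; it does not come from a map of bimodules *)
Definition unit_l : dmor C M (bar_l M) := @bmk k A B M (bar_l M) (tau_actr (tensor X (sval M))).

Lemma bapp_unit_l : bapp unit_l = tau_actr (tensor X (sval M)).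
Proof. exact: (@bmkK k A B M (bar_l M) 0 _ (tau_actr_hom HXM)). Qed.

Lemma unit_l_homog : homog 0 unit_l.
Proof. by apply/bapp_hom; rewrite bapp_unit_l; apply: tau_actr_hom. Qed.

(** The action after [unit_l] contracts both bar factors and is the identity on the nose. The other
    composite is id ⊗ tau after the right counit, and [htpy_l] connects it with the identity, which
    is tau acting through the first bar factor after the same counit. *)
Lemma hequiv_actl : hequiv (strict (M := bar_l M) (N := M) (tau_actl (sval M))).
Proof.
have lh := tau_actl_hom HM; have S0 := strict_homog (M := bar_l M) (N := M) lh.
have Kh : is_hom (-1) (bcomp (@htpy_l M) (tau_actr (tensor X (tensor X (sval M))))).
  apply: (is_hom_eq (m := -1 + 0)); first by rewrite addr0.
  exact: (hom_comp (@htpy_l_hom M) (tau_actr_hom (tens_bimod true HX HXM))).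
have bK : bapp (@bmk k A B (bar_l M) (bar_l M) (bcomp (@htpy_l M) (tau_actr (tensor X (tensor X (sval M)))))) = _ := @bmkK k A B (bar_l M) (bar_l M) _ _ Kh.
have hK : homog (-1) (@bmk k A B (bar_l M) (bar_l M) (bcomp (@htpy_l M) (tau_actr (tensor X (tensor X (sval M)))))).
  by apply/bapp_hom; rewrite bK.
exists unit_l, (@bmk k A B (bar_l M) (bar_l M) (bcomp (@htpy_l M) (tau_actr (tensor X (tensor X (sval M)))))), 0; split.
- exact: S0.
- exact: unit_l_homog.
- exact: hK.
- exact: homog0.
- apply: bapp_inj; rewrite (strict_dd (M := bar_l M) (N := M) lh); apply: bmap_ext => a b x.
  exact: (tau_actl_closed HM).
- apply: bapp_inj; rewrite (bapp_dd unit_l_homog) bapp_unit_l; apply: bmap_ext => a b x.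
  exact: (tau_actr_closed HXM).
- apply: bapp_inj; rewrite (bapp_dd hK) bK; apply: bmap_ext => a b x.
  rewrite (dhom_comp_closedr (@htpy_l_hom M) (tau_actr_closed (tens_bimod true HX HXM))) htpy_l_dhom.
  rewrite bappD bappN bapp_did (bapp_compo _ S0) bapp_unit_l (bapp_strict (M := bar_l M) (N := M) lh).
  have bh : is_hom 0 (bcomp (tau_actl (sval M)) (@bar_id k A B (sval (bar_l M)))).
    exact: (strict_is_hom (M := bar_l M) (N := M) lh).
  rewrite (bar_comp_tau_actr bh).
  by rewrite (lhalf_strict (M := bar_l M) (N := M) lh) (bar_idE HXM).
- rewrite (dd0 (dmor_dgvect _ _)); apply: bapp_inj.
  rewrite bappD bappN bapp_did (bapp_strict_compo (M := bar_l M) (N := M) lh unit_l_homog) bapp_unit_l.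
  by apply: bmap_ext => a b x; rewrite (bar_idE HM) subrr.
Qed.
End Left.

Section Right.
Variable M : C.
Let HM : is_bimod (sval M) := svalP M.
Let HXM := tens_bimod true HX HM.
Let HMY := tens_bimod true HM HY.
Definition htpy_r : bmap (tensor (tensor (sval M) Y) Y) (tensor (sval M) Y) :=
  bcomp (tmap (-1) (@bmap_id _ _ _ (sval M)) (@concat k B)) (@assoc _ _ _ _ _ (sval M) Y Y).

Lemma htpy_r_hom : is_hom (-1) htpy_r.
Proof.
exact: (hom_comp (tmap_hom HM HYY HM HY (hom_id (sval M)) (concat_hom B)) (assoc_hom HM HY HY)).
Qed.

Lemma htpy_r_dhom a b (t : tensor (tensor (sval M) Y) Y a b) :
  dhom (-1) htpy_r t = tmap 0 (tau_actr (sval M)) (@bmap_id _ _ _ Y) t - tau_actr (tensor (sval M) Y) a b t.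
Proof.
have ch := concat_hom B; have ch' : is_hom 0 (dhom (-1) (@concat k B)) by have := hom_dhom HYY HY ch; rewrite addNr.
have rh := tau_actr_hom HMY; have rh' := tau_actr_hom HM.
have kh : is_hom (-1) (tmap (-1) (@bmap_id _ _ _ (sval M)) (@concat k B)).
  by have := tmap_hom HM HYY HM HY (hom_id (sval M)) ch; rewrite add0r.
rewrite /htpy_r (dhom_comp_closedr kh (assoc_closed HM HY HY)).
rewrite (tmap_dhomr HM HYY HM HY (hom_id (sval M)) ch (@bmap_id_closed _ _ _ _)) addNr; move: t.
apply: (lin_ext (gens3l HM HY HY (a:=a) (b:=b))
  (lin_comp (tmap_lin HM HYY (hom_id (sval M)) ch' (a:=a) (b:=b)) (@assoc_lin _ _ _ _ _ (sval M) Y Y HM HY a b))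
  (lin_sub (tmap_lin HMY HY rh' (hom_id Y) (a:=a) (b:=b)) (hlin rh a b))).
move=> i t /gen3lP [c [d [p [q [r [m [y [y' [_ hm hy hy' ->]]]]]]]]].
rewrite assocE (tmap0E HM HYY (hom_id (sval M)) ch') (tmap0E HMY HY rh' (hom_id Y)) dhom_concat.
rewrite (linB (tmk_linr _)) (tau_actrE HM) (tau_actrE HMY) (tau_actlE HY) (tau_actrE HY) tens_ractE.
by rewrite tmk_act.
Qed.

Lemma tmap_tau_actl_tilde (N : C) n (f : bmap (tilde (sval N)) (sval M)) : is_hom n f ->
  bar_comp n (tmap 0 (tau_actl (sval M)) (@bmap_id _ _ _ Y)) f = rext f.
Proof.
move=> fh; have HN : is_bimod (sval N) := svalP N; have hh := lhalf_hom HN HM fh.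
apply: bmap_ext => a b t; rewrite bar_compE (tilde_mapE HN HM fh) /bcomp.
rewrite (tmap_id_rext (tens_bimod true HX HN) HXM HM (tau_actl_hom HM) hh).
by rewrite (tau_actl_lhalf HN HM fh).
Qed.

Lemma rext_bar_id : rext (@bar_id k A B (sval M)) = tmap 0 (tau_actl (sval M)) (@bmap_id _ _ _ Y).
Proof.
apply: bmap_ext => a b t; rewrite bar_idE'.
by rewrite (rext_tmap HXM HM HM (tau_actr_hom HM) (tau_actl_hom HM)) (rext_tau_actr HM).
Qed.

(** The mirror image of [unit_l]: the left bar factor is contracted and the right one is kept. *)
Definition unit_r : dmor C M (bar_r M) := @bmk k A B M (bar_r M) (tmap 0 (tau_actl (sval M)) (@bmap_id _ _ _ Y)).

Let uh : is_hom 0 (tmap 0 (tau_actl (sval M)) (@bmap_id _ _ _ Y)).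
Proof. exact: (tmap_hom HXM HY HM HY (tau_actl_hom HM) (hom_id Y)). Qed.

Lemma bapp_unit_r : bapp unit_r = tmap 0 (tau_actl (sval M)) (@bmap_id _ _ _ Y).
Proof. exact: (@bmkK k A B M (bar_r M) 0 _ uh). Qed.

Lemma unit_r_homog : homog 0 unit_r.
Proof. by apply/bapp_hom; rewrite bapp_unit_r; apply: uh. Qed.

Lemma unit_r_dd : dd unit_r = 0.
Proof.
apply: bapp_inj; rewrite (bapp_dd unit_r_homog) bapp_unit_r; apply: bmap_ext => a b x.
exact: (tmap_closed HXM HM HY HY (tau_actl_hom HM) (hom_id Y) (tau_actl_closed HM) (@bmap_id_closed _ _ _ Y)).
Qed.
End Right.

Lemma hequiv_actr (M : C) : hequiv (strict (M := bar_r M) (N := M) (tau_actr (sval M))).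
Proof.
have HM : is_bimod (sval M) := svalP M.
have HMY := tens_bimod true HM HY; have HXMY := tens_bimod true HX HMY.
have rh := tau_actr_hom HM; have S0 := strict_homog (M := bar_r M) (N := M) rh.
have lh := tau_actl_hom HMY.
have uc := tmap_closed HXMY HMY HY HY lh (hom_id Y) (tau_actl_closed HMY) (@bmap_id_closed _ _ _ Y).
pose K := bcomp (@htpy_r M) (tmap 0 (tau_actl (tensor (sval M) Y)) (@bmap_id _ _ _ Y)).
have Kh : is_hom (-1) K.
  apply: (is_hom_eq (m := -1 + (0 + 0))); first by rewrite !addr0.
  exact: (hom_comp (@htpy_r_hom M) (tmap_hom HXMY HY HMY HY lh (hom_id Y))).
pose h := @bmk k A B (bar_r M) (bar_r M) K.
have bK : bapp h = K := @bmkK k A B (bar_r M) (bar_r M) _ _ Kh.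
have hK : homog (-1) h by apply/bapp_hom; rewrite bK.
have rbh : is_hom 0 (bcomp (tau_actr (sval M)) (@bar_id k A B (sval (bar_r M)))).
  exact: (strict_is_hom (M := bar_r M) (N := M) rh).
(* In the differential of [htpy_r] the term that belongs to the identity, the contraction of the
   last bar factor, has the negative sign; hence the change of sign. *)
exists (unit_r M), (- h), 0; split.
- exact: S0.
- exact: unit_r_homog.
- exact: homogN.
- exact: homog0.
- apply: bapp_inj; rewrite (strict_dd (M := bar_r M) (N := M) rh); apply: bmap_ext => a b x.
  exact: (tau_actr_closed HM).
- exact: unit_r_dd.
- rewrite (linN (dd_linear (dmor_dgvect _ _))); apply: bapp_inj.
  rewrite !bappD !bappN bapp_did (bapp_dd hK) bK; apply: bmap_ext => a b x.
  rewrite (dhom_comp_closedr (@htpy_r_hom M) uc) htpy_r_dhom opprB.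
  rewrite (bapp_compo _ S0) bapp_unit_r (bapp_strict (M := bar_r M) (N := M) rh).
  rewrite (tmap_tau_actl_tilde (M := M) (N := bar_r M) rbh).
  rewrite -(tmap_id_rext (tens_bimod true HX HMY) HMY HM rh (bar_id_hom HMY)).
  by rewrite (@rext_bar_id (bar_r M)) (@bar_idE' (bar_r M)).
- rewrite (dd0 (dmor_dgvect _ _)); apply: bapp_inj.
  rewrite bappD bappN bapp_did (bapp_strict_compo (M := bar_r M) (N := M) rh (unit_r_homog M)) bapp_unit_r.
  by apply: bmap_ext => a b x; rewrite (@bar_idE' M) subrr.
Qed.

(** The bar unit is a section of the bar identity seen as a strict map from [tilde M] to M, and that
    map is a composite of a right and a left action, both homotopy equivalences. *)
Theorem hequiv_bar_unit (M : C) : hequiv (bar_unit M).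
Proof.
have HM : is_bimod (sval M) := svalP M; have HXM := tens_bimod true HX HM.
apply: (hequiv_section _ (bar_unit_homog M) (bar_unit_dd M) (bar_unit_section M)).
have -> : strict (M := tilde_obj M) (N := M) (@bar_id k A B (sval M)) =
    strict (M := bar_l M) (N := M) (tau_actl (sval M)) \c
    strict (M := bar_r (bar_l M)) (N := bar_l M) (tau_actr (tensor X (sval M))).
  by rewrite (strict_comp (L := bar_r (bar_l M)) (M := bar_l M) (N := M) (tau_actl_hom HM) (tau_actr_hom HXM)) (bar_idE HM).
exact: (hequiv_comp (hequiv_actr (bar_l M)) (hequiv_actl M)).
Qed.
End Resolution.

(** * Duals of convolutions *)

Section DualFunctor.
Variables (k : fieldType) (A B : dgcat k) (F : bimod A B -> bimod B A).
Variable Fm : forall (M' M : bimod A B) (n : int) (f : bmap (tilde M') M), bmap (tilde (F M)) (F M').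
Arguments Fm {M' M} n f [a b] _ : rename.

(** What the two dualising functors have in common, stated for raw maps with explicit degrees. The
    argument about convolutions uses only these properties and covers both. *)
Record dual_axioms : Prop := DualAxioms {
  da_bimod : forall M, is_bimod M -> is_bimod (F M);
  da_hom : forall M' M n (f : bmap (tilde M') M), is_bimod M' -> is_bimod M ->
    is_hom n f -> is_hom n (Fm n f);
  da_dhom : forall M' M n (f : bmap (tilde M') M), is_bimod M' -> is_bimod M ->
    is_hom n f -> dhom n (Fm n f) = Fm (n + 1) (dhom n f);
  da_id : forall M, is_bimod M -> Fm 0 (@bar_id k A B M) = @bar_id k B A (F M);
  da_linear : forall M' M n (s : k) (f g : bmap (tilde M') M), is_bimod M' -> is_bimod M ->
    is_hom n f -> is_hom n g ->
    Fm n (fun a b x => s *: f a b x + g a b x) = (fun a b x => s *: Fm n f x + Fm n g x);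
  da_comp : forall M'' M' M m n (g : bmap (tilde M') M) (f : bmap (tilde M'') M'),
    is_bimod M'' -> is_bimod M' -> is_bimod M -> is_hom m g -> is_hom n f ->
    bar_comp m (Fm n f) (Fm m g) = (fun b a x => sgn k (n * m) *: Fm (m + n) (bar_comp n g f) x) }.
Hypothesis HF : dual_axioms.

Notation C := (bar_cat A B).
Notation C' := (bar_cat B A).

Definition dual_obj (M : C) : C' := mkb (da_bimod HF (svalP M)).

Section Map.
Variables M N : C.
Let HM : is_bimod (sval M) := svalP M.
Let HN : is_bimod (sval N) := svalP N.
(** [Fm] takes the degree as an argument, so a general morphism is dualised component by component.
    The projection inside the sum makes each summand linear in [f]. *)
Definition dual_app (f : dmor C M N) : bmap (tilde (F (sval N))) (F (sval M)) := fun b a x =>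
  hsum f (fun n f' => Fm n (bapp (pr n f')) x).

Definition dual_mor (f : dmor C M N) : dmor C' (dual_obj N) (dual_obj M) :=
  @bmk k B A (dual_obj N) (dual_obj M) (dual_app f).

Let dual_pr_lin n b a (x : tilde (F (sval N)) b a) : linear (fun f : dmor C M N => Fm n (bapp (pr n f)) x).
Proof.
have prh (f : dmor C M N) : is_hom n (bapp (pr n f)) by apply/bapp_hom/(homog_pr (dmor_dgvect M N)).
move=> s f g.
have -> : bapp (pr n (s *: f + g)) = fun a b x => s *: bapp (pr n f) x + bapp (pr n g) x.
  by rewrite (pr_linear (dmor_dgvect M N)).
by rewrite (da_linear HF s HM HN (prh f) (prh g)).
Qed.

Let dual_app_lin b a (x : tilde (F (sval N)) b a) : linear (fun f => dual_app f x).
Proof.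
apply: (hsum_lin (dmor_dgvect M N) (F := fun n f' => Fm n (bapp (pr n f')) x)) => n.
exact: dual_pr_lin.
Qed.

Lemma dual_appE n f : homog n f -> dual_app f = Fm n (bapp f).
Proof.
move=> hf; apply: bmap_ext => b a x; rewrite /dual_app (hsum_homog (dmor_dgvect M N) hf) ?hf // => m.
exact: (lin0 (dual_pr_lin m x)).
Qed.

Lemma bapp_dual_app f : bapp (dual_mor f) = dual_app f.
Proof.
apply: bmap_ext => b a x; rewrite /bapp /dual_mor /bmk hsp_mk_span //; move: {b a x} f.
apply: (lspan_family (G := @homog k (dmor C M N)) (F := fun f t x => dual_app f x) (gens_homog (dmor_dgvect M N))).
  by move=> t x; apply: dual_app_lin.
move=> n f hf; apply: lspan_gen; exists n; rewrite /bhom_pred /= (dual_appE hf).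
by apply: (da_hom HF HM HN); apply/bapp_hom.
Qed.

Lemma bapp_dual n f : homog n f -> bapp (dual_mor f) = Fm n (bapp f).
Proof. by move=> hf; rewrite bapp_dual_app; apply: dual_appE. Qed.

Lemma dual_mor_lin : linear dual_mor.
Proof.
move=> s f g; apply: bapp_inj; rewrite bappD bappZ !bapp_dual_app; apply: bmap_ext => b a x.
exact: dual_app_lin.
Qed.

Lemma dual_mor_homog n f : homog n f -> homog n (dual_mor f).
Proof. by move=> hf; apply/bapp_hom; rewrite (bapp_dual hf); apply: (da_hom HF HM HN); apply/bapp_hom. Qed.

Lemma dual_mor_dd f : dual_mor (dd f) = dd (dual_mor f).
Proof.
move: f; apply: (lin_ext (gens_homog (dmor_dgvect M N)) (lin_comp dual_mor_lin (dd_linear (dmor_dgvect M N)))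
  (lin_comp (dd_linear (dmor_dgvect _ _)) dual_mor_lin)) => n f hf.
apply: bapp_inj; rewrite (bapp_dual (dd_homog (dmor_dgvect M N) hf)) (bapp_dd (dual_mor_homog hf)) (bapp_dd hf).
by rewrite (bapp_dual hf) (da_dhom HF HM HN) //; apply/bapp_hom.
Qed.
End Map.

Theorem dual_cfunctor : cfunctor dual_mor.
Proof.
split.
- exact: dual_mor_lin.
- by move=> a b n f; apply: dual_mor_homog.
- by move=> a b f; apply: dual_mor_dd.
- move=> a; apply: bapp_inj; rewrite (bapp_dual (did_homog a)) !bapp_did.
  exact: (da_id HF (svalP a)).
- move=> L M N m n g f hg hf; apply: bapp_inj; rewrite bappZ (bapp_compo _ (dual_mor_homog hg)).
  rewrite (bapp_dual (compo_homog hg hf)) (bapp_dual hg) (bapp_dual hf) (bapp_compo _ hf).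
  rewrite (da_comp HF (svalP L) (svalP M) (svalP N)); try exact/bapp_hom.
  by apply: bmap_ext => b a x; rewrite sgnZZ sgnZ1 //; odd_tac.
Qed.
End DualFunctor.

Lemma dualB_axioms (k : fieldType) (A B : dgcat k) :
  dual_axioms (F := @dualB k A B) (fun M' M n f => @dualB_map k A B M' M n f).
Proof.
split.
- by move=> M HM; apply: dualB_bimod.
- by move=> M' M n f HM' HM; apply: dualB_map_hom.
- by move=> M' M n f HM' HM; apply: dualB_map_dhom.
- by move=> M HM; apply: dualB_map_id.
- by move=> M' M n s f g HM' HM; apply: dualB_map_linear.
- by move=> M'' M' M m n g f HM'' HM' HM; apply: dualB_map_comp.
Qed.

Lemma dualA_axioms (k : fieldType) (A B : dgcat k) :
  dual_axioms (F := @dualA k A B) (fun M' M n f => @dualA_map k A B M' M n f).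
Proof.
split.
- by move=> M HM; apply: dualA_bimod.
- by move=> M' M n f HM' HM; apply: dualA_map_hom.
- by move=> M' M n f HM' HM; apply: dualA_map_dhom.
- by move=> M HM; apply: dualA_map_id.
- by move=> M' M n s f g HM' HM; apply: dualA_map_linear.
- by move=> M'' M' M m n g f HM'' HM' HM; apply: dualA_map_comp.
Qed.

Lemma is_zero_tilde (k : fieldType) (A B : dgcat k) (M : bimod A B) : is_bimod M -> is_zero M -> is_zero (tilde M).
Proof.
move=> HM M0 a b; have HX := bar_bimod A; have HY := bar_bimod B.
apply: tens_ind => [//|t u -> ->|c t y]; first by rewrite addr0.
have -> : t = 0; last exact: tmk0l.
move: t; apply: tens_ind => [//|t u -> ->|d x m]; first by rewrite addr0.
by rewrite (M0 _ _ m) tmk0r.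
Qed.

(** * Convolutions of twisted complexes over the bar category *)

Section TwistedComplex.
Variables (k : fieldType) (A B : dgcat k).
Notation C := (bar_cat A B).
Variables (s : seq int) (E : int -> C) (a : forall i j, dmor C (E i) (E j)).
Notation alpha := (fun i j : int => bapp (a i j)).

(** [is_twisted] in terms of the packaged bar category, with sums over a finite list in place of
    sums over all integers; [formal_twistedP] and [twisted_formal] translate between the two. *)
Record formal_twisted : Prop := FormalTwisted {
  ft_uniq : uniq s;
  ft_zero : forall i, i \notin s -> is_zero (sval (E i));
  ft_homog : forall i j : int, homog (i - j + 1) (a i j);
  ft_eq : forall i j : int, sgn k j *: dd (a i j) + \sum_(l <- s) a l j \c a i l = 0 }.

Lemma bapp_sum (M N : C) (I : Type) (r : seq I) (G : I -> dmor C M N) x y (t : tilde (sval M) x y) :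
  bapp (\sum_(i <- r) G i) t = \sum_(i <- r) bapp (G i) t.
Proof. exact: (lin_sum (bapp_linf (M := M) (N := N) t)). Qed.

Lemma twisted_fssum (Ez : forall i, i \notin s -> is_zero (sval (E i))) (us : uniq s)
  (ah : forall i j : int, homog (i - j + 1) (a i j)) (i j : int) x y (t : tilde (sval (E i)) x y) :
  \sum_(l \in [set: int]) bar_comp (i - l + 1) (bapp (a l j)) (bapp (a i l)) t =
  bapp (\sum_(l <- s) a l j \c a i l) t.
Proof.
rewrite (fssumE us) => [|l sl]; last first.
  rewrite /bar_comp [tilde_map _ _ _](is_zero_tilde (svalP (E l)) (Ez l sl)).
  exact: (lin0 (bapp_lin (a l j) (a:=x) (b:=y))).
by rewrite bapp_sum; apply: eq_bigr => l _; rewrite (bapp_compo _ (ah i l)).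
Qed.

Lemma formal_twistedP : formal_twisted -> is_twisted alpha.
Proof.
case=> us Ez ah ae; split.
- by move=> i; apply: svalP.
- by exists s => i si; apply: Ez.
- by move=> i j; apply/bapp_hom/ah.
- move=> i j x y t; rewrite (twisted_fssum Ez us ah) -(bapp_dd (ah i j)).
  by have := congr1 (fun u => bapp u t) (ae i j).
Qed.

Lemma twisted_formal : uniq s -> (forall i, i \notin s -> is_zero (sval (E i))) -> is_twisted alpha -> formal_twisted.
Proof.
move=> us Ez [_ _ ah ae]; have hh (i j : int) : homog (i - j + 1) (a i j) by apply/bapp_hom/ah.
split=> // i j; apply: bapp_inj; apply: bmap_ext => x y t.
by have := ae i j x y t; rewrite (twisted_fssum Ez us hh) -(bapp_dd (hh i j)).
Qed.

Hypothesis H : formal_twisted.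
Let us := ft_uniq H.
Let ah := ft_homog H.
Let alh (i j : int) : is_hom (i - j + 1) (bapp (a i j)). Proof. exact/bapp_hom/ah. Qed.
Let HE i : is_bimod (sval (E i)) := svalP (E i).
Let HT i : is_bimod (tilde (sval (E i))) := tilde_bimod (HE i).
Let tz i : i \notin s -> is_zero (tilde (sval (E i))).
Proof. by move=> si; apply/is_zero_tilde/(ft_zero H). Qed.

Notation delta := (conv_delta alpha).

Lemma conv_deltaE j x y (t : dsum (fun i => tilde (sval (E i)) x y : lmodType k)) :
  conv_delta alpha j t = \sum_(i <- s) tilde_map (i - j + 1) (bapp (a i j)) (dcomp t i).
Proof.
rewrite /conv_delta (fssumE us) // => i si; rewrite (tz si (dcomp t i)).
exact: (lin0 (hlin (tilde_map_hom (HE i) (HE j) (alh i j)) x y)).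
Qed.

Lemma conv_delta_dinj i j x y (v : tilde (sval (E i)) x y) :
  conv_delta alpha j (dinj i v) = tilde_map (i - j + 1) (bapp (a i j)) v.
Proof.
rewrite /conv_delta (fssum1 (i := i)) => [|l li]; first by rewrite dinj_eq.
by rewrite dinj_neq //; apply: (lin0 (hlin (tilde_map_hom (HE l) (HE j) (alh l j)) x y)).
Qed.

Lemma bapp_unit_compo (M N : C) n (f : dmor C M N) : homog n f ->
  bapp (bar_unit N \c f) = tilde_map n (bapp f).
Proof. by move=> hf; rewrite (bapp_compo (bar_unit N) hf) bapp_bar_unit. Qed.

(** The equation of the twisted complex, composed with [bar_unit], which turns every morphism in it
    into its [tilde_map]. *)
Lemma conv_twisted_eq i j x y (v : tilde (sval (E i)) x y) :
  sgn k j *: tilde_map (i - j + 1 + 1) (dhom (i - j + 1) (bapp (a i j))) v +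
  \sum_(l <- s) tilde_map (l - j + 1) (bapp (a l j)) (tilde_map (i - l + 1) (bapp (a i l)) v) = 0.
Proof.
have := congr1 (fun u => bapp (bar_unit (E j) \c u) v) (ft_eq H i j).
rewrite compo0r compoDr compoZr compo_sumr bappD bappZ bapp_sum.
have e0 := bapp_unit_compo (dd_homog (dmor_dgvect _ _) (ah i j)).
have es l : bapp (bar_unit (E j) \c (a l j \c a i l)) v =
    tilde_map (l - j + 1) (bapp (a l j)) (tilde_map (i - l + 1) (bapp (a i l)) v).
  rewrite (bapp_unit_compo (compo_homog (ah l j) (ah i l))).
  by rewrite (bapp_compo (a l j) (ah i l)) (tilde_map_comp (HE i) (HE l) (HE j) (alh l j) (alh i l)).
move=> e; rewrite -[RHS]e; congr (_ *: _ + _); last by apply: eq_bigr => l _; rewrite es.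
by rewrite e0 (bapp_dd (ah i j)).
Qed.

Lemma conv_differential : is_differential (fun i : int => i) (E := fun i => tilde (sval (E i))) (conv_delta alpha).
Proof.
have th i j := tilde_map_hom (HE i) (HE j) (alh i j).
split.
- move=> j x y c u v; rewrite !conv_deltaE scaler_sumr -big_split; apply: eq_bigr => l _.
  exact: (hlin (th l j) x y c (dcomp u l) (dcomp v l)).
- by move=> x y u; exists s => j sj; apply: (tz sj).
- move=> i j x y n v hv; rewrite conv_delta_dinj.
  have -> : n + i - j + 1 = i - j + 1 + n by ring.
  exact: (hom_homog (th i j)).
- by move=> i j x x' y n z v hz; rewrite !conv_delta_dinj (hom_lact (th i j) _ hz).
- by move=> i j x y y' v z; rewrite !conv_delta_dinj (hom_ract (th i j)).
- move=> i j x y v; rewrite !conv_delta_dinj conv_deltaE.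
  have -> : \sum_(l <- s) tilde_map (l - j + 1) (bapp (a l j))
      (dcomp (to_dsum (fun l => conv_delta alpha l (dinj i v) : tilde (sval (E l)) x y)) l) =
    \sum_(l <- s) tilde_map (l - j + 1) (bapp (a l j)) (tilde_map (i - l + 1) (bapp (a i l)) v).
    apply: eq_bigr => l _; rewrite dcomp_to_dsum ?conv_delta_dinj //.
    by exists s => m sm; apply: (tz sm).
  rewrite -[RHS](conv_twisted_eq j v); congr (_ + _).
  (* Expanding the differential of [tilde_map] produces the two separate terms of [delta_sqr] in
     which d occurs. *)
  rewrite -(tilde_map_dhom (HE i) (HE j) (alh i j)) /dhom scalerBr; congr (_ + _).
  by rewrite sgnZZ NsgnZ; apply: sgnZ_eq; odd_tac.
Qed.

Lemma conv_bimod : is_bimod (conv alpha).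
Proof. exact: (shift_bimod HT conv_differential). Qed.

Definition conv_obj : C := mkb conv_bimod.

Definition conv_inj i : dmor C (tilde_obj (E i)) conv_obj :=
  strict (M := tilde_obj (E i)) (N := conv_obj)
    (shift_inj (E := fun i => tilde (sval (E i))) (fun i : int => i) (conv_delta alpha) i).

Definition conv_proj i : dmor C conv_obj (tilde_obj (E i)) :=
  strict (M := conv_obj) (N := tilde_obj (E i))
    (shift_proj (E := fun i => tilde (sval (E i))) (fun i : int => i) (conv_delta alpha) i).

Definition conv_diff i j : dmor C (tilde_obj (E i)) (tilde_obj (E j)) :=
  strict (M := tilde_obj (E i)) (N := tilde_obj (E j)) (tilde_map (i - j + 1) (bapp (a i j))).

(** Injections and projections of the direct sum are strict morphisms. The objects involved are the
    [tilde (E i)] instead of the [E i], and the bar units have to bridge this difference. *)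
Lemma conv_fconv : fconv s conv_diff conv_inj conv_proj.
Proof.
have ih i := shift_inj_hom (fun i : int => i) HT (conv_delta alpha) i.
have ph i := shift_proj_hom (fun i : int => i) HT (conv_delta alpha) i.
have th i j := tilde_map_hom (HE i) (HE j) (alh i j).
split.
- exact: us.
- by move=> i j; apply: (strict_homog (M := tilde_obj (E i)) (N := tilde_obj (E j)) (th i j)).
- by move=> i; apply: (strict_homog (M := tilde_obj (E i)) (N := conv_obj) (ih i)).
- by move=> i; apply: (strict_homog (M := conv_obj) (N := tilde_obj (E i)) (ph i)).
- move=> i j ij; apply: bapp_inj.
  rewrite (bapp_strict_compo (M := conv_obj) (N := tilde_obj (E j)) (ph j)
    (strict_homog (M := tilde_obj (E i)) (N := conv_obj) (ih i))).
  rewrite (bapp_strict (M := tilde_obj (E i)) (N := conv_obj) (ih i)); apply: bmap_ext => x y v.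
  by rewrite /bcomp /shift_proj /shift_inj dinj_neq // eq_sym.
- move=> i; apply: bapp_inj.
  rewrite (bapp_strict_compo (M := conv_obj) (N := tilde_obj (E i)) (ph i)
    (strict_homog (M := tilde_obj (E i)) (N := conv_obj) (ih i))).
  rewrite (bapp_strict (M := tilde_obj (E i)) (N := conv_obj) (ih i)) bapp_did; apply: bmap_ext => x y v.
  by rewrite /bcomp /shift_proj /shift_inj dinj_eq.
- apply: bapp_inj; rewrite bapp_did; apply: bmap_ext => x y v; rewrite bapp_sum.
  rewrite [RHS](dsum_dinj us (x := bar_id v)) => [|i si]; last exact: (tz si).
  apply: eq_bigr => i _.
  rewrite (bapp_strict_compo (M := tilde_obj (E i)) (N := conv_obj) (ih i)
    (strict_homog (M := conv_obj) (N := tilde_obj (E i)) (ph i))).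
  by rewrite (bapp_strict (M := conv_obj) (N := tilde_obj (E i)) (ph i)).
- move=> i; apply: bapp_inj.
  rewrite (strict_dd (M := tilde_obj (E i)) (N := conv_obj) (ih i)); apply: bmap_ext => x y v; rewrite bapp_sum.
  transitivity (\sum_(j <- s) (dinj j (tilde_map (i - j + 1) (bapp (a i j)) (bar_id v)) : dsum (fun i => tilde (sval (E i)) x y : lmodType k))).
    rewrite /bcomp; move: (bar_id v) => {}v.
    rewrite /dhom /shift_inj (shift_ddE HT conv_differential) (linZ (@dinj_lin _ _ _ _)) addrAC addrN add0r.
    rewrite [LHS](dsum_dinj us) => [|j sj]; last exact: (tz sj).
    apply: eq_bigr => j _; rewrite dcomp_to_dsum ?conv_delta_dinj //.
    by exists s => l sl; apply: (tz sl).
  apply: eq_bigr => j _.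
  rewrite (bapp_strict_compo (M := tilde_obj (E j)) (N := conv_obj) (ih j)
    (strict_homog (M := tilde_obj (E i)) (N := tilde_obj (E j)) (th i j))).
  by rewrite (bapp_strict (M := tilde_obj (E i)) (N := tilde_obj (E j)) (th i j)).
Qed.

Lemma conv_diff_natural i j : conv_diff i j \c bar_unit (E i) = bar_unit (E j) \c a i j.
Proof. exact: (bar_unit_natural (ah i j)). Qed.

Lemma conv_diff0 i j : a i j = 0 -> conv_diff i j = 0.
Proof.
move=> a0; have th := tilde_map_hom (HE i) (HE j) (alh i j).
apply: bapp_inj; rewrite (bapp_strict (M := tilde_obj (E i)) (N := tilde_obj (E j)) th) -(bapp_unit_compo (ah i j)) a0.
by rewrite compo0r.
Qed.
End TwistedComplex.

Lemma hequiv_homotopy_equivalent (k : fieldType) (A B : dgcat k) (M N : bar_cat A B) (f : dmor (bar_cat A B) M N) :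
  hequiv f -> homotopy_equivalent (sval M) (sval N).
Proof.
have closed (P Q : bar_cat A B) (u : dmor (bar_cat A B) P Q) : homog 0 u -> dd u = 0 -> closed0 (bapp u).
  by move=> u0 du; split=> [|a b x]; [apply/bapp_hom | rewrite -(bapp_dd u0) du].
move=> [g [h [l [f0 g0 h1 l1 df dg dh dl]]]]; split; [exact: (svalP M) | exact: (svalP N) |].
exists (bapp f); split; first exact: closed.
exists (bapp g); split; first exact: closed.
- have h1' := homogN (dmor_dgvect M M) h1.
  exists (bapp (- h)); split; first exact/bapp_hom.
  move=> a b x; rewrite -(bapp_compo g f0) -bapp_did -(bapp_dd h1') (linN (dd_linear (dmor_dgvect M M))) dh.
  by rewrite opprB.
- exists (bapp l); split; first exact/bapp_hom.
  by move=> a b x; rewrite -(bapp_compo f g0) -bapp_did -(bapp_dd l1) dl.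
Qed.

Lemma did0_is_zero (k : fieldType) (A B : dgcat k) (M : bar_cat A B) : did M = 0 -> is_zero (sval M).
Proof.
move=> M0 a b m; have HM : is_bimod (sval M) := svalP M.
(* The identity morphism evaluated at (1 ⊗ 1) ⊗ m ⊗ (1 ⊗ 1) returns m. *)
have := bapp_did M; rewrite M0 => /(congr1 (fun f : bmap _ _ => f a b (tmk (tmk (two (idm a : diag A a a) (idm a)) m) (two (idm b : diag B b b) (idm b))))).
rewrite (bar_idE HM) /bcomp (tau_actrE (tens_bimod true (bar_bimod A) HM)) tens_ractE (tau_actlE HM).
by rewrite bapp0 !bar_tau_two !mcomp1l (ract1 HM) (lact1 HM) => <-.
Qed.

(** * The dual of a convolution *)

Section DualOfConvolution.
Variables (k : fieldType) (A B : dgcat k) (F : bimod A B -> bimod B A).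
Variable Fm : forall (M' M : bimod A B) (n : int) (f : bmap (tilde M') M), bmap (tilde (F M)) (F M').
Arguments Fm {M' M} n f [a b] _ : rename.
Hypothesis HF : dual_axioms (@Fm).
Notation C := (bar_cat A B).
Notation C' := (bar_cat B A).
Let HFm : cfunctor (@dual_mor k A B F (@Fm) HF) := dual_cfunctor HF.

(** A zero bimodule has zero identity in the bar category, F preserves this, and [did0_is_zero]
    leads back to bimodules. It provides the finiteness condition for the dual complex. *)
Lemma dual_is_zero (M : C) : is_zero (sval M) -> is_zero (F (sval M)).
Proof.
move=> M0; apply: (did0_is_zero (M := dual_obj HF M)); rewrite -(cf_id HFm).
have -> : did M = 0 by apply: bapp_inj; apply: bmap_ext => a b x; rewrite !(M0 _ _ (bapp _ x)).
exact: (lin0 (cf_lin HFm (a := M) (b := M))).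
Qed.

Section Formal.
Variables (s : seq int) (E : int -> C) (a : forall i j, dmor C (E i) (E j)).
Hypotheses (H : formal_twisted s a) (a1 : forall i j : int, (j <= i)%R -> a i j = 0).

Let E' (i : int) : C' := dual_obj HF (E (- i)).
Let a' (i j : int) : dmor C' (E' i) (E' j) := dual_diff (dual_mor HF) a i j.

Lemma dual_formal_twisted : formal_twisted (map -%R s) a'.
Proof.
split.
- by rewrite map_inj_uniq ?(ft_uniq H) //; apply: oppr_inj.
- move=> i si; apply: dual_is_zero; apply: (ft_zero H).
  by apply: contraNN si => si; rewrite -[i]opprK; apply: map_f.
- exact: (dual_diff_homog HFm (ft_homog H)).
- exact: (dual_twisted HFm (ft_homog H) (ft_eq H)).
Qed.

Lemma dual_diff0 (i j : int) : (j <= i)%R -> a' i j = 0.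
Proof.
move=> ji; have z : a (- j) (- i) = 0 by apply: a1; lia.
by rewrite /a' /dual_diff z (lin0 (@dual_mor_lin _ _ _ _ _ HF _ _)) scaler0.
Qed.

Let H' := dual_formal_twisted.

(** The comparison F(tilde E) -> F(E) -> tilde F(E): the dual of one bar unit, followed by another
    bar unit. *)
Let f i : dmor C' (dual_obj HF (tilde_obj (E (- i)))) (tilde_obj (E' i)) :=
  bar_unit (E' i) \c dual_mor HF (bar_unit (E (- i))).

Let f_hequiv i : hequiv (f i).
Proof. exact: (hequiv_comp (cf_hequiv HFm (hequiv_bar_unit _)) (hequiv_bar_unit _)). Qed.

(** Strict naturality of the bar unit is used twice, dualised for the original complex and directly
    for the dual one. Units have degree 0, so contravariance adds no sign. *)
Let f_natural (i j : int) :
  conv_diff a' i j \c f i = f j \c dual_diff (dual_mor HF) (conv_diff a) i j.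
Proof.
rewrite /f compoA (conv_diff_natural H') -!compoA; congr (_ \c _).
rewrite /a' /dual_diff compoZl compoZr; congr (_ *: _).
rewrite (cf_compV HFm (bar_unit_homog _) (ft_homog H _ _)).
rewrite (cf_compV HFm (fc_a (conv_fconv H) _ _) (bar_unit_homog _)).
by rewrite mulr0 mul0r (conv_diff_natural H).
Qed.

(** Both bimodules are formal convolutions over the negated list of indices, linked entry by entry
    by [f]. In the Boolean families [false] stands for the dual of the convolution and [true] for
    the convolution of the duals. *)
Theorem dual_conv_equivalent :
  homotopy_equivalent (F (conv (fun i j => bapp (a i j)))) (conv (fun i j => bapp (a' i j))).
Proof.
pose EE (b : bool) i := if b then tilde_obj (E' i) else dual_obj HF (tilde_obj (E (- i))).
pose XX (b : bool) := if b then conv_obj H' else dual_obj HF (conv_obj H).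
pose aa b : forall i j, dmor C' (EE b i) (EE b j) :=
  if b return forall i j, dmor C' (EE b i) (EE b j) then conv_diff a' else dual_diff (dual_mor HF) (conv_diff a).
pose ii b : forall i, dmor C' (EE b i) (XX b) :=
  if b return forall i, dmor C' (EE b i) (XX b) then conv_inj H'
  else fun i => sgn k i *: dual_mor HF (conv_proj H (- i)).
pose pp b : forall i, dmor C' (XX b) (EE b i) :=
  if b return forall i, dmor C' (XX b) (EE b i) then conv_proj H'
  else fun i => dual_mor HF (conv_inj H (- i)).
have fc b : fconv (map -%R s) (aa b) (ii b) (pp b).
  case: b; first exact: (conv_fconv H').
  exact: (fconv_dual HFm (fc_a (conv_fconv H)) (conv_fconv H)).
have a0 b (i j : int) : (j <= i)%R -> aa b i j = 0.
  case: b => ji; first by apply: (conv_diff0 H'); apply: dual_diff0.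
  have z : a (- j) (- i) = 0 by apply: a1; lia.
  by rewrite /= /dual_diff (conv_diff0 H z) (lin0 (@dual_mor_lin _ _ _ _ _ HF _ _)) scaler0.
exact: (hequiv_homotopy_equivalent (conv_hequiv fc a0 (f := f) f_hequiv f_natural)).
Qed.
End Formal.
End DualOfConvolution.

Section DualOfTwistedComplex.
Variables (k : fieldType) (A B : dgcat k) (F : bimod A B -> bimod B A).
Variable Fm : forall (M' M : bimod A B) (n : int) (f : bmap (tilde M') M), bmap (tilde (F M)) (F M').
Arguments Fm {M' M} n f [a b] _ : rename.
Hypothesis HF : dual_axioms (@Fm).
Variables (E : int -> bimod A B) (alpha : forall i j : int, bmap (tilde (E i)) (E j)).
Arguments alpha : clear implicits.
Hypotheses (Etw : is_twisted alpha) (E1 : one_sided alpha).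

Let alpha' (i j : int) : bmap (tilde (F (E (- i)))) (F (E (- j))) := fun b a x =>
  (-1) ^ (j ^+ 2 + i * j + 1) *: Fm (- j - - i + 1) (alpha (- j) (- i)) x.

(** A translation from raw families to the bar category and back: on homogeneous morphisms
    [dual_mor] has [Fm] as underlying map, so [dual_diff] becomes the family in the statement. *)
Theorem dual_twisted_complex :
  [/\ is_twisted alpha', one_sided alpha' & homotopy_equivalent (F (conv alpha)) (conv alpha')].
Proof.
pose Eo (i : int) : bar_cat A B := mkb (twisted_bimod Etw i).
pose a (i j : int) : dmor (bar_cat A B) (Eo i) (Eo j) := @bmk k A B (Eo i) (Eo j) (alpha i j).
have aE i j : bapp (a i j) = alpha i j := @bmkK k A B (Eo i) (Eo j) _ _ (twisted_hom Etw i j).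
have aE2 : (fun i j => bapp (a i j)) = alpha.
  by apply: functional_extensionality_dep => i; apply: functional_extensionality_dep => j.
have [s0 z0] := twisted_finite Etw.
have H : formal_twisted (undup s0) a.
  apply: twisted_formal; first exact: undup_uniq.
    by move=> i; rewrite mem_undup; apply: z0.
  by rewrite aE2.
have a0 (i j : int) : (j <= i)%R -> a i j = 0.
  by move=> ji; apply: bapp_inj; rewrite aE; apply: bmap_ext => x y t; apply: E1.
have alpha'E : (fun i j => bapp (dual_diff (dual_mor HF) a i j)) = alpha'.
  apply: functional_extensionality_dep => i; apply: functional_extensionality_dep => j.
  rewrite /dual_diff bappZ (bapp_dual HF (ft_homog H (- j) (- i))) aE.
  by [].
split.
- by rewrite -alpha'E; apply: (formal_twistedP (dual_formal_twisted HF H)).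
- move=> i j ji x y t; rewrite -alpha'E (dual_diff0 HF a0) //.
- by have := dual_conv_equivalent HF H a0; rewrite aE2 alpha'E.
Qed.
End DualOfTwistedComplex.

Theorem lemma3p44 (k : fieldType) (A B : dgcat k) (E : int -> bimod A B)
    (alpha : forall i j : int, bmap (tilde (E i)) (E j))
    (Etw : is_twisted alpha) (E1 : one_sided alpha) :
  (let EB (i : int) := dualB (E (- i)) in
   let alphaB (i j : int) : bmap (tilde (EB i)) (EB j) := fun b a x =>
     (-1) ^ (j ^+ 2 + i * j + 1) *:
       dualB_map (- j - - i + 1) (alpha (- j) (- i)) x in
   [/\ is_twisted alphaB, one_sided alphaB
     & homotopy_equivalent (dualB (conv alpha)) (conv alphaB)]) /\
  (let EA (i : int) := dualA (E (- i)) in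
   let alphaA (i j : int) : bmap (tilde (EA i)) (EA j) := fun b a x =>
     (-1) ^ (j ^+ 2 + i * j + 1) *:
       dualA_map (- j - - i + 1) (alpha (- j) (- i)) x in
   [/\ is_twisted alphaA, one_sided alphaA
     & homotopy_equivalent (dualA (conv alpha)) (conv alphaA)]).
Proof.
split.
- exact: (dual_twisted_complex (dualB_axioms A B) Etw E1).
- exact: (dual_twisted_complex (dualA_axioms A B) Etw E1).
Qed.
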